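(* Let $\Omega\subset\mathbb{R}^2$ be a bounded open convex set containing the origin in its interior, and suppose $$\sup_{\theta\in S^1}\sup_{\delta>0}\delta^{-1/2}\mu(\theta,\delta)<\infty.$$ Then there is a constant $C_\Omega$ such that for all $R\ge2$ and all $h$ with $R^{1/2}\le h\le R$, $$\mathcal{G}_\Omega(R,h)\le C_\Omega R^{1/2}.$$
   Context: For $t>0$ let $\mathcal{N}_\Omega(t)=\mathrm{card}(t\Omega\cap\mathbb{Z}^2)$, $E_\Omega(t)=\mathcal{N}_\Omega(t)-t^2\,\mathrm{area}(\Omega)$, and $\mathcal{G}_\Omega(R,h)=\big(\frac1h\int_R^{R+h}|E_\Omega(t)|^2dt\big)^{1/2}$. Let $\rho^*(\xi)=\sup\{\langle x,\xi\rangle:x\in\Omega\}$ for $\xi\in\mathbb{R}^2$. For $\theta\in S^1$ and $\delta>0$ let $\mathcal{C}(\theta,\delta)=\{x\in\partial\Omega:\langle x,\theta\rangle=\rho^*(\theta)-\delta\}$ and $\mu(\theta,\delta)=\mathrm{diam}(\mathcal{C}(\theta,\delta))$ (with $\mathrm{diam}(\emptyset)=0$). *)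

(* Defs.v *)
From HB Require Import structures.
From mathcomp Require Import all_boot all_order all_algebra.
From mathcomp Require Import all_classical all_reals all_analysis.
Set Implicit Arguments. Unset Strict Implicit. Unset Printing Implicit Defensive.
Import Order.TTheory GRing.Theory Num.Theory.
Import numFieldNormedType.Exports.
Local Open Scope classical_set_scope.
Local Open Scope ring_scope.

Section Defs.
Variable R : realType.
Implicit Types (Om : set (R * R)) (x y xi : R * R) (t d : R).

Definition dot2 x y : R := x.1 * y.1 + x.2 * y.2.
Definition dist2 x y : R := Num.sqrt ((x.1 - y.1) ^+ 2 + (x.2 - y.2) ^+ 2).

Definition S1 : set (R * R) := [set th | th.1 ^+ 2 + th.2 ^+ 2 = 1].

Definition convex2 Om : Prop :=
  forall x y (l : R), Om x -> Om y -> 0 <= l <= 1 ->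
    Om ((1 - l) * x.1 + l * y.1, (1 - l) * x.2 + l * y.2).

Definition bounded2 Om : Prop :=
  exists M : R, forall x, Om x -> `|x.1| <= M /\ `|x.2| <= M.

Definition area Om : R :=
  fine ((@lebesgue_measure R \x @lebesgue_measure R)%E Om).

Definition dilate t Om : set (R * R) := [set (t * x.1, t * x.2) | x in Om].

Definition latcount Om t : R :=
  fine (\esum_(p in [set p : int * int | dilate t Om (p.1%:~R, p.2%:~R)]) 1)%E.

Definition Eerr Om t : R := latcount Om t - t ^+ 2 * area Om.

Definition Gint Om (r h : R) : \bar R :=
  (\int[@lebesgue_measure R]_(t in `[r, (r + h)%R]) ((`|Eerr Om t| ^+ 2)%:E))%E.

Definition G Om r h : R := Num.sqrt (h^-1 * fine (Gint Om r h)).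

Definition rho_star Om xi : R := sup [set dot2 x xi | x in Om].

Definition boundary2 Om : set (R * R) := closure Om `\` interior Om.

Definition Ccap Om th d : set (R * R) :=
  [set x | boundary2 Om x /\ dot2 x th = rho_star Om th - d].

(* diameter; note sup set0 = 0 in MathComp-Analysis, so diam(empty) = 0 *)
Definition diam2 (A : set (R * R)) : R := sup [set dist2 x y | x in A & y in A].

Definition mu Om th d : R := diam2 (Ccap Om th d).

End Defs.

(* Main.v *)
Require Import Defs.
From HB Require Import structures.
From mathcomp Require Import all_boot all_order all_algebra.
From mathcomp Require Import all_classical all_reals all_analysis.
From mathcomp Require Import measurable_realfun ring lra zify.
Import Order.TTheory GRing.Theory Num.Theory.
Import numFieldNormedType.Exports.
Local Open Scope classical_set_scope.
Local Open Scope ring_scope.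
Set Implicit Arguments.
Unset Strict Implicit.
Unset Printing Implicit Defensive.

(** Put [h = sqrt r]. Smoothing the lattice at scale [1 / h] with a tent function
    traps [t ^ -2 N(t)] between integrals over [Om] of the periodised tent at
    [t + O(1 / h)], which costs an error [O(sqrt r)] in [E]. Fejer means replace
    the tent by a trigonometric polynomial whose coefficients are bounded by
    [min(1, (h / |k|) ^ 2)]. The Fourier transform of the indicator of [Om] at
    [t k] is the one-dimensional transform of the length of the slice of [Om]
    orthogonal to [k], a concave profile. Its middle contributes little; its two
    ends contribute waves of frequency [rho_star k] and [rho_star (- k)], with a
    slowly varying amplitude comparable to [1 / r] times the slice length at
    depth [2 / r], which the hypothesis on [mu] bounds by [r ^ -1/2 |k| ^ -3/2].

    Over a window of length [h], waves whose frequencies differ by more than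
    [1 / h] are almost orthogonal, so the mean square is a sum over pairs of
    lattice points in a common shell [rho_star k = const + O(1 / h)]. The number
    [O(|k|)] of points in a shell would lose a logarithm. To save a power, cut
    the shell into cells by direction: since [rho_star] is [C^{1,1}] by the
    hypothesis, the points of a cell lie on a line. The chord attached to a point
    consists of approximate subgradients of [rho_star] along this line, and
    subgradient intervals of a convex function do not overlap, so the lengths of
    the chords of a cell add up to at most the variation of the slope. *)

(** * Integrals of bounded functions with bounded support *)

(** The target fixes the exponents. Over a window of length [h] the square of [E] may integrate to
    [h ^ 3]; since [E] is [t ^ 2], about [h ^ 4] after squaring and another [h ^ 4] from [t] itself
    being of size [h ^ 2], times the oscillating sum, that sum must have integrated square [h ^ -5].
    A wave [k] has amplitude [h ^ -3 |k| ^ -3/2], so the pair sums of [|k| ^ -3/2 |l| ^ -3/2] over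
    common shells must stay bounded uniformly in [h]. With [O(|k|)] partners each they reduce to the
    sum of [|k| ^ -2] over the plane up to [h], which only just diverges: any fixed power saved
    suffices, and [|k| ^ 1/16] is a convenient one. In a cell of diameter [l] the integer cross
    product of two differences has size [l ^ 3 / |k|], and collinearity needs it below 1; hence
    cells of diameter below [|k| ^ 1/3]. The ends are cut at depth [1 / h], dual to the window, so
    that their amplitudes vary on the scale [h]. First and second differences replace derivatives,
    as slice lengths are merely concave. *)

Section Integral.
Variable R : realType.
Implicit Types (f g : R -> R) (M a b c d x y : R).

Notation leb := (@lebesgue_measure R).

Definition Ir f : R := \int[leb]_x f x.

(** One constant bounds both the values and the support. Such functions are integrable and closed
    under the operations below, so no integrability condition has to be carried along. *)
Definition nice f := measurable_fun setT f /\
  exists M, (forall x, `|f x| <= M) /\ (forall x, M < `|x| -> f x = 0).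

Lemma nice_integrable f : nice f -> leb.-integrable setT (EFin \o f).
Proof.
move=> [mf [M [fM f0]]].
have M0 : 0 <= M by apply: le_trans (fM 0).
pose g := fun x => M * \1_(`[- M, M]%classic : set R) x.
have ig : leb.-integrable setT (EFin \o g).
  have : leb.-integrable setT
      (fun x => (M%:E * (\1_(`[- M, M]%classic : set R) x)%:E)%E).
    by apply: integrableZl => //; exact: integrable_indic_itv.
  by [].
apply: (le_integrable measurableT _ _ ig).
  exact/measurable_EFinP.
move=> x _ /=; rewrite lee_fin /g indicE.
case: (boolP (x \in _)) => [_|].
  by rewrite mulr1 (ger0_norm M0).
rewrite notin_setE /= in_itv /= => /negP; rewrite -ler_norml -ltNge => h.
by rewrite f0 // normr0 mulr0 normr0.
Qed.

Lemma nice_bound f M c : measurable_fun setT f -> (forall x, `|f x| <= M) ->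
  (forall x, c < `|x| -> f x = 0) -> nice f.
Proof.
move=> mf fM f0; split => //; exists (Num.max M c); split=> x.
  by rewrite le_max fM.
by rewrite gt_max => /andP[_]; apply: f0.
Qed.

Lemma nice_meas f : nice f -> measurable_fun setT f. Proof. by case. Qed.

Lemma niceP f : nice f -> exists M, [/\ 0 <= M, measurable_fun setT f,
  (forall x, `|f x| <= M) & (forall x, M < `|x| -> f x = 0)].
Proof.
by move=> [mf [M [h1 h2]]]; exists M; split => //; apply: le_trans (h1 0).
Qed.

Lemma eq_nice f g : f =1 g -> nice f -> nice g.
Proof. by move=> /funext ->. Qed.

Lemma nice0 : nice (fun=> 0).
Proof. by apply: (@nice_bound _ 0 0) => // x; rewrite normr0. Qed.

Lemma nice_mul f g M : nice f -> measurable_fun setT g ->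
  (forall x, f x != 0 -> `|g x| <= M) -> nice (fun x => f x * g x).
Proof.
move=> /niceP[N [N0 mf fN f0]] mg gM.
apply: (@nice_bound _ (N * `|M|) N); first exact: measurable_funM.
  move=> x; rewrite normrM; have [->|fx] := eqVneq (f x) 0.
    by rewrite normr0 mul0r mulr_ge0.
  apply: ler_pM => //; apply: le_trans (gM _ fx) (ler_norm _).
by move=> x /f0 ->; rewrite mul0r.
Qed.

Lemma nice_mulb f g M : nice f -> measurable_fun setT g ->
  (forall x, `|g x| <= M) -> nice (fun x => f x * g x).
Proof. by move=> nf mg gM; apply: (nice_mul (M := M)). Qed.

Lemma niceZ a f : nice f -> nice (fun x => a * f x).
Proof.
move=> nf; apply: (@eq_nice (fun x => f x * a)) => [x|]; first exact: mulrC.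
by apply: (@nice_mulb _ (fun=> a) `|a|) => //.
Qed.

Lemma niceD f g : nice f -> nice g -> nice (fun x => f x + g x).
Proof.
move=> /niceP[N [N0 mf fN f0]] /niceP[M [M0 mg gM g0]].
apply: (@nice_bound _ (N + M) (N + M)); first exact: measurable_funD.
  by move=> x; apply: le_trans (ler_normD _ _) _; apply: lerD.
by move=> x h; rewrite f0 ?g0 ?addr0 //; lra.
Qed.

Lemma niceN f : nice f -> nice (fun x => - f x).
Proof. by move=> nf; apply: (eq_nice _ (niceZ (-1) nf)) => x; rewrite mulN1r. Qed.

Lemma niceB f g : nice f -> nice g -> nice (fun x => f x - g x).
Proof. by move=> nf ng; apply: niceD => //; apply: niceN. Qed.

Lemma niceM f g : nice f -> nice g -> nice (fun x => f x * g x).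
Proof. by move=> nf /niceP[M [_ mg gM _]]; apply: (nice_mulb (M := M)). Qed.

Lemma nice_norm f : nice f -> nice (fun x => `|f x|).
Proof.
move=> /niceP[N [N0 mf fN f0]]; apply: (@nice_bound _ N N) => //.
- exact: measurableT_comp.
- by move=> x; rewrite normr_id.
- by move=> x /f0 ->; rewrite normr0.
Qed.

Lemma nice_sum (I : Type) (s : seq I) (F : I -> R -> R) :
  (forall i, nice (F i)) -> nice (fun x => \sum_(i <- s) F i x).
Proof.
move=> nF; elim: s => [|i s IH].
  by apply: (eq_nice _ nice0) => x; rewrite big_nil.
by apply: (eq_nice _ (niceD (nF i) IH)) => x; rewrite big_cons.
Qed.

Lemma measurable_affine a b : measurable_fun setT (fun x : R => a * x + b).
Proof. by apply: measurable_funD => //; apply: measurable_funM. Qed.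

Lemma nice_affine f a b : a != 0 -> nice f -> nice (fun x => f (a * x + b)).
Proof.
move=> a0 /niceP[N [N0 mf fN f0]].
apply: (@nice_bound _ N ((N + `|b|) / `|a|)) => //.
  by apply: (measurableT_comp mf); exact: measurable_affine.
move=> x; rewrite ltr_pdivrMr ?normr_gt0 // => h; apply: f0.
have := ler_normD (a * x + b) (- b); rewrite addrK normrN normrM; nra.
Qed.

Lemma nice_shift f a : nice f -> nice (fun x => f (x + a)).
Proof.
by move=> nf; apply: (eq_nice _ (nice_affine a (oner_neq0 R) nf)) => x; rewrite mul1r.
Qed.

Lemma measurable_box c d : measurable_fun setT (\1_(`[c, d]%classic : set R) : R -> R).
Proof. exact: measurable_indic. Qed.

Lemma nice_cut f M a b : measurable_fun setT f ->
  (forall x, a <= x <= b -> `|f x| <= M) ->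
  nice (fun x => \1_(`[a, b]%classic : set R) x * f x).
Proof.
move=> mf fM; apply: (nice_mul (M := M)) => //.
- apply: (@nice_bound _ 1 (`|a| + `|b|)); first exact: measurable_box.
    by move=> x; rewrite indicE ger0_norm // lern1 leq_b1.
  move=> x h; rewrite indicE; case: (boolP (x \in _)) => //.
  rewrite inE /= in_itv /= => /andP[h1 h2].
  move: h; rewrite ltNge => /negP[]; rewrite ler_norml.
  have := ler_norm b; have := ler_norm (- a); rewrite normrN.
  have := normr_ge0 a; have := normr_ge0 b; lra.
- move=> x; rewrite indicE; case: (boolP (x \in _)); last by rewrite eqxx.
  by rewrite inE /= in_itv /= => /fM.
Qed.

Lemma eq_Ir f g : f =1 g -> Ir f = Ir g.
Proof. by move=> /funext ->. Qed.

Lemma Ir0 : Ir (fun=> 0) = 0.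
Proof. by rewrite /Ir Rintegral_cst // mul0r. Qed.

Lemma IrD f g : nice f -> nice g -> Ir (fun x => f x + g x) = Ir f + Ir g.
Proof. by move=> nf ng; rewrite /Ir RintegralD //; exact: nice_integrable. Qed.

Lemma IrZ a f : nice f -> Ir (fun x => a * f x) = a * Ir f.
Proof. by move=> nf; rewrite /Ir RintegralZl //; exact: nice_integrable. Qed.

Lemma IrN f : nice f -> Ir (fun x => - f x) = - Ir f.
Proof.
move=> nf; rewrite -mulN1r -IrZ //; by apply: eq_Ir => x; rewrite mulN1r.
Qed.

Lemma IrB f g : nice f -> nice g -> Ir (fun x => f x - g x) = Ir f - Ir g.
Proof. by move=> nf ng; rewrite IrD ?IrN //; exact: niceN. Qed.

Lemma Ir_sum (I : Type) (s : seq I) (F : I -> R -> R) :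
  (forall i, nice (F i)) ->
  Ir (fun x => \sum_(i <- s) F i x) = \sum_(i <- s) Ir (F i).
Proof.
move=> nF; elim: s => [|i s IH].
  by rewrite big_nil -[RHS]Ir0; apply: eq_Ir => x; rewrite big_nil.
rewrite big_cons -IH -IrD //; last exact: nice_sum.
by apply: eq_Ir => x; rewrite big_cons.
Qed.

Lemma Ir_ge0 f : (forall x, 0 <= f x) -> 0 <= Ir f.
Proof. by move=> f0; apply: Rintegral_ge0. Qed.

Lemma Ir_le f g : nice f -> nice g -> (forall x, f x <= g x) -> Ir f <= Ir g.
Proof.
by move=> nf ng fg; apply: le_Rintegral => //; apply: nice_integrable.
Qed.

Lemma Ir_norm f : nice f -> `|Ir f| <= Ir (fun x => `|f x|).
Proof. by move=> nf; apply: le_normr_Rintegral => //; apply: nice_integrable. Qed.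

Lemma nice_box c d : nice (\1_(`[c, d]%classic : set R)).
Proof.
apply: (eq_nice (f := fun x => \1_(`[c, d]%classic : set R) x * 1)).
  by move=> x; rewrite mulr1.
by apply: (nice_cut (M := 1)) => // x _; rewrite normr1.
Qed.

Lemma Ir_box c d : c <= d -> Ir (\1_(`[c, d]%classic : set R)) = d - c.
Proof.
move=> cd; rewrite /Ir /Rintegral integral_indic // setIT.
rewrite -[X in fine X]/(lebesgue_measure (`[c, d]%classic : set R)) lebesgue_measure_itv /=.
rewrite lte_fin; case: ltP => //= h.
by rewrite (_ : d = c) ?subrr //; apply/le_anti/andP.
Qed.

Lemma box_in c d x : c <= x <= d -> \1_(`[c, d]%classic : set R) x = 1 :> R.
Proof. by move=> h; rewrite indicE mem_set //= in_itv. Qed.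

Lemma box_out c d x : ~~ (c <= x <= d) -> \1_(`[c, d]%classic : set R) x = 0 :> R.
Proof. by move=> h; rewrite indicE memNset //= in_itv /=; exact/negP. Qed.

Lemma Ir_le_box f B c d : nice f -> c <= d -> (forall x, c <= x <= d -> f x <= B) ->
  (forall x, ~~ (c <= x <= d) -> f x <= 0) -> Ir f <= B * (d - c).
Proof.
move=> nf cd fB f0; rewrite -Ir_box // -IrZ; last exact: nice_box.
apply: Ir_le => //; first by apply: niceZ; exact: nice_box.
move=> x; have [h|h] := boolP (c <= x <= d).
  by rewrite box_in // mulr1 fB.
by rewrite box_out // mulr0 f0.
Qed.

End Integral.

(** * Affine changes of variable on the line *)

Section Affine.
Variable R : realType.
Implicit Types (f g : R -> R) (M a b c d x y : R).

Notation leb := (@lebesgue_measure R).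

Let phi a b : measurableTypeR R -> measurableTypeR R := fun x => a * x + b.

Let mphi a b : measurable_fun setT (phi a b).
Proof. exact: measurable_affine. Qed.

(** The scaled pushforward agrees with Lebesgue measure on half-open intervals, which determine it.
    For [a < 0] the preimage is half-open at the other end, hence the two shapes of interval. *)
Let phi_meas a b (A : set R) : a != 0 -> measurable A ->
  (`|a|%:E * pushforward leb (phi a b) A)%E = leb A.
Proof.
move=> a0 mA.
have := @lebesgue_measure_unique R (mscale (NngNum (normr_ge0 a))
   (pushforward leb (phi a b))).
move=> -> // X [[c d]] _ <-.
  rewrite /= /mscale /pushforward /=.
  have a0' : 0 < `|a| by rewrite normr_gt0.
  have : phi a b @^-1` `]c, d] = 
     if 0 < a then `](c - b) / a, (d - b) / a]%classic
      else `[(d - b) / a, (c - b) / a[%classic.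
    apply/seteqP; split => x; case: ifP => ap /=; rewrite !in_itv /= /phi.
    + by rewrite ltr_pdivrMr // ler_pdivlMr // => /andP[h1 h2]; apply/andP; split; lra.
    + have an : a < 0 by rewrite lt_neqAle a0 leNgt ap.
      by rewrite ltr_ndivlMr // ler_ndivrMr // => /andP[h1 h2]; apply/andP; split; lra.
    + by rewrite ltr_pdivrMr // ler_pdivlMr // => /andP[h1 h2]; apply/andP; split; lra.
    + have an : a < 0 by rewrite lt_neqAle a0 leNgt ap.
      by rewrite ltr_ndivlMr // ler_ndivrMr // => /andP[h1 h2]; apply/andP; split; lra.
  have L1 (x y : R) : lebesgue_measure (`]x, y]%classic : set R) =
      (if x < y then (y - x)%:E else 0%E).
    by rewrite lebesgue_measure_itv /= lte_fin EFinB.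
  have L2 (x y : R) : lebesgue_measure (`[x, y[%classic : set R) =
      (if x < y then (y - x)%:E else 0%E).
    by rewrite lebesgue_measure_itv /= lte_fin EFinB.
  case: (boolP (0 < a)) => ap E; rewrite -[pushforward _ _ _]/(leb (phi a b @^-1` `]c, d])) E [LHS]L1; [rewrite [X in (_ * X)%E]L1|rewrite [X in (_ * X)%E]L2].
  - rewrite ltr_pM2r ?invr_gt0 // ltrD2r; case: ifP => _; last by rewrite mule0.
    rewrite -EFinM; congr (_%:E).
    by rewrite gtr0_norm //; field.
  - have an : a < 0 by rewrite lt_neqAle a0 leNgt.
    rewrite ltr_nM2r ?invr_lt0 // ltrD2r; case: ifP => _; last by rewrite mule0.
    rewrite -EFinM; congr (_%:E).
    by rewrite ltr0_norm //; field.
Qed.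

Lemma nice_pos f : nice f -> nice (fun x => Num.max (f x) 0).
Proof.
move=> /niceP[N [N0 mf fN f0]]; apply: (@nice_bound _ _ N N) => //.
- by apply: measurable_maxr => //.
- by move=> x; apply: le_trans (fN x); rewrite ger0_norm ?le_max ?lexx ?orbT // ge_max ler_norm normr_ge0.
- by move=> x /f0 ->; rewrite maxxx.
Qed.

Let Ir_affine_ge0 f a b : a != 0 -> nice f -> (forall x, 0 <= f x) ->
  Ir (fun x => f (a * x + b)) = `|a|^-1 * Ir f.
Proof.
move=> a0 nf f0.
have a0' : 0 < `|a| by rewrite normr_gt0.
suff -> : Ir f = `|a| * Ir (fun x => f (a * x + b)).
  by rewrite mulrA mulVf ?mul1r // gt_eqF.
have nfa := nice_affine b a0 nf.
apply: EFin_inj; rewrite /Ir /Rintegral.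
have fin1 := integrable_fin_num measurableT (nice_integrable nf).
have fin2 := integrable_fin_num measurableT (nice_integrable nfa).
rewrite EFinM !fineK //.
have mf : measurable_fun setT (EFin \o f) by apply/measurable_EFinP; exact: nice_meas.
have E := @ge0_integral_pushforward _ _ _ _ R _ (mphi a b) leb setT (EFin \o f)
  measurableT mf (fun x _ => f0 x).
rewrite preimage_setT in E; rewrite -[X in (_ * X)%E]E.
rewrite -(ge0_integral_mscale _ measurableT (NngNum (normr_ge0 a))) //.
by apply: eq_measure_integral => A mA _; apply/esym; exact: (phi_meas b a0 mA).
Unshelve. by move=> x _; rewrite lee_fin.
Qed.

(** The pushforward formula serves nonnegative functions; a signed one is split into its positive
    and negative parts. *)
Lemma Ir_affine f a b : a != 0 -> nice f ->
  Ir (fun x => f (a * x + b)) = `|a|^-1 * Ir f.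
Proof.
move=> a0 nf.
have npf := nice_pos nf.
have nnf := nice_pos (niceN nf).
have E x : f x = Num.max (f x) 0 - Num.max (- f x) 0.
  by case: (leP (f x) 0); case: (leP (- f x) 0); lra.
rewrite [in RHS](eq_Ir E) IrB // (eq_Ir (fun x => E (a * x + b))) IrB //;
  [|exact: (nice_affine b a0 npf)|exact: (nice_affine b a0 nnf)].
rewrite (Ir_affine_ge0 b a0 npf) ?(Ir_affine_ge0 b a0 nnf) ?mulrBr //.
- by move=> x; rewrite le_max lexx orbT.
- by move=> x; rewrite le_max lexx orbT.
Qed.

Lemma Ir_shift f b : nice f -> Ir (fun x => f (x + b)) = Ir f.
Proof.
move=> nf; have := Ir_affine b (oner_neq0 R) nf.
rewrite normr1 invr1 mul1r => <-; by apply: eq_Ir => x; rewrite mul1r.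
Qed.

Lemma Ir_reflect f b : nice f -> Ir (fun x => f (b - x)) = Ir f.
Proof.
move=> nf; have := @Ir_affine f (-1) b _ nf.
rewrite normrN normr1 invr1 mul1r => <-; last by rewrite oppr_eq0 oner_eq0.
by apply: eq_Ir => x; rewrite mulN1r addrC.
Qed.

End Affine.

(** * Iterated integrals in the plane *)

Section Integral2.
Variable R : realType.
Implicit Types (f g : R * R -> R) (M : R).

Notation leb := (@lebesgue_measure R).

Definition nice2 f := measurable_fun setT f /\
  exists M, (forall x, `|f x| <= M) /\
    (forall x, M < `|x.1| \/ M < `|x.2| -> f x = 0).

Lemma nice2P f : nice2 f -> exists M, [/\ 0 <= M, measurable_fun setT f,
  (forall x, `|f x| <= M) & (forall x, M < `|x.1| \/ M < `|x.2| -> f x = 0)].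
Proof.
by move=> [mf [M [h1 h2]]]; exists M; split => //; apply: le_trans (h1 (0, 0)).
Qed.

(** Iterated rather than over the product measure, so that one-variable lemmas apply inside;
    [I2_prod] and [I2_swap] give the link with Fubini. *)
Definition I2 f : R := Ir (fun x => Ir (fun y => f (x, y))).

Lemma nice2_bound f M c : measurable_fun setT f -> (forall x, `|f x| <= M) ->
  (forall x, c < `|x.1| \/ c < `|x.2| -> f x = 0) -> nice2 f.
Proof.
move=> mf fM f0; split => //; exists (Num.max M c); split=> x.
  by rewrite le_max fM.
by rewrite !gt_max => -[/andP[_ h]|/andP[_ h]]; apply: f0; [left|right].
Qed.

Lemma nice2_integrable f : nice2 f -> (leb \x leb)%E.-integrable setT (EFin \o f).
Proof.
move=> /nice2P[M [M0 mf fM f0]].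
pose B : set (R * R) := `[- M, M]%classic `*` `[- M, M]%classic.
have mB : measurable B by apply: measurableX.
have EB : ((leb \x leb) B = lebesgue_measure (`[(- M)%R, M]%classic : set R) *
    lebesgue_measure (`[(- M)%R, M]%classic : set R))%E.
  by rewrite /B product_measure1E.
have ig : (leb \x leb)%E.-integrable setT (fun x => (M%:E * (\1_B x)%:E)%E).
  apply: integrableZl => //; apply/integrableP; split.
    by apply/measurable_EFinP; exact: measurable_indic.
  under eq_integral do rewrite gee0_abs ?lee_fin //.
  rewrite integral_indic // setIT [X in (X < _)%E]EB lebesgue_measure_itv /=.
  case: ifP => _; last by rewrite mule0 ltry.
  by rewrite -EFinM ltry.
apply: (le_integrable measurableT _ _ ig); first exact/measurable_EFinP.
move=> x _ /=; rewrite lee_fin indicE.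
case: (boolP (x \in _)) => [_|].
  by rewrite mulr1 (ger0_norm M0).
move=> /negP h; rewrite f0 ?normr0 //; apply: contrapT => /not_orP[] /negP; rewrite -leNgt => h1 /negP; rewrite -leNgt => h2; apply: h.
by rewrite inE; split; rewrite /= in_itv /= -ler_norml.
Qed.

Lemma nice2_sec1 f x : nice2 f -> nice (fun y => f (x, y)).
Proof.
move=> /nice2P[M [M0 mf fM f0]]; apply: (@nice_bound _ _ M M) => //.
  exact: (measurableT_comp mf (pair1_measurable x)).
by move=> y My; apply: f0; right.
Qed.

Lemma nice2_sec2 f y : nice2 f -> nice (fun x => f (x, y)).
Proof.
move=> /nice2P[M [M0 mf fM f0]]; apply: (@nice_bound _ _ M M) => //.
  exact: (measurableT_comp mf (pair2_measurable y)).
by move=> x My; apply: f0; left.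
Qed.

Lemma I2_prod f : nice2 f -> I2 f = (\int[(leb \x leb)%E]_x f x).
Proof.
move=> nf; rewrite /I2 /Ir /Rintegral; congr fine.
rewrite -integral12_prod_meas1 /=; last exact: nice2_integrable.
apply: eq_integral => x _; rewrite /fubini_F /= fineK //.
by apply: integrable_fin_num; [|exact: (nice_integrable (nice2_sec1 x nf))].
Qed.

Lemma I2_swap f : nice2 f -> I2 f = Ir (fun y => Ir (fun x => f (x, y))).
Proof.
move=> nf; rewrite I2_prod // /Ir /Rintegral; congr fine.
rewrite -integral21_prod_meas1 /=; last exact: nice2_integrable.
apply: eq_integral => y _; rewrite /fubini_G /= fineK //.
by apply: integrable_fin_num; [|exact: (nice_integrable (nice2_sec2 y nf))].
Qed.

Lemma nice_marg f : nice2 f -> nice (fun x => Ir (fun y => f (x, y))).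
Proof.
move=> nf; have /nice2P[M [M0 mf fM f0]] := nf.
apply: (@nice_bound _ _ (M * (M - - M)) M).
- apply/measurable_EFinP.
  have := measurable_fubini_F (nice2_integrable nf).
  apply: eq_measurable_fun => x _; rewrite /fubini_F /= fineK //.
  by apply: integrable_fin_num; [|exact: (nice_integrable (nice2_sec1 x nf))].
- move=> x; apply: le_trans (Ir_norm _) _; first exact: nice2_sec1.
  apply: Ir_le_box => //; first by apply: nice_norm; exact: nice2_sec1.
    by rewrite lerNl; lra.
  move=> y; rewrite -ler_norml -ltNge => h; rewrite f0 ?normr0 //; by right.
- move=> x Mx; rewrite -[RHS](@Ir0 R); apply: eq_Ir => y; apply: f0; by left.
Qed.

Lemma nice2_swap f : nice2 f -> nice2 (fun x => f (x.2, x.1)).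
Proof.
move=> /nice2P[M [M0 mf fM f0]]; apply: (@nice2_bound _ M M) => //.
  exact: (measurableT_comp mf (@measurable_swap _ _ R R)).
by move=> x h; apply: f0; case: h; [right|left].
Qed.

End Integral2.

(** * Oscillatory integrals of concave profiles *)

Section Osc.
Variable R : realType.
Implicit Types (f g q rho : R -> R) (M a b c d x y t p eta v W w Lam Q : R).

(** The free phase treats cosine and sine together: [p = - (pi / 2)] gives the sine. *)
Definition osc t p x : R := cos (2 * pi * t * x + p).

Lemma measurable_osc t p : measurable_fun setT (osc t p).
Proof.
apply: (measurableT_comp (f := cos)); last exact: measurable_affine.
exact: (continuous_measurable_fun (@continuous_cos R)).
Qed.

Lemma osc_le1 t p x : `|osc t p x| <= 1. Proof. exact: cos_max. Qed.

Lemma nice_osc f t p : nice f -> nice (fun x => f x * osc t p x).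
Proof. by move=> nf; apply: (nice_mulb nf (measurable_osc t p) (osc_le1 t p)). Qed.

Lemma osc_shift t p x : t != 0 -> osc t p (x + (2 * t)^-1) = - osc t p x.
Proof.
move=> t0; rewrite /osc -cosDpi; congr cos.
by field.
Qed.

Definition D2 f eta x := f (x + eta) + f (x - eta) - 2 * f x.

Lemma nice_D2 f eta : nice f -> nice (D2 f eta).
Proof.
by move=> nf; apply: niceB; [apply: niceD; exact: nice_shift|exact: niceZ].
Qed.

Lemma Ir_D2 f eta : nice f -> Ir (D2 f eta) = 0.
Proof.
move=> nf; rewrite IrB ?IrD ?IrZ ?Ir_shift //; try exact: nice_shift.
- lra.
- by apply: niceD; exact: nice_shift.
- exact: niceZ.
Qed.

(* Translating by half a period of the oscillating factor changes its sign. *)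
Lemma half_period_bound f t p : 0 < t -> nice f ->
  `|Ir (fun x => f x * osc t p x)| <= 4^-1 * Ir (fun x => `|D2 f (2 * t)^-1 x|).
Proof.
move=> t0 nf; set eta := (2 * t)^-1; set A := Ir _.
have tn0 : t != 0 by rewrite gt_eqF.
have E1 : Ir (fun x => f (x - eta) * osc t p x) = - A.
  rewrite -IrN; last exact: nice_osc.
  rewrite -[RHS](@Ir_shift R _ (- eta)); last by apply: niceN; exact: nice_osc.
  by apply: eq_Ir => x; rewrite -mulrN -(osc_shift p (x - eta) tn0) subrK.
have E2 : Ir (fun x => f (x + eta) * osc t p x) = - A.
  rewrite -IrN; last exact: nice_osc.
  rewrite -[RHS](@Ir_shift R _ eta); last by apply: niceN; exact: nice_osc.
  by apply: eq_Ir => x; rewrite (osc_shift p x tn0) mulrN opprK.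
(* Each translate contributes [- A] and the centre term [- 2 * A]. *)
have E : Ir (fun x => D2 f eta x * osc t p x) = - 4 * A.
  transitivity (Ir (fun x => f (x + eta) * osc t p x + f (x - eta) * osc t p x
      - 2 * (f x * osc t p x))).
    by apply: eq_Ir => x; rewrite /D2; ring.
  have n1 := nice_osc t p (nice_shift eta nf).
  have n2 := nice_osc t p (nice_shift (- eta) nf).
  have n3 := nice_osc t p nf.
  rewrite IrB ?IrD ?IrZ ?E1 ?E2 //; first by rewrite -/A; ring.
  - exact: niceD.
  - exact: niceZ.
have : `|- 4 * A| <= Ir (fun x => `|D2 f eta x|).
  rewrite -E; apply: le_trans (Ir_norm _) _; first by apply: nice_osc; exact: nice_D2.
  apply: Ir_le; [by apply: nice_norm; apply: nice_osc; exact: nice_D2| | ].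
    by apply: nice_norm; exact: nice_D2.
  by move=> x; rewrite normrM ler_piMr // osc_le1.
rewrite normrM normrN (ger0_norm (ler0n _ 4)) => h; rewrite ler_pdivlMl //.
Qed.

(** Concavity on [[c, d]] in three-point form; free of division, it allows the points to
    coincide. *)
Definition ccv c d f := forall x y z, c <= x -> x <= y -> y <= z -> z <= d ->
  (z - y) * f x + (y - x) * f z <= (z - x) * f y.

Section Concave.
Variables (f : R -> R) (c d : R).
Hypotheses (nf : nice f) (cf : ccv c d f) (fc : f c = 0) (fd : f d = 0).
Hypotheses (fl : forall x, x < c -> f x = 0) (fr : forall x, d < x -> f x = 0).

Lemma ccv_ge0 x : 0 <= f x.
Proof.
have [/fl-> //|cx] := ltP x c; have [/fr-> //|xd] := ltP d x.
have := cf (lexx c) cx xd (lexx d); rewrite fc fd !mulr0 addr0.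
have [cdE|cd] := eqVneq c d; first by rewrite (_ : x = d) ?fd //; lra.
by rewrite pmulr_rge0 // subr_gt0 lt_neqAle cd (le_trans cx).
Qed.

(** The chord from [x] to the zero at [d] lies below [f], and [c + 2 * eta] is at most half way from
    [c] to [d], so at least half of [f x] survives there. *)
Lemma ccv_left eta x : 0 < eta -> 4 * eta <= d - c -> x <= c + 2 * eta ->
  f x <= 2 * f (c + 2 * eta).
Proof.
move=> e0 ed xe; have [xc|cx] := ltP x c; first by rewrite fl // mulr_ge0 // ccv_ge0.
have xe' : c + 2 * eta <= d by lra.
have := cf cx xe xe' (lexx d); rewrite fd mulr0 addr0.
have := ccv_ge0 x; have := ccv_ge0 (c + 2 * eta).
set u := f _; set w := f _ => u0 w0 H.
have : (d - c - 2 * eta) * w <= (d - c) * u by nra.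
nra.
Qed.

Lemma ccv_right eta x : 0 < eta -> 4 * eta <= d - c -> d - 2 * eta <= x ->
  f x <= 2 * f (d - 2 * eta).
Proof.
move=> e0 ed xe; have [xc|cx] := ltP d x; first by rewrite fr // mulr_ge0 // ccv_ge0.
have xe' : c <= d - 2 * eta by lra.
have := cf (lexx c) xe' xe cx; rewrite fc mulr0 add0r.
have := ccv_ge0 x; have := ccv_ge0 (d - 2 * eta).
set u := f _; set w := f _ => u0 w0 H.
have : (d - c - 2 * eta) * w <= (d - c) * u by nra.
nra.
Qed.

(** By concavity [D2 f] is nonpositive except within [eta] of an end, and its integral is 0. So the
    integral of its absolute value is twice that of its positive part, which sits on two intervals
    of length [2 * eta] and is at most twice the value of [f] at depth [2 * eta]. *)
Lemma Ir_D2_ccv eta : 0 < eta -> 4 * eta <= d - c ->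
  Ir (fun x => `|D2 f eta x|) <= 8 * eta * (f (c + 2 * eta) + f (d - 2 * eta)).
Proof.
move=> e0 ed.
have nD := nice_D2 eta nf.
set F1 := f (c + 2 * eta); set F2 := f (d - 2 * eta).
pose b1 : R -> R := \1_(`[c - eta, c + eta]%classic).
pose b2 : R -> R := \1_(`[d - eta, d + eta]%classic).
have nb1 : nice b1 by exact: nice_box.
have nb2 : nice b2 by exact: nice_box.
have F10 : 0 <= F1 by exact: ccv_ge0.
have F20 : 0 <= F2 by exact: ccv_ge0.
have n1 : nice (fun x => - D2 f eta x) by exact: niceN.
have n2 : nice (fun x => 4 * F1 * b1 x) by exact: niceZ.
have n3 : nice (fun x => 4 * F2 * b2 x) by exact: niceZ.
apply: (@le_trans _ _ (Ir (fun x => - D2 f eta x + (4 * F1 * b1 x + 4 * F2 * b2 x)))); last first.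
  rewrite !IrD ?IrN ?IrZ ?Ir_D2 ?Ir_box //; try lra; exact: niceD.
apply: Ir_le; [exact: nice_norm|by apply: niceD => //; exact: niceD|move=> x].
have b10 : 0 <= b1 x by rewrite /b1 indicE.
have b20 : 0 <= b2 x by rewrite /b2 indicE.
have p1 : 0 <= 4 * F1 * b1 x by rewrite !mulr_ge0.
have p2 : 0 <= 4 * F2 * b2 x by rewrite !mulr_ge0.
have f0 := ccv_ge0.
suff H : D2 f eta x <= 2 * F1 * b1 x + 2 * F2 * b2 x.
  by rewrite ler_norml; apply/andP; split; lra.
rewrite /D2.
have [x1|x1] := ltP x (c - eta).
  rewrite (fl (x := x + eta)) ?(fl (x := x - eta)) ?(fl (x := x)); lra.
have [x2|x2] := leP x (c + eta).
  have -> : b1 x = 1 by rewrite /b1 box_in // x1 x2.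
  have : f (x + eta) <= 2 * F1 by apply: ccv_left => //; lra.
  have : f (x - eta) = 0.
    have [h|h] := ltP (x - eta) c; first exact: fl.
    by rewrite (_ : x - eta = c) //; lra.
  have := f0 x; lra.
have [x3|x3] := ltP (d + eta) x.
  rewrite (fr (x := x + eta)) ?(fr (x := x - eta)) ?(fr (x := x)); lra.
have [x4|x4] := leP (d - eta) x.
  have -> : b2 x = 1 by rewrite /b2 box_in // x3 x4.
  have : f (x - eta) <= 2 * F2 by apply: ccv_right => //; lra.
  have : f (x + eta) = 0.
    have [h|h] := ltP d (x + eta); first exact: fr.
    by rewrite (_ : x + eta = d) //; lra.
  have := f0 x; lra.
have := @cf (x - eta) x (x + eta); nra.
Qed.

(** Slopes of a concave function are extreme at its ends, and there the increment over [2 * eta] is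
    a value of [f], which starts from 0. Increments that leave [[c, d]] fall under [ccv_left] and
    [ccv_right]. *)
Lemma ccv_incr eta x y : 0 < eta -> 4 * eta <= d - c -> y - x = 2 * eta ->
  `|f y - f x| <= 2 * (f (c + 2 * eta) + f (d - 2 * eta)).
Proof.
move=> e0 ed yx.
have f0 := ccv_ge0; have u0 := f0 (c + 2 * eta); have v0 := f0 (d - 2 * eta).
have x0 := f0 x; have y0 := f0 y.
have [x1|x1] := ltP x c.
  have : f y <= 2 * f (c + 2 * eta) by apply: ccv_left => //; lra.
  rewrite (fl x1) => ?; rewrite subr0 ger0_norm //; lra.
have [y1|y1] := ltP d y.
  have : f x <= 2 * f (d - 2 * eta) by apply: ccv_right => //; lra.
  rewrite (fr y1) => ?; rewrite sub0r normrN ger0_norm //; lra.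
have h1 : f y - f x <= f (c + 2 * eta).
  have := @cf c x y; have := @cf c (c + 2 * eta) y; rewrite fc !mulr0 !add0r.
  move=> /(_ (lexx _)) A /(_ (lexx _)) B.
  have {}A : 2 * eta * f y <= (y - c) * f (c + 2 * eta) by have := A; lra.
  have {}B : (x - c) * f y <= (y - c) * f x by have := B; lra.
  rewrite -(@ler_pM2l _ (y - c)); [|lra]; nra.
have h2 : f x - f y <= f (d - 2 * eta).
  have := @cf x y d; have := @cf x (d - 2 * eta) d; rewrite fd !mulr0 !addr0.
  move=> A B.
  have {}A : 2 * eta * f x <= (d - x) * f (d - 2 * eta) by have := A; lra.
  have {}B : (d - y) * f x <= (d - x) * f y by have := B; lra.
  rewrite -(@ler_pM2l _ (d - x)); [|lra]; nra.
rewrite ler_norml; apply/andP; split; lra.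
Qed.

End Concave.

Lemma D2M f g eta x : D2 (fun x => f x * g x) eta x =
  f x * D2 g eta x + g x * D2 f eta x + 2^-1 * (D2 f eta x * D2 g eta x)
  + 2^-1 * ((f (x + eta) - f (x - eta)) * (g (x + eta) - g (x - eta))).
Proof. by rewrite /D2; field. Qed.

End Osc.

Section Trig.
Variable R : realType.
Implicit Types (x y : R).

Lemma norm_sin_le x : `|sin x| <= `|x|.
Proof.
wlog x0 : x / 0 <= x.
  move=> H; have [/H//|/ltW x0] := leP 0 x.
  by have := H (- x); rewrite sinN !normrN; apply; rewrite oppr_ge0.
have [|c _] := MVT_segment x0 (fun y _ => is_derive_sin y).
  by apply: continuous_subspaceT; exact: continuous_sin.
rewrite sin0 !subr0 => ->; rewrite normrM ler_piMl //; exact: cos_max.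
Qed.

Lemma cos_sub_half x y : cos x - cos y = - 2 * (sin ((x + y) / 2) * sin ((x - y) / 2)).
Proof.
have Ex : x = (x + y) / 2 + (x - y) / 2 by field.
have Ey : y = (x + y) / 2 - (x - y) / 2 by field.
by rewrite [X in cos X - _]Ex [X in _ - cos X]Ey cosD cosB; ring.
Qed.

Lemma norm_cos_sub1 x : `|cos x - 1| <= x ^+ 2 / 2.
Proof.
rewrite -[X in `|cos x - X|]cos0 cos_sub_half addr0 subr0 -expr2 normrM normrN normrX (ger0_norm (x := 2)) //.
have : `|sin (x / 2)| ^+ 2 <= `|x / 2| ^+ 2.
  by rewrite ler_pXn2r ?nnegrE // norm_sin_le.
have -> : x ^+ 2 = `|x / 2| ^+ 2 * 4 by rewrite real_normK ?num_real //; field.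
lra.
Qed.

Lemma pi_lt4 : pi < 4 :> R.
Proof. by have := pihalf_lt2 R; lra. Qed.

End Trig.

(** * Transforms of concave bumps and their variation in the frequency *)

Section Bump.
Variable R : realType.
Implicit Types (f g q rho : R -> R) (M a b c d x y t p eta v W w Lam Q : R).

Definition bump W rho := [/\ nice rho, ccv 0 (2 * W) rho, rho 0 = 0, rho (2 * W) = 0
  & forall x, ~~ (0 <= x <= 2 * W) -> rho x = 0].

(** The first two clauses feed the bound on [D2]. The third controls the height: a concave profile
    grows at most linearly away from its end. *)
Definition bump_le rho W eta Lam := [/\ rho (2 * eta) <= Lam,
  rho (2 * W - 2 * eta) <= Lam & forall w, eta * rho w <= W * Lam].

(** A factor [q] that varies on the scale [W] of the bump costs only a constant: in the product rule
    [D2M] each difference of [q] brings [eta / W], which pays for the width of the support. Asking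
    for [|w| <= 3 * W] leaves room for the shifts by [eta]. *)
Lemma Ir_D2_mult rho W eta Lam q Q : bump W rho -> 0 < eta -> 2 * eta <= W ->
  bump_le rho W eta Lam -> measurable_fun setT q ->
  (forall w, `|w| <= 3 * W -> [/\ `|q w| <= Q,
     `|q (w + eta) - q (w - eta)| <= Q * (eta / W) &
     `|D2 q eta w| <= Q * (eta / W) ^+ 2]) ->
  Ir (fun w => `|D2 (fun x => rho x * q x) eta w|) <= 40 * Q * eta * Lam.
Proof.
move=> [nr cr r0 r2 rz] e0 eW [L1 L2 Lm] mq hq.
have W0 : 0 < W by lra.
have Q0 : 0 <= Q.
  have [|h _ _] := hq 0; first by rewrite normr0; lra.
  by apply: le_trans h.
have rl x : x < 0 -> rho x = 0 by move=> h; apply: rz; apply/negP => /andP[]; lra.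
have rr x : 2 * W < x -> rho x = 0 by move=> h; apply: rz; apply/negP => /andP[]; lra.
have rge := ccv_ge0 cr r0 r2 rl rr.
have Lam0 : 0 <= Lam by exact: le_trans (rge _) L1.
set k := eta / W in hq.
have k0 : 0 < k by rewrite divr_gt0.
have k1 : k <= 2^-1 by rewrite ler_pdivrMr //; lra.
have kE : eta = k * W by rewrite /k divfK // gt_eqF.
have nrq : nice (fun x => rho x * q x).
  apply: (nice_mul (M := Q) nr mq) => x; have [h _|/rz ->] := boolP (0 <= x <= 2 * W); last by rewrite eqxx.
  have [|//] := hq x; rewrite ger0_norm; lra.
pose b1 : R -> R := \1_(`[0, 2 * W]%classic).
pose b2 : R -> R := \1_(`[- eta, 2 * W + eta]%classic).
have nb1 : nice b1 by exact: nice_box.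
have nb2 : nice b2 by exact: nice_box.
have nD := nice_norm (nice_D2 eta nr).
have n1 : nice (fun w => Q * Lam * k * b1 w) by exact: niceZ.
have n2 : nice (fun w => 2 * Q * `|D2 rho eta w|) by exact: niceZ.
have n3 : nice (fun w => 2 * Q * Lam * k * b2 w) by exact: niceZ.
(* The three summands integrate to at most 2, 32 and 6 times [Q * eta * Lam]. *)
apply: (@le_trans _ _ (Ir (fun w => Q * Lam * k * b1 w + 2 * Q * `|D2 rho eta w|
    + 2 * Q * Lam * k * b2 w))); last first.
  rewrite !IrD ?IrZ ?Ir_box //; try lra; last exact: niceD.
  have e4 : 4 * eta <= 2 * W - 0 by lra.
  have := Ir_D2_ccv nr cr r0 r2 rl rr e0 e4; rewrite add0r.
  move: (Ir _) => X hX.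
  have {}hX : X <= 16 * eta * Lam by nra.
  have : 2 * Q * X <= 32 * Q * eta * Lam by nra.
  have QL : 0 <= Q * Lam by rewrite mulr_ge0.
  rewrite kE => h.
  have : Q * Lam * k * (2 * W - 0) = 2 * (Q * Lam) * (k * W) by ring.
  have : 2 * Q * Lam * k * (2 * W + k * W - - (k * W)) <= 6 * (Q * Lam) * (k * W).
    have : Q * Lam * k * W * k <= Q * Lam * k * W * 2^-1.
      apply: ler_wpM2l => //; apply: mulr_ge0; [apply: mulr_ge0 => //; exact: ltW|exact: ltW].
    nra.
  lra.
apply: Ir_le; [by apply: nice_norm; exact: nice_D2|by apply: niceD => //; exact: niceD|].
move=> w.
have b10 : 0 <= b1 w by rewrite /b1 indicE.
have b20 : 0 <= b2 w by rewrite /b2 indicE.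
have QLk : 0 <= Q * Lam * k by apply: mulr_ge0; [exact: mulr_ge0|exact: ltW].
have [wb|wb] := boolP (- eta <= w <= 2 * W + eta); last first.
  have -> : D2 (fun x => rho x * q x) eta w = 0.
    rewrite /D2; have /orP[h|h] : (w < - eta) || (2 * W + eta < w).
      by rewrite !ltNge -negb_and.
    - by rewrite (rl (w + eta)) ?(rl (w - eta)) ?(rl w) ?mul0r ?mulr0 ?subr0 ?addr0 //; lra.
    - by rewrite (rr (w + eta)) ?(rr (w - eta)) ?(rr w) ?mul0r ?mulr0 ?subr0 ?addr0 //; lra.
  rewrite normr0; have : 0 <= Q * `|D2 rho eta w| by rewrite mulr_ge0.
  nra.
have -> : b2 w = 1 by rewrite /b2 box_in.
have [|q1 q2 q3] := hq w; first by case/andP: wb => wb1 wb2; rewrite ler_norml; apply/andP; split; lra.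
have T1 : `|rho w * D2 q eta w| <= Q * Lam * k * b1 w.
  have [wi|wi] := boolP (0 <= w <= 2 * W); last by rewrite rz // mul0r normr0; nra.
  rewrite /b1 box_in // mulr1 normrM (ger0_norm (rge w)).
  have H : k * rho w <= Lam.
    by rewrite -(ler_pM2r W0); have := Lm w; rewrite kE; lra.
  apply: (@le_trans _ _ (rho w * (Q * k ^+ 2))); first by apply: ler_wpM2l.
  have -> : rho w * (Q * k ^+ 2) = (k * rho w) * (Q * k) by ring.
  have -> : Q * Lam * k = Lam * (Q * k) by ring.
  by apply: ler_wpM2r => //; rewrite mulr_ge0 // ltW.
have T2 : `|q w * D2 rho eta w| <= Q * `|D2 rho eta w|.
  by rewrite normrM; apply: ler_wpM2r.
have T3 : `|D2 rho eta w * D2 q eta w| <= Q * `|D2 rho eta w|.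
  rewrite normrM mulrC; apply: ler_wpM2r => //; apply: le_trans q3 _.
  by rewrite ler_piMr // expr_le1 // ?ltW //; lra.
have T4 : `|(rho (w + eta) - rho (w - eta)) * (q (w + eta) - q (w - eta))| <= 4 * Lam * (Q * k).
  rewrite normrM; apply: ler_pM => //.
  have e4 : 4 * eta <= 2 * W - 0 by lra.
  apply: le_trans (ccv_incr cr r0 r2 rl rr e0 e4 _) _; first by ring.
  by rewrite add0r; lra.
rewrite D2M.
move: T1 T2 T3 T4; set A1 := rho w * _; set A2 := q w * _; set A3 := D2 rho eta w * _; set A4 := _ * (q _ - _).
move=> T1 T2 T3 T4.
have := ler_normD (A1 + A2 + 2^-1 * A3) (2^-1 * A4).
have := ler_normD (A1 + A2) (2^-1 * A3).
have := ler_normD A1 A2.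
rewrite !(normrM 2^-1) (ger0_norm (x := 2^-1)) //.
have : 0 <= Q * `|D2 rho eta w| by rewrite mulr_ge0.
lra.
Qed.

Lemma norm_Ir_mult rho W t p Lam q Q : bump W rho -> 0 < t -> 1 <= t * W ->
  bump_le rho W (2 * t)^-1 Lam -> measurable_fun setT q ->
  (forall w, `|w| <= 3 * W -> [/\ `|q w| <= Q,
     `|q (w + (2 * t)^-1) - q (w - (2 * t)^-1)| <= Q * ((2 * t)^-1 / W) &
     `|D2 q (2 * t)^-1 w| <= Q * ((2 * t)^-1 / W) ^+ 2]) ->
  `|Ir (fun w => rho w * q w * osc t p w)| <= 10 * Q * (2 * t)^-1 * Lam.
Proof.
move=> br t0 tW bl mq hq.
have e0 : 0 < (2 * t)^-1 by rewrite invr_gt0 mulr_gt0.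
have eW : 2 * (2 * t)^-1 <= W.
  rewrite invfM mulrA mulfV ?mul1r ?pnatr_eq0 // -(ler_pM2l t0) mulfV //; exact: lt0r_neq0.
have W0 : 0 < W by lra.
have [nr _ _ _ rz] := br.
have nrq : nice (fun x => rho x * q x).
  apply: (nice_mul (M := Q) nr mq) => x; have [/andP[h1 h2] _|/rz ->] := boolP (0 <= x <= 2 * W); last by rewrite eqxx.
  have [|//] := hq x; rewrite ger0_norm; lra.
apply: le_trans (half_period_bound p t0 nrq) _.
have := Ir_D2_mult br e0 eW bl mq hq; lra.
Qed.

Definition amp rho p t := Ir (fun w => rho w * osc t p w).

(** A difference in [t] becomes a multiplier depending on [v * w]. When [v * W <= 1] this multiplier
    is small and slowly varying on the bump, so that [norm_Ir_mult] bounds the variation of the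
    amplitude. *)
Lemma amp_D2 rho p t v : nice rho ->
  amp rho p (t + v) + amp rho p (t - v) - 2 * amp rho p t =
  Ir (fun w => rho w * (2 * (cos (2 * pi * v * w) - 1)) * osc t p w).
Proof.
move=> nr; rewrite /amp.
have n1 := nice_osc (t + v) p nr; have n2 := nice_osc (t - v) p nr.
have n3 := nice_osc t p nr.
rewrite -IrD // -IrZ // -IrB //; [|exact: niceD|exact: niceZ].
apply: eq_Ir => w; rewrite /osc.
rewrite (_ : 2 * pi * (t + v) * w + p = (2 * pi * t * w + p) + 2 * pi * v * w); last by ring.
rewrite (_ : 2 * pi * (t - v) * w + p = (2 * pi * t * w + p) - 2 * pi * v * w); last by ring.
by rewrite cosD cosB; ring.
Qed.

Lemma amp_D1 rho p t v : nice rho ->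
  amp rho p (t + v) - amp rho p (t - v) =
  Ir (fun w => rho w * (- 2 * sin (2 * pi * v * w)) * osc t (p - pi / 2) w).
Proof.
move=> nr; rewrite /amp.
have n1 := nice_osc (t + v) p nr; have n2 := nice_osc (t - v) p nr.
rewrite -IrB //.
apply: eq_Ir => w; rewrite /osc.
rewrite (_ : 2 * pi * (t + v) * w + p = (2 * pi * t * w + p) + 2 * pi * v * w); last by ring.
rewrite (_ : 2 * pi * (t - v) * w + p = (2 * pi * t * w + p) - 2 * pi * v * w); last by ring.
by rewrite addrA cosBpihalf cosD cosB; ring.
Qed.

Lemma amp_bound rho W t p Lam : bump W rho -> 0 < t -> 1 <= t * W ->
  bump_le rho W (2 * t)^-1 Lam -> `|amp rho p t| <= 10 * (2 * t)^-1 * Lam.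
Proof.
move=> br t0 tW bl.
have W0 : 0 < W by rewrite -(pmulr_rgt0 _ t0); lra.
have e0 : 0 < (2 * t)^-1 by rewrite invr_gt0 mulr_gt0.
have := @norm_Ir_mult rho W t p Lam (fun=> 1) 1 br t0 tW bl.
rewrite mulr1 /amp (eq_Ir (g := fun w => rho w * osc t p w)) => [|w]; last by rewrite mulr1.
apply => // w _; rewrite normr1 subrr normr0 /D2 (_ : 1 + 1 - 2 * 1 = 0 :> R); last by ring.
rewrite normr0 !mul1r; split => //; first by rewrite ltW ?divr_gt0.
by rewrite exprn_ge0 // ltW ?divr_gt0.
Qed.

(** The multiplier [- 2 * sin (2 * pi * v * w)] has size [v * W]; its second difference is what
    requires the constant 128. *)
Lemma amp_D1_bound rho W t p Lam v : bump W rho -> 0 < t -> 1 <= t * W ->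
  bump_le rho W (2 * t)^-1 Lam -> 0 <= v -> v * W <= 1 ->
  `|amp rho p (t + v) - amp rho p (t - v)| <= 10 * (128 * (v * W)) * (2 * t)^-1 * Lam.
Proof.
move=> br t0 tW bl v0 vW; have [nr _ _ _ _] := br.
have W0 : 0 < W by rewrite -(pmulr_rgt0 _ t0); lra.
rewrite amp_D1 //.
set eta := (2 * t)^-1.
have e0 : 0 < eta by rewrite invr_gt0 mulr_gt0.
apply: (norm_Ir_mult (q := fun w => - 2 * sin (2 * pi * v * w)) _ br t0 tW bl).
  apply: measurable_funM => //; apply: (measurableT_comp (f := @sin R)).
    exact: (continuous_measurable_fun (@continuous_sin R)).
  exact: mulrl_measurable.
move=> w wW.
have pi0 := pi_gt0 R; have pi4 := pi_lt4 R.
set k := v * W in vW *; have k0 : 0 <= k by rewrite mulr_ge0 // ltW.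
set e := eta / W; have e1 : 0 <= e by rewrite divr_ge0 // ltW.
have eE : eta = e * W by rewrite /e divfK // gt_eqF.
have sb x : `|2 * pi * v * x| <= 8 * v * `|x|.
  rewrite normrM [`|2 * pi * v|]ger0_norm; last by rewrite !mulr_ge0 // ltW.
  by apply: ler_wpM2r => //; apply: ler_wpM2r => //; lra.
have ke : 0 <= k * e by rewrite mulr_ge0.
have ve : v * eta = k * e by rewrite /k eE; ring.
have vw3 : v * `|w| <= 3 * k by rewrite /k; nra.
have sbe : `|2 * pi * v * eta| <= 8 * (k * e).
  by have := sb eta; rewrite (gtr0_norm e0) -[8 * v * eta]mulrA ve.
have sbw : `|2 * pi * v * w| <= 24 * k by have := sb w; lra.
have sq x y : 0 <= y -> `|x| <= y -> x ^+ 2 <= y ^+ 2.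
  by move=> y0 xy; rewrite -real_normK ?num_real // ler_pXn2r // nnegrE.
split.
- rewrite normrM normrN (ger0_norm (x := 2)) //.
  have := norm_sin_le (2 * pi * v * w); have := sb w.
  have : v * `|w| <= 3 * k by rewrite /k; nra.
  lra.
- rewrite -mulrBr normrM normrN (ger0_norm (x := 2)) //.
  rewrite (_ : 2 * pi * v * (w + eta) = 2 * pi * v * w + 2 * pi * v * eta); last by ring.
  rewrite (_ : 2 * pi * v * (w - eta) = 2 * pi * v * w - 2 * pi * v * eta); last by ring.
  rewrite sinD sinB (_ : _ - _ = 2 * (cos (2 * pi * v * w) * sin (2 * pi * v * eta))); last by ring.
  rewrite !normrM (ger0_norm (x := 2)) //.
  have h1 := le_trans (norm_sin_le (2 * pi * v * eta)) sbe.
  have := ler_pM (normr_ge0 _) (normr_ge0 _) (cos_max (2 * pi * v * w)) h1.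
  lra.
- rewrite /D2.
  rewrite (_ : 2 * pi * v * (w + eta) = 2 * pi * v * w + 2 * pi * v * eta); last by ring.
  rewrite (_ : 2 * pi * v * (w - eta) = 2 * pi * v * w - 2 * pi * v * eta); last by ring.
  rewrite sinD sinB (_ : _ - _ = - 4 * (sin (2 * pi * v * w) * (cos (2 * pi * v * eta) - 1))); last by ring.
  rewrite !normrM normrN (ger0_norm (x := 4)) //.
  have := norm_cos_sub1 (2 * pi * v * eta).
  have := sq _ _ (mulr_ge0 (ler0n _ 8) ke) sbe.
  have := sin_max (2 * pi * v * w).
  have := normr_ge0 (sin (2 * pi * v * w)).
  have := normr_ge0 (cos (2 * pi * v * eta) - 1).
  set X : R := `|_ - 1|; set Y : R := `|sin _|.
  have : k ^+ 2 * e ^+ 2 <= k * e ^+ 2.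
    by apply: ler_wpM2r; [exact: exprn_ge0|rewrite expr2 ler_piMr].
  move=> h1 X0 Y0 Y1 h2 h3; have : Y * X <= X by rewrite ler_piMl.
  lra.
Qed.

(** Here the multiplier has size [(v * W) ^ 2], and its first difference requires the constant
    768. *)
Lemma amp_D2_bound rho W t p Lam v : bump W rho -> 0 < t -> 1 <= t * W ->
  bump_le rho W (2 * t)^-1 Lam -> 0 <= v -> v * W <= 1 ->
  `|amp rho p (t + v) + amp rho p (t - v) - 2 * amp rho p t|
    <= 10 * (768 * (v * W) ^+ 2) * (2 * t)^-1 * Lam.
Proof.
move=> br t0 tW bl v0 vW; have [nr _ _ _ _] := br.
have W0 : 0 < W by rewrite -(pmulr_rgt0 _ t0); lra.
rewrite amp_D2 //.
set eta := (2 * t)^-1.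
have e0 : 0 < eta by rewrite invr_gt0 mulr_gt0.
apply: (norm_Ir_mult (q := fun w => 2 * (cos (2 * pi * v * w) - 1)) _ br t0 tW bl).
  apply: measurable_funM => //; apply: measurable_funB => //.
  apply: (measurableT_comp (f := @cos R)).
    exact: (continuous_measurable_fun (@continuous_cos R)).
  exact: mulrl_measurable.
move=> w wW.
have pi0 := pi_gt0 R; have pi4 := pi_lt4 R.
set k := v * W in vW *; have k0 : 0 <= k by rewrite mulr_ge0 // ltW.
set e := eta / W; have e1 : 0 <= e by rewrite divr_ge0 // ltW.
have eE : eta = e * W by rewrite /e divfK // gt_eqF.
have sb x : `|2 * pi * v * x| <= 8 * v * `|x|.
  rewrite normrM [`|2 * pi * v|]ger0_norm; last by rewrite !mulr_ge0 // ltW.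
  by apply: ler_wpM2r => //; apply: ler_wpM2r => //; lra.
have ke : 0 <= k * e by rewrite mulr_ge0.
have ve : v * eta = k * e by rewrite /k eE; ring.
have vw3 : v * `|w| <= 3 * k by rewrite /k; nra.
have sbe : `|2 * pi * v * eta| <= 8 * (k * e).
  by have := sb eta; rewrite (gtr0_norm e0) -[8 * v * eta]mulrA ve.
have sbw : `|2 * pi * v * w| <= 24 * k by have := sb w; lra.
have sq x y : 0 <= y -> `|x| <= y -> x ^+ 2 <= y ^+ 2.
  by move=> y0 xy; rewrite -real_normK ?num_real // ler_pXn2r // nnegrE.
split.
- rewrite normrM (ger0_norm (x := 2)) //.
  have := norm_cos_sub1 (2 * pi * v * w).
  have := sq _ _ (mulr_ge0 (ler0n _ 24) k0) sbw.
  have : 0 <= k ^+ 2 by exact: exprn_ge0.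
  lra.
- rewrite -mulrBr normrM (ger0_norm (x := 2)) //.
  rewrite (_ : 2 * pi * v * (w + eta) = 2 * pi * v * w + 2 * pi * v * eta); last by ring.
  rewrite (_ : 2 * pi * v * (w - eta) = 2 * pi * v * w - 2 * pi * v * eta); last by ring.
  rewrite cosD cosB (_ : _ - _ = - 2 * (sin (2 * pi * v * w) * sin (2 * pi * v * eta))); last by ring.
  rewrite !normrM normrN (ger0_norm (x := 2)) //.
  have h1 := le_trans (norm_sin_le (2 * pi * v * eta)) sbe.
  have h2 := le_trans (norm_sin_le (2 * pi * v * w)) sbw.
  have := ler_pM (normr_ge0 _) (normr_ge0 _) h2 h1.
  have : 0 <= k ^+ 2 * e by rewrite mulr_ge0 // exprn_ge0.
  lra.
- rewrite /D2.
  rewrite (_ : 2 * pi * v * (w + eta) = 2 * pi * v * w + 2 * pi * v * eta); last by ring.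
  rewrite (_ : 2 * pi * v * (w - eta) = 2 * pi * v * w - 2 * pi * v * eta); last by ring.
  rewrite cosD cosB (_ : _ - _ = 4 * (cos (2 * pi * v * w) * (cos (2 * pi * v * eta) - 1))); last by ring.
  rewrite !normrM (ger0_norm (x := 4)) //.
  have := norm_cos_sub1 (2 * pi * v * eta).
  have := sq _ _ (mulr_ge0 (ler0n _ 8) ke) sbe.
  have := cos_max (2 * pi * v * w).
  have := normr_ge0 (cos (2 * pi * v * w)).
  have := normr_ge0 (cos (2 * pi * v * eta) - 1).
  set X : R := `|_ - 1|; set Y : R := `|cos _|.
  have ke2 : 0 <= k ^+ 2 * e ^+ 2 by rewrite mulr_ge0 // exprn_ge0.
  move=> X0 Y0 Y1 h2 h3; have : Y * X <= X by rewrite ler_piMl.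
  lra.
Qed.

End Bump.

(** * Mean squares over a window *)

Section Regular.
Variable R : realType.
Implicit Types (f g a b rho : R -> R) (A B h s t v x : R).

(** A derivative-free form of [f], [h f'] and [h ^ 2 f''] being bounded by [A]: the function is of
    class [C^{1,1}] on the scale [h]. *)
Definition reg h T1 T2 A f := forall t v, 0 <= v -> v <= h -> T1 <= t - v -> t + v <= T2 ->
  [/\ `|f t| <= A, `|f (t + v) - f (t - v)| <= A * (v / h) & `|D2 f v t| <= A * (v / h) ^+ 2].

Lemma reg_bound h T1 T2 A f t : 0 < h -> reg h T1 T2 A f -> T1 <= t <= T2 -> `|f t| <= A.
Proof.
move=> h0 rf /andP[t1 t2].
have b1 : T1 <= t - 0 by rewrite subr0.
have b2 : t + 0 <= T2 by rewrite addr0.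
by have [] := rf t 0 (lexx 0) (ltW h0) b1 b2.
Qed.

Lemma regM h T1 T2 A B f g : 0 < h -> 0 <= A -> 0 <= B -> reg h T1 T2 A f -> reg h T1 T2 B g ->
  reg h T1 T2 (3 * A * B) (fun t => f t * g t).
Proof.
move=> h0 A0 B0 rf rg t v v0 vh t1 t2.
have [f1 f2 f3] := rf t v v0 vh t1 t2.
have [g1 g2 g3] := rg t v v0 vh t1 t2.
have b1 : T1 <= t + v - 0 by lra.
have b2 : t + v + 0 <= T2 by lra.
have b3 : T1 <= t - v - 0 by lra.
have b4 : t - v + 0 <= T2 by lra.
have [fp _ _] := rf (t + v) 0 (lexx 0) (ltW h0) b1 b2.
have [gm _ _] := rg (t - v) 0 (lexx 0) (ltW h0) b3 b4.
set k := v / h in f2 f3 g2 g3 *.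
have k0 : 0 <= k by rewrite divr_ge0 // ltW.
have k1 : k <= 1 by rewrite ler_pdivrMr // mul1r.
have AB : 0 <= A * B by rewrite mulr_ge0.
have k2 : k ^+ 2 <= 1 by rewrite expr_le1.
have k20 : 0 <= k ^+ 2 by rewrite exprn_ge0.
split.
- rewrite normrM; have := ler_pM (normr_ge0 _) (normr_ge0 _) f1 g1; lra.
- have -> : f (t + v) * g (t + v) - f (t - v) * g (t - v) =
    f (t + v) * (g (t + v) - g (t - v)) + (f (t + v) - f (t - v)) * g (t - v) by ring.
  apply: le_trans (ler_normD _ _) _; rewrite !normrM.
  have := ler_pM (normr_ge0 _) (normr_ge0 _) fp g2.
  have := ler_pM (normr_ge0 _) (normr_ge0 _) f2 gm.
  have : 0 <= A * B * k by rewrite mulr_ge0.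
  lra.
- rewrite D2M.
  have := ler_pM (normr_ge0 _) (normr_ge0 _) f1 g3.
  have := ler_pM (normr_ge0 _) (normr_ge0 _) g1 f3.
  have := ler_pM (normr_ge0 _) (normr_ge0 _) f3 g3.
  have := ler_pM (normr_ge0 _) (normr_ge0 _) f2 g2.
  rewrite -!normrM.
  set X1 := f t * _; set X2 := g t * _; set X3 := D2 f v t * _; set X4 := _ * (g _ - _).
  move=> h4 h3 h2 h1.
  have := ler_normD (X1 + X2 + 2^-1 * X3) (2^-1 * X4).
  have := ler_normD (X1 + X2) (2^-1 * X3).
  have := ler_normD X1 X2.
  rewrite !(normrM 2^-1) (ger0_norm (x := 2^-1)) //.
  have : 0 <= A * B * k ^+ 2 by rewrite mulr_ge0.
  have : A * k ^+ 2 * (B * k ^+ 2) <= A * B * k ^+ 2.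
    rewrite (_ : A * k ^+ 2 * (B * k ^+ 2) = A * B * k ^+ 2 * k ^+ 2); last by ring.
    by rewrite ler_piMr // mulr_ge0.
  lra.
Qed.

Definition sqpos x : R := Num.max 0 x ^+ 2.

Lemma sqpos_D2 x v : 0 <= sqpos (x + v) + sqpos (x - v) - 2 * sqpos x <= 2 * v ^+ 2.
Proof.
rewrite /sqpos; apply/andP; split;
case: (leP 0 (x + v)); case: (leP 0 (x - v)); case: (leP 0 x); nra.
Qed.

Lemma sqpos_D1 x y c : `|x| <= c -> `|y| <= c ->
  `|sqpos x - sqpos y| <= 2 * c * `|x - y|.
Proof.
move=> xc yc; have c0 : 0 <= c by apply: le_trans xc.
rewrite /sqpos subr_sqr normrM mulrC; apply: ler_pM => //.
  move: xc yc; rewrite !ler_norml => /andP[x1 x2] /andP[y1 y2].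
  by apply/andP; split; case: (leP 0 x); case: (leP 0 y); lra.
rewrite ler_norml; have := ler_norm (x - y); have := ler_norm (y - x); rewrite distrC.
by move=> *; apply/andP; split; case: (leP 0 x); case: (leP 0 y); lra.
Qed.

Lemma reg_sqpos h s c : 0 < h -> c ^+ 2 = 1 -> reg h (s - 3 * h) (s + 3 * h) 7
  (fun t => sqpos (1 + c * ((t - s) / (2 * h)))).
Proof.
move=> h0 c1 t v v0 vh t1 t2.
have hn : h != 0 by rewrite gt_eqF.
have cn : `|c| = 1 by apply/eqP; rewrite -sqr_norm_eq1 c1.
have bd y : s - 3 * h <= y <= s + 3 * h -> `|1 + c * ((y - s) / (2 * h))| <= 5 / 2.
  move=> /andP[y1 y2]; apply: le_trans (ler_normD _ _) _; rewrite normr1 normrM cn mul1r.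
  have : `|(y - s) / (2 * h)| <= 3 / 2.
    rewrite normrM (ger0_norm (x := _^-1)); last by rewrite invr_ge0; lra.
    rewrite ler_pdivrMr; last by lra.
    by rewrite ler_norml; apply/andP; split; lra.
  lra.
have k0 : 0 <= v / h by rewrite divr_ge0 // ltW.
have ct : `|1 + c * ((t - s) / (2 * h))| <= 5 / 2 by apply: bd; lra.
have cp : `|1 + c * ((t + v - s) / (2 * h))| <= 5 / 2 by apply: bd; lra.
have cm : `|1 + c * ((t - v - s) / (2 * h))| <= 5 / 2 by apply: bd; lra.
split.
- have := sqpos_D1 ct (y := 0); rewrite normr0 => /(_ ltac:(lra)).
  rewrite {2}/sqpos maxxx expr0n subr0 subr0.
  rewrite /sqpos ger0_norm ?exprn_ge0 // ?le_max ?lexx // => _.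
  have : Num.max 0 (1 + c * ((t - s) / (2 * h))) <= 5 / 2.
    by rewrite ge_max; apply/andP; split; [lra|apply: le_trans ct; exact: ler_norm].
  have : 0 <= Num.max 0 (1 + c * ((t - s) / (2 * h))) by rewrite le_max lexx.
  move: (Num.max _ _) => X; nra.
- apply: le_trans (sqpos_D1 cp cm) _.
  rewrite (_ : _ - _ = c * (v / h)); last by field.
  rewrite normrM cn mul1r ger0_norm //; lra.
- rewrite /D2.
  have := sqpos_D2 (1 + c * ((t - s) / (2 * h))) (c * (v / h) / 2).
  rewrite (_ : _ + c * (v / h) / 2 = 1 + c * ((t + v - s) / (2 * h))); last by field.
  rewrite (_ : _ - c * (v / h) / 2 = 1 + c * ((t - v - s) / (2 * h))); last by field.
  move=> /andP[h1 h2]; rewrite ger0_norm //; apply: le_trans h2 _.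
  rewrite !exprMn c1; have := sqr_ge0 (v / h); lra.
Qed.

(** With [y = (t - s) / (2 * h)] this is [(1 - y ^ 2) ^ 2] for [|y| <= 1] and 0 beyond. Written as a
    product of two truncated squares it inherits its regularity through [regM]; its bounded second
    differences give the quadratic decay of correlations. *)
Definition chi s h t : R :=
  sqpos (1 + 1 * ((t - s) / (2 * h))) * sqpos (1 + (-1) * ((t - s) / (2 * h))).

Lemma reg_chi h s : 0 < h -> reg h (s - 3 * h) (s + 3 * h) 147 (chi s h).
Proof.
move=> h0.
have -> : 147 = 3 * 7 * 7 :> R by ring.
by apply: regM => //; apply: reg_sqpos => //; rewrite ?expr1n // sqrrN expr1n.
Qed.

Lemma chi_ge0 s h t : 0 <= chi s h t.
Proof. by rewrite /chi /sqpos mulr_ge0 // exprn_ge0 // le_max lexx. Qed.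

Lemma chi_out s h t : 0 < h -> 2 * h <= `|t - s| -> chi s h t = 0.
Proof.
move=> h0 H; rewrite /chi.
have : 1 <= `|(t - s) / (2 * h)|.
  rewrite normrM (ger0_norm (x := _^-1)); last by rewrite invr_ge0; lra.
  by rewrite ler_pdivlMr ?mul1r //; lra.
rewrite real_ler_normr ?num_real // => /orP[h1|h1].
  have -> : sqpos (1 + -1 * ((t - s) / (2 * h))) = 0.
    by rewrite /sqpos max_l ?expr0n //; lra.
  by rewrite mulr0.
have -> : sqpos (1 + 1 * ((t - s) / (2 * h))) = 0.
  by rewrite /sqpos max_l ?expr0n //; lra.
by rewrite mul0r.
Qed.

Lemma chi_ge s h t : 0 < h -> `|t - s| <= h -> 2^-1 <= chi s h t.
Proof.
move=> h0 H.
have : `|(t - s) / (2 * h)| <= 2^-1.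
  rewrite normrM (ger0_norm (x := _^-1)); last by rewrite invr_ge0; lra.
  by rewrite ler_pdivrMr; lra.
rewrite /chi /sqpos; move: ((t - s) / _) => y; rewrite ler_norml => /andP[y1 y2].
rewrite !max_r; [|lra|lra].
rewrite -exprMn (_ : (1 + 1 * y) * (1 + -1 * y) = 1 - y ^+ 2); last by ring.
have : 3 / 4 <= 1 - y ^+ 2 by nra.
move: (1 - _) => z; nra.
Qed.

Lemma measurable_chi s h : measurable_fun setT (chi s h).
Proof.
have m c : measurable_fun setT (fun t : R => sqpos (1 + c * ((t - s) / (2 * h)))).
  apply: measurable_funX; apply: measurable_maxr => //.
  apply: measurable_funD => //; apply: measurable_funM => //.
  apply: measurable_funM => //; exact: measurable_funB.
by apply: measurable_funM.
Qed.

Lemma nice_chi s h f A : 0 < h -> measurable_fun setT f ->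
  reg h (s - 3 * h) (s + 3 * h) A f -> nice (fun t => chi s h t * f t).
Proof.
move=> h0 mf rf.
have nc : nice (chi s h).
  apply: (@nice_bound _ _ 147 (`|s| + 3 * h)); first exact: measurable_chi.
    move=> t; have [tl|tl] := leP (2 * h) `|t - s|; first by rewrite chi_out // normr0.
    apply: (reg_bound h0 (@reg_chi h s h0)); move: tl; rewrite ltr_norml => /andP[t1 t2].
    by apply/andP; split; lra.
  move=> t ht; apply: chi_out => //.
  have := ler_normD (t - s) s; rewrite subrK; lra.
apply: (nice_mul (M := A) nc mf) => t.
have [tl|tl _] := leP (2 * h) `|t - s|; first by rewrite chi_out // eqxx.
apply: (reg_bound h0 rf); move: tl; rewrite ltr_norml => /andP[t1 t2].
by apply/andP; split; lra.
Qed.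

(* [1 / (1 + (h D)^2)] is the off-diagonal decay of the correlation of two
   frequencies at distance [D] over a window of length [h]. *)
Lemma window_osc s h f A D p : 0 < h -> 0 <= D -> 0 <= A -> measurable_fun setT f ->
  reg h (s - 3 * h) (s + 3 * h) A f ->
  `|Ir (fun t => chi s h t * f t * osc D p t)| <= 64 * 64 * h * A / (1 + (h * D) ^+ 2).
Proof.
move=> h0 D0 A0 mf rf.
have nf := nice_chi h0 mf rf.
have rg := regM h0 (ler0n _ 147) A0 (@reg_chi h s h0) rf.
set g := fun t => chi s h t * f t in nf rg *.
have g0 t : 2 * h <= `|t - s| -> g t = 0 by move=> H; rewrite /g chi_out // mul0r.
have g1 t : `|g t| <= 441 * A.
  have [tl|tl] := leP (2 * h) `|t - s|; first by rewrite g0 // normr0; lra.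
  rewrite (_ : 441 = 3 * 147); last by ring.
  apply: (reg_bound h0 rg); move: tl; rewrite ltr_norml => /andP[t1 t2].
  by apply/andP; split; lra.
have hD0 : 0 <= h * D by rewrite mulr_ge0 // ltW.
have d0 : 0 < 1 + (h * D) ^+ 2 by have := sqr_ge0 (h * D); lra.
have hA0 : 0 <= h * A by rewrite mulr_ge0 // ltW.
rewrite ler_pdivlMr //.
(* With less than one period per length [h] the trivial bound suffices; otherwise the half period
   [v] is at most [h / 2], within reach of [reg]. *)
have [hD|hD] := ltP (h * D) 1.
  have T : `|Ir (fun t => g t * osc D p t)| <= 441 * A * (s + 2 * h - (s - 2 * h)).
    apply: le_trans (Ir_norm _) _; first exact: nice_osc.
    apply: Ir_le_box; [by apply: nice_norm; exact: nice_osc|lra| |].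
      move=> t _; rewrite normrM; apply: le_trans (g1 t).
      by rewrite ler_piMr // osc_le1.
    move=> t tb; rewrite g0 ?mul0r ?normr0 //; move: tb; apply: contraR.
    by rewrite -ltNge ltr_norml => /andP[t1 t2]; apply/andP; split; lra.
  have : (h * D) ^+ 2 <= 1 by rewrite expr_le1 // ltW.
  have := normr_ge0 (Ir (fun t => g t * osc D p t)).
  move: (`|_|) T => X T X0 h1.
  have : X * (1 + (h * D) ^+ 2) <= X * 2 by apply: ler_wpM2l => //; lra.
  lra.
have Dp : 0 < D by rewrite lt_neqAle D0 andbT; apply: contraTneq hD => <-; rewrite mulr0 -ltNge ltr01.
set v := (2 * D)^-1.
have v0 : 0 < v by rewrite invr_gt0 mulr_gt0.
have vh : v <= h / 2.
  rewrite /v invfM mulrC ler_pM2r // -(ler_pM2r Dp) mulVf ?gt_eqF //.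
have T : `|Ir (fun t => g t * osc D p t)| <=
   4^-1 * (3 * 147 * A * (v / h) ^+ 2 * (s + 2 * h + v - (s - 2 * h - v))).
  apply: le_trans (half_period_bound p Dp nf) _; rewrite -/v ler_pM2l ?invr_gt0 //.
  apply: Ir_le_box; [by apply: nice_norm; exact: nice_D2|lra| |].
    by move=> t /andP[t1 t2]; have [|||//|_ _] := rg t v; lra.
  move=> t tb; rewrite /D2 (g0 (t + v)) ?(g0 (t - v)) ?(g0 t) ?mulr0 ?subr0 ?addr0 ?normr0 //;
  move: tb; apply: contraR; rewrite -ltNge ltr_norml => /andP[t1 t2]; apply/andP; split; lra.
have vE : v / h * (2 * (h * D)) = 1.
  by rewrite /v; field; rewrite !gt_eqF.
have v2E : (v / h) ^+ 2 * (4 * (h * D) ^+ 2) = 1.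
  have := congr1 (fun x => x ^+ 2) vE; rewrite expr1n => H; apply: etrans H; ring.
move: T v2E; set K := (v / h) ^+ 2; set H2 := (h * D) ^+ 2 => T v2E.
have H21 : 1 <= H2 by rewrite /H2 expr_ge1.
have K0 : 0 <= K by exact: sqr_ge0.
move: (`|_|) T => X T.
have {}T : X <= 600 * (h * A) * K.
  have : 3 * 147 * A * K * (s + 2 * h + v - (s - 2 * h - v)) <= 3 * 147 * A * K * (5 * h).
    apply: ler_wpM2l; first by have : 0 <= A * K by [rewrite mulr_ge0]; lra.
    lra.
  have : 0 <= h * A * K by rewrite mulr_ge0.
  lra.
have : X * (1 + H2) <= 600 * (h * A) * K * (1 + H2) by apply: ler_wpM2r => //; exact: ltW.
have : h * A * (K * (1 + H2)) <= h * A * 1.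
  by apply: ler_wpM2l => //; nra.
lra.
Qed.

End Regular.

(** * Almost orthogonality through unit bins *)

Section Bins.
Variable R : realType.

Lemma inv_sqr_telescope (x : R) : 1 <= x -> (1 + x ^+ 2)^-1 <= 2 / x - 2 / (x + 1).
Proof.
move=> x1; have d0 : 0 < 1 + x ^+ 2 by have := sqr_ge0 x; lra.
have -> : 2 / x - 2 / (x + 1) = 2 / (x * (x + 1)).
  by field; rewrite !gt_eqF //; lra.
rewrite -[leLHS]mul1r ler_pdivrMr // mulrAC ler_pdivlMr; nra.
Qed.

(** Either side of the diagonal telescopes to at most 2, and the diagonal adds 1. *)
Lemma sum_kernel (N n : nat) :
  \sum_(m < N) (1 + (n%:R - m%:R) ^+ 2)^-1 <= 5 :> R.
Proof.
have A j : (j <= n)%N ->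
    \sum_(m < j) (1 + (n%:R - m%:R) ^+ 2)^-1 <= 2 / (n%:R - j%:R + 1) :> R.
  elim: j => [|j IH] jn.
    by rewrite big_ord0 divr_ge0 // subr0 addr_ge0.
  rewrite big_ord_recr /=; have {IH} := IH (ltnW jn).
  have x1 : 1 <= n%:R - j%:R :> R by rewrite lerBrDr addrC natr1 ler_nat.
  have := inv_sqr_telescope x1.
  have -> : n%:R - j.+1%:R + 1 = n%:R - j%:R :> R by rewrite -natr1; ring.
  lra.
have B i : \sum_(m < n.+1 + i) (1 + (n%:R - m%:R) ^+ 2)^-1 <= 5 - 2 / (i%:R + 1) :> R.
  elim: i => [|i IH].
    rewrite addn0 big_ord_recr /= subrr expr0n /= addr0 add0r invr1.
    by have := A n (leqnn n); rewrite subrr add0r; lra.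
  rewrite addnS big_ord_recr /=.
  have x1 : 1 <= i%:R + 1 :> R by rewrite lerDr.
  have := inv_sqr_telescope x1.
  have -> : (n%:R - (n.+1 + i)%:R) ^+ 2 = (i%:R + 1) ^+ 2 :> R.
    by rewrite natrD -natr1; ring.
  rewrite -[i.+1%:R]natr1; lra.
have [Nn|nN] := leqP N n.
  apply: le_trans (A N Nn) _; rewrite ler_pdivrMr.
    by have : N%:R <= n%:R :> R by [rewrite ler_nat]; lra.
  by have : N%:R <= n%:R :> R by [rewrite ler_nat]; lra.
rewrite -(subnKC nN); apply: le_trans (B _) _.
by rewrite lerBlDr lerDl divr_ge0 // addr_ge0.
Qed.

(** Schur's test: once the terms are grouped into bin masses [B n], a symmetric kernel with row sums
    at most 5 gives a quadratic form at most 5 times the sum of the [B n ^+ 2], which is the sum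
    over pairs in a common bin. *)
Lemma bins_ord (I : Type) (s : seq I) (x : I -> R) (N : nat) (p : I -> 'I_N) :
  (forall i, 0 <= x i) ->
  \sum_(i <- s) \sum_(j <- s) x i * x j * (1 + ((p i)%:R - (p j)%:R) ^+ 2)^-1
  <= 5 * \sum_(i <- s) \sum_(j <- s | p j == p i) x i * x j.
Proof.
move=> x0; pose B n := \sum_(i <- s | p i == n) x i.
pose k (n m : 'I_N) : R := (1 + (n%:R - m%:R) ^+ 2)^-1.
have B0 n : 0 <= B n by apply: sumr_ge0.
have k0 n m : 0 <= k n m.
  by rewrite invr_ge0; have := sqr_ge0 (n%:R - m%:R : R); lra.
have kC n m : k n m = k m n by rewrite /k -sqrrN opprB.
have sk n : \sum_m k n m <= 5 by exact: sum_kernel.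
have -> : \sum_(i <- s) \sum_(j <- s) x i * x j * (1 + ((p i)%:R - (p j)%:R) ^+ 2)^-1
    = \sum_n \sum_m B n * B m * k n m.
  rewrite (partition_big p xpredT) //=; apply: eq_bigr => n _.
  under eq_bigr => i _ do rewrite (partition_big p xpredT) //=.
  rewrite exchange_big /=; apply: eq_bigr => m _.
  rewrite big_distrlr /= mulr_suml; apply: eq_bigr => i /eqP <-.
  by rewrite mulr_suml; apply: eq_bigr => j /eqP <-.
have -> : \sum_(i <- s) \sum_(j <- s | p j == p i) x i * x j = \sum_n B n ^+ 2.
  rewrite (partition_big p xpredT) //=; apply: eq_bigr => n _.
  rewrite expr2 [RHS]big_distrlr /=; apply: eq_bigr => i /eqP pin.
  by apply: eq_bigl => j; rewrite pin.
apply: (@le_trans _ _ (\sum_n \sum_m 2^-1 * (B n ^+ 2 * k n m + B m ^+ 2 * k m n))).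
  apply: ler_sum => n _; apply: ler_sum => m _; rewrite (kC m n) -mulrDl.
  rewrite mulrA; apply: ler_wpM2r => //.
  have := sqr_ge0 (B n - B m); nra.
rewrite (eq_bigr (fun n => 2^-1 * \sum_m B n ^+ 2 * k n m + 2^-1 * \sum_m B m ^+ 2 * k m n)); last first.
  by move=> n _; rewrite -mulr_sumr big_split /= mulrDr.
rewrite big_split /= -!mulr_sumr [X in _ + 2^-1 * X]exchange_big /=.
have H : \sum_n \sum_m B n ^+ 2 * k n m <= 5 * \sum_n B n ^+ 2.
  rewrite mulr_sumr; apply: ler_sum => n _; rewrite -mulr_sumr mulrC.
  by apply: ler_wpM2r => //; exact: sqr_ge0.
lra.
Qed.

Lemma bins (I : eqType) (s : seq I) (x : I -> R) (n : I -> nat) :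
  (forall i, 0 <= x i) ->
  \sum_(i <- s) \sum_(j <- s) x i * x j * (1 + ((n i)%:R - (n j)%:R) ^+ 2)^-1
  <= 5 * \sum_(i <- s) \sum_(j <- s | n j == n i) x i * x j.
Proof.
move=> x0; pose N := \max_(i <- s) n i.
pose p i : 'I_N.+1 := inord (n i).
have pE i : i \in s -> (p i : nat) = n i.
  by move=> si; rewrite /p inordK // ltnS /N; exact: leq_bigmax_seq.
have := @bins_ord I s x N.+1 p x0.
rewrite (eq_big_seq (fun i => \sum_(j <- s) x i * x j * (1 + ((n i)%:R - (n j)%:R) ^+ 2)^-1)).
  rewrite [X in _ <= 5 * X](eq_big_seq (fun i => \sum_(j <- s | n j == n i) x i * x j)) //.
  move=> i si; rewrite big_seq_cond [RHS]big_seq_cond; apply: eq_bigl => j.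
  by case: (boolP (j \in s)) => //= sj; rewrite -val_eqE /= !pE.
by move=> i si; apply: eq_big_seq => j sj; rewrite !pE.
Qed.

End Bins.

(** * Mean square of a sum of modulated waves *)

Section MeanSquare.
Variable R : realType.

(** The product of two waves splits into the difference and the sum of their frequencies. As
    frequencies are nonnegative both are at least [|b i - b j|], so both correlations decay in the
    distance and Schur's test applies to the bins of [h * b]. *)
Lemma window_mean_square (I : eqType) (s : seq I) (c b A : I -> R) (a : I -> R -> R)
    (x0 h p : R) : 0 < h -> (forall i, 0 <= b i) -> (forall i, 0 <= A i) ->
  (forall i, measurable_fun setT (a i)) ->
  (forall i, reg h (x0 - 3 * h) (x0 + 3 * h) (A i) (a i)) ->
  Ir (fun t => chi x0 h t * (\sum_(i <- s) c i * (osc (b i) p t * a i t)) ^+ 2)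
  <= 240 * 32 * 32 * h * \sum_(i <- s)
      \sum_(j <- s | Num.truncn (h * b j) == Num.truncn (h * b i))
        (`|c i| * A i) * (`|c j| * A j).
Proof.
move=> h0 b0 A0 ma ra.
pose F i j t := 2^-1 * (c i * c j) * (chi x0 h t * (a i t * a j t) * osc `|b i - b j| 0 t)
   + 2^-1 * (c i * c j) * (chi x0 h t * (a i t * a j t) * osc (b i + b j) (2 * p) t).
have maa i j : measurable_fun setT (fun t => a i t * a j t) by apply: measurable_funM.
have raa i j : reg h (x0 - 3 * h) (x0 + 3 * h) (3 * A i * A j) (fun t => a i t * a j t).
  by apply: regM.
have nG i j D q : nice (fun t => chi x0 h t * (a i t * a j t) * osc D q t).
  by apply: nice_osc; apply: nice_chi.
have nF i j : nice (F i j).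
  by apply: niceD; apply: niceZ.
have -> : Ir (fun t => chi x0 h t * (\sum_(i <- s) c i * (osc (b i) p t * a i t)) ^+ 2)
   = \sum_(i <- s) \sum_(j <- s) Ir (F i j).
  rewrite (eq_bigr (fun i => Ir (fun t => \sum_(j <- s) F i j t))); last first.
    by move=> i _; rewrite Ir_sum.
  rewrite -Ir_sum; last by move=> i; apply: nice_sum.
  apply: eq_Ir => t; rewrite expr2 big_distrlr /= mulr_sumr; apply: eq_bigr => i _.
  rewrite mulr_sumr; apply: eq_bigr => j _; rewrite /F.
  have -> : osc `|b i - b j| 0 t = osc (b i) p t * osc (b j) p t + sin (2 * pi * b i * t + p) * sin (2 * pi * b j * t + p).
    rewrite /osc addr0 -cosB.
    have [h1|h1] := ger0P (b i - b j); last rewrite -cosN; congr cos; ring.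
  have -> : osc (b i + b j) (2 * p) t = osc (b i) p t * osc (b j) p t - sin (2 * pi * b i * t + p) * sin (2 * pi * b j * t + p).
    rewrite /osc -cosD; congr cos; ring.
  by field.
pose x i := `|c i| * A i; have x_ge0 i : 0 <= x i by rewrite mulr_ge0.
pose n i := Num.truncn (h * b i).
have hb i : 0 <= h * b i by rewrite mulr_ge0 // ltW.
have tr i : (n i)%:R <= h * b i < (n i)%:R + 1.
  have /andP[h1 h2] := truncn_itv (hb i).
  by rewrite h1 /= natr1.
(* The constant is [64 * 64] from [window_osc], times 3 from [regM], times 4 from rounding to bins;
   the two halves of [F] add up to one. *)
have step i j : Ir (F i j) <= (48 * 32 * 32) * h * (x i * x j * (1 + ((n i)%:R - (n j)%:R) ^+ 2)^-1).
  rewrite IrD; [|by apply: niceZ|by apply: niceZ]; rewrite !IrZ //.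
  have A3 : 0 <= 3 * A i * A j by rewrite !mulr_ge0.
  have D1 : 0 <= `|b i - b j| by [].
  have D2 : 0 <= b i + b j by rewrite addr_ge0.
  have := window_osc 0 h0 D1 A3 (maa i j) (raa i j).
  have := window_osc (2 * p) h0 D2 A3 (maa i j) (raa i j).
  set X := Ir _; set Y := Ir _.
  set k := (1 + ((n i)%:R - (n j)%:R) ^+ 2)^-1.
  (* Rounding moves the distance [h * D] by at most 1, and [1 + (z + 1) ^ 2 <= 4 * (1 + z ^ 2)]. *)
  have kb D : `|b i - b j| <= D -> (1 + (h * D) ^+ 2)^-1 <= 4 * k.
    move=> bD; have D0 : 0 <= D by apply: le_trans bD.
    have p1 : 0 < 1 + (h * D) ^+ 2 by have := sqr_ge0 (h * D); lra.
    have p2 : 0 < 1 + ((n i)%:R - (n j)%:R) ^+ 2 :> R.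
      by have := sqr_ge0 ((n i)%:R - (n j)%:R : R); lra.
    rewrite -[leLHS]mul1r ler_pdivrMr // mulrAC ler_pdivlMr // mul1r.
    have d1 : `|(n i)%:R - (n j)%:R| <= h * D + 1 :> R.
      have : h * `|b i - b j| <= h * D by rewrite ler_pM2l.
      have : h * (b i - b j) <= h * `|b i - b j| by rewrite ler_pM2l // ler_norm.
      have : h * (b j - b i) <= h * `|b i - b j| by rewrite ler_pM2l // distrC ler_norm.
      have /andP[i1 i2] := tr i; have /andP[j1 j2] := tr j.
      move=> ? ? ?; rewrite ler_norml; apply/andP; split; lra.
    have hD0 : 0 <= h * D by rewrite mulr_ge0 // ltW.
    have : ((n i)%:R - (n j)%:R) ^+ 2 <= (h * D + 1) ^+ 2 :> R.
      rewrite -real_normK ?num_real // ler_pXn2r // nnegrE //; lra.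
    have := sqr_ge0 (h * D - 1); nra.
  have bb : `|b i - b j| <= b i + b j.
    by have := b0 i; have := b0 j => *; rewrite ler_norml; apply/andP; split; lra.
  have hA : 0 <= (64 * 64) * h * (3 * A i * A j) by rewrite mulr_ge0 // mulr_ge0 // ltW.
  have k1 := ler_wpM2l hA (kb _ (lexx _)).
  have k2 := ler_wpM2l hA (kb _ bb).
  move=> /le_trans/(_ k2) hX /le_trans/(_ k1) hY.
  have cc : 0 <= `|c i| * `|c j| by rewrite mulr_ge0.
  have := ler_norm (c i * c j * Y); have := ler_norm (c i * c j * X).
  rewrite !normrM.
  have := ler_wpM2l cc hX; have := ler_wpM2l cc hY.
  rewrite /x; lra.
apply: (@le_trans _ _ (\sum_(i <- s) \sum_(j <- s) (48 * 32 * 32) * h * (x i * x j * (1 + ((n i)%:R - (n j)%:R) ^+ 2)^-1))).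
  by apply: ler_sum => i _; apply: ler_sum => j _.
under eq_bigr => i _ do rewrite -mulr_sumr.
rewrite -mulr_sumr.
have h480 : 0 <= (48 * 32 * 32) * h by rewrite mulr_ge0 // ltW.
apply: le_trans (ler_wpM2l h480 (bins s n x_ge0)) _.
rewrite mulrA; apply: ler_wpM2r; last by lra.
by apply: sumr_ge0 => i _; apply: sumr_ge0 => j _; rewrite mulr_ge0.
Qed.

End MeanSquare.

(** * Support function and chords *)

Section Body.
Variable R : realType.
Implicit Types (Om : set (R * R)) (k l p q x y : R * R).

Definition nrm x : R := Num.sqrt (x.1 ^+ 2 + x.2 ^+ 2).

Lemma nrm_ge0 x : 0 <= nrm x. Proof. exact: sqrtr_ge0. Qed.

Lemma nrmE x : nrm x ^+ 2 = x.1 ^+ 2 + x.2 ^+ 2.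
Proof. by rewrite sqr_sqrtr // addr_ge0 // sqr_ge0. Qed.

Lemma nrm_gt0 x : x != (0, 0) -> 0 < nrm x.
Proof.
move=> x0; rewrite sqrtr_gt0 lt_neqAle addr_ge0 ?sqr_ge0 // andbT eq_sym.
rewrite paddr_eq0 ?sqr_ge0 // !sqrf_eq0; apply: contra x0 => /andP[/eqP h1 /eqP h2].
by rewrite [X in X == _]surjective_pairing h1 h2.
Qed.

Lemma le_nrm x (c : R) : 0 <= c -> (nrm x <= c) = (x.1 ^+ 2 + x.2 ^+ 2 <= c ^+ 2).
Proof. by move=> c0; rewrite -nrmE ler_pXn2r // nnegrE // nrm_ge0. Qed.

Lemma ge_nrm x (c : R) : 0 <= c -> (c <= nrm x) = (c ^+ 2 <= x.1 ^+ 2 + x.2 ^+ 2).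
Proof. by move=> c0; rewrite -nrmE ler_pXn2r // nnegrE // nrm_ge0. Qed.

Lemma dot2_le x y : `|dot2 x y| <= nrm x * nrm y.
Proof.
rewrite -(@ler_pXn2r _ 2) ?nnegrE ?mulr_ge0 ?nrm_ge0 // exprMn !nrmE real_normK ?num_real // /dot2.
have := sqr_ge0 (x.1 * y.2 - x.2 * y.1); nra.
Qed.

Lemma abs1_le_nrm x : `|x.1| <= nrm x.
Proof. by rewrite ge_nrm // real_normK ?num_real // lerDl sqr_ge0. Qed.

Lemma abs2_le_nrm x : `|x.2| <= nrm x.
Proof. by rewrite ge_nrm // real_normK ?num_real // lerDr sqr_ge0. Qed.

Lemma nrm_le_abs x : nrm x <= `|x.1| + `|x.2|.
Proof.
rewrite le_nrm ?addr_ge0 // -[x.1 ^+ 2]real_normK ?num_real // -[x.2 ^+ 2]real_normK ?num_real //.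
have := normr_ge0 x.1; have := normr_ge0 x.2; nra.
Qed.

Lemma nrmD x y : nrm (x.1 + y.1, x.2 + y.2) <= nrm x + nrm y.
Proof.
rewrite le_nrm ?addr_ge0 ?nrm_ge0 //=.
have := dot2_le x y; have := nrmE x; have := nrmE y; have := ler_norm (dot2 x y).
rewrite /dot2; nra.
Qed.

(** An open set is the union of the rational boxes it contains. Boxes not contained in it are
    replaced by the empty set, so that the union runs over all rational triples. *)
Lemma measurable_open2 Om : open Om -> measurable Om.
Proof.
move=> oO.
pose box (a b e : rat) : set (R * R) :=
  `](ratr a - ratr e), (ratr a + ratr e)[%classic `*` `](ratr b - ratr e), (ratr b + ratr e)[%classic.
have -> : Om = \bigcup_(a in setT) \bigcup_(b in setT) \bigcup_(e in setT)
    (if `[< box a b e `<=` Om >] then box a b e else set0).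
  apply/seteqP; split => [x Ox|x [a _ [b _ [e _]]]]; last by case: asboolP => // + ?; exact.
  have /nbhs_ballP[e /= e0 he] : nbhs x Om by exact: open_nbhs_nbhs.
  have e4 : 0 < e / 4 by rewrite divr_gt0.
  have [a /itvP ha] : exists a : rat, ratr a \in `]x.1 - e / 4, x.1 + e / 4[.
    by apply: rat_in_itvoo; lra.
  have [b /itvP hb] : exists a : rat, ratr a \in `]x.2 - e / 4, x.2 + e / 4[.
    by apply: rat_in_itvoo; lra.
  have [r /itvP hr] : exists a : rat, ratr a \in `]e / 4, e / 2[.
    by apply: rat_in_itvoo; lra.
  have a1 : x.1 - e / 4 < ratr a by rewrite ha.
  have a2 : ratr a < x.1 + e / 4 by rewrite ha.
  have b1 : x.2 - e / 4 < ratr b by rewrite hb.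
  have b2 : ratr b < x.2 + e / 4 by rewrite hb.
  have r1 : e / 4 < ratr r by rewrite hr.
  have r2 : ratr r < e / 2 by rewrite hr.
  exists a => //; exists b => //; exists r => //.
  have -> : `[< box a b r `<=` Om >].
    apply/asboolP => y; rewrite /box => -[/=]; rewrite !in_itv /= => /andP[y1 y2] /andP[y3 y4].
    by apply: he; split; rewrite /ball /= ltr_norml; apply/andP; split; lra.
  by split; rewrite /= in_itv /=; apply/andP; split; lra.
apply: bigcupT_measurable_rat => a; apply: bigcupT_measurable_rat => b.
apply: bigcupT_measurable_rat => e; case: asboolP => _ //.
by apply: measurableX.
Qed.

Section Support.
Variables (Om : set (R * R)) (c0 M : R).
Hypotheses (oO : open Om) (cO : convex2 Om) (c0_gt0 : 0 < c0).
Hypothesis (OM : forall x, Om x -> nrm x <= M).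
Hypothesis (cOm : forall x, `|x.1| <= c0 -> `|x.2| <= c0 -> Om x).

Let b k := rho_star Om k.

Lemma Om0 : Om (0, 0). Proof. by apply: cOm; rewrite normr0 ltW. Qed.

Lemma M_ge0 : 0 <= M. Proof. by apply: le_trans (OM Om0); exact: nrm_ge0. Qed.

Lemma rho_has_sup k : has_sup [set dot2 x k | x in Om].
Proof.
split; first by exists (dot2 (0, 0) k), (0, 0) => //; exact: Om0.
exists (M * nrm k) => _ [x Ox <-].
apply: le_trans (ler_norm _) _; apply: le_trans (dot2_le _ _) _.
by apply: ler_wpM2r; [exact: nrm_ge0|exact: OM].
Qed.

Lemma dot2_le_rho x k : Om x -> dot2 x k <= b k.
Proof. by move=> Ox; apply: sup_upper_bound; [exact: rho_has_sup|exists x]. Qed.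

Lemma rho_approx k (z : R) : z < b k -> exists2 x, Om x & z < dot2 x k.
Proof.
move=> zb; have e0 : 0 < b k - z by rewrite subr_gt0.
have [_ [x Ox <-]] := sup_adherent e0 (rho_has_sup k).
by rewrite -/(rho_star Om k) -/(b k) subKr; exists x.
Qed.

Lemma rho_le k (z : R) : (forall x, Om x -> dot2 x k <= z) -> b k <= z.
Proof. by move=> h; rewrite leNgt; apply/negP => /rho_approx[x /h]; rewrite leNgt => /negP. Qed.

Lemma Om_shift x (u : R * R) : Om x -> exists2 e : R, 0 < e &
  forall s, `|s| < e -> Om (x.1 + s * u.1, x.2 + s * u.2).
Proof.
move=> Ox; have /nbhs_ballP[e /= e0 he] : nbhs x Om by exact: open_nbhs_nbhs.
have d0 : 0 < `|u.1| + `|u.2| + 1 by have := normr_ge0 u.1; have := normr_ge0 u.2; lra.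
exists (e / (`|u.1| + `|u.2| + 1)); first by rewrite divr_gt0.
move=> s; rewrite ltr_pdivlMr // => hs; apply: he.
have := normr_ge0 u.1; have := normr_ge0 u.2; have := normr_ge0 s.
split; rewrite /ball /= opprD addNKr normrN normrM; nra.
Qed.

(** Openness lets [x] move a little further in the direction [k]. *)
Lemma dot2_lt_rho x k : k != (0, 0) -> Om x -> dot2 x k < b k.
Proof.
move=> k0 Ox; have [e e0 he] := Om_shift k Ox.
have /he/(dot2_le_rho k) : `|e / 2| < e by rewrite gtr0_norm; lra.
rewrite /dot2 /=; have := nrm_gt0 k0; have := nrmE k => E n0.
have : 0 < e / 2 * nrm k ^+ 2 by rewrite mulr_gt0 ?exprn_gt0 //; lra.
rewrite E; lra.
Qed.

Lemma rho_ge k : c0 * nrm k <= b k.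
Proof.
have [->|k0] := eqVneq k (0, 0).
  rewrite {1}/nrm /= expr0n addr0 sqrtr0 mulr0.
  by apply: le_trans (dot2_le_rho _ Om0); rewrite /dot2 /= !mulr0 addr0.
have n0 := nrm_gt0 k0.
have h : Om (c0 * (k.1 / nrm k), c0 * (k.2 / nrm k)).
  apply: cOm => /=; rewrite normrM gtr0_norm // -[leRHS]mulr1 ler_pM2l // normrM normfV (gtr0_norm n0) ler_pdivrMr // mul1r.
    exact: abs1_le_nrm.
  exact: abs2_le_nrm.
have := dot2_le_rho k h; apply: le_trans; rewrite /dot2 /=.
have E := nrmE k.
rewrite (_ : _ + _ = c0 * ((k.1 ^+ 2 + k.2 ^+ 2) / nrm k)); last by ring.
by rewrite -E expr2 mulfK // gt_eqF.
Qed.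

Lemma rho_leM k : b k <= M * nrm k.
Proof.
apply: rho_le => x Ox; apply: le_trans (ler_norm _) _; apply: le_trans (dot2_le _ _) _.
by apply: ler_wpM2r; [exact: nrm_ge0|exact: OM].
Qed.

Lemma rho_lip k l : `|b k - b l| <= M * nrm (k.1 - l.1, k.2 - l.2).
Proof.
have H k' l' : b k' - b l' <= M * nrm (k'.1 - l'.1, k'.2 - l'.2).
  rewrite lerBlDr; apply: rho_le => x Ox.
  have := dot2_le_rho l' Ox; have := dot2_le x (k'.1 - l'.1, k'.2 - l'.2).
  have := ler_wpM2r (nrm_ge0 (k'.1 - l'.1, k'.2 - l'.2)) (OM Ox).
  have := ler_norm (dot2 x (k'.1 - l'.1, k'.2 - l'.2)); rewrite {1 2}/dot2 /=.
  rewrite {2 3}/dot2; nra.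
rewrite ler_norml; apply/andP; split; last exact: H.
have := H l k; rewrite (_ : nrm (l.1 - k.1, l.2 - k.2) = nrm (k.1 - l.1, k.2 - l.2)); first by lra.
by rewrite /nrm /= -(opprB k.1) -(opprB k.2) !sqrrN.
Qed.

Lemma rhoZ k (a : R) : 0 <= a -> b (a * k.1, a * k.2) = a * b k.
Proof.
move=> a0; have [->|an0] := eqVneq a 0.
  rewrite !mul0r; apply/le_anti/andP; split.
    by apply: rho_le => x _; rewrite /dot2 /= !mulr0 addr0.
  by apply: le_trans (dot2_le_rho _ Om0); rewrite /dot2 /= !mulr0 addr0.
have ap : 0 < a by rewrite lt_neqAle eq_sym an0.
apply/le_anti/andP; split.
  apply: rho_le => x Ox; have := dot2_le_rho k Ox; rewrite -(ler_pM2l ap) /dot2 /=; lra.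
rewrite mulrC -ler_pdivlMr //; apply: rho_le => x Ox.
rewrite ler_pdivlMr //; have := dot2_le_rho (a * k.1, a * k.2) Ox; rewrite /dot2 /=; lra.
Qed.

Section Chord.
Variable K : R.
Hypothesis muK : forall (th : R * R) (d : R), S1 th -> 0 < d ->
  d ^-1 * @Num.sqrt R d * mu Om th d <= K.

Lemma closure_bounded x : closure Om x -> nrm x <= M + 2.
Proof.
move=> /(_ (ball x 1)) [|y [Oy [/= b1 b2]]].
  by apply: nbhsx_ballx.
rewrite /ball /= in b1 b2.
have := nrmD y (x.1 - y.1, x.2 - y.2); rewrite /= !(addrC _ (_ - _)) !subrK -surjective_pairing.
have := nrm_le_abs (x.1 - y.1, x.2 - y.2) => /=; have := OM Oy; lra.
Qed.

Let line p (e : R * R) (s : R) : R * R := (p.1 + s * e.1, p.2 + s * e.2).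

Let line_bound p e s : e.1 ^+ 2 + e.2 ^+ 2 = 1 -> Om p -> Om (line p e s) -> `|s| <= 2 * M.
Proof.
move=> e1 Op Os.
have -> : `|s| = nrm (s * e.1, s * e.2).
  by rewrite /nrm /= !exprMn -mulrDr e1 mulr1 sqrtr_sqr.
have := nrmD (line p e s) (- p.1, - p.2); rewrite /line /=.
rewrite !(addrAC _ _ (- _)) !subrr !add0r.
have := OM Op; have := OM Os; rewrite /line.
have -> : nrm (- p.1, - p.2) = nrm p by rewrite /nrm /= !sqrrN.
lra.
Qed.

(** The exit parameter is a supremum, so the exit point is adherent to [Om]; it is not interior, for
    then the ray would continue inside. *)
Let exit p e : e.1 ^+ 2 + e.2 ^+ 2 = 1 -> Om p ->
  exists2 s : R, (forall t, Om (line p e t) -> t <= s) & boundary2 Om (line p e s).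
Proof.
move=> e1 Op; pose T := [set t | Om (line p e t)].
have T0 : T 0 by rewrite /T /line /= !mul0r !addr0 -surjective_pairing.
have hT : has_sup T.
  split; first by exists 0.
  exists (2 * M) => t Tt; apply: le_trans (ler_norm _) _; exact: line_bound Tt.
exists (sup T); first by move=> t Tt; apply: sup_upper_bound.
split.
  move=> B /nbhs_ballP[d /= d0 hd].
  have [t Tt ht] := @sup_adherent _ T d d0 hT.
  exists (line p e t); split => //; apply: hd.
  have h1 : t <= sup T by apply: sup_upper_bound.
  have e11 : `|e.1| <= 1.
    by rewrite -(@expr_le1 _ 2) // real_normK ?num_real // -e1 lerDl sqr_ge0.
  have e21 : `|e.2| <= 1.
    by rewrite -(@expr_le1 _ 2) // real_normK ?num_real // -e1 lerDr sqr_ge0.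
  have ab : `|sup T - t| < d by rewrite ger0_norm; lra.
  split; rewrite /ball /line /= opprD addrACA subrr add0r -mulrBl normrM.
    by apply: le_lt_trans ab; rewrite ler_piMr.
  by apply: le_lt_trans ab; rewrite ler_piMr.
move=> /interior_subset Os.
have [d d0 hd] := Om_shift e Os.
have : T (sup T + d / 2).
  rewrite /T /= /line !mulrDl !addrA; apply: hd; rewrite gtr0_norm; lra.
move=> /(sup_upper_bound hT); lra.
Qed.

(** The line through [p] and [q] leaves [Om] at two boundary points of the same depth, both in the
    set whose diameter is [mu], with [d] the depth divided by [nrm k]. The constant [|K| + 1] is
    positive whatever the sign of [K]. *)
Lemma chord_bound k p q : k != (0, 0) -> Om p -> Om q -> dot2 p k = dot2 q k ->
  ((p.1 - q.1) ^+ 2 + (p.2 - q.2) ^+ 2) * nrm k <= (`|K| + 1) ^+ 2 * (b k - dot2 p k).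
Proof.
move=> k0 Op Oq pq; have n0 := nrm_gt0 k0; have nE := nrmE k.
pose e : R * R := (- k.2 / nrm k, k.1 / nrm k).
have nn : nrm k != 0 by rewrite gt_eqF.
have n2 : nrm k ^+ 2 != 0 by rewrite expf_eq0.
have e1 : e.1 ^+ 2 + e.2 ^+ 2 = 1.
  by rewrite /e /= !exprMn sqrrN -mulrDl addrC -nE exprVn mulfV.
have e1' : (- e.1) ^+ 2 + (- e.2) ^+ 2 = 1 by rewrite !sqrrN.
pose tau := (q.1 - p.1) * e.1 + (q.2 - p.2) * e.2.
have pqE : (q.1 - p.1) * k.1 + (q.2 - p.2) * k.2 = 0.
  transitivity (dot2 q k - dot2 p k); last by rewrite pq subrr.
  by rewrite /dot2; ring.
have qE : q = line p e tau.
  rewrite /line /tau /e /= [LHS]surjective_pairing; congr (_, _).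
    have : (q.1 - p.1) * nrm k ^+ 2 = (- (q.1 - p.1) * k.2 + (q.2 - p.2) * k.1) * - k.2.
      apply/eqP; rewrite -subr_eq0 nE; apply/eqP.
      transitivity (k.1 * ((q.1 - p.1) * k.1 + (q.2 - p.2) * k.2)); first by ring.
      by rewrite pqE mulr0.
    move=> H; have {}H : q.1 - p.1 = (- (q.1 - p.1) * k.2 + (q.2 - p.2) * k.1) * - k.2 / nrm k ^+ 2.
      by rewrite -H mulfK.
    by rewrite -[LHS](subrK p.1) addrC; congr (_ + _); rewrite [LHS]H; field.
  have : (q.2 - p.2) * nrm k ^+ 2 = (- (q.1 - p.1) * k.2 + (q.2 - p.2) * k.1) * k.1.
    apply/eqP; rewrite -subr_eq0 nE; apply/eqP.
    transitivity (k.2 * ((q.1 - p.1) * k.1 + (q.2 - p.2) * k.2)); first by ring.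
    by rewrite pqE mulr0.
  move=> H; have {}H : q.2 - p.2 = (- (q.1 - p.1) * k.2 + (q.2 - p.2) * k.1) * k.1 / nrm k ^+ 2.
    by rewrite -H mulfK.
  by rewrite -[LHS](subrK p.2) addrC; congr (_ + _); rewrite [LHS]H; field.
have [s1 hs1 bs1] := exit e1 Op.
have [s2 hs2 bs2] := exit (e := (- e.1, - e.2)) e1' Op.
have bs2' : boundary2 Om (line p e (- s2)).
  by move: bs2; rewrite /line /= !mulrN -!mulNr.
have s10 : 0 <= s1 by apply: hs1; rewrite /line !mul0r !addr0 -surjective_pairing.
have s20 : 0 <= s2 by apply: hs2; rewrite /line !mul0r !addr0 -surjective_pairing.
have t1 : tau <= s1 by apply: hs1; rewrite -qE.
have t2 : - tau <= s2 by apply: hs2; move: Oq; rewrite {1}qE /line /= !mulrNN.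
pose th : R * R := (k.1 / nrm k, k.2 / nrm k).
have th1 : S1 th by rewrite /S1 /= !exprMn -mulrDl -nE exprVn mulfV.
have rth : rho_star Om th = b k / nrm k.
  have := @rhoZ k (nrm k)^-1; rewrite invr_ge0 nrm_ge0 => /(_ isT).
  by rewrite /th ![_ / nrm k]mulrC.
pose d := (b k - dot2 p k) / nrm k.
have d0 : 0 < d by rewrite divr_gt0 // subr_gt0 dot2_lt_rho.
have ldot s : dot2 (line p e s) th = rho_star Om th - d.
  rewrite rth /d /dot2 /line /th /e /=; field; exact: nn.
have C1 : Ccap Om th d (line p e s1) by split.
have C2 : Ccap Om th d (line p e (- s2)) by split.
have mu1 : s1 + s2 <= mu Om th d.
  have -> : s1 + s2 = dist2 (line p e s1) (line p e (- s2)).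
    rewrite /dist2 /line /=.
    have -> : (p.1 + s1 * e.1 - (p.1 + - s2 * e.1)) ^+ 2 + (p.2 + s1 * e.2 - (p.2 + - s2 * e.2)) ^+ 2
       = (s1 + s2) ^+ 2 * (e.1 ^+ 2 + e.2 ^+ 2) by ring.
    by rewrite e1 mulr1 sqrtr_sqr ger0_norm // addr_ge0.
  apply: sup_upper_bound; last by exists (line p e s1) => //; exists (line p e (- s2)).
  split; first by exists (dist2 (line p e s1) (line p e (- s2))), (line p e s1) => //; exists (line p e (- s2)).
  (* A supremum dominates its members only for a bounded set, hence the appeal to the boundedness of
     the closure. *)
  exists (2 * (M + 2)) => _ [x [[cx _] _] [y [[cy _] _] <-]].
  have := closure_bounded cx; have := closure_bounded cy.
  have := nrmD x (- y.1, - y.2); rewrite /=.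
  have -> : nrm (- y.1, - y.2) = nrm y by rewrite /nrm /= !sqrrN.
  rewrite /dist2 -/(nrm (x.1 - y.1, x.2 - y.2)); lra.
have sd0 : 0 < Num.sqrt d by rewrite sqrtr_gt0.
have muk : mu Om th d <= (`|K| + 1) * Num.sqrt d.
  have := muK th1 d0.
  have -> : d^-1 * Num.sqrt d = (Num.sqrt d)^-1.
    by rewrite -{1}(sqr_sqrtr (ltW d0)) expr2 invfM mulfVK // gt_eqF.
  rewrite mulrC ler_pdivrMr // => /le_trans; apply.
  by apply: ler_wpM2r; [exact: ltW|have := ler_norm K; lra].
have tau_le : tau ^+ 2 <= (`|K| + 1) ^+ 2 * d.
  rewrite -(sqr_sqrtr (ltW d0)) -exprMn -real_normK ?num_real // ler_pXn2r ?nnegrE //.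
    by rewrite ler_norml; apply/andP; split; lra.
have -> : (p.1 - q.1) ^+ 2 + (p.2 - q.2) ^+ 2 = tau ^+ 2.
  rewrite qE /line /=.
  have -> : (p.1 - (p.1 + tau * e.1)) ^+ 2 + (p.2 - (p.2 + tau * e.2)) ^+ 2 = tau ^+ 2 * (e.1 ^+ 2 + e.2 ^+ 2) by ring.
  by rewrite e1 mulr1.
by rewrite -ler_pdivlMr // -mulrA.
Qed.

End Chord.
End Support.
End Body.

(** * Lengths of sets on the line, and concavity up to the ends *)

Section Interval.
Variable R : realType.
Implicit Types (T : set R) (f : R -> R) (c d x y z D e : R).

Lemma Ir_indic_le T D : 0 <= D -> nice (\1_T : R -> R) ->
  (forall x y, T x -> T y -> `|x - y| <= D) -> Ir (\1_T) <= D.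
Proof.
move=> D0 nT hT.
have [[x0 Tx0]|T0] := pselect (exists x, T x); last first.
  rewrite (eq_Ir (g := fun=> 0)) ?Ir0 // => x.
  by rewrite indicE memNset // => Tx; apply: T0; exists x.
pose i := inf T.
have hb : has_lbound T.
  exists (x0 - D) => y Ty; have := hT _ _ Tx0 Ty; rewrite ler_norml => /andP[_]; lra.
have H := @Ir_le_box R (\1_T) 1 i (i + D) nT.
have := H; rewrite mul1r addrAC subrr add0r; apply.
- lra.
- by move=> x _; rewrite indicE lern1 leq_b1.
- move=> x; apply: contraR; rewrite -ltNge indicE; case: (boolP (x \in T)); last by rewrite ltxx.
  rewrite inE => Tx _; apply/andP; split; first exact: ge_inf.
  rewrite -lerBlDr; apply: lb_le_inf; first by exists x0.
  by move=> y Ty; have := hT _ _ Tx Ty; rewrite ler_norml => /andP[_]; lra.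
Qed.

Lemma Ir_indic_ge T x y : nice (\1_T : R -> R) ->
  (forall z, x <= z <= y -> T z) -> x <= y -> y - x <= Ir (\1_T).
Proof.
move=> nT hT xy; rewrite -Ir_box //; apply: Ir_le => //; first exact: nice_box.
move=> z; have [h|h] := boolP (x <= z <= y); last by rewrite box_out // indicE.
by rewrite box_in // indicE mem_set //; exact: hT.
Qed.

(** The measure of a set is at most its diameter, which two of its points attain up to [e]. *)
Lemma Ir_indic_approx T e : nice (\1_T : R -> R) -> (exists x, T x) -> 0 < e ->
  exists x y, [/\ T x, T y, x <= y & Ir (\1_T) - e <= y - x].
Proof.
move=> nT [x0 Tx0] e0.
have [h|h] := leP (Ir (\1_T)) e.
  by exists x0, x0; split => //; rewrite subrr; lra.
apply: contrapT => H.
suff : Ir (\1_T) <= Ir (\1_T) - e by lra.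
apply: Ir_indic_le => //; first by lra.
move=> x y Tx Ty; rewrite leNgt; apply/negP => hxy; apply: H.
have [xy|yx] := leP x y.
  by exists x, y; split => //; move: hxy; rewrite distrC ger0_norm; lra.
by exists y, x; split => //; [exact: ltW|move: hxy; rewrite gtr0_norm; lra].
Qed.

(** A triple touching an end is a limit of interior triples in which the nonnegative value near that
    end is dropped. Continuity at the ends is thereby avoided: the profile may jump down to 0. *)
Lemma ccv_closure f c d : (forall x, 0 <= f x) -> f c = 0 -> f d = 0 ->
  (forall x y z, c < x -> x < y -> y < z -> z < d ->
     (z - y) * f x + (y - x) * f z <= (z - x) * f y) -> ccv c d f.
Proof.
move=> f0 fc fd H x y z cx xy yz zd.
have lim (A B : R) l r : l < r -> (forall u, l < u < r -> A <= u * B) -> A <= r * B.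
  move=> lr hu; rewrite leNgt; apply/negP => h.
  pose e := Num.min ((r - l) / 2) ((A - r * B) / (2 * (`|B| + 1))).
  have B1 : 0 < `|B| + 1 by have := normr_ge0 B; lra.
  have e0 : 0 < e by rewrite lt_min !divr_gt0 //; lra.
  have e1 : e <= (r - l) / 2 by rewrite ge_min lexx.
  have e2 : e * (2 * (`|B| + 1)) <= A - r * B.
    by rewrite -ler_pdivlMr ?mulr_gt0 // ge_min lexx orbT.
  have := hu (r - e); have -> : l < r - e < r by apply/andP; split; lra.
  move=> /(_ isT); have := ler_norm B; have := ler_norm (- B); rewrite normrN.
  nra.
have lim' (A B : R) l r : l < r -> (forall u, l < u < r -> A <= u * B) -> A <= l * B.
  move=> lr hu; rewrite -[leRHS]opprK -mulNr -mulrN; apply: (lim _ _ (- r)); first by lra.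
  by move=> u hr; rewrite -mulrNN opprK; apply: hu; lra.
have [->|xny] := eqVneq x y; first by rewrite subrr mul0r addr0.
have [->|ynz] := eqVneq y z; first by rewrite subrr mul0r add0r.
have {}xy : x < y by rewrite lt_neqAle xny.
have {}yz : y < z by rewrite lt_neqAle ynz.
have Hr x' : c < x' -> x' < y -> (d - y) * f x' <= (d - x') * f y.
  move=> cx' xy'; have [dy|yd] := leP d y.
    have : (d - y) * f x' <= 0 by apply: mulr_le0_ge0 => //; lra.
    have := lt_le_trans yz zd; lra.
  suff : x' * f y - y * f x' <= d * (f y - f x') by lra.
  apply: (lim _ _ y) => // u /andP[yu ud]; have := H x' y u cx' xy' yu ud.
  have : 0 <= (y - x') * f u by rewrite mulr_ge0 // subr_ge0 ltW.
  lra.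
have Hl z' : z' < d -> y < z' -> (y - c) * f z' <= (z' - c) * f y.
  move=> zd' yz'; have cy := le_lt_trans cx xy.
  suff : y * f z' - z' * f y <= c * (f z' - f y) by lra.
  apply: (lim' _ _ _ y) => // u /andP[cu uy]; have := H u y z' cu uy yz' zd'.
  have : 0 <= (z' - y) * f u by rewrite mulr_ge0 // subr_ge0 ltW.
  lra.
have [zE|zn] := eqVneq z d; have [xE|xn] := eqVneq x c.
- by rewrite zE xE fc fd !mulr0 addr0 mulr_ge0 // subr_ge0; lra.
- rewrite zE fd mulr0 addr0; apply: Hr => //; rewrite lt_neqAle eq_sym xn //.
- rewrite xE fc mulr0 add0r; apply: Hl => //; rewrite lt_neqAle zn //.
- by apply: H => //; rewrite lt_neqAle ?zn ?(eq_sym c) ?xn.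
Qed.

End Interval.

(** * Lengths of slices *)

Section Slice.
Variable R : realType.
Implicit Types (k p q x y z : R * R) (s t w ph : R).

(** The line [dot2 x k = s] parametrised by one of its coordinates, the second whenever [k.1] is
    nonzero; this makes the passage to slice coordinates affine in a single variable. *)
Definition slice_pt k s t : R * R :=
  if k.1 != 0 then ((s - k.2 * t) / k.1, t) else (t, (s - k.1 * t) / k.2).

Definition slice_dir k : R * R :=
  if k.1 != 0 then (- k.2 / k.1, 1) else (1, - k.1 / k.2).

Lemma neq0_pair k : k != (0, 0) -> k.1 == 0 -> k.2 != 0.
Proof.
move=> k0 /eqP k1; apply: contra k0 => /eqP k2.
by rewrite [X in X == _]surjective_pairing k1 k2.
Qed.

Lemma dot2_slice_pt k s t : k != (0, 0) -> dot2 (slice_pt k s t) k = s.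
Proof.
move=> k0; rewrite /slice_pt /dot2; case: ifPn => /= [h|/negPn h]; first by field.
by have := neq0_pair k0 h => h2; field.
Qed.

Lemma slice_pt_dot2 k z : k != (0, 0) ->
  exists t, z = slice_pt k (dot2 z k) t.
Proof.
move=> k0; rewrite /dot2; have [h|/negPn h] := boolP (k.1 != 0).
  by exists z.2; rewrite /slice_pt h /= [LHS]surjective_pairing; congr (_, _); field.
have := neq0_pair k0 h => h2.
by exists z.1; rewrite /slice_pt h /= [LHS]surjective_pairing; congr (_, _); field.
Qed.

Lemma slice_dir_gt0 k : 0 < nrm (slice_dir k).
Proof.
apply: nrm_gt0; rewrite /slice_dir; case: ifP => _; apply/eqP.
  by case=> _ /eqP; rewrite oner_eq0.
by case=> /eqP; rewrite oner_eq0.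
Qed.

Lemma slice_pt_dist k s t t' : k != (0, 0) ->
  ((slice_pt k s t).1 - (slice_pt k s t').1) ^+ 2 +
  ((slice_pt k s t).2 - (slice_pt k s t').2) ^+ 2 = (`|t - t'| * nrm (slice_dir k)) ^+ 2.
Proof.
move=> k0; rewrite exprMn real_normK ?num_real // nrmE /slice_pt /slice_dir.
case: ifPn => /= [h|/negPn h]; first by field.
by have := neq0_pair k0 h => h2; field.
Qed.

Lemma slice_pt_conv k s s' t t' l : k != (0, 0) ->
  slice_pt k ((1 - l) * s + l * s') ((1 - l) * t + l * t') =
  ((1 - l) * (slice_pt k s t).1 + l * (slice_pt k s' t').1,
   (1 - l) * (slice_pt k s t).2 + l * (slice_pt k s' t').2).
Proof.
move=> k0; rewrite /slice_pt; case: ifPn => /= [h|/negPn h]; congr (_, _); try by field.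
by have := neq0_pair k0 h => h2; field.
Qed.

Lemma slice_pt_opp k s t : slice_pt (- k.1, - k.2) s t = slice_pt k (- s) t.
Proof.
rewrite /slice_pt /= oppr_eq0; case: ifP => _ //; congr (_, _).
- by rewrite invrN mulrN -mulNr; congr (_ / _); ring.
- by rewrite invrN mulrN -mulNr; congr (_ / _); ring.
Qed.

Lemma slice_dir_opp k : slice_dir (- k.1, - k.2) = slice_dir k.
Proof.
by rewrite /slice_dir /= oppr_eq0; case: ifP => _ //; congr (_, _); rewrite invrN mulrNN.
Qed.

Lemma measurable_slice_pt k :
  measurable_fun setT (fun u : R * R => slice_pt k u.1 u.2).
Proof.
have m1 : measurable_fun setT (@fst R R) by exact: measurable_fst.
have m2 : measurable_fun setT (@snd R R) by exact: measurable_snd.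
rewrite /slice_pt; case: (k.1 != 0); apply/measurable_fun_pairP; split => //=.
- apply: measurable_funM => //; apply: measurable_funB => //; exact: measurable_funM.
- apply: measurable_funM => //; apply: measurable_funB => //; exact: measurable_funM.
Qed.

Variables (Om : set (R * R)) (c0 M : R).
Hypotheses (oO : open Om) (cO : convex2 Om) (c0_gt0 : 0 < c0).
Hypothesis (OM : forall x, Om x -> nrm x <= M).
Hypothesis (cOm : forall x, `|x.1| <= c0 -> `|x.2| <= c0 -> Om x).

Let b k := rho_star Om k.
Let opp k : R * R := (- k.1, - k.2).

Definition section k s := [set t | Om (slice_pt k s t)].

(** The Euclidean length of the slice divided by [nrm k]: the density at [s] of the image of area on
    [Om] under [dot2 _ k]. *)
Definition slice_len k s : R := nrm (slice_dir k) / nrm k * Ir (\1_(section k s)).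

Lemma nice2_slice k : k != (0, 0) -> nice2 (fun u : R * R => \1_(section k u.1) u.2 : R).
Proof.
move=> k0.
have mO : measurable_fun setT (\1_Om : R * R -> R).
  by apply: measurable_indic; exact: measurable_open2.
apply: (@nice2_bound _ _ 1 (M * nrm k + M)).
- exact: (measurableT_comp mO (measurable_slice_pt k)).
- by move=> x; rewrite indicE ger0_norm // lern1 leq_b1.
- move=> u hu; rewrite indicE memNset // => Ou; have := OM Ou => h1.
  have s1 : `|u.1| <= M * nrm k.
    rewrite -(dot2_slice_pt u.1 u.2 k0); apply: le_trans (dot2_le _ _) _.
    by apply: ler_wpM2r => //; exact: nrm_ge0.
  have s2 : `|u.2| <= M.
    apply: le_trans h1; have := abs1_le_nrm (slice_pt k u.1 u.2).
    have := abs2_le_nrm (slice_pt k u.1 u.2); rewrite /slice_pt.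
    by case: ifP => //=.
  have := M_ge0 c0_gt0 OM cOm; have := mulr_ge0 (M_ge0 c0_gt0 OM cOm) (nrm_ge0 k).
  by case: hu; lra.
Qed.

Lemma nice_section k s : k != (0, 0) -> nice (\1_(section k s) : R -> R).
Proof. by move=> k0; have := nice2_sec1 s (nice2_slice k0). Qed.

Lemma nice_slice_len k : k != (0, 0) -> nice (slice_len k).
Proof. by move=> k0; apply: niceZ; exact: (nice_marg (nice2_slice k0)). Qed.

Lemma slice_len_ge0 k s : 0 <= slice_len k s.
Proof.
rewrite mulr_ge0 ?divr_ge0 ?nrm_ge0 //; apply: Ir_ge0 => x; by rewrite indicE.
Qed.

Lemma slice_len_opp k s : slice_len (opp k) s = slice_len k (- s).
Proof.
rewrite /slice_len slice_dir_opp /opp.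
have -> : nrm (- k.1, - k.2) = nrm k by rewrite /nrm /= !sqrrN.
congr (_ * _); apply: eq_Ir => t; rewrite !indicE.
suff -> : section (- k.1, - k.2) s = section k (- s) by [].
by apply/seteqP; split => x; rewrite /section /= slice_pt_opp.
Qed.

Lemma section_convex k s (x y z : R) : k != (0, 0) -> section k s x -> section k s y ->
  x <= z <= y -> section k s z.
Proof.
move=> k0 sx sy /andP[xz zy].
have [xy|xy] := eqVneq x y; first by rewrite (_ : z = x) //; lra.
have xy' : 0 < y - x by rewrite subr_gt0 lt_neqAle xy (le_trans xz).
pose l := (z - x) / (y - x).
have l01 : 0 <= l <= 1.
  by rewrite divr_ge0 /=; [rewrite ler_pdivrMr // mul1r|lra|lra]; lra.
have := cO sx sy l01; rewrite -(slice_pt_conv _ _ _ _ _ k0) /section /=.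
have -> : (1 - l) * s + l * s = s by ring.
have -> // : (1 - l) * x + l * y = z by rewrite /l; field; rewrite gt_eqF.
Qed.

Lemma section_nonempty k s : k != (0, 0) -> - b (opp k) < s -> s < b k ->
  exists t, section k s t.
Proof.
move=> k0 s1 s2.
have [z1 O1 h1] := rho_approx c0_gt0 OM cOm s2.
have s1' : - s < rho_star Om (opp k) by have := s1; rewrite /b; lra.
have [z2 O2] := rho_approx c0_gt0 OM cOm s1'.
rewrite {1}/dot2 /= !mulrN -opprD ltrN2 -/(dot2 z2 k) => h2.
pose l := (s - dot2 z2 k) / (dot2 z1 k - dot2 z2 k).
have l01 : 0 <= l <= 1.
  by rewrite divr_ge0 /=; [rewrite ler_pdivrMr ?mul1r|lra|lra]; lra.
have := cO O2 O1 l01; set z := (_, _) => Oz.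
have zs : dot2 z k = s.
  have -> : dot2 z k = (1 - l) * dot2 z2 k + l * dot2 z1 k by rewrite /z /dot2 /=; ring.
  by rewrite /l; field; rewrite gt_eqF //; lra.
have [t] := slice_pt_dot2 z k0; rewrite zs => zE.
by exists t; rewrite /section /= -zE.
Qed.

Lemma slice_len_out k s : k != (0, 0) -> s <= - b (opp k) \/ b k <= s -> slice_len k s = 0.
Proof.
move=> k0 hs; rewrite /slice_len (eq_Ir (g := fun=> 0)) ?Ir0 ?mulr0 // => t.
rewrite indicE memNset // => Ot; have kn0 : opp k != (0, 0).
  by apply: contra k0 => /eqP[/eqP + /eqP]; rewrite !oppr_eq0 => /eqP h1 /eqP h2; rewrite [k]surjective_pairing h1 h2.
have := dot2_lt_rho oO c0_gt0 OM cOm k0 Ot.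
have := dot2_lt_rho oO c0_gt0 OM cOm kn0 Ot.
rewrite dot2_slice_pt // {1}/dot2 /= !mulrN -opprD -/(dot2 (slice_pt k s t) k) dot2_slice_pt //.
by rewrite -/(b _) -/(b _); case: hs; lra.
Qed.

(** Brunn's theorem in the plane: convex combinations of the ends of the slices at [x] and [z] lie
    in the slice at [y]. Slices of an open set do not attain their ends, hence the error [e]. *)
Lemma slice_len_ccv k : k != (0, 0) -> ccv (- b (opp k)) (b k) (slice_len k).
Proof.
move=> k0; apply: ccv_closure.
- exact: slice_len_ge0.
- by apply: slice_len_out => //; left.
- by apply: slice_len_out => //; right.
move=> x y z cx xy yz zd; rewrite /slice_len.
set g := nrm _ / _; have g0 : 0 <= g by rewrite divr_ge0 // nrm_ge0.
set l := fun s : R => Ir (\1_(section k s) : R -> R).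
suff : (z - y) * l x + (y - x) * l z <= (z - x) * l y.
  rewrite -/(l x) -/(l y) -/(l z) => H; have := ler_wpM2l g0 H; lra.
apply/ler_addgt0Pr => e e0.
have e1 : 0 < e / (z - x) by rewrite divr_gt0 // subr_gt0 (lt_trans xy).
have yd := lt_trans yz zd; have cy := lt_trans cx xy.
have nx := section_nonempty k0 cx (lt_trans xy yd).
have nz := section_nonempty k0 (lt_trans cy yz) zd.
have [x1 [x2 [sx1 sx2 x12 hx]]] := Ir_indic_approx (nice_section x k0) nx e1.
have [z1 [z2 [sz1 sz2 z12 hz]]] := Ir_indic_approx (nice_section z k0) nz e1.
pose t := (y - x) / (z - x).
have zx : 0 < z - x by rewrite subr_gt0 (lt_trans xy).
have t01 : 0 <= t <= 1.
  by rewrite divr_ge0 /=; [rewrite ler_pdivrMr ?mul1r|lra|lra]; lra.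
have yE : (1 - t) * x + t * z = y by rewrite /t; field; rewrite gt_eqF.
have := cO sx1 sz1 t01; rewrite -(slice_pt_conv _ _ _ _ _ k0) yE => s1.
have := cO sx2 sz2 t01; rewrite -(slice_pt_conv _ _ _ _ _ k0) yE => s2.
have {}t01 := andP t01; case: t01 => t0 t1.
have h12 : (1 - t) * x1 + t * z1 <= (1 - t) * x2 + t * z2.
  by apply: lerD; apply: ler_wpM2l => //; lra.
have := Ir_indic_ge (nice_section y k0) (fun u => section_convex k0 s1 s2 (z := u)) h12.
rewrite -/(l y) -/(l x) -/(l z) in hx hz *.
have tE : t * (z - x) = y - x by rewrite /t divfK // gt_eqF.
have eE : e / (z - x) * (z - x) = e by rewrite divfK // gt_eqF.
move: (e / (z - x)) eE hx hz => e' eE hx hz H.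
have H1 := ler_wpM2r (ltW zx) H.
have H2 := ler_wpM2l (_ : 0 <= z - y) hx; have {}H2 := H2 ltac:(lra).
have H3 := ler_wpM2l (_ : 0 <= y - x) hz; have {}H3 := H3 ltac:(lra).
have -> : (z - x) * l y + e = l y * (z - x) + e by ring.
have : ((1 - t) * x2 + t * z2 - ((1 - t) * x1 + t * z1)) * (z - x) =
  (z - y) * (x2 - x1) + (y - x) * (z2 - z1).
  rewrite (_ : z - y = z - x - (y - x)); last by ring.
  by rewrite -tE; ring.
lra.
Qed.

Lemma I2_slice k t ph : k != (0, 0) ->
  I2 (fun x => \1_Om x * osc t ph (dot2 x k)) = Ir (fun s => slice_len k s * osc t ph s).
Proof.
move=> k0; have nO : nice2 (fun x => \1_Om x : R).
  apply: (@nice2_bound _ _ 1 M).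
  - by apply: measurable_indic; exact: measurable_open2.
  - by move=> x; rewrite indicE ger0_norm // lern1 leq_b1.
  - move=> x hx; rewrite indicE memNset // => /OM h.
    by have := abs1_le_nrm x; have := abs2_le_nrm x; case: hx; lra.
have mosc : measurable_fun setT (fun x : R * R => osc t ph (dot2 x k)).
  apply: (measurableT_comp (@measurable_osc R t ph)).
  by apply: measurable_funD; apply: measurable_funM.
have n2mul (f g : R * R -> R) : nice2 f -> measurable_fun setT g ->
    (forall x, `|g x| <= 1) -> nice2 (fun x => f x * g x).
  move=> /nice2P[N [N0 mf fN f0]] mg g1; apply: (@nice2_bound _ _ N N).
  - exact: measurable_funM.
  - by move=> x; rewrite normrM -[N]mulr1; apply: ler_pM.
  - by move=> x /f0 ->; rewrite mul0r.
have nf := n2mul _ _ nO mosc (fun x => osc_le1 t ph _).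
set f := (fun x : R * R => \1_Om x * _) in nf *.
pose h (u : R * R) : R := \1_(section k u.1) u.2 * osc t ph u.1.
have nh : nice2 h.
  apply: n2mul; first exact: nice2_slice.
    exact: (measurableT_comp (@measurable_osc R t ph)).
  by move=> x; exact: osc_le1.
have fh s r : f (slice_pt k s r) = h (s, r).
  by rewrite /f /h /= dot2_slice_pt // !indicE.
have E : I2 h = Ir (fun s => Ir (\1_(section k s)) * osc t ph s).
  apply: eq_Ir => s; rewrite /h /= mulrC -IrZ; last exact: nice_section.
  by apply: eq_Ir => r; rewrite mulrC.
have -> : Ir (fun s => slice_len k s * osc t ph s) = nrm (slice_dir k) / nrm k * I2 h.
  rewrite E -IrZ; last by apply: nice_osc; exact: (nice_marg (nice2_slice k0)).
  by apply: eq_Ir => s; rewrite /slice_len mulrA.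
rewrite (I2_swap nh); have nk0 := nrm_gt0 k0.
have [k1|/negPn k1] := boolP (k.1 != 0).
- have -> : nrm (slice_dir k) / nrm k = `|k.1|^-1.
    apply/eqP; rewrite -(@eqrXn2 _ 2) // ?divr_ge0 ?invr_ge0 ?nrm_ge0 //; apply/eqP.
    rewrite exprMn nrmE /slice_dir k1 /= exprVn nrmE exprVn real_normK ?num_real //.
    by field; rewrite k1 -nrmE expf_eq0 /= gt_eqF.
  rewrite (I2_swap nf) -IrZ; last exact: (nice_marg (nice2_swap nh)).
  apply: eq_Ir => y.
  have nfy := nice2_sec2 y nf.
  have k1' : k.1^-1 != 0 by rewrite invr_eq0.
  have := Ir_affine (- k.2 * y / k.1) k1' nfy.
  rewrite normfV invrK (eq_Ir (g := fun s => h (s, y))) => [->|s].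
    by rewrite mulKf // normr_eq0.
  by rewrite -fh /slice_pt k1; congr (f (_, _)); field.
- have k2 := neq0_pair k0 k1.
  have -> : nrm (slice_dir k) / nrm k = `|k.2|^-1.
    apply/eqP; rewrite -(@eqrXn2 _ 2) // ?divr_ge0 ?invr_ge0 ?nrm_ge0 //; apply/eqP.
    rewrite exprMn nrmE /slice_dir k1 /= exprVn nrmE exprVn real_normK ?num_real //.
    by rewrite (eqP k1) expr0n /= add0r; field.
  rewrite -IrZ; last exact: (nice_marg (nice2_swap nh)).
  apply: eq_Ir => x.
  have nfx := nice2_sec1 x nf.
  have k2' : k.2^-1 != 0 by rewrite invr_eq0.
  have := Ir_affine (- k.1 * x / k.2) k2' nfx.
  rewrite normfV invrK (eq_Ir (g := fun s => h (s, x))) => [->|s].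
    by rewrite mulKf // normr_eq0.
  by rewrite -fh /slice_pt k1; congr (f (_, _)); field.
Qed.

Section ChordLen.
Variable K2 : R.
Hypothesis K20 : 0 <= K2.
Hypothesis chord : forall k p q, k != (0, 0) -> Om p -> Om q -> dot2 p k = dot2 q k ->
  ((p.1 - q.1) ^+ 2 + (p.2 - q.2) ^+ 2) * nrm k <= K2 * (b k - dot2 p k).

Lemma slice_len_sqrt k w : k != (0, 0) -> 0 <= w ->
  slice_len k (b k - w) <= Num.sqrt (K2 * w / nrm k) / nrm k.
Proof.
move=> k0 w0; have nk0 := nrm_gt0 k0; have d0 := slice_dir_gt0 k.
rewrite /slice_len mulrAC ler_pdivrMr // divfK ?gt_eqF // mulrC -ler_pdivlMr //.
apply: Ir_indic_le; [by rewrite divr_ge0 ?sqrtr_ge0 // ltW|exact: nice_section|].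
move=> x y sx sy; have := chord k0 sx sy; rewrite !dot2_slice_pt // => /(_ erefl).
rewrite slice_pt_dist // (_ : b k - (b k - w) = w); last by ring.
move=> h; have {}h : (`|x - y| * nrm (slice_dir k)) ^+ 2 <= K2 * w / nrm k.
  by rewrite ler_pdivlMr.
rewrite ler_pdivlMr //.
rewrite -(@ler_pXn2r _ 2) // ?nnegrE ?sqrtr_ge0 ?mulr_ge0 ?nrm_ge0 //.
by rewrite sqr_sqrtr // divr_ge0 ?mulr_ge0 // ltW.
Qed.

(** A chord with both ends inside the open set need not realise the full length of the slice; half
    of it is always available. *)
Lemma slice_len_chord k s : k != (0, 0) -> - b (opp k) < s -> s < b k ->
  exists p q, [/\ Om p, Om q, dot2 p k = s, dot2 q k = s &
    nrm k * slice_len k s / 2 <= nrm (p.1 - q.1, p.2 - q.2)].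
Proof.
move=> k0 s1 s2; have nk0 := nrm_gt0 k0; have d0 := slice_dir_gt0 k.
have ne := section_nonempty k0 s1 s2.
set l : R := Ir (\1_(section k s) : R -> R).
have l0 : 0 <= l by apply: Ir_ge0 => x; rewrite indicE.
have [x [y [sx sy xy hxy]]] : exists x y : R, [/\ section k s x, section k s y, x <= y & l / 2 <= y - x].
  have [l00|ln0] := eqVneq l 0.
    by case: ne => x sx; exists x, x; split => //; rewrite l00 subrr mul0r.
  have l2 : 0 < l / 2 by rewrite divr_gt0 // lt_neqAle eq_sym ln0.
  have [x [y [sx sy xy hxy]]] := Ir_indic_approx (nice_section s k0) ne l2.
  by exists x, y; split => //; move: hxy; rewrite -/l; lra.
exists (slice_pt k s x), (slice_pt k s y); split => //; try exact: dot2_slice_pt.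
have h0 : 0 <= nrm k * slice_len k s / 2.
  by apply: divr_ge0 => //; apply: mulr_ge0; [exact: nrm_ge0|exact: slice_len_ge0].
rewrite ge_nrm //= slice_pt_dist // ler_pXn2r ?nnegrE //; last by apply: mulr_ge0; rewrite ?nrm_ge0.
rewrite /slice_len -/l (_ : _ / 2 = l / 2 * nrm (slice_dir k)); last first.
  by field; rewrite gt_eqF.
by apply: ler_wpM2r; [exact: ltW|rewrite distrC ger0_norm // subr_ge0].
Qed.

End ChordLen.
End Slice.

(** * Splitting off the ends of a profile *)

Section EndPiece.
Variable R : realType.
Implicit Types (f g rho : R -> R) (c d s t p w W eta : R).

(* The end piece of a concave profile [f] vanishing at [d]: it follows [f] down
   to depth [W] and then the line to 0 at depth [2 W]. Cutting along that line
   leaves a remainder ([mid]) that is still concave. *)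
Definition cap f d W w : R :=
  if 0 <= w <= 2 * W then Num.min (f (d - w)) (f (d - W) * (2 * W - w) / W) else 0.

Section Cap.
Variables (f : R -> R) (c d W : R).
Hypotheses (nf : nice f) (cf : ccv c d f) (f0 : forall x, 0 <= f x).
Hypotheses (fc : f c = 0) (fd : f d = 0).
Hypotheses (W0 : 0 < W) (W4 : 4 * W <= d - c).

Let line w := f (d - W) * (2 * W - w) / W.

(** Concavity and the zero at [c], at distance at least [4 * W], make [f] fall more slowly than the
    line beyond depth [W]. So the minimum in [cap] is [f] up to depth [W] and the line after it. *)
Let below_line w : 0 <= w -> w <= W -> f (d - w) <= line w.
Proof.
have hW0 := W0; have hW4 := W4.
move=> w0 wW; rewrite /line ler_pdivlMr //.
have := @cf c (d - W) (d - w); rewrite fc mulr0 add0r => H.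
have {}H : (d - W - c) * f (d - w) <= (d - w - c) * f (d - W) by apply: H; lra.
have := f0 (d - w); have := f0 (d - W); set a := f _; set b := f _ => a0 b0.
rewrite -/a -/b in H.
have B0 : 0 < d - c - W by lra.
rewrite -(ler_pM2l B0).
have H' : (d - c - W) * b * W <= (d - w - c) * a * W by apply: ler_wpM2r; [exact: ltW|lra].
have : (d - w - c) * W <= (d - c - W) * (2 * W - w) by nra.
move=> /(ler_wpM2r a0); lra.
Qed.

Let above_line w : W <= w -> w <= d - c -> line w <= f (d - w).
Proof.
have hW0 := W0; have hW4 := W4.
move=> w0 wd; rewrite /line ler_pdivrMr //.
have := @cf c (d - w) (d - W); rewrite fc mulr0 add0r => H.
have {}H : (d - w - c) * f (d - W) <= (d - W - c) * f (d - w) by apply: H; lra.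
have := f0 (d - w); have := f0 (d - W); set a := f _; set b := f _ => a0 b0.
rewrite -/a -/b in H.
have B0 : 0 < d - c - W by lra.
rewrite -(ler_pM2l B0).
have H' : (d - w - c) * a * W <= (d - W - c) * b * W by apply: ler_wpM2r; [exact: ltW|lra].
have : (d - c - W) * (2 * W - w) <= (d - w - c) * W by nra.
move=> /(ler_wpM2r a0); lra.
Qed.

Lemma nice_cap : nice (cap f d W).
Proof.
have hW0 := W0.
pose g w := Num.min (f (d - w)) (line w).
have mg : measurable_fun setT g.
  apply: measurable_minr.
    have -> : (fun w => f (d - w)) = (fun w => f (-1 * w + d)).
      by apply/funext => w; congr f; ring.
    by apply: (measurableT_comp (nice_meas nf)); exact: measurable_affine.
  apply: measurable_funM => //; apply: measurable_funM => //; exact: measurable_funB.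
have gb w : 0 <= w <= 2 * W -> `|g w| <= 2 * f (d - W).
  move=> /andP[w0 w2]; have l0 : 0 <= line w.
    by rewrite /line; apply: divr_ge0; [apply: mulr_ge0 => //; lra|exact: ltW].
  rewrite ger0_norm; last by rewrite le_min f0.
  rewrite ge_min; apply/orP; right; rewrite /line ler_pdivrMr //.
  by have := f0 (d - W); nra.
apply: (eq_nice _ (nice_cut mg gb)) => w; rewrite /cap -/(line w) -/(g w).
by case: ifPn => h; [rewrite box_in // mul1r|rewrite box_out // mul0r].
Qed.

Lemma ccv_cap : ccv 0 (2 * W) (cap f d W).
Proof.
have hW0 := W0; have hW4 := W4.
move=> x y z x0 xy yz z2; rewrite /cap -!/(line _).
have bx : 0 <= x <= 2 * W by apply/andP; split; lra.
have by' : 0 <= y <= 2 * W by apply/andP; split; lra.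
have bz : 0 <= z <= 2 * W by apply/andP; split; lra.
rewrite bx by' bz.
have lin : (z - y) * line x + (y - x) * line z = (z - x) * line y.
  by rewrite /line; field; rewrite gt_eqF.
have := @cf (d - z) (d - y) (d - x) => H.
have {}H : (y - x) * f (d - z) + (z - y) * f (d - x) <= (z - x) * f (d - y).
  rewrite (_ : y - x = d - x - (d - y)); last by ring.
  rewrite (_ : z - y = d - y - (d - z)); last by ring.
  by rewrite (_ : z - x = d - x - (d - z)); [apply: H; lra|ring].
have m1 u : Num.min (f (d - u)) (line u) <= f (d - u) by rewrite ge_min lexx.
have m2 u : Num.min (f (d - u)) (line u) <= line u by rewrite ge_min lexx orbT.
have zy : 0 <= z - y by lra.
have yx : 0 <= y - x by lra.
have := ler_wpM2l zy (m1 x); have := ler_wpM2l zy (m2 x).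
have := ler_wpM2l yx (m1 z); have := ler_wpM2l yx (m2 z).
move: (Num.min (f (d - x)) _) (Num.min (f (d - z)) _) => A B.
by case: (leP (f (d - y)) (line y)); lra.
Qed.

Lemma cap0 : cap f d W 0 = 0.
Proof.
have hW0 := W0; have hW4 := W4.
rewrite /cap subr0 fd; case: ifP => // _; rewrite min_l //.
by apply: divr_ge0; [apply: mulr_ge0 => //; lra|exact: ltW].
Qed.

Lemma cap2W : cap f d W (2 * W) = 0.
Proof. by rewrite /cap; case: ifP => // _; rewrite subrr mulr0 mul0r min_r. Qed.

Lemma bump_cap : bump W (cap f d W).
Proof.
have hW0 := W0; have hW4 := W4.
split; [exact: nice_cap|exact: ccv_cap|exact: cap0|exact: cap2W|].
by move=> x /negbTE h; rewrite /cap h.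
Qed.

Lemma cap_slope eta : 0 < eta -> 2 * eta <= W -> 2 * eta * f (d - W) <= W * f (d - 2 * eta).
Proof.
have hW0 := W0; have hW4 := W4.
move=> e0 eW; have := @cf (d - W) (d - 2 * eta) d; rewrite fd mulr0 addr0 => H.
have {}H : (d - (d - 2 * eta)) * f (d - W) <= (d - (d - W)) * f (d - 2 * eta) by apply: H; lra.
lra.
Qed.

(** The line meets its own end with slope [f (d - W) / W], which is at most the mean slope of [f]
    between [d - 2 * eta] and [d]; the value at depth [2 * eta] at the tip therefore controls both
    ends. *)
Lemma bump_le_cap eta : 0 < eta -> 2 * eta <= W ->
  bump_le (cap f d W) W eta (f (d - 2 * eta)).
Proof.
have hW0 := W0; have hW4 := W4.
move=> e0 eW; have S := cap_slope e0 eW; have a0 := f0 (d - W); have l0 := f0 (d - 2 * eta).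
split.
- by rewrite /cap; case: ifP => // _; rewrite ge_min lexx.
- rewrite /cap; case: ifP => // _; rewrite ge_min; apply/orP; right.
  by rewrite ler_pdivrMr //; lra.
- move=> w; rewrite /cap; case: ifPn => [/andP[w0 w2]|_]; last by rewrite mulr0 mulr_ge0 // ltW.
  apply: (@le_trans _ _ (eta * line w)); first by rewrite ler_pM2l // ge_min lexx orbT.
  have : line w <= 2 * f (d - W) by rewrite /line ler_pdivrMr //; nra.
  nra.
Qed.

Lemma cap_pos s : s <= d - W -> c <= s -> cap f d W (d - s) = Num.max 0 (line (d - s)).
Proof.
have hW0 := W0; have hW4 := W4.
move=> sW cs; rewrite /cap -/(line _) subKr; case: ifPn => [/andP[h1 h2]|h].
  rewrite min_r; last by rewrite -[s in f s](subKr d); apply: above_line; lra.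
  rewrite max_r //; apply: divr_ge0; [apply: mulr_ge0 => //; lra|exact: ltW].
rewrite max_l //; rewrite /line pmulr_lle0 ?invr_gt0 //; apply: mulr_ge0_le0 => //.
move: h; rewrite negb_and -!ltNge => /orP[]; lra.
Qed.

Lemma cap_full s : d - W <= s -> s <= d -> cap f d W (d - s) = f s.
Proof.
have hW0 := W0; have hW4 := W4.
move=> sW sd; have bd : 0 <= d - s <= 2 * W by apply/andP; split; lra.
rewrite /cap -/(line _) subKr bd.
by rewrite min_l // -[s in f s](subKr d); apply: below_line; lra.
Qed.

Lemma line_convex x y z : x <= y -> y <= z ->
  (z - x) * Num.max 0 (line (d - y)) <=
  (z - y) * Num.max 0 (line (d - x)) + (y - x) * Num.max 0 (line (d - z)).
Proof.
have hW0 := W0.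
move=> xy yz.
have lin : (z - y) * line (d - x) + (y - x) * line (d - z) = (z - x) * line (d - y).
  by rewrite /line; field; rewrite gt_eqF.
have m1 u : 0 <= Num.max 0 (line u) by rewrite le_max lexx.
have m2 u : line u <= Num.max 0 (line u) by rewrite le_max lexx orbT.
have zy : 0 <= z - y by lra.
have yx : 0 <= y - x by lra.
have := ler_wpM2l zy (m1 (d - x)); have := ler_wpM2l zy (m2 (d - x)).
have := ler_wpM2l yx (m1 (d - z)); have := ler_wpM2l yx (m2 (d - z)).
move: (Num.max 0 (line (d - x))) (Num.max 0 (line (d - z))) => A B.
by case: (leP 0 (line (d - y))); lra.
Qed.

(** From depth [W] on, [f] rises and the line falls, each by at most [f (d - W) / W] per unit
    length, over a length [2 * eta]. *)
Lemma cap_incr eta : 0 < eta -> 2 * eta <= W ->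
  f (d - W - 2 * eta) - Num.max 0 (line (W + 2 * eta)) <= f (d - W) * (4 * eta / W).
Proof.
have hW0 := W0; have hW4 := W4.
move=> e0 eW.
have m2 : line (W + 2 * eta) <= Num.max 0 (line (W + 2 * eta)) by rewrite le_max lexx orbT.
suff : f (d - W - 2 * eta) - line (W + 2 * eta) <= f (d - W) * (4 * eta / W) by lra.
rewrite /line -(ler_pM2r W0) mulrBl divfK ?gt_eqF //.
rewrite (_ : f (d - W) * (4 * eta / W) * W = f (d - W) * (4 * eta)); last first.
  by field; rewrite gt_eqF.
have := @cf (d - W - 2 * eta) (d - W) d; rewrite fd mulr0 addr0 => H.
have {}H : (d - (d - W)) * f (d - W - 2 * eta) <= (d - (d - W - 2 * eta)) * f (d - W) by apply: H; lra.
lra.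
Qed.

End Cap.

Lemma nice_opp f : nice f -> nice (fun s => f (- s)).
Proof.
move=> nf; have h : -1 != 0 :> R by rewrite oppr_eq0 oner_eq0.
by apply: (eq_nice _ (nice_affine 0 h nf)) => x; congr f; ring.
Qed.

Lemma ccv_opp f c d : ccv c d f -> ccv (- d) (- c) (fun s => f (- s)).
Proof.
move=> cf x y z cx xy yz zd.
have : (- x - - y) * f (- z) + (- y - - z) * f (- x) <= (- x - - z) * f (- y) by apply: cf; lra.
lra.
Qed.

Section Split.
Variables (f : R -> R) (c d W : R).
Hypotheses (nf : nice f) (cf : ccv c d f) (f0 : forall x, 0 <= f x).
Hypotheses (fc : f c = 0) (fd : f d = 0).
Hypothesis fout : forall x, x <= c \/ d <= x -> f x = 0.
Hypotheses (W0 : 0 < W) (W4 : 4 * W <= d - c).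

Let f' s := f (- s).
Let nf' : nice f' := nice_opp nf.
Let cf' : ccv (- d) (- c) f' := ccv_opp cf.
Let f0' x : 0 <= f' x. Proof. exact: f0. Qed.
Let fc' : f' (- d) = 0. Proof. by rewrite /f' opprK. Qed.
Let fd' : f' (- c) = 0. Proof. by rewrite /f' opprK. Qed.
Let W4' : 4 * W <= - c - - d. Proof. by rewrite opprK addrC. Qed.

Definition mid s := f s - cap f d W (d - s) - cap f' (- c) W (- c - - s).

Lemma nice_mid : nice mid.
Proof.
have hW0 := W0; have hW4 := W4.
have n1 : nice (fun s => cap f d W (d - s)).
  have h : -1 != 0 :> R by rewrite oppr_eq0 oner_eq0.
  by apply: (eq_nice _ (nice_affine d h (nice_cap d nf f0 W0))) => x; congr cap; ring.
have n2 : nice (fun s => cap f' (- c) W (- c - - s)).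
  by apply: (eq_nice _ (nice_shift (- c) (nice_cap (- c) nf' f0' W0))) => x; congr cap; ring.
by apply: niceB => //; apply: niceB.
Qed.

Let mid_out s : ~~ (c + W < s < d - W) -> mid s = 0.
Proof.
have hW0 := W0; have hW4 := W4.
rewrite negb_and -!leNgt => /orP[h|h]; rewrite /mid.
  have -> : cap f d W (d - s) = 0.
    by rewrite /cap ifF //; apply/negbTE; rewrite negb_and -!ltNge; apply/orP; right; lra.
  have [cs|sc] := leP c s.
    by rewrite (cap_full cf' f0' fc' W0 W4' (s := - s)) /f' ?opprK ?subr0 ?subrr //; lra.
  rewrite /cap ifF ?fout ?subr0 //; first by left; lra.
  by apply/negbTE; rewrite negb_and -!ltNge; apply/orP; left; lra.
have -> : cap f' (- c) W (- c - - s) = 0.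
  by rewrite /cap ifF //; apply/negbTE; rewrite negb_and -!ltNge; apply/orP; right; lra.
have [cs|sc] := leP s d.
  by rewrite (cap_full cf f0 fc W0 W4 (s := s)) ?subr0 ?subrr //; lra.
rewrite /cap ifF ?fout ?subr0 //; first by right; lra.
by apply/negbTE; rewrite negb_and -!ltNge; apply/orP; left; lra.
Qed.

(** On this range both caps are positive parts of affine functions, hence convex, and subtracting
    them preserves concavity. *)
Let ccv_mid : ccv (c + W) (d - W) mid.
Proof.
have hW0 := W0; have hW4 := W4.
move=> x y z cx xy yz zd; rewrite /mid.
rewrite !(cap_pos cf f0 fc W0 W4); try lra.
rewrite !(cap_pos cf' f0' fc' W0 W4'); try lra.
have H1 := @cf x y z.
have {}H1 := H1 ltac:(lra) xy yz ltac:(lra).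
have H2 := line_convex f d W0 xy yz.
have := @line_convex f' (- c) W W0 (- z) (- y) (- x).
rewrite !lerN2 !(opprK x) !(opprK y) !(opprK z) => /(_ yz xy) H3.
move: H2 H3; set A1 := Num.max 0 _; set A2 := Num.max 0 _; set A3 := Num.max 0 _.
set B1 := Num.max 0 _; set B2 := Num.max 0 _; set B3 := Num.max 0 _.
lra.
Qed.

(** The remainder is concave, vanishes at both cuts and by [cap_incr] leaves them with slope of
    order [f / W]. [Ir_D2_ccv] then gains a second factor [eta / W]. *)
Lemma Ir_mid t p : 0 < t -> 1 <= t * W ->
  `|Ir (fun s => mid s * osc t p s)| <= 2 / (t ^+ 2 * W) * (f (c + W) + f (d - W)).
Proof.
have hW0 := W0; have hW4 := W4.
move=> t0 tW; apply: le_trans (half_period_bound p t0 nice_mid) _.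
set eta := (2 * t)^-1.
have e0 : 0 < eta by rewrite invr_gt0 mulr_gt0.
have eW : 2 * eta <= W.
  rewrite /eta invfM mulrA mulfV ?mul1r ?pnatr_eq0 // -(ler_pM2l t0) mulfV //; exact: lt0r_neq0.
have e4 : 4 * eta <= d - W - (c + W) by lra.
have m0 : mid (c + W) = 0 by apply: mid_out; rewrite ltxx.
have m1 : mid (d - W) = 0 by apply: mid_out; rewrite ltxx andbF.
have ml x : x < c + W -> mid x = 0 by move=> h; apply: mid_out; rewrite negb_and -!leNgt ltW.
have mr x : d - W < x -> mid x = 0 by move=> h; apply: mid_out; rewrite negb_and -!leNgt orbC ltW.
have := Ir_D2_ccv nice_mid ccv_mid m0 m1 ml mr e0 e4.
have hR : mid (d - W - 2 * eta) <= f (d - W) * (4 * eta / W).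
  have := cap_incr cf fd W0 W4 e0 eW; rewrite /mid.
  rewrite (cap_pos cf f0 fc W0 W4); try lra.
  rewrite (cap_pos cf' f0' fc' W0 W4'); try lra.
  have -> : d - (d - W - 2 * eta) = W + 2 * eta by ring.
  set A := Num.max 0 _; set B := Num.max 0 _.
  have : 0 <= B by rewrite /B le_max lexx.
  lra.
have hL : mid (c + W + 2 * eta) <= f (c + W) * (4 * eta / W).
  have := cap_incr cf' fd' W0 W4' e0 eW; rewrite /mid.
  rewrite (cap_pos cf f0 fc W0 W4); try lra.
  rewrite (cap_pos cf' f0' fc' W0 W4'); try lra.
  have -> : - c - - (c + W + 2 * eta) = W + 2 * eta by ring.
  have -> : f' (- c - W) = f (c + W) by rewrite /f'; congr f; ring.
  have -> : f' (- c - W - 2 * eta) = f (c + W + 2 * eta) by rewrite /f'; congr f; ring.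
  set A := Num.max 0 _; set B := Num.max 0 _.
  have : 0 <= B by rewrite /B le_max lexx.
  lra.
move=> H; have -> : 2 / (t ^+ 2 * W) = 8 * eta * eta / W.
  by rewrite /eta; field; rewrite !gt_eqF.
have : 8 * eta * (mid (c + W + 2 * eta) + mid (d - W - 2 * eta)) <=
   8 * eta * (f (c + W) * (4 * eta / W) + f (d - W) * (4 * eta / W)).
  by apply: ler_wpM2l; lra.
lra.
Qed.

(** Reflecting to depth coordinates exhibits the piece, as a function of [t], as a wave whose
    frequency is the position [e] of the tip, with two amplitudes in quadrature. *)
Lemma Ir_cap g e t : nice g ->
  Ir (fun s => g (e - s) * osc t 0 s) =
  osc e 0 t * amp g 0 t + osc e (- (pi / 2)) t * amp g (- (pi / 2)) t.
Proof.
have hW0 := W0; have hW4 := W4.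
move=> ng; have n1 := nice_osc t 0 ng; have n2 := nice_osc t (- (pi / 2)) ng.
rewrite /amp -!IrZ // -IrD; [|exact: niceZ|exact: niceZ].
have h : -1 != 0 :> R by rewrite oppr_eq0 oner_eq0.
have nge : nice (fun s => g (e - s)).
  by apply: (eq_nice _ (nice_affine e h ng)) => x; congr g; ring.
rewrite -[LHS](Ir_reflect e (nice_osc t 0 nge)).
apply: eq_Ir => w; rewrite subKr /osc !addr0 !cosBpihalf.
have -> : 2 * pi * t * (e - w) = 2 * pi * e * t - 2 * pi * t * w by ring.
by rewrite cosB; ring.
Qed.

Lemma Ir_split t : let rR := cap f d W in let rL := cap f' (- c) W in
  Ir (fun s => f s * osc t 0 s) = Ir (fun s => mid s * osc t 0 s) +
  (osc d 0 t * amp rR 0 t + osc d (- (pi / 2)) t * amp rR (- (pi / 2)) t) +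
  (osc (- c) 0 t * amp rL 0 t + osc (- c) (- (pi / 2)) t * amp rL (- (pi / 2)) t).
Proof.
have hW0 := W0; have hW4 := W4.
move=> rR rL.
have nR : nice rR by exact: nice_cap.
have nL : nice rL by exact: nice_cap.
rewrite -!Ir_cap //.
have h : -1 != 0 :> R by rewrite oppr_eq0 oner_eq0.
have nR' : nice (fun s => rR (d - s)).
  by apply: (eq_nice _ (nice_affine d h nR)) => x; congr rR; ring.
have nL' : nice (fun s => rL (- c - s)).
  by apply: (eq_nice _ (nice_affine (- c) h nL)) => x; congr rL; ring.
have nL2 : nice (fun s => rL (- c - - s)).
  by apply: (eq_nice _ (nice_shift (- c) nL)) => x; congr rL; ring.
have -> : Ir (fun s => rL (- c - s) * osc t 0 s) = Ir (fun s => rL (- c - - s) * osc t 0 s).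
  rewrite -(Ir_reflect 0 (nice_osc t 0 nL')); apply: eq_Ir => s.
  by rewrite sub0r /osc !addr0 mulrN cosN.
have o1 := nice_osc t 0 nR'; have o2 := nice_osc t 0 nL2; have o3 := nice_osc t 0 nice_mid.
rewrite -IrD // -IrD //; last exact: niceD.
by apply: eq_Ir => s; rewrite /mid -/f' -/rR -/rL; ring.
Qed.

End Split.
End EndPiece.

(** * Near-maximisers and neighbouring frequencies *)

Section Monotone.
Variable R : realType.

(* Consecutive subgradient intervals [m i, M i] of a convex function do not
   overlap, up to the error [d0], so their lengths add up to at most the
   variation of the slope. *)
Lemma sum_subgradients (N q : nat) (b tau m M : nat -> R) (d0 del : R) :
  (0 < q)%N -> (2 * q <= N)%N -> 0 <= d0 -> 0 <= del ->
  (forall i, (i.+1 < N)%N -> tau i + 1 <= tau i.+1) ->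
  (forall i j, (i < N)%N -> (j < N)%N -> b i - d0 + M i * (tau j - tau i) <= b j) ->
  (forall i j, (i < N)%N -> (j < N)%N -> b i - d0 + m i * (tau j - tau i) <= b j) ->
  (forall i, (i < N)%N -> m i <= M i) ->
  (forall i j, (i < N)%N -> (j < N)%N -> b i - b j <= del) ->
  \sum_(q <= i < N - q) (M i - m i) <= 2 * (del + d0) / q%:R + 2 * d0 * N%:R.
Proof.
move=> q0 qN d00 del0 tauS bM bm mM bdel.
have tauD i j : (i + j < N)%N -> tau i + j%:R <= tau (i + j)%N.
  elim: j => [|j IH]; first by rewrite !addn0 addr0.
  rewrite addnS => h; have := IH (ltnW h); have := tauS _ h; rewrite -natr1; lra.
have qp : 0 < q%:R :> R by rewrite ltr0n.
(* The two subgradient inequalities between neighbours are added; the total error [2 * d0] is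
   divided by a spacing of at least 1. *)
have step i : (i.+1 < N)%N -> M i <= m i.+1 + 2 * d0.
  move=> h; have h' := ltnW h; have := bM _ _ h' h; have := bm _ _ h h'; have := tauS _ h.
  set D := tau i.+1 - tau i => t1 t2 t3.
  have D1 : 1 <= D by rewrite /D; lra.
  have D0 : 0 < D by lra.
  rewrite -(ler_pM2r D0).
  have -> : (m i.+1 + 2 * d0) * D = m i.+1 * D + 2 * d0 * D by ring.
  have : 2 * d0 <= 2 * d0 * D by rewrite ler_peMr // mulr_ge0.
  have : m i.+1 * (tau i - tau i.+1) = - (m i.+1 * D) by rewrite /D; ring.
  lra.
have tele a n : (a + n < N)%N ->
    \sum_(a <= i < (a + n).+1) (M i - m i) <= M (a + n)%N - m a + 2 * d0 * n%:R.
  elim: n => [|n IH]; first by rewrite addn0 big_nat1 mulr0 addr0.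
  rewrite addnS => h; rewrite big_nat_recr /=; last by lia.
  have := IH (ltnW h); have := step _ h; rewrite -natr1; lra.
have [qn|qn] := ltnP q (N - q); last first.
  by rewrite big_geq // addr_ge0 ?divr_ge0 ?mulr_ge0 // addr_ge0.
have E : (N - q = (q + (N - q - q.+1)).+1)%N by lia.
set n := (N - q - q.+1)%N in E.
rewrite E; have h : (q + n < N)%N by lia.
apply: le_trans (tele _ _ h) _.
have n_le : n%:R <= N%:R :> R by rewrite ler_nat; lia.
have h0 : (0 < N)%N by lia.
(* The [q] points beyond give a base of length at least [q], over which [b] varies by at most
   [del]. *)
have up : M (q + n)%N <= (del + d0) / q%:R.
  have lt : (N.-1 < N)%N by lia.
  have := bM _ _ h lt; have := bdel _ _ lt h.
  have := tauD (q + n)%N q; rewrite (_ : (q + n + q)%N = N.-1); last by lia.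
  move=> /(_ lt) t1 t2 t3; rewrite ler_pdivlMr //.
  have [M0|M0] := ltP (M (q + n)%N) 0.
    by have : M (q + n)%N * q%:R <= 0 by [rewrite mulr_le0_ge0 // ltW]; lra.
  have : M (q + n)%N * q%:R <= M (q + n)%N * (tau N.-1 - tau (q + n)%N).
    by apply: ler_wpM2l => //; lra.
  lra.
have dn : - m q <= (del + d0) / q%:R.
  have lt : (q < N)%N by lia.
  have := bm _ _ lt h0; have := bdel _ _ h0 lt.
  have := tauD 0%N q; rewrite add0n => /(_ lt) t1 t2 t3; rewrite ler_pdivlMr //.
  have [M0|M0] := ltP (- m q) 0.
    by have : - m q * q%:R <= 0 by [rewrite mulr_le0_ge0 // ltW]; lra.
  have : - m q * q%:R <= - m q * (tau q - tau 0%N).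
    by apply: ler_wpM2l => //; lra.
  lra.
have : 2 * d0 * n%:R <= 2 * d0 * N%:R by apply: ler_wpM2l => //; rewrite mulr_ge0.
lra.
Qed.

End Monotone.

Section NearMax.
Variable R : realType.
Implicit Types (k l p q x y u v : R * R).

Definition cross u v : R := u.1 * v.2 - u.2 * v.1.

Lemma lagrange u v x y : dot2 u x * dot2 v y = dot2 u y * dot2 v x + cross u v * cross x y.
Proof. by rewrite /dot2 /cross; ring. Qed.

Lemma cross_le u v : `|cross u v| <= nrm u * nrm v.
Proof.
rewrite -(@ler_pXn2r _ 2) ?nnegrE ?mulr_ge0 ?nrm_ge0 // exprMn !nrmE real_normK ?num_real // /cross.
have := sqr_ge0 (u.1 * v.1 + u.2 * v.2); nra.
Qed.

Lemma dot2_orth k u v : nrm k != 0 -> dot2 u k = 0 ->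
  `|dot2 v u| * nrm k = `|cross v k| * nrm u.
Proof.
move=> k0 uk; apply/eqP; rewrite -(@eqrXn2 _ 2) ?mulr_ge0 ?nrm_ge0 //.
rewrite !exprMn !real_normK ?num_real // -subr_eq0; apply/eqP.
have e1 : dot2 v u * nrm k ^+ 2 = cross v k * cross u k.
  have -> : nrm k ^+ 2 = dot2 k k by rewrite nrmE /dot2; ring.
  have ku : dot2 k u = 0 by rewrite -uk /dot2; ring.
  by rewrite lagrange ku mulr0 add0r.
have e2 : cross u k ^+ 2 = nrm u ^+ 2 * nrm k ^+ 2.
  have : cross u k ^+ 2 + dot2 u k ^+ 2 = nrm u ^+ 2 * nrm k ^+ 2.
    by rewrite !nrmE /cross /dot2; ring.
  by rewrite uk expr0n addr0.
have k2 : nrm k ^+ 2 != 0 by rewrite expf_eq0.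
apply: (mulIf k2); rewrite mul0r mulrBl.
have -> : dot2 v u ^+ 2 * nrm k ^+ 2 * nrm k ^+ 2 = (dot2 v u * nrm k ^+ 2) ^+ 2 by ring.
by rewrite e1 exprMn e2; ring.
Qed.

Variables (Om : set (R * R)) (c0 M K2 : R).
Hypotheses (cO : convex2 Om) (c0_gt0 : 0 < c0).
Hypothesis (OM : forall x, Om x -> nrm x <= M).
Hypothesis (cOm : forall x, `|x.1| <= c0 -> `|x.2| <= c0 -> Om x).
Let b k := rho_star Om k.
Hypothesis K20 : 0 <= K2.
Hypothesis chord : forall k p q, k != (0, 0) -> Om p -> Om q -> dot2 p k = dot2 q k ->
  ((p.1 - q.1) ^+ 2 + (p.2 - q.2) ^+ 2) * nrm k <= K2 * (b k - dot2 p k).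

(** In [depth_dist] the first term pays for a chord at constant depth, the second for levelling the
    depths, the third for the case of large depth. *)
Definition C1 : R := 2 * K2 + 4 * (M ^+ 3 / c0 ^+ 2) + 8 * (M ^+ 2 / c0) + 1.

Let M0 : 0 <= M := M_ge0 c0_gt0 OM cOm.

Lemma C1_ge1 : 1 <= C1.
Proof.
have h := K20; have := divr_ge0 (exprn_ge0 3 M0) (exprn_ge0 2 (ltW c0_gt0)).
have := divr_ge0 (exprn_ge0 2 M0) (ltW c0_gt0); rewrite /C1; lra.
Qed.

Let dif x y : R * R := (x.1 - y.1, x.2 - y.2).

(** The chord bound compares points of equal depth only. The shallower point is therefore scaled
    towards the origin until its depth is that of the other; this moves it by [O(D / nrm k)]. If [y]
    has lost half of [b k], the diameter of [Om] is bound enough. *)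
Lemma depth_dist k x y D : k != (0, 0) -> Om x -> Om y ->
  b k - dot2 x k <= D -> b k - dot2 y k <= D -> nrm (dif x y) ^+ 2 * nrm k <= C1 * D.
Proof.
move=> k0 Ox Oy; have n0 := nrm_gt0 k0; have hM := M0; have hc := c0_gt0; have hK := K20.
have := dot2_le_rho c0_gt0 OM cOm k Ox; have := dot2_le_rho c0_gt0 OM cOm k Oy; rewrite -!/(b k).
wlog xy : x y Ox Oy / dot2 y k <= dot2 x k.
  move=> H; have [xy|/ltW xy] := leP (dot2 y k) (dot2 x k); first exact: H.
  move=> yb xb hx hy; have := H _ _ Oy Ox xy xb yb hy hx.
  by rewrite !nrmE /= -(opprB x.1) -(opprB x.2) !sqrrN.
move=> yb xb _ hD; set d := b k - dot2 y k in hD.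
have d0 : 0 <= d by rewrite subr_ge0.
apply: (@le_trans _ _ (C1 * d)); last by apply: ler_wpM2l => //; have := C1_ge1; lra.
have bge := rho_ge c0_gt0 OM cOm k; rewrite -/(b k) in bge.
have ble := rho_leM c0_gt0 OM cOm k; rewrite -/(b k) in ble.
have t1 : 0 <= M ^+ 3 / c0 ^+ 2 by rewrite divr_ge0 ?exprn_ge0 // ltW.
have t2 : 0 <= M ^+ 2 / c0 by rewrite divr_ge0 ?exprn_ge0 // ltW.
have [yh|yh] := leP (dot2 y k) (b k / 2).
  have nb : nrm (dif x y) <= 2 * M.
    have := nrmD x (- y.1, - y.2); rewrite /dif /= (_ : nrm (- y.1, - y.2) = nrm y).
      by have := OM Ox; have := OM Oy; lra.
    by rewrite /nrm /= !sqrrN.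
  have nb2 : nrm (dif x y) ^+ 2 <= 4 * M ^+ 2.
    have -> : 4 * M ^+ 2 = (2 * M) ^+ 2 by ring.
    by rewrite ler_pXn2r ?nnegrE ?nrm_ge0 // mulr_ge0.
  have h1 : nrm (dif x y) ^+ 2 * nrm k <= 4 * M ^+ 2 * nrm k by apply: ler_wpM2r => //; exact: ltW.
  have h2 : M ^+ 2 * nrm k <= M ^+ 2 / c0 * (2 * d).
    rewrite (_ : M ^+ 2 / c0 * (2 * d) = M ^+ 2 * (2 * d) / c0); last by ring.
    rewrite ler_pdivlMr // -mulrA; apply: ler_wpM2l; first exact: exprn_ge0.
    by rewrite mulrC /d; lra.
  have : 0 <= (2 * K2 + 4 * (M ^+ 3 / c0 ^+ 2) + 1) * d by rewrite mulr_ge0 //; lra.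
  rewrite /C1; lra.
have xp : 0 < dot2 x k.
  have : 0 <= c0 * nrm k by rewrite mulr_ge0 // ltW.
  lra.
pose s := (dot2 x k - dot2 y k) / dot2 x k.
have s01 : 0 <= s <= 1.
  rewrite divr_ge0 ?subr_ge0 //=; last exact: ltW.
  rewrite ler_pdivrMr // mul1r; have : 0 <= c0 * nrm k by rewrite mulr_ge0 // ltW.
  lra.
have Ox' : Om ((1 - s) * x.1, (1 - s) * x.2).
  by have := cO Ox (Om0 c0_gt0 cOm) s01; rewrite /= !mulr0 !addr0.
set x' := (_, _) in Ox'.
have x'k : dot2 x' k = dot2 y k.
  have -> : dot2 x' k = (1 - s) * dot2 x k by rewrite /x' /dot2 /=; ring.
  by rewrite /s; field; rewrite gt_eqF.
have := chord k0 Ox' Oy x'k; rewrite x'k -/d => h1.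
have xx : nrm (dif x x') = s * nrm x.
  rewrite /nrm /dif /x' /=.
  have -> : (x.1 - (1 - s) * x.1) ^+ 2 + (x.2 - (1 - s) * x.2) ^+ 2 = s ^+ 2 * (x.1 ^+ 2 + x.2 ^+ 2) by ring.
  by rewrite sqrtrM ?sqr_ge0 // sqrtr_sqr ger0_norm; case/andP: s01.
have s_le : s * nrm x * (c0 * nrm k) <= 2 * M * d.
  have s0 : 0 <= s by case/andP: s01.
  have e1 : s * (c0 * nrm k) <= 2 * d.
    have : s * (c0 * nrm k) <= s * (2 * dot2 x k) by apply: ler_wpM2l => //; lra.
    have : s * dot2 x k = dot2 x k - dot2 y k by rewrite /s divfK // gt_eqF.
    rewrite /d; lra.
  have := OM Ox; have := nrm_ge0 x => nx0 nxM.
  have -> : s * nrm x * (c0 * nrm k) = nrm x * (s * (c0 * nrm k)) by ring.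
  have -> : 2 * M * d = M * (2 * d) by ring.
  by apply: ler_pM => //; apply: mulr_ge0 => //; apply: mulr_ge0; exact: ltW.
have h2 : nrm (dif x x') ^+ 2 * nrm k <= 2 * (M ^+ 3 / c0 ^+ 2) * d.
  rewrite xx.
  have A0 : 0 <= s * nrm x by rewrite mulr_ge0 ?nrm_ge0 //; case/andP: s01.
  have sq : (s * nrm x * (c0 * nrm k)) ^+ 2 <= (2 * M * d) ^+ 2.
    have cn0 : 0 <= c0 * nrm k by rewrite mulr_ge0 // ltW.
    rewrite ler_pXn2r ?nnegrE; [exact: s_le|by []|exact: mulr_ge0|].
    by apply: mulr_ge0 => //; exact: mulr_ge0.
  have d_le : d <= M * nrm k / 2 by rewrite /d; lra.
  have cn : 0 < c0 ^+ 2 * nrm k by rewrite mulr_gt0 ?exprn_gt0.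
  rewrite -(ler_pM2r cn).
  have -> : (s * nrm x) ^+ 2 * nrm k * (c0 ^+ 2 * nrm k) = (s * nrm x * (c0 * nrm k)) ^+ 2 by ring.
  have -> : 2 * (M ^+ 3 / c0 ^+ 2) * d * (c0 ^+ 2 * nrm k) = 4 * M ^+ 2 * d * (M * nrm k / 2).
    by field; rewrite gt_eqF.
  apply: le_trans sq _.
  have -> : (2 * M * d) ^+ 2 = 4 * M ^+ 2 * d * d by ring.
  by apply: ler_wpM2l => //; rewrite !mulr_ge0 ?exprn_ge0.
have h3 : nrm (dif x y) ^+ 2 <= 2 * nrm (dif x x') ^+ 2 + 2 * ((x'.1 - y.1) ^+ 2 + (x'.2 - y.2) ^+ 2).
  have pw (a' b' c' : R) : (a' - c') ^+ 2 <= 2 * (a' - b') ^+ 2 + 2 * (b' - c') ^+ 2.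
    by have := sqr_ge0 (a' - b' - (b' - c')); nra.
  rewrite !nrmE.
  have := pw x.1 x'.1 y.1; have := pw x.2 x'.2 y.2.
  move: x' Ox' x'k h1 xx h2 => x' *; rewrite /dif /=; lra.
have := ler_wpM2r (ltW n0) h3.
have : 0 <= (8 * (M ^+ 2 / c0) + 1) * d by rewrite mulr_ge0 //; lra.
rewrite /C1; lra.
Qed.

(** A near-maximiser stands for the gradient of [rho_star]. The term [C1 * nrm v ^+ 2 / nrm k] is
    the second-order Taylor error of a [C^{1,1}] function, obtained by comparing near-maximisers for
    [k] and for [k + v]. *)
Lemma near_max k v x eps del : k != (0, 0) -> v != (0, 0) -> Om x ->
  b k - dot2 x k <= eps -> eps <= C1 * nrm v ^+ 2 / nrm k ->
  `|b (k.1 + v.1, k.2 + v.2) - b k| <= del ->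
  `|dot2 x v| <= del + 3 * (C1 * nrm v ^+ 2 / nrm k).
Proof.
move=> k0 v0 Ox hx; set E := C1 * _ / _ => hE.
have n0 := nrm_gt0 k0; have nv0 := nrm_gt0 v0; have C11 := C1_ge1.
have C10 : 0 < C1 by lra.
set l := (_, _); rewrite ler_norml => /andP[b1 b2].
have E0 : 0 < E by rewrite divr_gt0 // mulr_gt0 // exprn_gt0.
have lE : b l - E < b l by lra.
have [y Oy hy] := rho_approx c0_gt0 OM cOm lE.
have dl z : dot2 z l = dot2 z k + dot2 z v by rewrite /l /dot2 /=; ring.
have yb : dot2 y k <= b k by exact: (dot2_le_rho c0_gt0 OM cOm).
have xb : dot2 x k + dot2 x v <= b l by rewrite -dl; exact: (dot2_le_rho c0_gt0 OM cOm).
have {}hy : b l - E < dot2 y k + dot2 y v by rewrite -dl.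
set X := nrm (dif x y).
have vX : dot2 y v - dot2 x v <= nrm v * X.
  have -> : dot2 y v - dot2 x v = - dot2 (dif x y) v by rewrite /dif /dot2 /=; ring.
  apply: le_trans (ler_norm _) _; rewrite normrN mulrC; exact: dot2_le.
have vX0 : 0 <= nrm v * X by rewrite mulr_ge0 ?nrm_ge0.
have hxE := le_trans hx hE.
have D1 : b k - dot2 x k <= 2 * E + nrm v * X by lra.
have D2 : b k - dot2 y k <= 2 * E + nrm v * X by lra.
have := depth_dist k0 Ox Oy D1 D2; rewrite -/X => H.
(* In this unit [depth_dist] reads [X ^ 2 <= 2 * y0 ^ 2 + y0 * X], whose positive root is
   [2 * y0]. *)
pose y0 := C1 * nrm v / nrm k.
have y00 : 0 < y0 by rewrite divr_gt0 // mulr_gt0.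
have EE : E = y0 * nrm v by rewrite /E /y0; field; rewrite gt_eqF.
have X0 : 0 <= X by exact: nrm_ge0.
have Xy : X <= 2 * y0.
  rewrite leNgt; apply/negP => h.
  have : X ^+ 2 <= 2 * y0 ^+ 2 + y0 * X.
    rewrite -(ler_pM2r n0); apply: le_trans H _; rewrite le_eqVlt; apply/orP; left; apply/eqP.
    by rewrite EE /y0; field; rewrite gt_eqF.
  nra.
have : nrm v * X <= nrm v * (2 * y0) by apply: ler_wpM2l => //; exact: ltW.
rewrite ler_norml => ?; apply/andP; split; rewrite ?EE; lra.
Qed.

Lemma near_max_exists k : k != (0, 0) -> 2 * C1 <= c0 * nrm k ^+ 2 ->
  exists x, [/\ Om x, b k - dot2 x k <= C1 / nrm k & c0 / 2 * nrm k <= dot2 x k].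
Proof.
move=> k0 hk; have n0 := nrm_gt0 k0; have C11 := C1_ge1.
have e0 : b k - C1 / nrm k < b k by rewrite ltrBlDr ltrDl divr_gt0 //; lra.
have [x Ox hx] := rho_approx c0_gt0 OM cOm e0.
exists x; split => //; first by lra.
have bge := rho_ge c0_gt0 OM cOm k; rewrite -/(b k) in bge.
have : C1 / nrm k <= c0 * nrm k / 2.
  by rewrite ler_pdivrMr //; lra.
lra.
Qed.

(** Both steps are nearly orthogonal to the same near-maximiser, whose length is at least [c0 / 2].
    For lattice steps a cross product below 1 vanishes. *)
Lemma nearly_parallel k v v' ell del : k != (0, 0) -> 2 * C1 <= c0 * nrm k ^+ 2 ->
  1 <= nrm v -> 1 <= nrm v' -> nrm v <= ell -> nrm v' <= ell -> 0 <= del ->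
  `|b (k.1 + v.1, k.2 + v.2) - b k| <= del ->
  `|b (k.1 + v'.1, k.2 + v'.2) - b k| <= del ->
  `|cross v v'| * c0 <= 4 * ell * (del + 3 * (C1 * ell ^+ 2 / nrm k)).
Proof.
move=> k0 hk v1 v1' vl vl' del0 bv bv'; have n0 := nrm_gt0 k0; have C11 := C1_ge1.
have hc := c0_gt0.
have [x [Ox hx kx]] := near_max_exists k0 hk.
have nz u : 1 <= nrm u -> u != (0, 0).
  by apply: contraTneq => ->; rewrite /nrm /= expr0n addr0 sqrtr0 -ltNge ltr01.
have ex u : 1 <= nrm u -> C1 / nrm k <= C1 * nrm u ^+ 2 / nrm k.
  move=> u1; rewrite ler_pM2r ?invr_gt0 // ler_peMr ?expr_ge1 //; lra.
have B u : 1 <= nrm u -> nrm u <= ell ->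
    `|b (k.1 + u.1, k.2 + u.2) - b k| <= del -> `|dot2 x u| <= del + 3 * (C1 * ell ^+ 2 / nrm k).
  move=> u1 ul bu; apply: le_trans (near_max k0 (nz _ u1) Ox hx (ex _ u1) bu) _.
  rewrite lerD2l ler_pM2l // ler_pM2r ?invr_gt0 // ler_pM2l; last by lra.
  by rewrite ler_pXn2r ?nnegrE ?nrm_ge0 //; apply: le_trans ul; exact: nrm_ge0.
have := B _ v1 vl bv; have := B _ v1' vl' bv'.
set T := del + _ => Bv' Bv.
have xn : c0 / 2 <= nrm x.
  rewrite -(ler_pM2r n0); apply: le_trans kx _; apply: le_trans (ler_norm _) _; exact: dot2_le.
have T0 : 0 <= T by apply: le_trans Bv; rewrite normr_ge0.
have l0 : 0 <= ell by lra.
have xp : 0 < nrm x by lra.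
(* the cross product times [|x|^2], expanded in the frame of [x] *)
have id : cross v v' * nrm x ^+ 2 = dot2 x v * cross x v' - dot2 x v' * cross x v.
  by rewrite nrmE /cross /dot2; ring.
have ab : `|cross v v'| * nrm x ^+ 2 <= 2 * (T * ell * nrm x).
  rewrite -[X in _ * X]ger0_norm ?exprn_ge0 ?nrm_ge0 // -normrM id.
  apply: le_trans (ler_normB _ _) _; rewrite !normrM.
  have h1 : `|cross x v'| <= ell * nrm x.
    by apply: le_trans (cross_le _ _) _; rewrite mulrC ler_pM2r.
  have h2 : `|cross x v| <= ell * nrm x.
    by apply: le_trans (cross_le _ _) _; rewrite mulrC ler_pM2r.
  have := ler_pM (normr_ge0 _) (normr_ge0 _) Bv h1.
  have := ler_pM (normr_ge0 _) (normr_ge0 _) Bv' h2.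
  lra.
have ab' : `|cross v v'| * nrm x <= 2 * (T * ell).
  by rewrite -(ler_pM2r xp) -mulrA -expr2; lra.
have := ler_wpM2l (normr_ge0 (cross v v')) xn.
lra.
Qed.

(** The step [v] is nearly orthogonal to a near-maximiser, which has a definite component along [k];
    so [v] is not nearly parallel to [k]. Projecting a chord, orthogonal to [k], onto the line of
    the cell then loses only a constant factor. *)
Lemma transversal k v u : k != (0, 0) -> 2 * C1 <= c0 * nrm k ^+ 2 -> v != (0, 0) ->
  1 <= nrm v -> `|b (k.1 + v.1, k.2 + v.2) - b k| <= c0 / 8 ->
  24 * C1 * nrm v <= c0 * nrm k -> dot2 u k = 0 ->
  c0 / 4 * (nrm v * nrm u) <= M * `|dot2 v u|.
Proof.
move=> k0 hk v0 v1 bv vk uk; have n0 := nrm_gt0 k0; have C11 := C1_ge1.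
have nv0 := nrm_gt0 v0; have hc := c0_gt0.
have [x [Ox hx kx]] := near_max_exists k0 hk.
have ex : C1 / nrm k <= C1 * nrm v ^+ 2 / nrm k.
  by rewrite ler_pM2r ?invr_gt0 // ler_peMr ?expr_ge1 //; lra.
have xv : `|dot2 x v| <= c0 / 4 * nrm v.
  apply: le_trans (near_max k0 v0 Ox hx ex bv) _.
  have : C1 * nrm v ^+ 2 / nrm k <= c0 / 24 * nrm v.
    by rewrite ler_pdivrMr //; have := ler_wpM2r (ltW nv0) vk; lra.
  have : c0 * 1 <= c0 * nrm v by rewrite ler_pM2l.
  lra.
have kn : nrm k != 0 by rewrite gt_eqF.
rewrite -(ler_pM2r n0).
have -> : c0 / 4 * (nrm v * nrm u) * nrm k = c0 / 4 * (nrm v * nrm k) * nrm u by ring.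
have -> : M * `|dot2 v u| * nrm k = M * (`|dot2 v u| * nrm k) by ring.
rewrite (dot2_orth v kn uk) [X in _ <= X]mulrA; apply: ler_wpM2r; first exact: nrm_ge0.
have id : dot2 x k * nrm v ^+ 2 = dot2 k v * dot2 x v - cross v k * cross x v.
  by rewrite nrmE /cross /dot2; ring.
have h1 : c0 / 2 * nrm k * nrm v ^+ 2 <= nrm k * nrm v * (c0 / 4 * nrm v) + `|cross v k| * (M * nrm v).
  apply: (@le_trans _ _ (dot2 x k * nrm v ^+ 2)).
    by apply: ler_wpM2r => //; rewrite exprn_ge0 // nrm_ge0.
  rewrite id; apply: le_trans (ler_norm _) _; apply: le_trans (ler_normB _ _) _.
  rewrite !normrM; apply: lerD; first by apply: ler_pM => //; exact: dot2_le.
  apply: ler_wpM2l => //; apply: le_trans (cross_le _ _) _.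
  by rewrite ler_pM2r //; exact: OM.
rewrite -(ler_pM2r nv0); lra.
Qed.

End NearMax.

(** * Counting frequencies in a shell *)

Section Lattice.
Variable R : realType.
Implicit Types (k l m : int * int).

Definition vec k : R * R := (k.1%:~R, k.2%:~R).

Lemma nrm_unit (a : R) (e : R * R) : e.1 ^+ 2 + e.2 ^+ 2 = 1 ->
  nrm (a * e.1, a * e.2) = `|a|.
Proof. by move=> ee; rewrite /nrm /= !exprMn -mulrDr ee mulr1 sqrtr_sqr. Qed.

Lemma intr_lt1_eq0 (z : int) : `|z%:~R : R| < 1 -> z = 0.
Proof.
rewrite -intr_norm -[1]/(1%:~R) ltr_int => h; apply/eqP; rewrite -absz_eq0; lia.
Qed.

Lemma nrm_vec_ge1 k : k != (0, 0) -> 1 <= nrm (vec k).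
Proof.
move=> k0; have h (z : int) : z != 0 -> 1 <= `|z%:~R : R|.
  by move=> z0; rewrite leNgt; apply: contra z0 => /intr_lt1_eq0 ->.
have [k1|k1] := eqVneq k.1 0; last by apply: le_trans (abs1_le_nrm _); exact: h.
apply: le_trans (abs2_le_nrm _); apply: h; apply: contra k0 => /eqP k2.
by rewrite [k]surjective_pairing k1 k2.
Qed.

Lemma vec_neq0 k : k != (0, 0) -> vec k != (0, 0).
Proof.
by move/nrm_vec_ge1; apply: contraTneq => ->; rewrite /nrm /= expr0n addr0 sqrtr0 -ltNge ltr01.
Qed.

Lemma vecB k l : (k.1%:~R - l.1%:~R, k.2%:~R - l.2%:~R) = vec (k.1 - l.1, k.2 - l.2).
Proof. by rewrite /vec /= !rmorphB. Qed.

Lemma vec_dist_ge1 k l : k != l -> 1 <= nrm (vec (k.1 - l.1, k.2 - l.2)).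
Proof.
move=> kl; apply: nrm_vec_ge1; apply: contra kl => /eqP[/eqP + /eqP].
rewrite !subr_eq0 => /eqP h1 /eqP h2.
by rewrite [k]surjective_pairing [l]surjective_pairing h1 h2.
Qed.

Lemma cross_vec k l : cross (vec k) (vec l) = (k.1 * l.2 - k.2 * l.1)%:~R.
Proof. by rewrite /cross /vec /= rmorphB !rmorphM. Qed.

Variables (Om : set (R * R)) (c0 M K2 : R).
Hypotheses (cO : convex2 Om) (c0_gt0 : 0 < c0).
Hypothesis (OM : forall x, Om x -> nrm x <= M).
Hypothesis (cOm : forall x, `|x.1| <= c0 -> `|x.2| <= c0 -> Om x).
Let b k := rho_star Om (vec k).
Hypothesis K20 : 0 <= K2.
Hypothesis chord : forall k p q : R * R, k != (0, 0) -> Om p -> Om q -> dot2 p k = dot2 q k ->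
  ((p.1 - q.1) ^+ 2 + (p.2 - q.2) ^+ 2) * nrm k <= K2 * (rho_star Om k - dot2 p k).

Let C1 := C1 c0 M K2.

Section Cell.
Variables (Q : seq (int * int)) (kap del ell d0 S A : R) (p q : int * int -> R * R)
  (al : int * int -> R).
Hypotheses (uQ : uniq Q) (kap0 : 0 < kap) (del0 : 0 <= del) (d00 : 0 <= d0) (S0 : 0 <= S)
  (A0 : 0 <= A).
Hypothesis Qk : forall k, k \in Q -> k != (0, 0) /\ kap <= nrm (vec k).
Hypothesis Qb : forall k l, k \in Q -> l \in Q -> `|b l - b k| <= del.
Hypothesis Ql : forall k l, k \in Q -> l \in Q -> nrm (vec (l.1 - k.1, l.2 - k.2)) <= ell.
Hypotheses (h1 : 2 * C1 <= c0 * kap ^+ 2)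
  (h2 : 4 * ell * (del + 3 * (C1 * ell ^+ 2 / kap)) < c0) (h3 : del <= c0 / 8)
  (h4 : 24 * C1 * ell <= c0 * kap).
Hypothesis Qpq : forall k, k \in Q -> [/\ Om (p k), Om (q k),
  dot2 (p k) (vec k) = b k - d0 & dot2 (q k) (vec k) = b k - d0].
Hypothesis alA : forall k, k \in Q -> al k <= A.
Hypothesis alS : forall k, k \in Q ->
  al k <= S * nrm ((p k).1 - (q k).1, (p k).2 - (q k).2).

(** Hypothesis [h1] supplies near-maximisers, [h2] makes the integer cross products smaller than 1
    and so the cell collinear, [h3] and [h4] make the chords transversal to its line. The slope is
    controlled only away from the ends of the line, so [n] points at each end are bounded by [A]. *)
Lemma cell_bound (n : nat) : (0 < n)%N ->
  \sum_(k <- Q) al k <= 2 * n%:R * A +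
    S * (4 * M / c0) * (2 * (del + d0) / n%:R + 2 * d0 * (size Q)%:R).
Proof.
move=> n0; have M0 := M_ge0 c0_gt0 OM cOm; have hc := c0_gt0; have hd := del0; have hd0 := d00.
have hS := S0; have hk := kap0; have hA := A0.
have C11 : 1 <= C1 by exact: (C1_ge1 c0_gt0 OM cOm K20).
have H1 := h1; have H2 := h2; have H3 := h3; have H4 := h4.
have T0 : 0 <= S * (4 * M / c0) * (2 * (del + d0) / n%:R + 2 * d0 * (size Q)%:R).
  apply: mulr_ge0; last by apply: addr_ge0; [apply: divr_ge0 => //; lra|apply: mulr_ge0 => //; lra].
  by apply: mulr_ge0 => //; apply: divr_ge0; [apply: mulr_ge0|exact: ltW].
have [Qn|nQ] := leqP (size Q) (2 * n).
  apply: (@le_trans _ _ (2 * n%:R * A)); last by rewrite lerDl.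
  apply: (@le_trans _ _ (\sum_(k <- Q) A)).
    by rewrite big_seq [leRHS]big_seq; apply: ler_sum => k /alA.
  rewrite big_const_seq count_predT iter_addr_0 -[A *+ _]mulr_natl; apply: ler_wpM2r => //.
  by rewrite -natrM ler_nat.
pose dif k l := vec (k.1 - l.1, k.2 - l.2).
have kap_sq k : k \in Q -> 2 * C1 <= c0 * nrm (vec k) ^+ 2.
  move=> kQ; have [_ kk] := Qk kQ; apply: le_trans h1 _; rewrite ler_pM2l //.
  by rewrite ler_pXn2r ?nnegrE ?nrm_ge0 // ltW.
have add_dif k l : ((vec l).1 + (dif k l).1, (vec l).2 + (dif k l).2) = vec k.
  by rewrite /dif -vecB /vec /= !(addrC _ (_ - _)) !subrK.
have [k0 [k1 [k0Q k1Q k01]]] : exists k0 k1, [/\ k0 \in Q, k1 \in Q & k1 != k0].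
  move: nQ uQ; case: (Q) => [|k0 [|k1 Q']] //=; first by case: (n) n0.
  rewrite inE negb_or => _ /andP[/andP[h _] _]; exists k0, k1.
  by split; rewrite ?inE ?eqxx ?orbT // eq_sym.
pose w := dif k1 k0.
have w1 : 1 <= nrm w by exact: vec_dist_ge1.
have wl : nrm w <= ell by exact: Ql.
have wp : 0 < nrm w by lra.
have ell1 : 1 <= ell by lra.
have crossw k : k \in Q -> cross (dif k k0) w = 0.
  move=> kQ; have [->|kk0] := eqVneq k k0.
    by rewrite /dif !subrr /cross /vec /= !mul0r subrr.
  have [k0n kk0'] := Qk k0Q.
  have bb l : l \in Q -> `|rho_star Om ((vec k0).1 + (dif l k0).1, (vec k0).2 + (dif l k0).2) - rho_star Om (vec k0)| <= del.
    by move=> lQ; rewrite add_dif; exact: Qb.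
  have := nearly_parallel cO c0_gt0 OM cOm K20 chord (vec_neq0 k0n) (kap_sq _ k0Q)
    (vec_dist_ge1 kk0) w1 (Ql k0Q kQ) wl del0 (bb _ kQ) (bb _ k1Q).
  rewrite -/C1 -/(dif k k0) -/w => X.
  have {}X : `|cross (dif k k0) w| * c0 < c0.
    apply: le_lt_trans X (le_lt_trans _ h2).
    apply: ler_wpM2l; first by lra.
    rewrite lerD2l ler_pM2l //; apply: ler_wpM2l; first by rewrite mulr_ge0 ?exprn_ge0 //; lra.
    by rewrite lef_pV2 ?posrE //; apply: lt_le_trans kk0'.
  move: X; rewrite gtr_pMl // /dif /w /dif cross_vec => /intr_lt1_eq0 ->.
  by [].
pose e : R * R := (w.1 / nrm w, w.2 / nrm w).
have wE : nrm w ^+ 2 = w.1 ^+ 2 + w.2 ^+ 2 by exact: nrmE.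
have wn : nrm w != 0 by rewrite gt_eqF.
have ee : e.1 ^+ 2 + e.2 ^+ 2 = 1.
  by rewrite /e /= !exprMn -mulrDl -wE exprVn mulfV // expf_eq0.
pose tau k := dot2 (vec k) e.
have dif_tau0 k : k \in Q -> dif k k0 = ((tau k - tau k0) * e.1, (tau k - tau k0) * e.2).
  move=> kQ; have tE : tau k - tau k0 = dot2 (dif k k0) e.
    by rewrite /tau /dif -vecB /dot2 /vec /=; ring.
  have := crossw _ kQ; rewrite tE; move: (dif k k0) => v cv.
  have ce : cross v e = 0.
    have -> : cross v e = cross v w / nrm w by rewrite /cross /e /=; field.
    by rewrite cv mul0r.
  rewrite [LHS]surjective_pairing; move: ce; rewrite /cross => ce.
  congr (_, _); rewrite /dot2.
    transitivity (v.1 * (e.1 ^+ 2 + e.2 ^+ 2)); first by rewrite ee mulr1.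
    transitivity ((v.1 * e.1 + v.2 * e.2) * e.1 + (v.1 * e.2 - v.2 * e.1) * e.2); first by ring.
    by rewrite ce mul0r addr0.
  transitivity (v.2 * (e.1 ^+ 2 + e.2 ^+ 2)); first by rewrite ee mulr1.
  transitivity ((v.1 * e.1 + v.2 * e.2) * e.2 - (v.1 * e.2 - v.2 * e.1) * e.1); first by ring.
  by rewrite ce mul0r subr0.
have dif_tau k l : k \in Q -> l \in Q -> dif k l = ((tau k - tau l) * e.1, (tau k - tau l) * e.2).
  move=> kQ lQ; have e1 := dif_tau0 _ kQ; have e2 := dif_tau0 _ lQ.
  have : dif k l = ((dif k k0).1 - (dif l k0).1, (dif k k0).2 - (dif l k0).2).
    by rewrite /dif -!vecB /=; congr (_, _); ring.
  by move=> ->; rewrite e1 e2 /=; congr (_, _); ring.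
have tau_dist k l : k \in Q -> l \in Q -> k != l -> 1 <= `|tau k - tau l|.
  move=> kQ lQ kl; apply: le_trans (vec_dist_ge1 kl) _; rewrite -/(dif k l) dif_tau //.
  by rewrite nrm_unit.
pose s := sort (fun k l => tau k <= tau l) Q.
have ps : perm_eq s Q by rewrite perm_sort.
have us : uniq s by rewrite sort_uniq.
have sQ k : (k \in s) = (k \in Q) by exact: perm_mem.
have sN : size s = size Q by exact: size_sort.
have ss : sorted (fun k l => tau k <= tau l) s.
  by apply: sort_sorted => k l; exact: le_total.
pose N := size Q; pose x i := nth (0, 0) s i.
have xQ i : (i < N)%N -> x i \in Q by move=> iN; rewrite -sQ mem_nth // sN.
pose Mx i := Num.max (dot2 (p (x i)) e) (dot2 (q (x i)) e).
pose mx i := Num.min (dot2 (p (x i)) e) (dot2 (q (x i)) e).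
(* A point of [Om] at depth [d0] is a subgradient of [rho_star] at [k] up to [d0]; only its
   component along [e] matters on the line. *)
have sub z k l : Om z -> k \in Q -> l \in Q -> dot2 z (vec k) = b k - d0 ->
    b k - d0 + dot2 z e * (tau l - tau k) <= b l.
  move=> Oz kQ lQ zk; have := dot2_le_rho c0_gt0 OM cOm (vec l) Oz; apply: le_trans.
  rewrite -zk -(add_dif l k) (dif_tau _ _ lQ kQ) /dot2 /= le_eqVlt; apply/orP; left; apply/eqP; ring.
have key := @sum_subgradients R N n (fun i => b (x i)) (fun i => tau (x i)) mx Mx d0 del n0.
have {}key : \sum_(n <= i < N - n) (Mx i - mx i) <= 2 * (del + d0) / n%:R + 2 * d0 * N%:R.
  apply: key => //; first exact: ltnW.
  - move=> i iN; have iN' := ltnW iN.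
    have le : tau (x i) <= tau (x i.+1).
      have := sorted_ltn_nth (fun y x z : int * int => @le_trans _ _ (tau y) (tau x) (tau z)) (0, 0) ss.
      by move=> /(_ i i.+1); rewrite !inE sN => H; apply: H.
    have : x i.+1 != x i by rewrite nth_uniq ?sN // eqn_leq ltnn.
    by move=> /(tau_dist _ _ (xQ _ iN) (xQ _ iN')); rewrite ger0_norm ?subr_ge0 //; lra.
  - move=> i j iN jN; have [Op Oq pk qk] := Qpq (xQ _ iN).
    by rewrite /Mx; case: (leP (dot2 (p (x i)) e) _) => _; apply: sub => //; exact: xQ.
  - move=> i j iN jN; have [Op Oq pk qk] := Qpq (xQ _ iN).
    by rewrite /mx; case: (leP (dot2 (p (x i)) e) _) => _; apply: sub => //; exact: xQ.
  - by move=> i _; rewrite /Mx /mx; case: (leP (dot2 (p (x i)) e) (dot2 (q (x i)) e)) => // /ltW.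
  - by move=> i j iN jN; apply: le_trans (ler_norm _) _; apply: Qb; exact: xQ.
have alM i : (i < N)%N -> al (x i) <= S * (4 * M / c0) * (Mx i - mx i).
  move=> iN; have kQ := xQ _ iN; apply: le_trans (alS kQ) _; rewrite -mulrA; apply: ler_wpM2l => //.
  have [kn kk] := Qk kQ; have [Op Oq pk qk] := Qpq kQ.
  set u := (_, _).
  have uk : dot2 u (vec (x i)) = 0.
    have -> : dot2 u (vec (x i)) = dot2 (p (x i)) (vec (x i)) - dot2 (q (x i)) (vec (x i)).
      by rewrite /u /dot2 /=; ring.
    by rewrite pk qk subrr.
  have [l lQ lk] : exists2 l, l \in Q & l != x i.
    have [h|h] := eqVneq (x i) k0; first by exists k1; rewrite // h.
    by exists k0; rewrite // eq_sym.
  have v1 := vec_dist_ge1 lk; have vl := Ql kQ lQ.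
  have v0 : dif l (x i) != (0, 0).
    by apply: contraTneq v1; rewrite -/(dif _ _) => ->; rewrite /nrm /= expr0n addr0 sqrtr0 -ltNge ltr01.
  have bb : `|rho_star Om ((vec (x i)).1 + (dif l (x i)).1, (vec (x i)).2 + (dif l (x i)).2) - rho_star Om (vec (x i))| <= c0 / 8.
    by rewrite add_dif; apply: le_trans (Qb kQ lQ) h3.
  have c24 : 24 * C1 * nrm (dif l (x i)) <= c0 * nrm (vec (x i)).
    apply: (@le_trans _ _ (24 * C1 * ell)); first by apply: ler_wpM2l => //; lra.
    by apply: le_trans h4 _; rewrite ler_pM2l.
  have := transversal cO c0_gt0 OM cOm K20 chord (vec_neq0 kn) (kap_sq _ kQ) v0 v1 bb c24 uk.
  have -> : dot2 (dif l (x i)) u = (tau l - tau (x i)) * (dot2 (p (x i)) e - dot2 (q (x i)) e).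
    by rewrite (dif_tau _ _ lQ kQ) /u /dot2 /=; ring.
  have -> : nrm (dif l (x i)) = `|tau l - tau (x i)|.
    by rewrite (dif_tau _ _ lQ kQ) nrm_unit.
  have t0 : 0 < `|tau l - tau (x i)| by apply: lt_le_trans (tau_dist _ _ lQ kQ lk).
  rewrite normrM => H.
  have {}H : c0 / 4 * nrm u <= M * `|dot2 (p (x i)) e - dot2 (q (x i)) e|.
    rewrite -(ler_pM2l t0); lra.
  have -> : Mx i - mx i = `|dot2 (p (x i)) e - dot2 (q (x i)) e|.
    rewrite /Mx /mx; case: leP => h; first by rewrite distrC ger0_norm // subr_ge0.
    by rewrite ger0_norm // subr_ge0 ltW.
  rewrite mulrAC ler_pdivlMr //; lra.
have -> : \sum_(k <- Q) al k = \sum_(0 <= i < N) al (x i).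
  by rewrite -(perm_big _ ps) /= (big_nth (0, 0)) sN.
have nN : (n <= N)%N by apply: leq_trans (ltnW nQ); rewrite leq_pmull.
have nN2 : (n <= N - n)%N by rewrite leq_subRL // addnn -mul2n; exact: ltnW.
have NnN : (N - n <= N)%N by exact: leq_subr.
rewrite (big_cat_nat (n := n)) //= (big_cat_nat (m := n) (n := N - n)) //=.
(* This serves the [n] points at each end; the middle range goes through [key]. *)
have triv a c : (c <= N)%N -> \sum_(a <= i < c) al (x i) <= (c - a)%:R * A.
  move=> cN; apply: (@le_trans _ _ (\sum_(a <= i < c) A)).
    rewrite big_nat_cond [leRHS]big_nat_cond; apply: ler_sum => i /andP[/andP[_ ic] _].
    by apply: alA; apply: xQ; exact: leq_trans ic cN.
  by rewrite big_const_nat iter_addr_0 -[A *+ _]mulr_natl.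
have t1 := triv 0%N n nN; rewrite subn0 in t1.
have t2 := triv (N - n)%N N (leqnn _); rewrite subKn // in t2.
have t3 : \sum_(n <= i < N - n) al (x i) <= S * (4 * M / c0) * (2 * (del + d0) / n%:R + 2 * d0 * N%:R).
  apply: (@le_trans _ _ (\sum_(n <= i < N - n) S * (4 * M / c0) * (Mx i - mx i))).
    rewrite big_nat_cond [leRHS]big_nat_cond; apply: ler_sum => i /andP[/andP[_ ic] _].
    by apply: alM; exact: leq_trans ic NnN.
  rewrite -mulr_sumr; apply: ler_wpM2l => //.
  by rewrite mulr_ge0 // divr_ge0 ?mulr_ge0 // ltW.
lra.
Qed.

End Cell.
End Lattice.

(** * Direction cells and the number of points in a shell *)

Section Count.
Variable R : realType.
Implicit Types (k l : int * int).

Lemma size_le_box (Q : seq (int * int)) (n : nat) : uniq Q ->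
  (forall k l, k \in Q -> l \in Q -> nrm (vec R (l.1 - k.1, l.2 - k.2)) <= n%:R) ->
  (size Q <= (2 * n + 1) ^ 2)%N.
Proof.
move=> uQ hQ; have [->|[k0 k0Q]] : Q = [::] \/ exists k0, k0 \in Q.
  by case: (Q) => [|k0 Q']; [left|right; exists k0; rewrite inE eqxx].
  by [].
have bd (z : int) : `|z%:~R : R| <= n%:R -> (`|z| <= n)%N.
  by rewrite -intr_norm -[n%:R]/(n%:~R) ler_int; lia.
have bQ k : k \in Q -> (`|k.1 - k0.1| <= n)%N /\ (`|k.2 - k0.2| <= n)%N.
  move=> kQ; have h := hQ _ _ k0Q kQ; split; apply: bd.
    by apply: le_trans h; apply: (abs1_le_nrm (vec R (_, _))).
  by apply: le_trans h; apply: (abs2_le_nrm (vec R (_, _))).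
pose f k : 'I_(2 * n).+1 * 'I_(2 * n).+1 :=
  (inord (absz (k.1 - k0.1 + n%:Z)), inord (absz (k.2 - k0.2 + n%:Z))).
have inj : {in Q &, injective f}.
  have injc (z a c : int) : (`|(a - z)%R| <= n)%N -> (`|(c - z)%R| <= n)%N ->
      inord (absz (a - z + n%:Z)) = inord (absz (c - z + n%:Z)) :> 'I_(2 * n).+1 -> a = c.
    move=> az cz /(congr1 val) /=; rewrite !inordK; [lia| |]; clear -az cz; lia.
  move=> k l kQ lQ [f1 f2].
  have [k1 k2] := bQ _ kQ; have [l1 l2] := bQ _ lQ.
  rewrite [k]surjective_pairing [l]surjective_pairing.
  by rewrite (injc _ _ _ k1 l1 f1) (injc _ _ _ k2 l2 f2).
have us : uniq (map f Q) by rewrite map_inj_in_uniq.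
rewrite -(size_map f) -(card_uniqP us); apply: leq_trans (max_card _) _.
by rewrite card_prod card_ord -mulnn addn1.
Qed.

Lemma int_norm_ratio (x y : int) : (`|x| <= `|y|)%N -> y != 0 ->
  -1 <= (x%:~R : R) / `|y%:~R| <= 1.
Proof.
move=> xy y0; have y0' : 0 < `|y%:~R : R| by rewrite normr_gt0 intr_eq0.
have h : `|x%:~R : R| <= `|y%:~R| by rewrite -!intr_norm ler_int; lia.
by rewrite ler_pdivrMr // ler_pdivlMr // mul1r mulN1r -ler_norml.
Qed.

(** Directions are encoded by central projection onto the square of side 2, without angles: [steep]
    and [side] select the edge, [slope] the position on it, and [height] is the sup norm, the
    dilation factor. *)
Definition steep k : bool := (`|k.2| <= `|k.1|)%N.
Definition slope k : R :=
  if steep k then k.2%:~R / `|k.1%:~R| else k.1%:~R / `|k.2%:~R|.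
Definition side k : bool := if steep k then 0 <= k.1 else 0 <= k.2.
Definition dirn k : R * R :=
  if steep k then ((-1) ^+ ~~ side k, slope k) else (slope k, (-1) ^+ ~~ side k).
Definition height k : R := if steep k then `|k.1%:~R| else `|k.2%:~R|.
(** The last of the [2 * J + 1] slots is there for the slope 1. *)
Definition cell_of (J : nat) k : bool * bool * 'I_(2 * J).+1 :=
  (steep k, side k, inord (Num.truncn (J%:R * (slope k + 1)))).

Lemma signed_abs (z : int) : `|z%:~R| * (-1) ^+ (~~ (0 <= z)) = z%:~R :> R.
Proof.
case: (leP 0 z) => h /=; first by rewrite mulr1 ger0_norm // ler0z.
by rewrite expr1 mulrN1 ltr0_norm ?opprK // ltrz0.
Qed.

Lemma steep_neq0 k : k != (0, 0) -> steep k -> k.1 != 0.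
Proof.
rewrite /steep => k0 h; apply: contra k0 => /eqP k1; move: h; rewrite k1 absz0 leqn0 absz_eq0.
by move=> /eqP k2; rewrite [k]surjective_pairing k1 k2.
Qed.

Lemma flat_neq0 k : ~~ steep k -> k.2 != 0.
Proof. by rewrite /steep -ltnNge; apply: contraTneq => ->. Qed.

Lemma height_gt0 k : k != (0, 0) -> 0 < height k.
Proof.
move=> k0; rewrite /height; case: ifPn => h; rewrite normr_gt0 intr_eq0.
  exact: steep_neq0.
exact: flat_neq0.
Qed.

Lemma vec_dirn k : k != (0, 0) -> vec R k = (height k * (dirn k).1, height k * (dirn k).2).
Proof.
move=> k0; have := height_gt0 k0; rewrite /vec /height /dirn /slope /side.
case: ifPn => h h0 /=; rewrite signed_abs; congr (_, _); rewrite mulrC divfK // gt_eqF //.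
Qed.

Lemma slope_bound k : k != (0, 0) -> -1 <= slope k <= 1.
Proof.
move=> k0; rewrite /slope; case: ifPn => h; apply: int_norm_ratio => //.
- exact: steep_neq0.
- by move: h; rewrite /steep -ltnNge => /ltnW.
- exact: flat_neq0.
Qed.

Lemma dirn_norms k : k != (0, 0) -> 1 <= nrm (dirn k) /\ `|(dirn k).1| + `|(dirn k).2| <= 2.
Proof.
move=> /slope_bound; rewrite -ler_norml => sb; rewrite /dirn; case: ifP => _; split.
- by apply: le_trans (abs1_le_nrm _); rewrite normr_sign.
- by rewrite /= normr_sign; lra.
- by apply: le_trans (abs2_le_nrm _); rewrite normr_sign.
- by rewrite /= normr_sign; lra.
Qed.

Lemma same_cell_dirn J k l : (0 < J)%N -> k != (0, 0) -> l != (0, 0) ->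
  cell_of J k = cell_of J l ->
  `|(dirn k).1 - (dirn l).1| + `|(dirn k).2 - (dirn l).2| <= J%:R^-1.
Proof.
move=> J0 k0 l0 [e1 e2 /(congr1 val) /=].
have /andP[k1 k2] := slope_bound k0; have /andP[l1 l2] := slope_bound l0.
have Jp : 0 < J%:R :> R by rewrite ltr0n.
have tb (x : R) : -1 <= x -> x <= 1 -> (Num.truncn (J%:R * (x + 1)) < (2 * J).+1)%N.
  move=> x1 x2; rewrite ltnS -(@ler_nat R).
  have x0 : 0 <= J%:R * (x + 1) by rewrite mulr_ge0 //; lra.
  have /andP[h _] := truncn_itv x0; apply: le_trans h _.
  by rewrite natrM mulrC; apply: ler_wpM2r => //; lra.
rewrite !inordK ?tb // => tE.
have sl : `|slope k - slope l| <= J%:R^-1.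
  have x0 : 0 <= J%:R * (slope k + 1) by rewrite mulr_ge0 //; lra.
  have y0 : 0 <= J%:R * (slope l + 1) by rewrite mulr_ge0 //; lra.
  have := truncn_itv x0; have := truncn_itv y0; rewrite -tE -natr1 => /andP[a1 a2] /andP[b1 b2].
  rewrite -(ler_pM2l Jp) mulfV ?gt_eqF // -[X in X * _](gtr0_norm Jp) -normrM.
  by rewrite ler_norml; apply/andP; split; lra.
rewrite /dirn -e1 -e2; case: ifP => _ /=; rewrite subrr normr0 ?addr0 ?add0r //.
Qed.

Lemma sum_cells (Q : seq (int * int)) J (F : int * int -> R) (X : R) :
  (forall c, \sum_(k <- Q | cell_of J k == c) F k <= X) ->
  \sum_(k <- Q) F k <= 4 * (2 * J%:R + 1) * X.
Proof.
move=> hX; rewrite (partition_big (cell_of J) xpredT) //=.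
apply: (@le_trans _ _ (\sum_(c : bool * bool * 'I_(2 * J).+1) X)); first by apply: ler_sum.
rewrite sumr_const !card_prod !card_bool card_ord -[X *+ _]mulr_natl.
by rewrite !natrM -[(2 * J).+1%:R]natr1 natrM; lra.
Qed.

Variables (Om : set (R * R)) (c0 M K2 : R).
Hypotheses (cO : convex2 Om) (c0_gt0 : 0 < c0).
Hypothesis (OM : forall x, Om x -> nrm x <= M).
Hypothesis (cOm : forall x, `|x.1| <= c0 -> `|x.2| <= c0 -> Om x).
Let b k := rho_star Om (vec R k).

(** By homogeneity [b] is the height times [rho_star] of the direction, a Lipschitz function at
    least [c0]; near values of [b] in near directions force near heights. *)
Lemma same_cell_dist J k l (del B : R) : (0 < J)%N -> k != (0, 0) -> l != (0, 0) ->
  cell_of J k = cell_of J l -> `|b k - b l| <= del -> b l <= B ->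
  nrm (vec R (k.1 - l.1, k.2 - l.2)) <= 2 * ((del + M * (B / c0 / J%:R)) / c0) + B / c0 / J%:R.
Proof.
move=> J0 k0 l0 kl bkl bl; have hc := c0_gt0; have hM := M_ge0 c0_gt0 OM cOm.
have Jp : 0 < J%:R :> R by rewrite ltr0n.
have ud := same_cell_dirn J0 k0 l0 kl.
have [uk1 uk2] := dirn_norms k0; have [ul1 ul2] := dirn_norms l0.
have xk := height_gt0 k0; have xl := height_gt0 l0.
set u := dirn k in ud uk1 uk2 *; set u' := dirn l in ud ul1 ul2 *.
set x := height k in xk *; set x' := height l in xl *.
have bkE : b k = x * rho_star Om u by rewrite /b vec_dirn // (rhoZ c0_gt0 OM cOm) // ltW.
have blE : b l = x' * rho_star Om u' by rewrite /b vec_dirn // (rhoZ c0_gt0 OM cOm) // ltW.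
have bu1 : c0 <= rho_star Om u.
  by apply: le_trans (rho_ge c0_gt0 OM cOm u); rewrite ler_peMr // ltW.
have bu1' : c0 <= rho_star Om u'.
  by apply: le_trans (rho_ge c0_gt0 OM cOm u'); rewrite ler_peMr // ltW.
have x'B : x' <= B / c0.
  rewrite ler_pdivlMr //; apply: le_trans bl; rewrite blE ler_pM2l //.
have ubu : `|rho_star Om u - rho_star Om u'| <= M * J%:R^-1.
  apply: le_trans (rho_lip c0_gt0 OM cOm u u') _; apply: ler_wpM2l => //.
  exact: le_trans (nrm_le_abs (_, _)) ud.
have JV0 : 0 <= J%:R^-1 :> R by rewrite invr_ge0 ltW.
have xx : `|x - x'| <= (del + M * (B / c0 / J%:R)) / c0.
  rewrite ler_pdivlMr //; apply: (@le_trans _ _ (`|x - x'| * rho_star Om u)).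
    by apply: ler_wpM2l.
  rewrite -[X in _ * X <= _]ger0_norm; last by lra.
  rewrite -normrM.
  have -> : (x - x') * rho_star Om u = (b k - b l) - x' * (rho_star Om u - rho_star Om u').
    by rewrite bkE blE; ring.
  apply: le_trans (ler_normB _ _) _; apply: lerD => //.
  rewrite normrM (gtr0_norm xl).
  have := ler_pM (ltW xl) (normr_ge0 _) x'B ubu; lra.
rewrite -vecB; apply: le_trans (nrm_le_abs _) _ => /=.
have := congr1 fst (vec_dirn k0); have := congr1 snd (vec_dirn k0).
have := congr1 fst (vec_dirn l0); have := congr1 snd (vec_dirn l0).
rewrite /vec /= -/u -/u' -/x -/x' => -> -> -> ->.
have e1 : `|x * u.1 - x' * u'.1| <= `|x - x'| * `|u.1| + x' * `|u.1 - u'.1|.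
  have -> : x * u.1 - x' * u'.1 = (x - x') * u.1 + x' * (u.1 - u'.1) by ring.
  by apply: le_trans (ler_normD _ _) _; rewrite !normrM (gtr0_norm xl).
have e2 : `|x * u.2 - x' * u'.2| <= `|x - x'| * `|u.2| + x' * `|u.2 - u'.2|.
  have -> : x * u.2 - x' * u'.2 = (x - x') * u.2 + x' * (u.2 - u'.2) by ring.
  by apply: le_trans (ler_normD _ _) _; rewrite !normrM (gtr0_norm xl).
have := ler_wpM2l (normr_ge0 (x - x')) uk2.
have := ler_pM (ltW xl) (addr_ge0 (normr_ge0 (u.1 - u'.1)) (normr_ge0 (u.2 - u'.2))) x'B ud.
lra.
Qed.

(** With [J] of order [B] a direction cell of the shell has bounded diameter, hence boundedly many
    lattice points. *)
Lemma shell_count : exists2 C : R, 0 < C & forall (Q : seq (int * int)) (B : R),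
  uniq Q -> (forall k, k \in Q -> k != (0, 0)) ->
  (forall k l, k \in Q -> l \in Q -> `|b k - b l| <= 1) ->
  (forall k, k \in Q -> b k <= B) -> (size Q)%:R <= C * (`|B| + 1).
Proof.
have hc := c0_gt0; have hM := M_ge0 c0_gt0 OM cOm.
pose D := 2 * ((1 + M) / c0) + 1.
have D0 : 0 <= D by rewrite addr_ge0 // mulr_ge0 // divr_ge0 ?addr_ge0 // ltW.
pose n := (Num.truncn D).+1.
have Dn : D <= n%:R by rewrite /n; have /andP[_ /ltW] := truncn_itv D0.
pose N : R := ((2 * n + 1) ^ 2)%N%:R.
exists (4 * (2 * (1 / c0) + 3) * N).
  by rewrite !mulr_gt0 // ?ltr0n ?expn_gt0 ?addn1 // addr_gt0 // mulr_gt0 // divr_gt0.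
move=> Q B uQ Q0 Qb QB.
have X0 : 0 <= `|B| / c0 by rewrite divr_ge0 // ltW.
pose J := (Num.truncn (`|B| / c0)).+1.
have /andP[J1 /ltW J2] := truncn_itv X0; rewrite -/J in J2.
have J3 : J%:R <= `|B| / c0 + 1 by rewrite /J -natr1 lerD2r.
have Jp : 0 < J%:R :> R by rewrite ltr0n.
have XJ : `|B| / c0 / J%:R <= 1 by rewrite ler_pdivrMr // mul1r.
have -> : (size Q)%:R = \sum_(k <- Q) 1 :> R by rewrite big_const_seq count_predT iter_addr_0.
have N0 : 0 <= N by [].
apply: (@le_trans _ _ (4 * (2 * J%:R + 1) * N)); last first.
  have : (4 * (2 * J%:R + 1)) <= 4 * (2 * (1 / c0) + 3) * (`|B| + 1).
    have : 0 <= 1 / c0 by rewrite divr_ge0 // ltW.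
    have J3' : J%:R <= `|B| * (1 / c0) + 1 by rewrite div1r.
    have := normr_ge0 B; nra.
  by move=> /(ler_wpM2r N0); lra.
apply: sum_cells => c.
rewrite -big_filter big_const_seq count_predT iter_addr_0 /N ler_nat.
apply: size_le_box; first exact: filter_uniq.
move=> k l; rewrite !mem_filter => /andP[/eqP ck kQ] /andP[/eqP cl lQ].
apply: le_trans Dn.
have BB : b k <= `|B| by apply: le_trans (QB _ kQ) (ler_norm _).
apply: le_trans (same_cell_dist (J := J) _ (Q0 _ lQ) (Q0 _ kQ) _ (Qb _ _ lQ kQ) BB) _ => //.
  by rewrite ck cl.
apply: lerD => //; apply: ler_wpM2l => //; rewrite ler_pM2r ?invr_gt0 // lerD2l.
by rewrite ler_piMr.
Qed.

Hypothesis K20 : 0 <= K2.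
Hypothesis chord : forall k p q : R * R, k != (0, 0) -> Om p -> Om q -> dot2 p k = dot2 q k ->
  ((p.1 - q.1) ^+ 2 + (p.2 - q.2) ^+ 2) * nrm k <= K2 * (rho_star Om k - dot2 p k).

Let C1 := C1 c0 M K2.

(* The shell is cut into direction cells of diameter [rho ^ 5]; the points of a
   cell are collinear, and [cell_bound] with [n = rho ^ 4] beats the trivial
   count [rho ^ 16] by a factor [rho]. *)
Lemma shell_strong (A : R) : 0 < M -> 0 <= A -> exists2 C : R, 0 < C & exists2 rho0 : R, 1 <= rho0 &
  forall (rho h : R) (Q : seq (int * int)) (p q : int * int -> R * R) (al : int * int -> R),
  rho0 <= rho -> rho ^+ 16 <= h -> uniq Q ->
  (forall k, k \in Q -> k != (0, 0) /\ c0 * rho ^+ 16 / (2 * M) <= nrm (vec R k)) ->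
  (forall k, k \in Q -> b k <= 2 * M * rho ^+ 16) ->
  (forall k l, k \in Q -> l \in Q -> `|b k - b l| <= h^-1) ->
  (forall k, k \in Q -> [/\ Om (p k), Om (q k),
     dot2 (p k) (vec R k) = b k - 2 / h ^+ 2 & dot2 (q k) (vec R k) = b k - 2 / h ^+ 2]) ->
  (forall k, 0 <= al k) -> (forall k, k \in Q -> al k <= A) ->
  (forall k, k \in Q -> al k <= h * (Num.sqrt (2 * M / c0) * rho ^+ 8) *
     nrm ((p k).1 - (q k).1, (p k).2 - (q k).2)) ->
  \sum_(k <- Q) al k <= C * rho ^+ 15.
Proof.
move=> M0 A0; have hc := c0_gt0.
have C11 : 1 <= C1 by exact: (C1_ge1 c0_gt0 OM cOm K20).
pose Lc := 2 / c0 + (2 * M / c0 + 1) * (2 * M / c0).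
have Mc : 0 < 2 * M / c0 by rewrite divr_gt0 // mulr_gt0.
have L0 : 0 < Lc by rewrite addr_gt0 // ?divr_gt0 // mulr_gt0 // addr_gt0.
pose s1 := Num.sqrt (2 * M / c0); have s10 : 0 <= s1 by exact: sqrtr_ge0.
pose C4 := 4 * A + (4 * M / c0) * (6 * s1 + 4 * s1 * (2 * Lc + 3) ^+ 2) + 1.
have M4 : 0 <= 4 * M / c0 by rewrite divr_ge0 ?mulr_ge0 ?ltW.
have C40 : 0 < C4.
  apply: ltr_wpDl; last by [].
  apply: addr_ge0; first exact: mulr_ge0.
  apply: mulr_ge0 => //; apply: addr_ge0; first exact: mulr_ge0.
  by apply: mulr_ge0; [exact: mulr_ge0|exact: sqr_ge0].
(* The thresholds [e1] to [e4] on [rho] yield [c1] to [c4], the hypotheses [h1] to [h4] of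
   [cell_bound]. *)
pose e1 := 8 * C1 * M ^+ 2 / c0 ^+ 3.
pose e2 := 4 * Lc * (1 + 6 * C1 * Lc ^+ 2 * M / c0) / c0 + 1.
pose e3 := 8 / c0.
pose e4 := 48 * C1 * Lc * M / c0 ^+ 2.
have C10 : 0 < C1 by lra.
have e10 : 0 < e1 by rewrite divr_gt0 ?mulr_gt0 ?exprn_gt0.
have e2' : 0 < 1 + 6 * C1 * Lc ^+ 2 * M / c0.
  by rewrite addr_gt0 // divr_gt0 // !mulr_gt0 // exprn_gt0.
have e20 : 0 < e2 by rewrite addr_gt0 // divr_gt0 // !mulr_gt0.
have e30 : 0 < e3 by rewrite divr_gt0.
have e40 : 0 < e4 by rewrite divr_gt0 ?mulr_gt0 ?exprn_gt0.
exists (20 * C4); first by rewrite mulr_gt0.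
exists (1 + e1 + e2 + e3 + e4); first by lra.
move=> rho h Q p q al hr hh uQ Qk QB Qb Qpq al0 alA alS.
have r1 : 1 <= rho by lra.
have re1 : e1 <= rho by lra.
have re2 : e2 <= rho by lra.
have re3 : e3 <= rho by lra.
have re4 : e4 <= rho by lra.
have r0 : 0 < rho by lra.
have rp n : 0 < rho ^+ n by rewrite exprn_gt0.
have rn n : 1 <= rho ^+ n by exact: exprn_ege1.
have rle m n : (m <= n)%N -> rho ^+ m <= rho ^+ n by move=> mn; rewrite ler_weXn2l.
have h0 : 0 < h by apply: lt_le_trans hh.
have h1 : 1 <= h by apply: le_trans hh.
(* Points have size [rho ^ 16], so [rho ^ 11] directions leave cells of diameter [rho ^ 5], whose
   cube is below [rho ^ 16]. *)
pose J := (Num.truncn (rho ^+ 11)).+1.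
have /andP[J1 /ltW J2] := truncn_itv (ltW (rp 11)); rewrite -/J in J2.
have J3 : J%:R <= 2 * rho ^+ 11 by rewrite /J -natr1; have := rn 11; lra.
have Jp : 0 < J%:R :> R by rewrite ltr0n.
pose ell := Lc * rho ^+ 5.
pose kap := c0 * rho ^+ 16 / (2 * M).
have kap0 : 0 < kap by rewrite divr_gt0 ?mulr_gt0.
have XJ : 2 * M * rho ^+ 16 / c0 / J%:R <= 2 * M / c0 * rho ^+ 5.
  rewrite ler_pdivrMr //.
  have -> : 2 * M * rho ^+ 16 / c0 = 2 * M / c0 * rho ^+ 5 * rho ^+ 11 by ring.
  by rewrite ler_pM2l // mulr_gt0.
have hV : h^-1 <= 1 by rewrite invf_le1.
have ell_ge k l : k \in Q -> l \in Q -> cell_of J k = cell_of J l ->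
    nrm (vec R (l.1 - k.1, l.2 - k.2)) <= ell.
  move=> kQ lQ kl; have [k0 _] := Qk _ kQ; have [l0 _] := Qk _ lQ.
  apply: le_trans (same_cell_dist (J := J) _ l0 k0 (esym kl) (Qb _ _ lQ kQ) (QB _ kQ)) _ => //.
  have t1 : (h^-1 + M * (2 * M * rho ^+ 16 / c0 / J%:R)) / c0 <=
      (1 * rho ^+ 5 + M * (2 * M / c0 * rho ^+ 5)) / c0.
    rewrite ler_pM2r ?invr_gt0 //; apply: lerD; first by rewrite mul1r; exact: le_trans hV (rn 5).
    by rewrite ler_pM2l.
  apply: le_trans (lerD (ler_wpM2l (ler0n _ 2) t1) XJ) _.
  rewrite /ell /Lc le_eqVlt; apply/orP; left; apply/eqP; ring.
(* This [n] balances the end terms [n * A] against [S * h^-1 / n], where [S * h^-1] is of order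
   [rho ^ 8]. *)
pose n := (Num.truncn (rho ^+ 4)).+1.
have /andP[n1 /ltW n2] := truncn_itv (ltW (rp 4)); rewrite -/n in n2.
have n3 : n%:R <= 2 * rho ^+ 4 by rewrite /n -natr1; have := rn 4; lra.
have np : 0 < n%:R :> R by rewrite ltr0n.
have c1 : 2 * C1 <= c0 * kap ^+ 2.
  have -> : c0 * kap ^+ 2 = c0 ^+ 3 / (4 * M ^+ 2) * rho ^+ 32.
    by rewrite /kap; field; rewrite gt_eqF.
  apply: (@le_trans _ _ (c0 ^+ 3 / (4 * M ^+ 2) * rho)).
    apply: (@le_trans _ _ (c0 ^+ 3 / (4 * M ^+ 2) * e1)).
      by rewrite /e1 le_eqVlt; apply/orP; left; apply/eqP; field; rewrite !gt_eqF.
    by rewrite ler_pM2l // divr_gt0 ?mulr_gt0 ?exprn_gt0.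
  rewrite ler_pM2l ?divr_gt0 ?mulr_gt0 ?exprn_gt0 //.
  by have := rle 1%N 32 isT; rewrite expr1.
have hV16 : h^-1 <= (rho ^+ 16)^-1 by rewrite lef_pV2 ?posrE.
have c2 : 4 * ell * (h^-1 + 3 * (C1 * ell ^+ 2 / kap)) < c0.
  have : 4 * ell * (h^-1 + 3 * (C1 * ell ^+ 2 / kap)) <=
     4 * Lc * (1 + 6 * C1 * Lc ^+ 2 * M / c0) / rho.
    have b1 : 4 * ell * h^-1 <= 4 * Lc / rho.
      have -> : 4 * Lc / rho = 4 * ell * (rho ^+ 6)^-1 by rewrite /ell; field; rewrite gt_eqF.
      rewrite ler_pM2l; last by rewrite !mulr_gt0.
      by apply: le_trans hV16 _; rewrite lef_pV2 ?posrE // rle.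
    have b2 : 4 * ell * (3 * (C1 * ell ^+ 2 / kap)) = 4 * Lc * (6 * C1 * Lc ^+ 2 * M / c0) / rho.
      by rewrite /ell /kap; field; rewrite !gt_eqF.
    lra.
  move=> /le_lt_trans; apply; rewrite ltr_pdivrMr //.
  apply: (@lt_le_trans _ _ (c0 * e2)); last by rewrite ler_pM2l.
  have -> : c0 * e2 = 4 * Lc * (1 + 6 * C1 * Lc ^+ 2 * M / c0) + c0.
    by rewrite /e2; field; rewrite gt_eqF.
  by rewrite ltrDl.
have c3 : h^-1 <= c0 / 8.
  apply: le_trans hV16 _; rewrite -[leRHS]invrK lef_pV2 ?posrE ?invr_gt0 ?divr_gt0 //.
  rewrite invf_div -/e3; apply: le_trans re3 _.
  by have := rle 1%N 16 isT; rewrite expr1.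
have c4 : 24 * C1 * ell <= c0 * kap.
  have -> : c0 * kap = c0 ^+ 2 / (2 * M) * rho ^+ 16 by rewrite /kap; field; rewrite gt_eqF.
  have -> : rho ^+ 16 = rho ^+ 11 * rho ^+ 5 by rewrite -exprD.
  rewrite /ell (mulrA (24 * C1)) (mulrA (c0 ^+ 2 / (2 * M))).
  apply: ler_wpM2r; first exact: ltW.
  apply: (@le_trans _ _ (c0 ^+ 2 / (2 * M) * e4)).
    by rewrite /e4 le_eqVlt; apply/orP; left; apply/eqP; field; rewrite !gt_eqF.
  rewrite ler_pM2l ?divr_gt0 ?mulr_gt0 ?exprn_gt0 //; apply: le_trans re4 _.
  by have := rle 1%N 11 isT; rewrite expr1.
pose S := h * (s1 * rho ^+ 8).
have S0 : 0 <= S by rewrite mulr_ge0 ?mulr_ge0 // ltW.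
have V0 : 0 <= h^-1 by rewrite invr_ge0 ltW.
have dd0 : 0 <= 2 / h ^+ 2 by rewrite divr_ge0 ?exprn_ge0 // ltW.
pose n' := (Num.truncn ell).+1.
have l0 : 0 <= ell by rewrite mulr_ge0 // ltW.
have /andP[m1 /ltW m2] := truncn_itv l0; rewrite -/n' in m2.
have m3 : n'%:R <= (Lc + 1) * rho ^+ 5 by have := m1; rewrite /n' -natr1 /ell; have := rn 5; lra.
apply: (@le_trans _ _ (4 * (2 * J%:R + 1) * (C4 * rho ^+ 4))); last first.
  have -> : 20 * C4 * rho ^+ 15 = 4 * (5 * rho ^+ 11) * (C4 * rho ^+ 4) by ring.
  apply: ler_wpM2r; first by rewrite mulr_ge0 // ltW.
  by have := rn 11; lra.
apply: sum_cells => c; rewrite -big_filter; set Qc := [seq k <- Q | cell_of J k == c].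
have Qc_in k : k \in Qc -> k \in Q /\ cell_of J k = c.
  by rewrite mem_filter => /andP[/eqP].
have uQc : uniq Qc by exact: filter_uniq.
have cb := @cell_bound R Om c0 M K2 cO c0_gt0 OM cOm K20 chord Qc kap h^-1 ell (2 / h ^+ 2) S A p q al
  uQc kap0 V0 dd0 S0 A0.
have {}cb := cb (fun k kQ => Qk _ (proj1 (Qc_in _ kQ))).
have {}cb := cb (fun k l kQ lQ => Qb _ _ (proj1 (Qc_in _ lQ)) (proj1 (Qc_in _ kQ))).
have {}cb : \sum_(k <- Qc) al k <= 2 * n%:R * A + S * (4 * M / c0) *
    (2 * (h^-1 + 2 / h ^+ 2) / n%:R + 2 * (2 / h ^+ 2) * (size Qc)%:R).
  apply: cb => //.
  - move=> k l kQ lQ; have [kQ' ck] := Qc_in _ kQ; have [lQ' cl] := Qc_in _ lQ.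
    by apply: ell_ge => //; rewrite ck cl.
  - by move=> k kQ; apply: Qpq; exact: (proj1 (Qc_in _ kQ)).
  - by move=> k kQ; apply: alA; exact: (proj1 (Qc_in _ kQ)).
  - by move=> k kQ; apply: alS; exact: (proj1 (Qc_in _ kQ)).
apply: le_trans cb _.
have sN : (size Qc)%:R <= (2 * Lc + 3) ^+ 2 * rho ^+ 10 :> R.
  have : (size Qc <= (2 * n' + 1) ^ 2)%N.
    apply: size_le_box => // k l kQ lQ.
    have [kQ' ck] := Qc_in _ kQ; have [lQ' cl] := Qc_in _ lQ.
    by apply: le_trans m2; apply: ell_ge => //; rewrite ck cl.
  rewrite -(ler_nat R) => /le_trans; apply.
  have -> : (2 * Lc + 3) ^+ 2 * rho ^+ 10 = ((2 * Lc + 3) * rho ^+ 5) ^+ 2 by ring.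
  rewrite natrX ler_pXn2r ?nnegrE //; last by rewrite mulr_ge0 // ?ltW //; lra.
  by rewrite natrD natrM; have := rn 5; lra.
(* [S h^-1 = s1 rho^8] and [S h^-2 <= s1 rho^-8] *)
have Sh : S * h^-1 = s1 * rho ^+ 8 by rewrite /S; field; rewrite gt_eqF.
have Shh : S * (2 / h ^+ 2) * rho ^+ 8 <= 2 * s1.
  have -> : S * (2 / h ^+ 2) * rho ^+ 8 = 2 * s1 * (rho ^+ 16 / h) by rewrite /S; field; rewrite gt_eqF.
  by rewrite ler_piMr ?mulr_ge0 // ler_pdivrMr // mul1r.
have T1 : 2 * n%:R * A <= 4 * A * rho ^+ 4.
  have := ler_wpM2r A0 n3; lra.
have T2 : S * (2 * (h^-1 + 2 / h ^+ 2) / n%:R) <= 6 * s1 * rho ^+ 4.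
  rewrite mulrA ler_pdivrMr //.
  have : 6 * s1 * rho ^+ 4 * rho ^+ 4 <= 6 * s1 * rho ^+ 4 * n%:R.
    by apply: ler_wpM2l => //; rewrite !mulr_ge0 // ltW.
  have : S * (2 / h ^+ 2) <= S * (2 / h ^+ 2) * rho ^+ 8.
    by rewrite ler_peMr // mulr_ge0.
  have : 2 * s1 <= 2 * s1 * rho ^+ 8 by rewrite ler_peMr // mulr_ge0.
  have -> : 6 * s1 * rho ^+ 4 * rho ^+ 4 = 6 * s1 * rho ^+ 8 by rewrite -mulrA -exprD.
  have -> : S * (2 * (h^-1 + 2 / h ^+ 2)) = 2 * (S * h^-1) + 2 * (S * (2 / h ^+ 2)) by ring.
  rewrite Sh; lra.
have T3 : S * (2 * (2 / h ^+ 2) * (size Qc)%:R) <= 4 * s1 * (2 * Lc + 3) ^+ 2 * rho ^+ 4.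
  have SS : 0 <= S * (2 / h ^+ 2) by rewrite mulr_ge0.
  have h2 := ler_wpM2l SS sN.
  have h3 : S * (2 / h ^+ 2) * ((2 * Lc + 3) ^+ 2 * rho ^+ 10) =
     (2 * Lc + 3) ^+ 2 * rho ^+ 2 * (S * (2 / h ^+ 2) * rho ^+ 8) by ring.
  have P0 : 0 <= (2 * Lc + 3) ^+ 2 * rho ^+ 2 by rewrite mulr_ge0 ?sqr_ge0.
  have h4 := ler_wpM2l P0 Shh.
  have h5 : (2 * Lc + 3) ^+ 2 * s1 * rho ^+ 2 <= (2 * Lc + 3) ^+ 2 * s1 * rho ^+ 4.
    by apply: ler_wpM2l; [rewrite mulr_ge0 ?sqr_ge0|exact: rle].
  lra.
have := ler_wpM2l M4 (lerD T2 T3).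
have := rp 4; rewrite /C4; lra.
Qed.

End Count.

Ltac nneg := repeat first [ assumption | apply: ltW; assumption | exact: ler0n
  | exact: sqrtr_ge0 | exact: normr_ge0 | exact: nrm_ge0 | exact: sqr_ge0
  | apply: exprn_ge0 | apply: mulr_ge0 | apply: addr_ge0 | rewrite invr_ge0 ].

(** * Sums over frequencies *)

Section Telescopes.
Variable R : realType.
Implicit Types (x y h : R).

Definition root16 x : R := Num.sqrt (Num.sqrt (Num.sqrt (Num.sqrt x))).

Lemma root16X x : 0 <= x -> root16 x ^+ 16 = x.
Proof.
move=> x0; rewrite -[16%N]/(2 * (2 * (2 * 2)))%N !exprM /root16.
by rewrite !sqr_sqrtr ?sqrtr_ge0.
Qed.

Lemma root16_ge0 x : 0 <= root16 x. Proof. exact: sqrtr_ge0. Qed.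

Lemma root16_gt0 x : 0 < x -> 0 < root16 x.
Proof. by move=> x0; rewrite /root16 !sqrtr_gt0. Qed.

Lemma ler_root16 x y : x <= y -> root16 x <= root16 y.
Proof. by move=> xy; rewrite /root16; do 4 apply: ler_wsqrtr. Qed.

(** The saved power makes the harmonic series converge. The sum telescopes against the reciprocal of
    [root16]; 32 is the exponent 16 times 2, the largest ratio of consecutive integers. *)
Lemma sum_root16 (N : nat) : \sum_(n < N) (n.+1%:R * root16 n.+1%:R)^-1 <= 32.
Proof.
suff : \sum_(n < N) (n.+1%:R * root16 n.+1%:R)^-1 <= 32 * (1 - (root16 N.+1%:R)^-1).
  move=> /le_trans; apply; have : 0 <= (root16 N.+1%:R)^-1 by rewrite invr_ge0 root16_ge0.
  lra.
elim: N => [|N IH]; first by rewrite big_ord0 /root16 !sqrtr1 invr1 subrr mulr0.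
rewrite big_ord_recr /=; apply: le_trans (lerD IH (lexx _)) _.
have m0 : 0 < N.+1%:R :> R by rewrite ltr0n.
have m0' : 0 < N.+2%:R :> R by rewrite ltr0n.
have x0 := root16_gt0 m0; have y0 := root16_gt0 m0'.
have xy : root16 N.+1%:R <= root16 N.+2%:R by apply: ler_root16; rewrite ler_nat.
have xE := root16X (ltW m0); have yE := root16X (ltW m0').
move: xE yE; set x := root16 _ in x0 xy *; set y := root16 _ in y0 xy * => xE yE.
have x1 : 1 <= x ^+ 16 by rewrite xE ler1n.
have D : 1 = y ^+ 16 - x ^+ 16 by rewrite xE yE -[N.+2%:R]natr1; ring.
have D2 : 1 <= (y - x) * (16 * y ^+ 15).
  rewrite {1}D subrXX; apply: ler_wpM2l; first by rewrite subr_ge0.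
  apply: (@le_trans _ _ (\sum_(i < 16) y ^+ 15)); last first.
    by rewrite sumr_const card_ord mulr_natl.
  apply: ler_sum => i _.
  have -> : y ^+ 15 = y ^+ (16 - i.+1) * y ^+ i by rewrite -exprD; congr (_ ^+ _); case: i => /=; lia.
  by apply: ler_wpM2l; [rewrite exprn_ge0 // ltW|rewrite lerXn2r // nnegrE ltW].
have y16 : y ^+ 16 <= 2 * x ^+ 16 by lra.
have D3 : y <= 32 * (y - x) * x ^+ 16.
  have yx : 0 <= y - x by rewrite subr_ge0.
  apply: (@le_trans _ _ (y * ((y - x) * (16 * y ^+ 15)))); first by rewrite ler_peMr // ltW.
  have -> : y * ((y - x) * (16 * y ^+ 15)) = 16 * ((y - x) * y ^+ 16) by ring.
  by have := ler_wpM2l yx y16; lra.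
rewrite -xE.
have -> : (x ^+ 16 * x)^-1 = y / (x ^+ 16 * x * y) by field; rewrite !gt_eqF.
have -> : 32 * (1 - y^-1) = 32 * (1 - x^-1) + 32 * (y - x) * x ^+ 16 / (x ^+ 16 * x * y).
  by field; rewrite !gt_eqF.
rewrite lerD2l ler_pM2r // invr_gt0 !mulr_gt0 // exprn_gt0 //.
Qed.

Lemma sum_shifted_square (N : nat) h : 0 < h -> \sum_(n < N) h / (n.+1%:R + h) ^+ 2 <= 1.
Proof.
move=> h0; suff : \sum_(n < N) h / (n.+1%:R + h) ^+ 2 <= 1 - h / (N%:R + h).
  move=> /le_trans; apply; rewrite gerBl divr_ge0 //; first exact: ltW.
  by rewrite addr_ge0 // ltW.
elim: N => [|N IH]; first by rewrite big_ord0 add0r divff ?subrr // gt_eqF.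
rewrite big_ord_recr /=; apply: le_trans (lerD IH (lexx _)) _.
have a0 : 0 < N%:R + h by rewrite ltr_wpDl.
rewrite -[N.+1%:R]natr1; move: (N%:R) a0 => z a0.
have -> : 1 - h / (z + 1 + h) = 1 - h / (z + h) + h / ((z + h) * (z + 1 + h)).
  by field; rewrite !gt_eqF //; lra.
rewrite lerD2l ler_pM2l // lef_pV2 ?posrE; last 2 first.
- by rewrite exprn_gt0 //; lra.
- by rewrite mulr_gt0 //; lra.
by rewrite expr2; apply: ler_wpM2r; lra.
Qed.

Lemma sum_inv_sqrt (N : nat) : \sum_(n < N) (Num.sqrt (n.+1%:R : R))^-1 <= 2 * Num.sqrt N%:R.
Proof.
elim: N => [|N IH]; first by rewrite big_ord0 sqrtr0 mulr0.
rewrite big_ord_recr /=; apply: le_trans (lerD IH (lexx _)) _.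
have m0 : 0 < N.+1%:R :> R by rewrite ltr0n.
have u0 : 0 < Num.sqrt (N.+1%:R : R) by rewrite sqrtr_gt0.
have uE := sqr_sqrtr (ltW m0); have vE := sqr_sqrtr (ler0n R N).
have v0 := sqrtr_ge0 (N%:R : R).
have vu : Num.sqrt (N%:R : R) <= Num.sqrt N.+1%:R by apply: ler_wsqrtr; rewrite ler_nat.
have nE : (N.+1%:R : R) = N%:R + 1 by rewrite natr1.
move: (Num.sqrt N.+1%:R) (Num.sqrt N%:R) u0 v0 vu uE vE => u v u0 v0 vu uE vE.
rewrite nE in uE.
rewrite -subr_ge0 -(pmulr_rge0 _ u0).
have -> : u * (2 * u - (2 * v + u^-1)) = 2 * u ^+ 2 - 2 * u * v - 1 by field; rewrite gt_eqF.
by have := sqr_ge0 (u - v); rewrite sqrrB; lra.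
Qed.

End Telescopes.

(** * Weighted sums over shells and bins *)

Section BinSums.
Variable R : realType.
Implicit Types (k l : int * int) (h : R).
Variables (Om : set (R * R)) (c0 M K2 : R).
Hypotheses (oO : open Om) (cO : convex2 Om) (c0_gt0 : 0 < c0) (M_gt0 : 0 < M).
Hypothesis (OM : forall x, Om x -> nrm x <= M).
Hypothesis (cOm : forall x, `|x.1| <= c0 -> `|x.2| <= c0 -> Om x).
Let b k := rho_star Om (vec R k).
Let nv k := nrm (vec R k).
Hypothesis K20 : 0 <= K2.
Hypothesis chord : forall k p q : R * R, k != (0, 0) -> Om p -> Om q -> dot2 p k = dot2 q k ->
  ((p.1 - q.1) ^+ 2 + (p.2 - q.2) ^+ 2) * nrm k <= K2 * (rho_star Om k - dot2 p k).

Let b_ge0 k : 0 <= b k.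
Proof.
apply: le_trans (rho_ge c0_gt0 OM cOm (vec R k)).
by apply: mulr_ge0; [exact: ltW|exact: nrm_ge0].
Qed.

Lemma shell_sum : exists2 C : R, 0 < C & forall (s : seq (int * int)) (N : nat)
    (F : int * int -> R) (G : nat -> R), uniq s -> (forall k, k \in s -> k != (0, 0)) ->
  (forall n, 0 <= G n) -> (forall k, k \in s -> (Num.truncn (b k) < N)%N) ->
  (forall k, k \in s -> F k <= G (Num.truncn (b k))) ->
  \sum_(k <- s) F k <= C * \sum_(n < N) n.+1%:R * G n.
Proof.
have [C C0 hC] := shell_count c0_gt0 OM cOm.
exists (2 * C); first by rewrite mulr_gt0.
move=> s N F G us s0 G0 sN FG.
apply: (@le_trans _ _ (\sum_(k <- s) \sum_(n < N) if Num.truncn (b k) == n then G n else 0)).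
  rewrite big_seq [leRHS]big_seq; apply: ler_sum => k ks.
  rewrite (bigD1 (Ordinal (sN _ ks))) //= eqxx; apply: le_trans (FG _ ks) _.
  rewrite lerDl; apply: sumr_ge0 => n _; case: eqP => // _; exact: G0.
rewrite exchange_big mulr_sumr; apply: ler_sum => n _ /=.
rewrite -big_mkcond -big_filter big_const_seq count_predT iter_addr_0 -[G n *+ _]mulr_natl.
rewrite mulrA; apply: ler_wpM2r; first exact: G0.
set Q := [seq k <- s | _].
have Qn k : k \in Q -> n%:R <= b k < n%:R + 1.
  rewrite mem_filter => /andP[/eqP kn _]; have := truncn_itv (b_ge0 k).
  by rewrite kn -natr1.
have Qs k : k \in Q -> k \in s by rewrite mem_filter => /andP[].
have := hC Q (n%:R + 1).
have -> : `|n%:R + 1 : R| = n%:R + 1 by rewrite ger0_norm.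
move=> H; apply: le_trans (H _ _ _ _) _.
- exact: filter_uniq.
- by move=> k /Qs; exact: s0.
- move=> k l /Qn/andP[k1 k2] /Qn/andP[l1 l2]; rewrite -/(b k) -/(b l) ler_norml.
  by apply/andP; split; lra.
- by move=> k /Qn/andP[_ /ltW].
rewrite -[n.+1%:R]natr1; have := ler0n R n; nra.
Qed.

Lemma shell_le_nrm k : k != (0, 0) -> (Num.truncn (b k)).+1%:R <= (M + 1) * nv k.
Proof.
move=> k0; have h1 : 1 <= nv k := nrm_vec_ge1 R k0.
have h2 := rho_leM c0_gt0 OM cOm (vec R k); rewrite -/(b k) -/(nv k) in h2.
have /andP[h3 _] := truncn_itv (b_ge0 k).
by rewrite -natr1; lra.
Qed.

(* [h ^ -2] is the reciprocal of the dilation parameter, hence the depth that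
   an oscillation of frequency [k] resolves. *)
Definition tip_len h k : R := h * slice_len Om (vec R k) (b k - 2 / h ^+ 2).

Let A : R := Num.sqrt (2 * K2).
Let wt k : R := Num.sqrt (nv k) * nv k.

Let nv_ge1 k : k != (0, 0) -> 1 <= nv k := @nrm_vec_ge1 R k.
Let nv_gt0 k : k != (0, 0) -> 0 < nv k.
Proof. by move=> /nv_ge1; apply: lt_le_trans. Qed.
Let wt_gt0 k : k != (0, 0) -> 0 < wt k.
Proof. by move=> /nv_gt0 nk; apply: mulr_gt0 => //; rewrite sqrtr_gt0. Qed.

Lemma tip_len_ge0 h k : 0 <= h -> 0 <= tip_len h k.
Proof. by move=> h0; apply: mulr_ge0 => //; exact: slice_len_ge0. Qed.

Lemma tip_len_le h k : 0 < h -> k != (0, 0) -> wt k * tip_len h k <= A.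
Proof.
move=> h0 k0; have nk := nv_gt0 k0.
have w0 : 0 <= 2 / h ^+ 2 by rewrite divr_ge0 // exprn_ge0 // ltW.
have := slice_len_sqrt oO c0_gt0 OM cOm K20 chord (vec_neq0 R k0) w0.
rewrite -/(b k) -/(nv k) => H.
have P : 0 <= wt k * h by rewrite mulr_ge0 ?ltW ?wt_gt0.
rewrite /tip_len mulrA; apply: le_trans (ler_wpM2l P H) _.
have -> : wt k * h * (Num.sqrt (K2 * (2 / h ^+ 2) / nv k) / nv k) =
    Num.sqrt (h ^+ 2) * Num.sqrt (nv k) * Num.sqrt (K2 * (2 / h ^+ 2) / nv k).
  by rewrite sqrtr_sqr gtr0_norm // /wt; field; rewrite gt_eqF.
rewrite -sqrtrM ?sqr_ge0 // -sqrtrM; last by apply: mulr_ge0; [exact: sqr_ge0|exact: ltW].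
rewrite /A le_eqVlt; apply/orP; left; apply/eqP; congr Num.sqrt; field.
by rewrite !gt_eqF.
Qed.

Let bin h k l := Num.truncn (h * b l) == Num.truncn (h * b k).

Let bin_dist h k l m : 0 < h -> bin h k l -> bin h k m -> `|b l - b m| <= h^-1.
Proof.
move=> h0 /eqP kl /eqP km.
have Hb j : 0 <= h * b j by rewrite mulr_ge0 // ltW.
have /andP[l1 l2] := truncn_itv (Hb l); have /andP[m1 m2] := truncn_itv (Hb m).
rewrite kl -natr1 in l1 l2; rewrite km -natr1 in m1 m2.
rewrite -(ler_pM2l h0) mulfV ?gt_eqF // -[X in X * _](gtr0_norm h0) -normrM ler_norml.
by apply/andP; split; lra.
Qed.

Let bin_refl h k : bin h k k. Proof. exact: eqxx. Qed.

(** The saving over the trivial shell count. It is claimed only for [nv k <= h], the range of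
    [shell_strong]; beyond it the decay of the coefficients takes over. *)
Let tail k h : R := if nv k <= h then (root16 (nv k))^-1 else 1.

(** Nearly equal values of [b], which is comparable with the norm, force comparable norms. *)
Let bin_nrm h k l : 0 < h -> h^-1 <= c0 / 2 -> k != (0, 0) -> bin h k l ->
  c0 / (2 * M) * nv k <= nv l.
Proof.
move=> h0 hc k0 kl; have c00 := c0_gt0; have M0 := M_gt0.
have := bin_dist h0 kl (bin_refl h k); rewrite ler_norml => /andP[d1 d2].
have := rho_ge c0_gt0 OM cOm (vec R k); have := rho_leM c0_gt0 OM cOm (vec R l).
rewrite -/(b k) -/(b l) -/(nv k) -/(nv l) => bl bk.
have nk := nv_ge1 k0.
have -> : c0 / (2 * M) * nv k = c0 / 2 * nv k / M by field; rewrite gt_eqF.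
by rewrite ler_pdivrMr //; nra.
Qed.

Lemma bin_sum : exists2 C : R, 0 < C & exists2 h0 : R, 1 <= h0 & forall h s k, h0 <= h ->
  uniq s -> (forall l, l \in s -> l != (0, 0)) -> k != (0, 0) ->
  \sum_(l <- s | bin h k l) wt l * tip_len h l <= C * nv k * tail k h.
Proof.
have hc := c0_gt0; have hM := M_gt0.
have [Cc Cc0 hCc] := shell_count c0_gt0 OM cOm.
have A0 : 0 <= A / 2 by rewrite divr_ge0 // sqrtr_ge0.
have A0' : 0 <= A by exact: sqrtr_ge0.
have [Cs Cs0 [rho0 rho1 hCs]] := shell_strong cO c0_gt0 OM cOm K20 chord M_gt0 A0.
pose D := A * Cc * (M + 3) * rho0.
have rho00 : 0 < rho0 by lra.
have D0 : 0 <= D.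
  by rewrite /D; apply: mulr_ge0; [apply: mulr_ge0; [apply: mulr_ge0|]|]; lra.
exists (2 * Cs + D); first by lra.
have cV : 0 < 2 / c0 by rewrite divr_gt0.
have MV : 0 < M^-1 by rewrite invr_gt0.
exists (2 + 2 / c0 + M^-1); first by lra.
move=> h s k hh us s0 k0.
have h2 : 2 <= h by lra.
have hp : 0 < h by lra.
have hV1 : h^-1 <= 1 by rewrite invf_le1 //; lra.
have hVc : h^-1 <= c0 / 2.
  by rewrite -[leRHS]invrK lef_pV2 ?posrE ?invr_gt0 ?divr_gt0 // invf_div; lra.
have hVM : h^-1 <= M by rewrite -[leRHS]invrK lef_pV2 ?posrE ?invr_gt0 //; lra.
have hVp : 0 < h^-1 by rewrite invr_gt0.
have nk1 := nv_ge1 k0; have nk0 := nv_gt0 k0.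
have bkM := rho_leM c0_gt0 OM cOm (vec R k); rewrite -/(b k) -/(nv k) in bkM.
have bkc := rho_ge c0_gt0 OM cOm (vec R k); rewrite -/(b k) -/(nv k) in bkc.
rewrite -big_filter; set Q := [seq l <- s | _].
have uQ : uniq Q by exact: filter_uniq.
have Qs l : l \in Q -> l \in s /\ bin h k l by rewrite mem_filter => /andP[].
have Q0 l : l \in Q -> l != (0, 0) by move=> /Qs[/s0].
have Qd l m : l \in Q -> m \in Q -> `|b l - b m| <= h^-1.
  by move=> /Qs[_ kl] /Qs[_ km]; exact: bin_dist kl km.
have Qk l : l \in Q -> b l <= b k + h^-1.
  move=> /Qs[_ kl]; have := bin_dist hp kl (bin_refl h k).
  by rewrite ler_norml => /andP[_]; lra.
have root0 := root16_gt0 nk0.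
case: (boolP ((rho0 <= root16 (nv k)) && (nv k <= h))) => [/andP[kr kh]|kn].
  rewrite /tail kh.
  have rE := root16X (ltW nk0).
  have hd : 2 / h ^+ 2 < c0.
    rewrite ltr_pdivrMr ?exprn_gt0 // expr2.
    have : 2 <= c0 * h.
      have e2 : c0 * (2 / c0) = 2 by field; rewrite gt_eqF.
      by rewrite -[X in X <= _]e2 ler_pM2l //; lra.
    nra.
  (* Stated for every [l], with arbitrary points at 0, so that [choice] turns the chords into a
     function. *)
  have chd l : exists pq : (R * R) * (R * R), l != (0, 0) -> [/\ Om pq.1, Om pq.2,
      dot2 pq.1 (vec R l) = b l - 2 / h ^+ 2, dot2 pq.2 (vec R l) = b l - 2 / h ^+ 2 &
      nv l * slice_len Om (vec R l) (b l - 2 / h ^+ 2) / 2 <=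
      nrm (pq.1.1 - pq.2.1, pq.1.2 - pq.2.2)].
    have [->|l0] := eqVneq l (0, 0); first by exists ((0, 0), (0, 0)).
    have bl := rho_ge c0_gt0 OM cOm (vec R l); rewrite -/(b l) -/(nv l) in bl.
    have nl := nv_ge1 l0.
    have bo : 0 <= rho_star Om (- (vec R l).1, - (vec R l).2).
      apply: le_trans (rho_ge c0_gt0 OM cOm _).
      by apply: mulr_ge0; [exact: ltW|exact: nrm_ge0].
    have s1 : - rho_star Om (- (vec R l).1, - (vec R l).2) < b l - 2 / h ^+ 2.
      have : c0 <= c0 * nv l by rewrite ler_peMr // ltW.
      lra.
    have w0 : 0 < 2 / h ^+ 2 by rewrite divr_gt0 // exprn_gt0.
    have s2 : b l - 2 / h ^+ 2 < b l by lra.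
    have [p [q H]] := slice_len_chord oO cO c0_gt0 OM cOm (vec_neq0 R l0) s1 s2.
    by exists (p, q).
  have [pq hpq] := choice chd.
  (* Here [rho ^ 16] is [nv k], and the weights are halved because [slice_len_chord] realises only
     half of a slice. *)
  have := hCs (root16 (nv k)) h Q (fun l => (pq l).1) (fun l => (pq l).2)
    (fun l => wt l * tip_len h l / 2) kr.
  rewrite rE => H.
  have {}H : \sum_(l <- Q) wt l * tip_len h l / 2 <= Cs * root16 (nv k) ^+ 15.
    apply: H => //.
    - move=> l lQ; split; first exact: Q0.
      have [_ kl] := Qs _ lQ; have := bin_nrm hp hVc k0 kl.
      by rewrite -/(nv l); congr (_ <= _); field; rewrite gt_eqF.
    - move=> l lQ; apply: le_trans (Qk _ lQ) _.
      have : M <= M * nv k by rewrite ler_peMr // ltW.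
      lra.
    - by move=> l /Q0/hpq[].
    - by move=> l; rewrite divr_ge0 // mulr_ge0 ?tip_len_ge0 ?mulr_ge0 ?sqrtr_ge0 ?nrm_ge0 // ltW.
    - by move=> l /Q0 l0; rewrite ler_pM2r ?invr_gt0 //; exact: tip_len_le.
    - move=> l lQ; have l0 := Q0 _ lQ; have [_ _ _ _ Hl] := hpq _ l0.
      have -> : wt l * tip_len h l / 2 = h * Num.sqrt (nv l) *
          (nv l * slice_len Om (vec R l) (b l - 2 / h ^+ 2) / 2).
        by rewrite /wt /tip_len; ring.
      have P0 : 0 <= h * Num.sqrt (nv l) by rewrite mulr_ge0 ?sqrtr_ge0 // ltW.
      apply: le_trans (ler_wpM2l P0 Hl) _; apply: ler_wpM2r; first exact: nrm_ge0.
      apply: ler_wpM2l; first exact: ltW.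
      have -> : root16 (nv k) ^+ 8 = Num.sqrt (nv k).
        rewrite -[in RHS]rE -[16%N]/(8 * 2)%N exprM sqrtr_sqr ger0_norm //.
        by rewrite exprn_ge0 // ltW.
      rewrite -sqrtrM; last by rewrite divr_ge0 ?mulr_ge0 ?ltW.
      apply: ler_wsqrtr; rewrite mulrAC ler_pdivlMr //.
      have := rho_ge c0_gt0 OM cOm (vec R l); rewrite -/(b l) -/(nv l).
      have := Qk _ lQ; have : M <= M * nv k by rewrite ler_peMr // ltW.
      lra.
  have H2 : \sum_(l <- Q) wt l * tip_len h l <= 2 * Cs * root16 (nv k) ^+ 15.
    by move: H; rewrite -mulr_suml ler_pdivrMr //; lra.
  apply: le_trans H2 _.
  have -> : (2 * Cs + D) * nv k * (root16 (nv k))^-1 = (2 * Cs + D) * root16 (nv k) ^+ 15.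
    by rewrite -{1}rE; field; rewrite gt_eqF.
  by apply: ler_wpM2r; [rewrite exprn_ge0 // ltW|lra].
have T : \sum_(l <- Q) wt l * tip_len h l <= A * (size Q)%:R.
  apply: (@le_trans _ _ (\sum_(l <- Q) A)).
    by rewrite big_seq [leRHS]big_seq; apply: ler_sum => l /Q0; exact: tip_len_le.
  by rewrite big_const_seq count_predT iter_addr_0 mulr_natr.
apply: le_trans T _.
have cnt : (size Q)%:R <= Cc * (`|b k + 1| + 1).
  apply: hCc => //.
  - by move=> l m lQ mQ; apply: le_trans (Qd _ _ lQ mQ) hV1.
  - by move=> l lQ; have := Qk _ lQ; rewrite -/(b l); lra.
have bk0 := b_ge0 k.
rewrite ger0_norm in cnt; last by lra.
(* In the remaining cases there is nothing to save: either [nv k] exceeds [h], or its root is below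
   the constant [rho0]. *)
have t0 : 1 <= rho0 * tail k h.
  move: kn; rewrite /tail; case: ifP => kh; rewrite ?andbT ?andbF; last by rewrite mulr1.
  by rewrite -ltNge => /ltW; rewrite ler_pdivlMr // mul1r.
have Hk : Cc * (b k + 1 + 1) <= Cc * (M + 3) * nv k.
  rewrite -mulrA ler_pM2l //; nra.
apply: le_trans (ler_wpM2l A0' (le_trans cnt Hk)) _.
have tail0 : 0 <= tail k h by rewrite /tail; case: ifP => // _; rewrite invr_ge0 ltW.
apply: (@le_trans _ _ (D * nv k * tail k h)); last first.
  by apply: ler_wpM2r => //; apply: ler_wpM2r; [exact: ltW|lra].
have -> : D * nv k * tail k h = A * (Cc * (M + 3) * nv k) * (rho0 * tail k h) by rewrite /D; ring.
apply: ler_peMr => //; apply: mulr_ge0 => //; apply: mulr_ge0; last exact: ltW.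
by apply: mulr_ge0; lra.
Qed.

(** Rewrites the term of a frequency beyond [h] in the shell index, in the shape summed by
    [sum_shifted_square]. *)
Let wide_tail h k : 0 < h -> k != (0, 0) -> h < nv k ->
  h / nv k ^+ 3 <= (M + 2) ^+ 3 * ((Num.truncn (b k)).+1%:R^-1 *
     (h / ((Num.truncn (b k)).+1%:R + h) ^+ 2)).
Proof.
move=> h0 k0 hk; have hM := M_gt0; have nk := nv_gt0 k0.
have m1 := shell_le_nrm k0; have m0 : 0 < (Num.truncn (b k)).+1%:R :> R by rewrite ltr0n.
move: ((Num.truncn (b k)).+1%:R) m1 m0 => m m1 m0; move: (nv k) hk nk m1 => x hk nk m1.
have e1 : m <= (M + 2) * x by nra.
have e2 : m + h <= (M + 2) * x by nra.
have p2 : 0 < m + h by lra.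
have e3 : m * (m + h) ^+ 2 <= (M + 2) ^+ 3 * x ^+ 3.
  have -> : (M + 2) ^+ 3 * x ^+ 3 = ((M + 2) * x) * ((M + 2) * x) ^+ 2 by ring.
  apply: ler_pM => //; [exact: ltW|exact: sqr_ge0|].
  by rewrite lerXn2r ?nnegrE //; lra.
rewrite ler_pdivrMr ?exprn_gt0 //.
have -> : (M + 2) ^+ 3 * (m^-1 * (h / (m + h) ^+ 2)) * x ^+ 3 =
   h * ((M + 2) ^+ 3 * x ^+ 3) / (m * (m + h) ^+ 2) by field; rewrite !gt_eqF.
by rewrite ler_pdivlMr ?mulr_gt0 ?exprn_gt0 // ler_pM2l.
Qed.

Let shells (s : seq (int * int)) : exists N, forall k, k \in s -> (Num.truncn (b k) < N)%N.
Proof.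
elim: s => [|k s [N hN]]; first by exists 0%N.
exists (maxn N (Num.truncn (b k)).+1) => l; rewrite inE => /orP[/eqP ->|/hN h].
  exact: leq_maxr.
exact: leq_trans h (leq_maxl _ _).
Qed.

(** Within a bin the weights [wt] are comparable, so the double sum reduces to that of
    [|gam k| * tail k h / nv k ^+ 2]. With about [n] points in shell [n], the part up to [h] is the
    series of [sum_root16], and beyond [h] the decay of [gam] leads to [sum_shifted_square]. *)
Lemma weighted_bins (Gam : R) : 0 <= Gam -> exists2 C : R, 0 < C & exists2 h0 : R, 1 <= h0 &
  forall h s (gam : int * int -> R), h0 <= h -> uniq s -> (forall k, k \in s -> k != (0, 0)) ->
  (forall k, `|gam k| <= Gam) -> (forall k, `|gam k| * nrm (vec R k) ^+ 2 <= Gam * h ^+ 2) ->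
  \sum_(k <- s) \sum_(l <- s | Num.truncn (h * rho_star Om (vec R l)) ==
      Num.truncn (h * rho_star Om (vec R k)))
    (`|gam k| * tip_len h k) * (`|gam l| * tip_len h l) <= C.
Proof.
move=> G0; have hc := c0_gt0; have hM := M_gt0.
have [Cb Cb0 [h0 h01 hCb]] := bin_sum.
have [Cs Cs0 hCs] := shell_sum.
pose c := c0 / (2 * M).
have cp : 0 < c by rewrite divr_gt0 // mulr_gt0.
have A0 : 0 <= A by exact: sqrtr_ge0.
have csp : 0 < Num.sqrt c * c by rewrite mulr_gt0 ?sqrtr_gt0.
pose B := Gam / (Num.sqrt c * c) * Cb * A.
have B0 : 0 <= B by rewrite /B; nneg.
pose E := Gam * (M + 2) ^+ 3.
have M20 : 0 <= M + 2 by lra.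
have E0 : 0 <= E by rewrite /E; nneg.
exists (B * (E * (Cs * 33)) + 1); first by apply: ltr_wpDl => //; nneg.
have cV : 0 < 2 / c0 by rewrite divr_gt0.
exists (h0 + 2 / c0); first by lra.
move=> h s gam hh us s0 g1 g2.
have hp : 0 < h by lra.
have hVc : h^-1 <= c0 / 2.
  by rewrite -[leRHS]invrK lef_pV2 ?posrE ?invr_gt0 ?divr_gt0 // invf_div; lra.
apply: (@le_trans _ _ (B * (E * (Cs * 33)))); last by lra.
have inner k : k \in s -> \sum_(l <- s | bin h k l)
    (`|gam k| * tip_len h k) * (`|gam l| * tip_len h l) <= B * (`|gam k| * tail k h / nv k ^+ 2).
  move=> /s0 k0; have nk := nv_gt0 k0; have wk := wt_gt0 k0.
  have tk : tip_len h k <= A / wt k by rewrite ler_pdivlMr // mulrC; exact: tip_len_le.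
  have t0 := tip_len_ge0 k (ltW hp).
  have tl : 0 <= tail k h by rewrite /tail; case: ifP => // _; rewrite invr_ge0 root16_ge0.
  rewrite -mulr_sumr.
  have I : \sum_(l <- s | bin h k l) `|gam l| * tip_len h l <=
      Gam / (Num.sqrt c * c * wt k) * (Cb * nv k * tail k h).
    apply: (@le_trans _ _ (Gam / (Num.sqrt c * c * wt k) *
       \sum_(l <- s | bin h k l) wt l * tip_len h l)); last first.
      apply: ler_wpM2l; first by rewrite divr_ge0 // mulr_ge0 ?ltW.
      by apply: hCb => //; lra.
    rewrite mulr_sumr big_seq_cond [leRHS]big_seq_cond; apply: ler_sum => l /andP[/s0 l0 kl].
    have tl0 := tip_len_ge0 l (ltW hp); have nl := bin_nrm hp hVc k0 kl; rewrite -/c in nl.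
    rewrite mulrA; apply: ler_wpM2r => //; apply: le_trans (g1 l) _.
    rewrite mulrAC ler_pdivlMr; last exact: mulr_gt0.
    apply: ler_wpM2l => //.
    have -> : Num.sqrt c * c * wt k = Num.sqrt (c * nv k) * (c * nv k).
      by rewrite (sqrtrM (nv k) (ltW cp)) /wt; ring.
    apply: ler_pM; [exact: sqrtr_ge0|by rewrite mulr_ge0 // ltW|exact: ler_wsqrtr|exact: nl].
  have gt : 0 <= `|gam k| * tip_len h k by exact: mulr_ge0.
  apply: (@le_trans _ _ ((`|gam k| * tip_len h k) *
    (Gam / (Num.sqrt c * c * wt k) * (Cb * nv k * tail k h)))).
    exact: ler_wpM2l.
  have P0 : 0 <= Gam / (Num.sqrt c * c * wt k) * (Cb * nv k * tail k h).
    by nneg.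
  have := ler_wpM2r P0 (ler_wpM2l (normr_ge0 (gam k)) tk).
  move=> /le_trans; apply; rewrite le_eqVlt; apply/orP; left; apply/eqP.
  have sq : Num.sqrt (nv k) ^+ 2 = nv k by rewrite sqr_sqrtr // ltW.
  have sn : Num.sqrt (nv k) != 0 by rewrite gt_eqF // sqrtr_gt0.
  have cn : Num.sqrt c != 0 by rewrite gt_eqF // sqrtr_gt0.
  rewrite /B /wt; move: (tail k h) sq sn; move: (Num.sqrt (nv k)) => z y.
  move: (nv k) => x <- zn.
  by field; rewrite zn cn gt_eqF.
apply: (@le_trans _ _ (\sum_(k <- s) B * (`|gam k| * tail k h / nv k ^+ 2))).
  by rewrite big_seq [leRHS]big_seq; apply: ler_sum => k ks; exact: inner.
rewrite -mulr_sumr; apply: ler_wpM2l => //.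
have [N hN] := shells s.
pose G (n : nat) : R := E * (n.+1%:R ^- 2 / root16 n.+1%:R + n.+1%:R^-1 * (h / (n.+1%:R + h) ^+ 2)).
have Gp n : 0 <= n.+1%:R ^- 2 / root16 n.+1%:R :> R.
  by rewrite divr_ge0 ?root16_ge0 // invr_ge0 exprn_ge0.
have Gp' n : 0 <= n.+1%:R^-1 * (h / (n.+1%:R + h) ^+ 2).
  by nneg.
have G0' n : 0 <= G n by rewrite mulr_ge0 // addr_ge0.
apply: le_trans (hCs s N _ G us s0 G0' hN _) _.
  move=> k /s0 k0; have nk := nv_gt0 k0; have nk1 := nv_ge1 k0.
  rewrite /tail; case: (leP (nv k) h) => kh; last first.
    rewrite mulr1; apply: (@le_trans _ _ (Gam * (h / nv k ^+ 3))).
      rewrite ler_pdivrMr ?exprn_gt0 //.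
      have -> : Gam * (h / nv k ^+ 3) * nv k ^+ 2 = Gam * h / nv k by field; rewrite gt_eqF.
      rewrite ler_pdivlMr // -(ler_pM2r nk).
      have := g2 k; rewrite -/(nv k) -mulrA -expr2 => /le_trans; apply.
      rewrite expr2 mulrA; apply: ler_wpM2l; first by rewrite mulr_ge0 // ltW.
      exact: ltW.
    have := ler_wpM2l G0 (wide_tail hp k0 kh) => /le_trans; apply.
    by rewrite (mulrA Gam); apply: ler_wpM2l => //; rewrite lerDr; exact: Gp.
  apply: (@le_trans _ _ (Gam * ((root16 (nv k))^-1 / nv k ^+ 2))).
    rewrite -mulrA; apply: ler_wpM2r => //.
    by rewrite divr_ge0 ?sqr_ge0 // invr_ge0 root16_ge0.
  rewrite /G /E -mulrA; apply: ler_wpM2l => //; rewrite mulrDr.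
  apply: (@le_trans _ _ ((M + 2) ^+ 3 * ((Num.truncn (b k)).+1%:R ^- 2 /
      root16 (Num.truncn (b k)).+1%:R))); last first.
    by rewrite lerDl; nneg.
  have m1 := shell_le_nrm k0; have m0 : 0 < (Num.truncn (b k)).+1%:R :> R by rewrite ltr0n.
  move: ((Num.truncn (b k)).+1%:R) m1 m0 => m m1 m0; move: (nv k) kh nk nk1 m1 => x kh nk nk1 m1.
  have e1 : m <= (M + 2) * x by nra.
  have r1 := root16_gt0 m0; have r2 := root16_gt0 nk.
  have e2 : root16 m <= (M + 2) * root16 x.
    rewrite -(@ler_pXn2r _ 16) ?nnegrE //; [|exact: ltW|by apply: mulr_ge0; lra].
    rewrite exprMn !root16X ?(ltW m0) ?(ltW nk) //; apply: le_trans e1 _.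
    apply: ler_wpM2r; first exact: ltW.
    by rewrite -[X in X <= _]expr1 ler_weXn2l //; lra.
  have e3 : m ^+ 2 * root16 m <= (M + 2) ^+ 3 * (x ^+ 2 * root16 x).
    have -> : (M + 2) ^+ 3 * (x ^+ 2 * root16 x) = ((M + 2) * x) ^+ 2 * ((M + 2) * root16 x) by ring.
    apply: ler_pM => //; [exact: sqr_ge0|exact: ltW|].
    by rewrite lerXn2r ?nnegrE //; lra.
  have -> : (root16 x)^-1 / x ^+ 2 = (x ^+ 2 * root16 x)^-1.
    by field; rewrite !gt_eqF.
  have -> : (M + 2) ^+ 3 * (m ^- 2 / root16 m) = (M + 2) ^+ 3 / (m ^+ 2 * root16 m).
    by field; rewrite !gt_eqF.
  rewrite ler_pdivlMr ?mulr_gt0 ?exprn_gt0 // mulrC ler_pdivrMr ?mulr_gt0 ?exprn_gt0 //.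
have -> : \sum_(n < N) n.+1%:R * G n = E * (\sum_(n < N) (n.+1%:R * root16 n.+1%:R)^-1 +
    \sum_(n < N) h / (n.+1%:R + h) ^+ 2).
  rewrite -big_split mulr_sumr; apply: eq_bigr => n _; rewrite /G /=.
  have m0 : n.+1%:R != 0 :> R by rewrite pnatr_eq0.
  have r0 : root16 n.+1%:R != 0 :> R by rewrite gt_eqF // root16_gt0 // ltr0n.
  have p0 : n.+1%:R + h != 0 by rewrite gt_eqF // ltr_wpDl.
  move: m0 r0 p0; move: (root16 _) => y; move: (n.+1%:R) => x m0 r0 p0.
  by field; rewrite m0 r0 p0.
have H : \sum_(n < N) (n.+1%:R * root16 n.+1%:R)^-1 + \sum_(n < N) h / (n.+1%:R + h) ^+ 2 <= 33.
  by have := sum_root16 R N; have := sum_shifted_square N hp; lra.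
rewrite mulrCA; apply: ler_wpM2l => //; apply: ler_wpM2l => //; exact: ltW.
Qed.

(** The first-power sum needed for the middle parts, where absolute values suffice: up to [h] it is
    a sum of [n ^ -1/2] over shells, beyond [h] the decay of [gam] makes it converge. *)
Lemma weighted_sum (Gam : R) : 0 <= Gam -> exists2 C : R, 0 < C &
  forall h s (gam : int * int -> R), 1 <= h -> uniq s -> (forall k, k \in s -> k != (0, 0)) ->
  (forall k, `|gam k| <= Gam) -> (forall k, `|gam k| * nrm (vec R k) ^+ 2 <= Gam * h ^+ 2) ->
  \sum_(k <- s) `|gam k| / (Num.sqrt (nrm (vec R k)) * nrm (vec R k)) <= C * Num.sqrt h.
Proof.
move=> G0; have hc := c0_gt0; have hM := M_gt0.
have [Cs Cs0 hCs] := shell_sum.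
pose D := M + 2.
have D0 : 0 < D by rewrite /D; lra.
pose E1 := Gam * (Num.sqrt D * D).
have E10 : 0 <= E1 by rewrite /E1; nneg.
pose E2 := Gam * D ^+ 3.
have E20 : 0 <= E2 by rewrite /E2; nneg.
exists (Cs * (E1 * (2 * Num.sqrt D)) + Cs * E2 + 1).
  by apply: ltr_wpDl => //; nneg.
move=> h s gam h1 us s0 g1 g2.
have hp : 0 < h by lra.
have sh : 0 < Num.sqrt h by rewrite sqrtr_gt0.
rewrite (bigID (fun k => nv k <= h)) /=.
apply: (@le_trans _ _ (Cs * (E1 * (2 * Num.sqrt D)) * Num.sqrt h + Cs * E2 * Num.sqrt h)); last first.
  by rewrite -mulrDl; apply: ler_wpM2r; [exact: ltW|rewrite lerDl].
apply: lerD.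
  rewrite -big_filter; set Q := [seq k <- s | _].
  have Qs k : k \in Q -> k != (0, 0) /\ nv k <= h by rewrite mem_filter => /andP[? /s0].
  pose N := (Num.truncn (M * h)).+1.
  have Mh : 0 <= M * h by rewrite mulr_ge0 ?ltW.
  pose G (n : nat) : R := E1 / (Num.sqrt n.+1%:R * n.+1%:R).
  apply: le_trans (hCs Q N _ G _ _ _ _ _) _.
  - exact: filter_uniq.
  - by move=> k /Qs[].
  - by move=> n; rewrite divr_ge0 // mulr_ge0 // sqrtr_ge0.
  - move=> k /Qs[k0 kh]; rewrite ltnS; apply: le_truncn.
    by apply: le_trans (rho_leM c0_gt0 OM cOm _) _; rewrite ler_pM2l.
  - move=> k /Qs[k0 kh]; have nk := nv_gt0 k0; have nk1 := nv_ge1 k0; rewrite /G -/(nv k).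
    have m1 := shell_le_nrm k0; have m0 : 0 < (Num.truncn (b k)).+1%:R :> R by rewrite ltr0n.
    move: ((Num.truncn (b k)).+1%:R) m1 m0 => m m1 m0; move: (nv k) kh nk nk1 m1 => x kh nk nk1 m1.
    have e1 : m <= D * x by rewrite /D; nra.
    rewrite ler_pdivlMr ?mulr_gt0 ?sqrtr_gt0 // mulrAC ler_pdivrMr ?mulr_gt0 ?sqrtr_gt0 //.
    rewrite /E1 -mulrA; apply: ler_pM => //; first by rewrite mulr_ge0 ?sqrtr_ge0 ?ltW.
    have -> : Num.sqrt D * D * (Num.sqrt x * x) = Num.sqrt (D * x) * (D * x).
      by rewrite (sqrtrM x (ltW D0)); ring.
    by apply: ler_pM; [exact: sqrtr_ge0|exact: ltW|exact: ler_wsqrtr|exact: e1].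
  have -> : \sum_(n < N) n.+1%:R * G n = E1 * \sum_(n < N) (Num.sqrt n.+1%:R)^-1.
    rewrite mulr_sumr; apply: eq_bigr => n _; rewrite /G.
    have m0 : n.+1%:R != 0 :> R by rewrite pnatr_eq0.
    have r0 : Num.sqrt n.+1%:R != 0 :> R by rewrite gt_eqF // sqrtr_gt0 ltr0n.
    move: m0 r0; move: (Num.sqrt _) => y; move: (n.+1%:R) => x m0 r0.
    by field; rewrite m0 r0.
  rewrite -(mulrA Cs) -(mulrA E1) -(mulrA 2); apply: ler_wpM2l; first exact: ltW.
  apply: ler_wpM2l => //; apply: le_trans (sum_inv_sqrt R N) _; apply: ler_wpM2l => //.
  rewrite -(sqrtrM h (ltW D0)); apply: ler_wsqrtr.
  have /andP[t1 _] := truncn_itv Mh; rewrite /N -natr1 /D; nra.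
rewrite -big_filter; set Q := [seq k <- s | _].
have Qs k : k \in Q -> k != (0, 0) /\ h < nv k by rewrite mem_filter -ltNge => /andP[? /s0].
have [N hN] := shells Q.
pose G (n : nat) : R := E2 * Num.sqrt h * (n.+1%:R^-1 * (h / (n.+1%:R + h) ^+ 2)).
apply: le_trans (hCs Q N _ G _ _ _ hN _) _.
- exact: filter_uniq.
- by move=> k /Qs[].
- by move=> n; rewrite /G; nneg.
- move=> k /Qs[k0 kh]; have nk := nv_gt0 k0; rewrite -/(nv k).
  apply: (@le_trans _ _ (Gam * Num.sqrt h * (h / nv k ^+ 3))); last first.
    have P0 : 0 <= Gam * Num.sqrt h by rewrite mulr_ge0 // ltW.
    have := ler_wpM2l P0 (wide_tail hp k0 kh) => /le_trans; apply.
    by rewrite /G /E2 le_eqVlt; apply/orP; left; apply/eqP; rewrite /D; ring.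
  have sk : 0 < Num.sqrt (nv k) by rewrite sqrtr_gt0.
  rewrite ler_pdivrMr ?mulr_gt0 //.
  have -> : Gam * Num.sqrt h * (h / nv k ^+ 3) * (Num.sqrt (nv k) * nv k) =
     Gam * h * (Num.sqrt h * Num.sqrt (nv k)) / nv k ^+ 2 by field; rewrite gt_eqF.
  rewrite ler_pdivlMr ?exprn_gt0 //; apply: le_trans (g2 k) _.
  rewrite expr2 mulrA; apply: ler_wpM2l; first by rewrite mulr_ge0 // ltW.
  rewrite -[X in X <= _]sqr_sqrtr ?(ltW hp) // expr2 ler_pM2l //.
  by apply: ler_wsqrtr; exact: ltW.
have -> : \sum_(n < N) n.+1%:R * G n = E2 * Num.sqrt h * \sum_(n < N) h / (n.+1%:R + h) ^+ 2.
  rewrite mulr_sumr; apply: eq_bigr => n _; rewrite /G.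
  have m0 : n.+1%:R != 0 :> R by rewrite pnatr_eq0.
  have p0 : n.+1%:R + h != 0 by rewrite gt_eqF // ltr_wpDl.
  move: m0 p0; move: (n.+1%:R) (Num.sqrt h) => x y m0 p0.
  by field; rewrite m0 p0.
rewrite mulrA (mulrA Cs) -[leRHS]mulr1; apply: ler_wpM2l; first by nneg.
exact: sum_shifted_square.
Qed.

End BinSums.

(** * A smoothed lattice and its Fejer means *)

Section Tent.
Variables (R : realType) (eps : R).
Hypothesis eps0 : 0 < eps.
Implicit Types (u v x : R) (z : int).

Definition tent u : R := Num.max 0 (1 - `|u| / eps).

Lemma tent_ge0 u : 0 <= tent u. Proof. by rewrite le_max lexx. Qed.

Lemma tent_le1 u : tent u <= 1.
Proof. by rewrite ge_max ler01 gerBl divr_ge0 // ltW. Qed.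

Lemma tent_out u : eps <= `|u| -> tent u = 0.
Proof.
by move=> h; apply/eqP; rewrite eq_le tent_ge0 ge_max lexx subr_le0 ler_pdivlMr // mul1r h.
Qed.

Lemma tent_in u : `|u| <= eps -> tent u = 1 - `|u| / eps.
Proof. by move=> h; rewrite /tent max_r // subr_ge0 ler_pdivrMr // mul1r. Qed.

Lemma measurable_tent : measurable_fun setT tent.
Proof.
apply: measurable_maxr => //; apply: measurable_funB => //.
by apply: measurable_funM => //; exact: normr_measurable.
Qed.

Lemma nice_tent : nice tent.
Proof.
apply: (@nice_bound _ _ 1 eps); first exact: measurable_tent.
  by move=> x; rewrite ger0_norm ?tent_ge0 // tent_le1.
by move=> x /ltW; exact: tent_out.
Qed.

Lemma ccv_tent : ccv (- eps) eps tent.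
Proof.
move=> x y z x0 xy yz z0.
have b w : - eps <= w -> w <= eps -> `|w| <= eps by move=> h1 h2; rewrite ler_norml h1.
rewrite !tent_in ?b //; try lra.
have e0 := eps0.
have zy : 0 <= z - y by lra.
have yx : 0 <= y - x by lra.
have zx : 0 <= z - x by lra.
have : (z - x) * `|y| <= (z - y) * `|x| + (y - x) * `|z|.
  rewrite -(ger0_norm zx) -(ger0_norm zy) -(ger0_norm yx) -!normrM.
  have -> : (z - x) * y = (z - y) * x + (y - x) * z by ring.
  exact: ler_normD.
move=> /(ler_wpM2r (ltW (_ : 0 < eps^-1))); rewrite invr_gt0 => /(_ e0); lra.
Qed.

Lemma tentN u : tent (- u) = tent u. Proof. by rewrite /tent normrN. Qed.

Lemma tent_lip u v : `|tent u - tent v| <= `|u - v| / eps.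
Proof.
have e0 : 0 <= eps^-1 by rewrite invr_ge0 ltW.
have h : forall a b : R, tent a - tent b <= `|a - b| / eps.
  move=> a b; have ab : `|b| <= `|a| + `|a - b|.
    by have := ler_normB a (a - b); rewrite subKr.
  have := ler_wpM2r e0 ab; rewrite mulrDl => {}ab.
  have d0 : 0 <= `|a - b| / eps by exact: mulr_ge0.
  rewrite /tent; case: (leP 0 (1 - `|a| / eps)) => h1; case: (leP 0 (1 - `|b| / eps)) => h2; lra.
have h1 := h u v; have h2 := h v u; rewrite (distrC v) in h2.
by rewrite ler_norml; apply/andP; split; lra.
Qed.

(** Its exact value is never computed; [mass_ge] is enough. *)
Definition mass := Ir tent.

Lemma mass_ge : eps / 2 <= mass.
Proof.
have e0 := eps0.
have nb := niceZ 2^-1 (nice_box (- (eps / 2)) (eps / 2)).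
have -> : eps / 2 = Ir (fun x => 2^-1 * \1_(`[- (eps / 2), eps / 2]%classic : set R) x).
  by rewrite IrZ ?Ir_box; [field|lra|exact: nice_box].
apply: Ir_le => //; first exact: nice_tent.
move=> x; case: (boolP (- (eps / 2) <= x <= eps / 2)) => h; last first.
  by rewrite box_out // mulr0 tent_ge0.
rewrite box_in // mulr1 tent_in; last by rewrite ler_norml; case/andP: h => ? ?; apply/andP; split; lra.
have : `|x| / eps <= 2^-1.
  by rewrite ler_pdivrMr // ler_norml; case/andP: h => ? ?; apply/andP; split; lra.
lra.
Qed.

Let mass_gt0 : 0 < mass.
Proof. by apply: lt_le_trans mass_ge; rewrite divr_gt0. Qed.

Definition tri u := tent u / mass.

Lemma tri_ge0 u : 0 <= tri u. Proof. by rewrite divr_ge0 ?tent_ge0 // ltW. Qed.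

Lemma tri_out u : eps <= `|u| -> tri u = 0.
Proof. by move=> h; rewrite /tri tent_out // mul0r. Qed.

Lemma nice_tri : nice tri.
Proof. by apply: (eq_nice _ (niceZ mass^-1 nice_tent)) => x; rewrite mulrC. Qed.

Lemma Ir_tri : Ir tri = 1.
Proof.
rewrite (eq_Ir (g := fun x => mass^-1 * tent x)); last by move=> x; rewrite mulrC.
by rewrite IrZ ?mulVf ?gt_eqF //; exact: nice_tent.
Qed.

Lemma triN u : tri (- u) = tri u. Proof. by rewrite /tri tentN. Qed.

Lemma tri_lip u v : `|tri u - tri v| <= `|u - v| / (eps * mass).
Proof.
rewrite /tri -mulrBl normrM invfM mulrA [`|mass^-1|]gtr0_norm ?invr_gt0 //.
by rewrite ler_pM2r ?invr_gt0 // tent_lip.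
Qed.

Lemma ccv_tri : ccv (- eps) eps tri.
Proof.
move=> x y z x0 xy yz z0; have := ccv_tent x0 xy yz z0.
move=> /(ler_wpM2r (ltW (_ : 0 < mass^-1))); rewrite invr_gt0 => /(_ mass_gt0).
by rewrite /tri; lra.
Qed.

Lemma tri_near s : 0 <= s -> s <= 2 * eps -> tri (eps - s) <= 2 * s / eps ^+ 2.
Proof.
move=> s0 s1; have e0 := eps0.
rewrite /tri ler_pdivrMr //; have hm := mass_ge.
have t : tent (eps - s) <= s / eps.
  rewrite tent_in; last by rewrite ler_norml; apply/andP; split; lra.
  rewrite -subr_ge0; have -> : s / eps - (1 - `|eps - s| / eps) = (`|eps - s| - (eps - s)) / eps.
    by field; rewrite gt_eqF.
  by apply: divr_ge0; [rewrite subr_ge0 ler_norm|exact: ltW].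
apply: le_trans t _.
have -> : s / eps = 2 * s / eps ^+ 2 * (eps / 2) by field; rewrite gt_eqF.
by apply: ler_wpM2l => //; rewrite divr_ge0 ?exprn_ge0 ?mulr_ge0 // ltW.
Qed.

Definition gam z : R := Ir (fun u => tri u * osc z%:~R 0 u).

Lemma gam_le1 z : `|gam z| <= 1.
Proof.
have n1 := nice_osc z%:~R 0 nice_tri; apply: le_trans (Ir_norm n1) _.
rewrite -[leRHS]Ir_tri; apply: Ir_le; [exact: nice_norm|exact: nice_tri|] => u.
rewrite normrM ger0_norm ?tri_ge0 //.
rewrite -[leRHS]mulr1; apply: ler_wpM2l; [exact: tri_ge0|exact: osc_le1].
Qed.

Lemma gam0 : gam 0 = 1.
Proof.
rewrite -[RHS]Ir_tri; apply: eq_Ir => u.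
by rewrite /osc mulr0 mul0r addr0 cos0 mulr1.
Qed.

(** The kernel is concave on its support, so [Ir_D2_ccv] applies, and by [tri_near] the values it
    involves are themselves linear in the half period: together a quadratic gain. *)
Lemma gam_decay z : `|gam z| * (eps * z%:~R) ^+ 2 <= 4.
Proof.
have e0 := eps0.
set t : R := `|z%:~R|.
have -> : (eps * z%:~R) ^+ 2 = (eps * t) ^+ 2 by rewrite !exprMn /t real_normK // num_real.
have gE : gam z = Ir (fun u => tri u * osc t 0 u).
  apply: eq_Ir => u; congr (_ * _); rewrite /osc !addr0 /t.
  by case: (ger0P (z%:~R : R)) => // _; rewrite mulrN mulNr cosN.
have t0 : 0 <= t by exact: normr_ge0.
have [et|et] := ltP (eps * t) 1.
  have : (eps * t) ^+ 2 <= 1 by rewrite expr_le1 // ?mulr_ge0 // ltW.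
  have := gam_le1 z; have := normr_ge0 (gam z); have := sqr_ge0 (eps * t); nra.
have {}t0 : 0 < t by rewrite lt_neqAle t0 andbT; apply: contraTneq et => <-; rewrite mulr0 -ltNge ltr01.
pose eta := (2 * t)^-1.
have h0 : 0 < eta by rewrite invr_gt0 mulr_gt0.
have et2 : eta * 2 * t = 1 by rewrite /eta; field; rewrite gt_eqF.
have h1 : 2 * eta <= eps.
  by rewrite -(ler_pM2r t0); lra.
have o1 x : x < - eps -> tri x = 0 by move=> h; apply: tri_out; rewrite ler_normr; apply/orP; right; lra.
have o2 x : eps < x -> tri x = 0 by move=> h; apply: tri_out; rewrite ler_normr; apply/orP; left; lra.
have z1 : tri (- eps) = 0 by apply: tri_out; rewrite normrN gtr0_norm.
have z2 : tri eps = 0 by apply: tri_out; rewrite gtr0_norm.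
have h4 : 4 * eta <= eps - - eps by lra.
have B := Ir_D2_ccv nice_tri ccv_tri z1 z2 o1 o2 h0 h4.
have s0 : 0 <= 2 * eta by lra.
have s1 : 2 * eta <= 2 * eps by lra.
have T := tri_near s0 s1.
have E : tri (- eps + 2 * eta) = tri (eps - 2 * eta) by rewrite -triN; congr tri; ring.
have H := half_period_bound 0 t0 nice_tri; rewrite -/eta -gE in H.
have {}H : `|gam z| <= 16 * eta ^+ 2 / eps ^+ 2.
  apply: le_trans H _.
  have : 8 * eta * (tri (- eps + 2 * eta) + tri (eps - 2 * eta)) <= 8 * eta * (2 * (2 * (2 * eta) / eps ^+ 2)).
    by rewrite E; apply: ler_wpM2l; lra.
  lra.
apply: le_trans (ler_wpM2r (sqr_ge0 _) H) _.
rewrite le_eqVlt; apply/orP; left; apply/eqP.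
by rewrite /eta; field; rewrite !gt_eqF.
Qed.

(** Waves are eigenfunctions of convolution with [tri]; the sine part drops out because [tri] is
    even. *)
Lemma Ir_tri_shift z x : Ir (fun v => tri (x - v) * osc z%:~R 0 v) = gam z * osc z%:~R 0 x.
Proof.
have n1 p := nice_osc z%:~R p nice_tri.
have odd : Ir (fun u => tri u * osc z%:~R (- (pi / 2)) u) = 0.
  have := Ir_reflect 0 (n1 (- (pi / 2))).
  rewrite (eq_Ir (g := fun u => - (tri u * osc z%:~R (- (pi / 2)) u))); last first.
    by move=> u; rewrite sub0r triN /osc !cosBpihalf mulrN sinN mulrN.
  rewrite IrN //; move: (Ir _) => y; lra.
have nx : nice (fun v => tri (x - v) * osc z%:~R 0 v).
  apply: nice_osc; have h : -1 != 0 :> R by rewrite oppr_eq0 oner_eq0.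
  by apply: (eq_nice _ (nice_affine x h nice_tri)) => v; congr tri; ring.
rewrite -(Ir_reflect x nx).
rewrite (eq_Ir (g := fun u => osc z%:~R 0 x * (tri u * osc z%:~R 0 u) +
   osc z%:~R (- (pi / 2)) x * (tri u * osc z%:~R (- (pi / 2)) u))); last first.
  move=> u; rewrite subKr /osc !addr0 !cosBpihalf.
  have -> : 2 * pi * z%:~R * (x - u) = 2 * pi * z%:~R * x - 2 * pi * z%:~R * u by ring.
  by rewrite cosB; ring.
by rewrite IrD ?IrZ ?odd ?mulr0 ?addr0 1?mulrC //; exact: niceZ.
Qed.

End Tent.

(** * Unfolding integrals of periodic functions *)

Section Unfold.
Variable R : realType.
Implicit Types (f g : R -> R) (x v s : R) (m z : int) (B : nat).

Definition zs B : seq int := [seq i%:Z - B%:Z | i <- iota 0 (2 * B).+1].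

Lemma mem_zs B z : (z \in zs B) = (`|z| <= B)%N.
Proof.
apply/mapP/idP => [[i]|h]; first by rewrite mem_iota => /andP[_ h] ->; lia.
exists (absz (z + B%:Z)); last lia.
by rewrite mem_iota; lia.
Qed.

Lemma uniq_zs B : uniq (zs B).
Proof. by rewrite map_inj_uniq ?iota_uniq // => i j h; lia. Qed.

Lemma sum_zsN B (F : int -> R) : \sum_(m <- zs B) F (- m) = \sum_(m <- zs B) F m.
Proof.
rewrite -(big_map -%R xpredT F); apply: perm_big; apply: uniq_perm.
- by rewrite map_inj_uniq ?uniq_zs //; exact: oppr_inj.
- exact: uniq_zs.
by move=> z; rewrite -{1}[z]opprK mem_map ?mem_zs ?abszN //; exact: oppr_inj.
Qed.

(** Half-open, so that integer translates tile the line exactly and not merely almost everywhere. *)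
Definition cell x : R := \1_(`[- 2^-1, 2^-1[%classic : set R) x.

Lemma cellE x : cell x = (- 2^-1 <= x < 2^-1)%R%:R.
Proof. by rewrite /cell indicE mem_setE in_itv. Qed.

Lemma cell_ge0 x : 0 <= cell x. Proof. by rewrite cellE ler0n. Qed.

Lemma measurable_cell : measurable_fun setT cell.
Proof. exact: measurable_indic. Qed.

Lemma nice_cell : nice cell.
Proof.
apply: (@nice_bound _ _ 1 1); first exact: measurable_cell.
  by move=> x; rewrite cellE ger0_norm ?ler0n // lern1 leq_b1.
move=> x; rewrite cellE; case: (boolP (_ && _)) => // /andP[h1 h2].
have : `|x| <= 1 by rewrite ler_norml; apply/andP; split; lra.
by rewrite leNgt => /negbTE ->.
Qed.

Lemma cell_sum B x : `|x| <= B%:R -> \sum_(m <- zs B) cell (x - m%:~R) = 1.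
Proof.
move=> xB; pose n := Num.floor (x + 2^-1).
have /andP[n1 n2] := floor_itv (x + 2^-1); rewrite -/n in n1 n2.
have nB : n \in zs B.
  move: xB; rewrite ler_norml => /andP[x1 x2].
  have u1 : n < B%:Z + 1 by rewrite -(ltr_int R) intrD; have : (B%:Z)%:~R = B%:R :> R by []; lra.
  have u2 : - B%:Z < n + 1 by rewrite -(ltr_int R) intrN; have : (B%:Z)%:~R = B%:R :> R by []; lra.
  by rewrite mem_zs; lia.
rewrite (bigD1_seq n) ?uniq_zs //= big1 ?addr0 => [|m mn].
  by rewrite cellE; rewrite intrD in n2; case: (boolP (_ && _)) => //; rewrite negb_and -ltNge -leNgt => /orP[]; lra.
rewrite cellE; case: (boolP (_ && _)) => // /andP[h1 h2].
case/eqP: mn; apply/eqP; rewrite eq_le.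
have u1 : m < n + 1 by rewrite -(ltr_int R) ; lra.
have u2 : n < m + 1 by rewrite -(ltr_int R) intrD; lra.
lia.
Qed.

Lemma cell_sumD B x : `|x| <= B%:R -> \sum_(m <- zs B) cell (x + m%:~R) = 1.
Proof.
move=> h; rewrite -[RHS](cell_sum h) -[RHS]sum_zsN; apply: eq_bigr => m _.
by rewrite intrN opprK.
Qed.

Lemma Ir_unfold f g (G : R) B : nice f -> (forall x, B%:R < `|x| -> f x = 0) ->
  measurable_fun setT g -> (forall x, `|g x| <= G) ->
  (forall x m, g (x + m%:~R) = g x) ->
  Ir (fun x => f x * g x) = Ir (fun x => cell x * g x * \sum_(m <- zs B) f (x + m%:~R)).
Proof.
move=> nf f0 mg gG gper.
have nfg : nice (fun x => f x * g x) by exact: nice_mulb gG.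
have mc m : measurable_fun setT (fun x => cell (x - m%:~R)).
  by apply: (measurableT_comp measurable_cell); exact: measurable_funB.
have c1 x : `|cell x| <= 1 by rewrite cellE ger0_norm ?ler0n // lern1 leq_b1.
have nm m : nice (fun x => f x * g x * cell (x - m%:~R)).
  by apply: (nice_mulb (M := 1) nfg (mc m)) => x.
have ncg : nice (fun x => cell x * g x) by apply: (nice_mulb nice_cell mg gG).
have nm' m : nice (fun x => cell x * g x * f (x + m%:~R)).
  by apply: niceM => //; exact: nice_shift.
rewrite (eq_Ir (g := fun x => \sum_(m <- zs B) f x * g x * cell (x - m%:~R))); last first.
  move=> x; rewrite -mulr_sumr; have [h|h] := leP `|x| B%:R; first by rewrite cell_sum // mulr1.
  by rewrite f0 // !mul0r.
rewrite Ir_sum // [in RHS](eq_Ir (g := fun x => \sum_(m <- zs B) cell x * g x * f (x + m%:~R))); last first.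
  by move=> x; rewrite mulr_sumr.
rewrite Ir_sum //; apply: eq_bigr => m _.
rewrite -(Ir_shift m%:~R (nm m)); apply: eq_Ir => x.
by rewrite gper addrK; ring.
Qed.

Lemma osc_periodic z p x m : osc z%:~R p (x + m%:~R) = osc z%:~R p x.
Proof.
have H (n : nat) y : cos (y + 2 * pi * n%:R) = cos y :> R.
  elim: n => [|n IH]; first by rewrite mulr0 addr0.
  by rewrite -[n.+1%:R]natr1 mulrDr mulr1 addrA -[RHS]IH mulr_natl cosD2pi.
rewrite /osc; have -> : 2 * pi * z%:~R * (x + m%:~R) + p = 2 * pi * z%:~R * x + p + 2 * pi * (z * m)%:~R.
  by rewrite intrM; ring.
case: (z * m) => n; first exact: H.
by rewrite NegzE intrN mulrN -[LHS](H n.+1) subrK.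
Qed.

Lemma Ir_cell : Ir cell = 1.
Proof.
apply/eqP; rewrite eq_le; apply/andP; split.
  have -> : 1 = Ir (\1_(`[- 2^-1, 2^-1]%classic : set R)) by rewrite Ir_box; [field|lra].
  apply: Ir_le; [exact: nice_cell|exact: nice_box|] => x.
  rewrite cellE; case: (boolP (_ && _)) => [/andP[h1 h2]|_]; last by rewrite indicE ler0n.
  by rewrite box_in // h1 ltW.
rewrite leNgt; apply/negP => h; set c := Ir cell in h.
pose e := (1 - c) / 2.
have c0 : 0 <= c by apply: Ir_ge0; exact: cell_ge0.
have : Ir (\1_(`[- 2^-1, 2^-1 - e]%classic : set R)) <= c.
  apply: Ir_le; [exact: nice_box|exact: nice_cell|] => x.
  case: (boolP (- 2^-1 <= x <= 2^-1 - e)) => [hx|hx]; last by rewrite box_out // cell_ge0.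
  rewrite box_in // cellE; case/andP: hx => h1 h2.
  by have -> : - 2^-1 <= x < 2^-1 by apply/andP; split=> //; rewrite /e in h2; lra.
by rewrite Ir_box /e; lra.
Qed.

(** A shift by half a period changes the sign of the wave, while unfolding shows that the shift of
    the cell leaves the integral unchanged. *)
Lemma Ir_cell_osc z p : z != 0 -> Ir (fun x => cell x * osc z%:~R p x) = 0.
Proof.
move=> z0; set t : R := z%:~R.
have t0 : t != 0 by rewrite intr_eq0.
pose s := (2 * t)^-1.
have s1 : `|s| <= 2^-1.
  rewrite /s normrV ?unitfE ?mulf_neq0 // lef_pV2 ?posrE ?normr_gt0 ?mulf_neq0 //.
  rewrite normrM ger0_norm // ler_peMr // /t -intr_norm -[1]/(1%:~R) ler_int; lia.
have nc := nice_osc t p nice_cell.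
have E := Ir_shift s nc.
have U := @Ir_unfold (fun x => cell (x + s)) (osc t p) 1 1 (nice_shift s nice_cell).
have {}U : Ir (fun x => cell (x + s) * osc t p x) =
    Ir (fun x => cell x * osc t p x * \sum_(m <- zs 1) cell (x + m%:~R + s)).
  apply: U; [|exact: measurable_osc|exact: osc_le1|exact: osc_periodic].
  move=> x h; rewrite cellE; case: (boolP (_ && _)) => // /andP[h1 h2].
  suff : `|x| <= 1 by lra.
  by move: s1; rewrite !ler_norml => /andP[? ?]; apply/andP; split; lra.
have F : Ir (fun x => cell (x + s) * osc t p x) = Ir (fun x => cell x * osc t p x).
  rewrite U; apply: eq_Ir => x.
  case: (boolP (- 2^-1 <= x < 2^-1)) => h; last by rewrite cellE (negbTE h) !mul0r.
  rewrite (eq_bigr (fun m => cell (x + s + m%:~R))); last by move=> m _; congr cell; ring.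
  rewrite cell_sumD ?mulr1 //; case/andP: h => h1 h2.
  by move: s1; rewrite !ler_norml => /andP[? ?]; apply/andP; split; lra.
have N : Ir (fun x => cell (x + s) * osc t p (x + s)) = - Ir (fun x => cell (x + s) * osc t p x).
  rewrite -IrN; last by apply: nice_osc; apply: nice_shift; exact: nice_cell.
  by apply: eq_Ir => x; rewrite osc_shift // mulrN.
move: N; rewrite E F; lra.
Qed.

End Unfold.

(** * Fejer kernel and uniform approximation of the periodised tent *)

Section Fejer.
Variable R : realType.
Implicit Types (x y v : R) (z m : int) (n B : nat).

(** With [z = y / 2], the mean value theorem gives [sin z >= z * cos z], so
    [sin y = 2 sin z cos z >= y cos^2 z]; and [2 cos^2 z >= 1] because [cos y >= 0]. *)
Lemma sin_ge_half y : 0 <= y -> y <= pi / 2 -> y / 2 <= sin y.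
Proof.
move=> y0 yp; have p0 := pi_gt0 R; pose z := y / 2.
have z0 : 0 <= z by rewrite /z; lra.
have [c] := MVT_segment z0 (fun t _ => is_derive_sin t)
  (@continuous_subspaceT _ _ _ _ (@continuous_sin R)).
rewrite in_itv /= sin0 !subr0 => /andP[c0 cz] sz.
have cc : cos z <= cos c.
  rewrite leNgt; apply/negP; rewrite ltr_cos ?in_itv /= ?c0 ?z0 /=; [|rewrite /z; lra|rewrite /z in cz; lra].
  by rewrite ltNge cz.
have yE : y = z + z by rewrite /z; field.
have cz0 : 0 <= cos z by apply: cos_ge0_pihalf; rewrite /z; apply/andP; split; lra.
have cy0 : 0 <= cos y by apply: cos_ge0_pihalf; apply/andP; split; lra.
have c2 : 1 <= 2 * (cos z * cos z).
  have := cos2Dsin2 z; move: cy0; rewrite {1}yE cosD; have := sqr_ge0 (cos z); rewrite !expr2; lra.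
have s2 : z * cos z <= sin z by rewrite sz mulrC; apply: ler_wpM2r.
have -> : sin y = 2 * (sin z * cos z) by rewrite {1}yE sinD; ring.
rewrite -/z; nra.
Qed.

Lemma one_sub_cos_ge v : `|v| <= 2^-1 -> 2 * v ^+ 2 <= 1 - cos (2 * pi * v).
Proof.
move=> v2; have p2 := pi_ge2 R; have p0 := pi_gt0 R.
have -> : cos (2 * pi * v) = cos (2 * pi * `|v|).
  by case: (ger0P v) => // _; rewrite mulrN cosN.
rewrite -(real_normK (num_real v)); have := normr_ge0 v; move: `|v| v2 => u u2 u0.
have py : pi * u <= pi / 2 by nra.
have py0 : 0 <= pi * u by nra.
have H := sin_ge_half py0 py.
have -> : 2 * pi * u = pi * u + pi * u by ring.
rewrite cosD; have := cos2Dsin2 (pi * u); rewrite !expr2.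
have : u <= sin (pi * u) by nra.
nra.
Qed.

Definition dif n (i j : 'I_n) : int := i%:Z - j%:Z.

(** The double sum is the squared modulus of an exponential sum, whence its sign; it also keeps each
    trigonometric coefficient as a count of pairs. *)
Definition fejer n v : R := n%:R^-1 * \sum_(i < n) \sum_(j < n) osc (dif i j)%:~R 0 v.

Lemma fejer_ge0 n v : 0 <= fejer n v.
Proof.
apply: mulr_ge0; first by rewrite invr_ge0.
pose a (i : 'I_n) : R := 2 * pi * i%:R * v.
have -> : \sum_(i < n) \sum_(j < n) osc (dif i j)%:~R 0 v =
    (\sum_(i < n) cos (a i)) ^+ 2 + (\sum_(i < n) sin (a i)) ^+ 2.
  rewrite !expr2 !big_distrlr /= -big_split; apply: eq_bigr => i _; rewrite -big_split.
  apply: eq_bigr => j _ /=; rewrite /osc addr0 -cosB; congr cos.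
  by rewrite /dif intrB /a; ring.
by rewrite addr_ge0 ?sqr_ge0.
Qed.

Lemma measurable_fejer n : measurable_fun setT (fejer n).
Proof.
apply: measurable_funM => //; apply: measurable_sum => i; apply: measurable_sum => j.
exact: measurable_osc.
Qed.

Lemma fejer_bound n v : `|fejer n v| <= n%:R^-1 * \sum_(i < n) \sum_(j < n) 1.
Proof.
rewrite normrM ger0_norm ?invr_ge0 //; apply: ler_wpM2l; first by rewrite invr_ge0.
apply: le_trans (ler_norm_sum _ _ _) _; apply: ler_sum => i _.
by apply: le_trans (ler_norm_sum _ _ _) _; apply: ler_sum => j _; exact: osc_le1.
Qed.

Lemma fejer_periodic n v m : fejer n (v + m%:~R) = fejer n v.
Proof.
by congr (_ * _); apply: eq_bigr => i _; apply: eq_bigr => j _; exact: osc_periodic.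
Qed.

Let nice_cf n : nice (fun v => cell v * fejer n v).
Proof. exact: (nice_mulb (nice_cell R) (measurable_fejer n) (fejer_bound n)). Qed.

Let cfE n v : cell v * fejer n v =
  n%:R^-1 * \sum_(i < n) \sum_(j < n) cell v * osc (dif i j)%:~R 0 v.
Proof.
rewrite /fejer mulrCA; congr (_ * _); rewrite mulr_sumr.
by apply: eq_bigr => i _; rewrite mulr_sumr.
Qed.

Let Ir_co z : Ir (fun v : R => cell v * osc z%:~R 0 v) = (z == 0)%:R.
Proof.
case: eqP => [->|/eqP z0]; last exact: Ir_cell_osc.
rewrite -[RHS](Ir_cell R); apply: eq_Ir => v.
by rewrite /osc mulr0 mul0r addr0 cos0 mulr1.
Qed.

Let nice_co z p : nice (fun v : R => cell v * osc z%:~R p v) := nice_osc z%:~R p (nice_cell R).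

Lemma Ir_fejer n : Ir (fun v => cell v * fejer n.+1 v) = 1.
Proof.
rewrite (eq_Ir (@cfE n.+1)) IrZ; last by apply: nice_sum => i; apply: nice_sum => j.
rewrite Ir_sum; last by move=> i; apply: nice_sum => j.
rewrite (eq_bigr (fun=> 1)) => [|i _].
  by rewrite sumr_const card_ord -[1 *+ _]/(n.+1%:R) mulVf // pnatr_eq0.
rewrite Ir_sum // (bigD1 i) //= Ir_co /dif subrr eqxx big1 ?addr0 // => j ji.
rewrite Ir_co subr_eq0; case: eqP => // -[] /esym /ord_inj ij.
by rewrite ij eqxx in ji.
Qed.

Lemma sum_next n : \sum_(i < n.+1) \sum_(j < n.+1) (i.+1 == j)%:R = n%:R :> R.
Proof.
rewrite exchange_big big_ord_recl /= big1 // add0r.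
rewrite (eq_bigr (fun=> 1)) ?sumr_const ?card_ord // => j _.
rewrite (bigD1 (widen_ord (leqnSn n) j)) //= [fintype.bump _ _]add1n eqxx big1 ?addr0 // => i ij.
rewrite eqSS; case: eqP => // h; case/eqP: ij; exact: ord_inj.
Qed.

(** The first coefficient of the kernel of order [n + 1] is [n / (n + 1)], as [n] pairs satisfy
    [j = i + 1]. This measures its concentration at 0. *)
Lemma Ir_fejer_cos n :
  Ir (fun v => cell v * fejer n.+1 v * (1 - osc 1 0 v)) = n.+1%:R^-1.
Proof.
pose F (i j : 'I_n.+1) v := 2^-1 * (cell v * osc (dif i j + 1)%:~R 0 v) +
  2^-1 * (cell v * osc (dif i j - 1)%:~R 0 v).
have nF i j : nice (F i j) by apply: niceD; apply: niceZ.
have E v : cell v * fejer n.+1 v * (1 - osc 1 0 v) = cell v * fejer n.+1 v -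
    n.+1%:R^-1 * \sum_(i < n.+1) \sum_(j < n.+1) F i j v.
  rewrite mulrBr mulr1; congr (_ - _); rewrite cfE -mulrA; congr (_ * _).
  rewrite mulr_suml; apply: eq_bigr => i _; rewrite mulr_suml; apply: eq_bigr => j _.
  have e1 : (dif i j + 1)%:~R = (dif i j)%:~R + 1 :> R by rewrite intrD.
  have e2 : (dif i j - 1)%:~R = (dif i j)%:~R - 1 :> R by rewrite intrB.
  rewrite /F /osc !addr0 e1 e2.
  have -> : 2 * pi * ((dif i j)%:~R + 1) * v = 2 * pi * (dif i j)%:~R * v + 2 * pi * 1 * v by ring.
  have -> : 2 * pi * ((dif i j)%:~R - 1) * v = 2 * pi * (dif i j)%:~R * v - 2 * pi * 1 * v by ring.
  by rewrite cosD cosB; field.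
have nFF : nice (fun v => \sum_(i < n.+1) \sum_(j < n.+1) F i j v).
  by apply: nice_sum => i; apply: nice_sum => j.
rewrite (eq_Ir E) IrB //; last exact: niceZ.
rewrite Ir_fejer IrZ // Ir_sum; last by move=> i; apply: nice_sum => j.
have -> : \sum_(i < n.+1) Ir (fun v => \sum_(j < n.+1) F i j v) = n%:R.
  rewrite (eq_bigr (fun i : 'I_n.+1 => \sum_(j < n.+1) (2^-1 * (i.+1 == j)%:R + 2^-1 * (j.+1 == i)%:R))).
    rewrite (eq_bigr (fun i : 'I_n.+1 => 2^-1 * \sum_(j < n.+1) (i.+1 == j)%:R +
       2^-1 * \sum_(j < n.+1) (j.+1 == i)%:R)) => [|i _]; last by rewrite big_split /= !mulr_sumr.
    by rewrite big_split /= -!mulr_sumr sum_next exchange_big sum_next; field.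
  move=> i _; rewrite Ir_sum //; apply: eq_bigr => j _.
  rewrite /F IrD ?IrZ ?Ir_co //; [|exact: niceZ|exact: niceZ].
  congr (_ * _%:R + _ * _%:R); rewrite /dif; congr nat_of_bool; lia.
have n0 : n.+1%:R != 0 :> R by rewrite pnatr_eq0.
rewrite -[n%:R](addrK 1) natr1 mulrBr mulVf // mulr1; ring.
Qed.

Variable eps : R.

Definition tsum n x : R :=
  n%:R^-1 * \sum_(i < n) \sum_(j < n) gam eps (dif i j) * osc (dif i j)%:~R 0 x.

Definition weight n z : R := n%:R^-1 * \sum_(i < n) \sum_(j < n) (dif i j == z)%:R.

Lemma tsum_weight n x : tsum n x =
  \sum_(z <- zs n) weight n z * gam eps z * osc z%:~R 0 x.
Proof.
rewrite /tsum; pose F z := gam eps z * osc z%:~R 0 x.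
have E (i j : 'I_n) : F (dif i j) = \sum_(z <- zs n) (dif i j == z)%:R * F z.
  have h : dif i j \in zs n by rewrite mem_zs /dif; have := ltn_ord i; have := ltn_ord j; lia.
  rewrite (bigD1_seq _ h) ?uniq_zs //= eqxx mul1r big1 ?addr0 // => z zn.
  by rewrite eq_sym (negbTE zn) mul0r.
under eq_bigr => i _ do under eq_bigr => j _ do rewrite -/(F (dif i j)) E.
under eq_bigr => i _ do rewrite exchange_big.
rewrite exchange_big /= mulr_sumr; apply: eq_bigr => z _.
rewrite /weight -/(F z) -!mulrA -/(F z); congr (_ * _); rewrite mulr_suml; apply: eq_bigr => i _.
by rewrite mulr_suml.
Qed.

Lemma weight_ge0 n z : 0 <= weight n z.
Proof.
by apply: mulr_ge0; rewrite ?invr_ge0 //; apply: sumr_ge0 => i _; apply: sumr_ge0.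
Qed.

Lemma weight_le1 n z : weight n z <= 1.
Proof.
have [->|n0] := eqVneq n 0%N; first by rewrite /weight invr0 mul0r.
rewrite /weight ler_pdivrMl ?ltr0n ?lt0n // mulr1.
apply: (@le_trans _ _ (\sum_(i < n) 1)); last by rewrite sumr_const card_ord.
apply: ler_sum => i _; case: (boolP [exists j : 'I_n, dif i j == z]) => [/existsP[j0 h0]|].
  rewrite (bigD1 j0) //= h0 big1 ?addr0 // => j jj.
  case: eqP => // h; case/eqP: jj; apply: ord_inj.
  by move: h0 h; rewrite /dif => /eqP; lia.
rewrite negb_exists => /forallP h; rewrite big1 // => j _.
by rewrite (negbTE (h j)).
Qed.

Lemma weight0 n : weight n.+1 0 = 1.
Proof.
rewrite /weight (eq_bigr (fun=> 1)) => [|i _].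
  by rewrite sumr_const card_ord -[1 *+ _]/(n.+1%:R) mulVf // pnatr_eq0.
rewrite (bigD1 i) //= /dif subrr eqxx big1 ?addr0 // => j ji.
by rewrite subr_eq0; case: eqP => // -[] /ord_inj h; rewrite h eqxx in ji.
Qed.

Hypotheses (eps0 : 0 < eps) (eps1 : eps <= 1).

(** A finite stand-in for the periodised kernel: for [eps <= 1] it is the full periodisation
    wherever [|x| + 1 <= B]. *)
Definition spike B x : R := \sum_(m <- zs B) tri eps (x + m%:~R).

Let nice_refl f x : nice f -> nice (fun v => f (x - v)).
Proof.
move=> nf; have h : -1 != 0 :> R by rewrite oppr_eq0 oner_eq0.
by apply: (eq_nice _ (nice_affine x h nf)) => v; congr f; ring.
Qed.

Let ntri := nice_tri eps0.

Lemma nice_spike B : nice (spike B).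
Proof. by apply: nice_sum => m; exact: nice_shift. Qed.

Lemma tsum_fejer n x : tsum n x = Ir (fun v => tri eps (x - v) * fejer n v).
Proof.
have nt := nice_refl x ntri.
rewrite (eq_Ir (g := fun v => n%:R^-1 * \sum_(i < n) \sum_(j < n)
    tri eps (x - v) * osc (dif i j)%:~R 0 v)); last first.
  move=> v; rewrite /fejer mulrCA; congr (_ * _); rewrite mulr_sumr.
  by apply: eq_bigr => i _; rewrite mulr_sumr.
have no i j : nice (fun v => tri eps (x - v) * osc (@dif n i j)%:~R 0 v) by exact: nice_osc.
rewrite IrZ; last by apply: nice_sum => i; apply: nice_sum => j.
congr (_ * _); rewrite Ir_sum; last by move=> i; apply: nice_sum => j.
apply: eq_bigr => i _; rewrite Ir_sum //; apply: eq_bigr => j _.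
by rewrite Ir_tri_shift.
Qed.

Lemma tsum_cell n B x : `|x| + 1 <= B%:R ->
  tsum n x = Ir (fun v => cell v * fejer n v * spike B (x - v)).
Proof.
move=> xB; rewrite tsum_fejer.
have := Ir_unfold (B := B) (nice_refl x ntri) _ (measurable_fejer n) (fejer_bound n) (@fejer_periodic n).
move=> ->; last first.
  move=> v hv; apply: (tri_out eps0); apply: le_trans eps1 _.
  by have := ler_normD (x - v) (- x); have := ler_normB x (x - v); rewrite subKr; lra.
apply: eq_Ir => v; congr (_ * _); rewrite /spike -[RHS]sum_zsN; apply: eq_bigr => m _.
by congr tri; rewrite intrN; ring.
Qed.

Lemma spike_lip B x y :
  `|spike B x - spike B y| <= (size (zs B))%:R / (eps * mass eps) * `|x - y|.
Proof.
rewrite /spike -sumrB; apply: le_trans (ler_norm_sum _ _ _) _.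
apply: (@le_trans _ _ (\sum_(m <- zs B) `|x - y| / (eps * mass eps))).
  apply: ler_sum => m _; apply: le_trans (tri_lip eps0 _ _) _.
  by rewrite (_ : x + m%:~R - (y + m%:~R) = x - y) //; ring.
by rewrite big_const_seq count_predT iter_addr_0 -[_ *+ size _]mulr_natl mulrAC mulrA.
Qed.

(** Korovkin's argument: the Lipschitz bound is majorised by [e / 2 + C * (1 - cos)], and the kernel
    is nonnegative with mass 1 and integral [1 / n] against [1 - cos]. *)
Lemma fejer_approx B (e : R) : 0 < e -> exists n0 : nat, forall n x, (n0 <= n)%N ->
  `|x| + 1 <= B%:R -> `|tsum n.+1 x - spike B x| <= e.
Proof.
move=> e0; pose L := (size (zs B))%:R / (eps * mass eps).
have m0 : 0 < mass eps by apply: lt_le_trans (mass_ge eps0); rewrite divr_gt0.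
have L0 : 0 <= L by rewrite divr_ge0 // mulr_ge0 // ltW.
pose C := L ^+ 2 / (4 * e).
have C0 : 0 <= C by rewrite divr_ge0 ?sqr_ge0 // mulr_ge0 // ltW.
have X0 : 0 <= 2 * C / e by apply: divr_ge0; [exact: mulr_ge0|exact: ltW].
exists (Num.truncn (2 * C / e)) => n x n0 xB.
have nC : C / n.+1%:R <= e / 2.
  have np : 0 < n.+1%:R :> R by rewrite ltr0n.
  have /andP[_ h] := truncn_itv X0.
  have {}h : 2 * C / e <= n.+1%:R by apply: le_trans (ltW h) _; rewrite ler_nat.
  rewrite ler_pdivrMr //; rewrite ler_pdivrMr // in h; lra.
have ncf := nice_cf n.+1; have ns := nice_refl x (nice_spike B).
have nT : nice (fun v => cell v * fejer n.+1 v * spike B (x - v)) by exact: niceM.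
have nD : nice (fun v => cell v * fejer n.+1 v * (spike B (x - v) - spike B x)).
  apply: (eq_nice _ (niceB nT (niceZ (spike B x) ncf))) => v; ring.
have nO : nice (fun v => cell v * fejer n.+1 v * (1 - osc 1 0 v)).
  by apply: (eq_nice _ (niceB ncf (nice_osc 1 0 ncf))) => v; ring.
have -> : tsum n.+1 x - spike B x = Ir (fun v => cell v * fejer n.+1 v * (spike B (x - v) - spike B x)).
  have E : spike B x = Ir (fun v => spike B x * (cell v * fejer n.+1 v)).
    by rewrite IrZ // Ir_fejer mulr1.
  rewrite (tsum_cell n.+1 xB) [X in _ - X]E -IrB //; last exact: niceZ.
  by apply: eq_Ir => v; ring.
apply: le_trans (Ir_norm nD) _.
apply: (@le_trans _ _ (Ir (fun v => e / 2 * (cell v * fejer n.+1 v) +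
   C * (cell v * fejer n.+1 v * (1 - osc 1 0 v))))).
  apply: Ir_le; [exact: nice_norm|by apply: niceD; apply: niceZ|] => v.
  have K0 := fejer_ge0 n.+1 v; have c0 := cell_ge0 v.
  rewrite normrM (ger0_norm (mulr_ge0 c0 K0)).
  have [h|h] := boolP (- 2^-1 <= v < 2^-1); last by rewrite cellE (negbTE h) !mul0r !mulr0 addr0.
  have v2 : `|v| <= 2^-1 by case/andP: h => h1 h2; rewrite ler_norml; apply/andP; split; lra.
  have Lv := spike_lip B (x - v) x; rewrite -/L in Lv.
  rewrite (_ : x - v - x = - v) ?normrN in Lv; last by ring.
  have oc := one_sub_cos_ge v2.
  have -> : e / 2 * (cell v * fejer n.+1 v) + C * (cell v * fejer n.+1 v * (1 - osc 1 0 v)) =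
     cell v * fejer n.+1 v * (e / 2 + C * (1 - osc 1 0 v)) by ring.
  apply: ler_wpM2l; first exact: mulr_ge0.
  apply: le_trans Lv _; rewrite /osc mulr1 addr0.
  apply: (@le_trans _ _ (e / 2 + C * (2 * v ^+ 2))); last by rewrite lerD2l; apply: ler_wpM2l.
  rewrite /C -(real_normK (num_real v)); move: `|v| => u.
  (* AM-GM: [L u <= e/2 + L^2 u^2 / (2 e)] *)
  rewrite -subr_ge0; have -> : e / 2 + L ^+ 2 / (4 * e) * (2 * u ^+ 2) - L * u = (e - L * u) ^+ 2 / (2 * e).
    by field; rewrite gt_eqF.
  by rewrite divr_ge0 ?sqr_ge0 // mulr_ge0 // ltW.
rewrite IrD ?IrZ ?Ir_fejer ?Ir_fejer_cos //; [|exact: niceZ|exact: niceZ].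
by have := lerD (lexx (e / 2)) nC; rewrite mulr1 -splitr.
Qed.

End Fejer.

(** * Mean square of the oscillating part *)

Section OscTransform.
Variable R : realType.
Implicit Types (f : R -> R).

(** Measurability in [t] comes from Fubini; the cut to [[a, c]] provides the bounded support. *)
Lemma nice_osc_transform f a c p : nice f ->
  nice (fun t => \1_(`[a, c]%classic : set R) t * Ir (fun w => f w * osc t p w)).
Proof.
move=> /niceP[N [N0 mf fN f0]].
have n2 : nice2 (fun x : R * R => \1_(`[a, c]%classic : set R) x.1 * (f x.2 * osc x.1 p x.2)).
  apply: (@nice2_bound _ _ N (N + `|a| + `|c|)).
  - apply: measurable_funM.
      by apply: (measurableT_comp (@measurable_box R a c)); exact: measurable_fst.
    apply: measurable_funM; first by apply: (measurableT_comp mf); exact: measurable_snd.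
    apply: (measurableT_comp (f := cos)); first exact: (continuous_measurable_fun (@continuous_cos R)).
    apply: measurable_funD => //; apply: measurable_funM; last exact: measurable_snd.
    by apply: measurable_funM => //; exact: measurable_fst.
  - move=> x; rewrite !normrM indicE; case: (_ \in _); last by rewrite normr0 mul0r.
    rewrite normr1 mul1r; apply: le_trans (fN x.2); rewrite -[leRHS]mulr1.
    by apply: ler_wpM2l => //; exact: osc_le1.
  - move=> x [h|h]; last by rewrite f0 ?mul0r ?mulr0 //; have := normr_ge0 a; have := normr_ge0 c; lra.
    rewrite box_out ?mul0r //; apply/negP => /andP[h1 h2]; move: h; rewrite ltNge => /negP; apply.
    have := ler_norm c; have := ler_norm (- a); rewrite normrN => ac cc.
    by rewrite ler_norml; apply/andP; split; have := normr_ge0 a; have := normr_ge0 c; lra.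
apply: (eq_nice _ (nice_marg n2)) => t /=.
rewrite indicE; case: (_ \in _); last first.
  by rewrite mul0r -[RHS](Ir0 R); apply: eq_Ir => w; rewrite mul0r.
by rewrite mul1r; apply: eq_Ir => w; rewrite mul1r.
Qed.

Lemma nice_window (s h : R) : 0 < h -> nice (chi s h).
Proof.
move=> h0; apply: (eq_nice (f := fun t : R => chi s h t * 1)); first by move=> t; rewrite mulr1.
apply: (@nice_chi _ s h (fun=> 1) 1) => // t v v0 vh _ _; split.
- by rewrite normr1.
- by rewrite subrr normr0 mul1r divr_ge0 // ltW.
- rewrite /D2 (_ : _ - _ = 0) ?normr0 ?mul1r ?sqr_ge0 //; ring.
Qed.

Lemma Ir_window (s h : R) : 0 < h -> Ir (chi s h) <= 147 * (6 * h).
Proof.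
move=> h0; have -> : 6 * h = s + 3 * h - (s - 3 * h) by ring.
apply: Ir_le_box; [exact: nice_window|lra| |].
  by move=> x hx; apply: le_trans (ler_norm _) _; exact: reg_bound h0 (@reg_chi _ h s h0) hx.
move=> x hx; rewrite chi_out //; apply: contraNT hx; rewrite -ltNge ltr_norml => /andP[h1 h2].
by apply/andP; split; lra.
Qed.

Lemma Ir_square_sum5 w f1 f2 f3 f4 f5 : nice w -> (forall t, 0 <= w t) ->
  nice f1 -> nice f2 -> nice f3 -> nice f4 -> nice f5 ->
  Ir (fun t => w t * (f1 t + f2 t + f3 t + f4 t + f5 t) ^+ 2) <=
  5 * Ir (fun t => w t * f1 t ^+ 2) + 5 * Ir (fun t => w t * f2 t ^+ 2) +
  5 * Ir (fun t => w t * f3 t ^+ 2) + 5 * Ir (fun t => w t * f4 t ^+ 2) +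
  5 * Ir (fun t => w t * f5 t ^+ 2).
Proof.
move=> nw w0 n1 n2 n3 n4 n5.
have nsq f : nice f -> nice (fun t => w t * f t ^+ 2).
  by move=> nf; apply: niceM => //; apply: (eq_nice _ (niceM nf nf)) => t; rewrite expr2.
have nz f : nice f -> nice (fun t => 5 * (w t * f t ^+ 2)) by move=> /nsq; exact: niceZ.
have nS := niceD (niceD (niceD (niceD n1 n2) n3) n4) n5.
have m2 := niceD (nz _ n1) (nz _ n2); have m3 := niceD m2 (nz _ n3).
have m4 := niceD m3 (nz _ n4); have m5 := niceD m4 (nz _ n5).
rewrite -(IrZ 5 (nsq _ n1)) -(IrZ 5 (nsq _ n2)) -(IrZ 5 (nsq _ n3)) -(IrZ 5 (nsq _ n4)).
rewrite -(IrZ 5 (nsq _ n5)).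
rewrite -(IrD (nz _ n1) (nz _ n2)) -(IrD m2 (nz _ n3)) -(IrD m3 (nz _ n4)) -(IrD m4 (nz _ n5)).
apply: Ir_le => [||t]; [exact: (nsq _ nS)|exact: m5|].
have := w0 t; move: (w t) (f1 t) (f2 t) (f3 t) (f4 t) (f5 t) => c z1 z2 z3 z4 z5 c0.
have -> : 5 * (c * z1 ^+ 2) + 5 * (c * z2 ^+ 2) + 5 * (c * z3 ^+ 2) +
   5 * (c * z4 ^+ 2) + 5 * (c * z5 ^+ 2) =
   c * (5 * (z1 ^+ 2 + z2 ^+ 2 + z3 ^+ 2 + z4 ^+ 2 + z5 ^+ 2)) by ring.
apply: ler_wpM2l => //; rewrite -subr_ge0.
have -> : 5 * (z1 ^+ 2 + z2 ^+ 2 + z3 ^+ 2 + z4 ^+ 2 + z5 ^+ 2) - (z1 + z2 + z3 + z4 + z5) ^+ 2 =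
   (z1 - z2) ^+ 2 + (z1 - z3) ^+ 2 + (z1 - z4) ^+ 2 + (z1 - z5) ^+ 2 + (z2 - z3) ^+ 2 +
   (z2 - z4) ^+ 2 + (z2 - z5) ^+ 2 + (z3 - z4) ^+ 2 + (z3 - z5) ^+ 2 + (z4 - z5) ^+ 2 by ring.
by rewrite !addr_ge0 ?sqr_ge0.
Qed.

End OscTransform.

(** * End pieces of the transform and their mean square *)

Section Window.
Variable R : realType.
Implicit Types (k l : int * int) (h t x p : R) (s : seq (int * int)).
Variables (Om : set (R * R)) (c0 M K2 : R).
Hypotheses (oO : open Om) (cO : convex2 Om) (c0_gt0 : 0 < c0) (M_gt0 : 0 < M).
Hypothesis (OM : forall x : R * R, Om x -> nrm x <= M).
Hypothesis (cOm : forall x : R * R, `|x.1| <= c0 -> `|x.2| <= c0 -> Om x).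
Let b k := rho_star Om (vec R k).
Let L k := slice_len Om (vec R k).
Hypothesis K20 : 0 <= K2.
Hypothesis chord : forall k p q : R * R, k != (0, 0) -> Om p -> Om q -> dot2 p k = dot2 q k ->
  ((p.1 - q.1) ^+ 2 + (p.2 - q.2) ^+ 2) * nrm k <= K2 * (rho_star Om k - dot2 p k).

Definition opp2 k : int * int := (- k.1, - k.2).

Lemma opp2K : involutive opp2. Proof. by case=> a c; rewrite /opp2 /= !opprK. Qed.

Lemma vec_opp2 k : vec R (opp2 k) = (- (vec R k).1, - (vec R k).2).
Proof. by rewrite /vec /opp2 /= !intrN. Qed.

Lemma opp2_eq0 k : (opp2 k == (0, 0)) = (k == (0, 0)).
Proof. by case: k => a c; rewrite /opp2 /= !xpair_eqE !oppr_eq0. Qed.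

Lemma nrm_opp2 k : nrm (vec R (opp2 k)) = nrm (vec R k).
Proof. by rewrite vec_opp2 /nrm /= !sqrrN. Qed.

Let LN k : L (opp2 k) = fun x => L k (- x).
Proof. by apply/funext => x; rewrite /L vec_opp2 slice_len_opp. Qed.

Let bN k : rho_star Om (- (vec R k).1, - (vec R k).2) = b (opp2 k).
Proof. by rewrite /b vec_opp2. Qed.

Let b_ge k : k != (0, 0) -> c0 <= b k.
Proof.
move=> k0; apply: le_trans (rho_ge c0_gt0 OM cOm (vec R k)).
by rewrite ler_peMr ?(ltW c0_gt0) // nrm_vec_ge1.
Qed.

Let b_ge0 k : 0 <= b k.
Proof.
apply: le_trans (rho_ge c0_gt0 OM cOm (vec R k)).
by apply: mulr_ge0; [exact: ltW|exact: nrm_ge0].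
Qed.

Let nL k : k != (0, 0) -> nice (L k).
Proof. by move=> k0; exact: (nice_slice_len oO c0_gt0 OM cOm (vec_neq0 R k0)). Qed.

Let L0 k x : 0 <= L k x. Proof. exact: slice_len_ge0. Qed.

Let cL k : k != (0, 0) -> ccv (- b (opp2 k)) (b k) (L k).
Proof.
move=> k0; have := slice_len_ccv oO cO c0_gt0 OM cOm (vec_neq0 R k0).
by rewrite -bN.
Qed.

Let Lout k x : k != (0, 0) -> x <= - b (opp2 k) \/ b k <= x -> L k x = 0.
Proof. by rewrite -bN => k0 h; exact: (slice_len_out oO c0_gt0 OM cOm (vec_neq0 R k0)). Qed.

Let Lc k : k != (0, 0) -> L k (- b (opp2 k)) = 0.
Proof. by move=> k0; apply: Lout => //; left. Qed.

Let Ld k : k != (0, 0) -> L k (b k) = 0.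
Proof. by move=> k0; apply: Lout => //; right. Qed.

(** The width [h^-1] turns the condition [v * W <= 1] of the amplitude bounds into [v <= h], and
    [v * W] into the ratio [v / h] of [reg]. *)
Definition lobe h k : R -> R := cap (L k) (b k) h^-1.

Let long h k : 0 < h -> 4 / c0 <= h -> k != (0, 0) -> 4 * h^-1 <= b k - - b (opp2 k).
Proof.
move=> h0 hc k0; rewrite opprK; have h1 := b_ge k0; have h2 := b_ge0 (opp2 k); have hc0 := c0_gt0.
have : 4 * h^-1 <= c0 by rewrite ler_pdivrMr // mulrC -ler_pdivrMr.
lra.
Qed.

Lemma lobe_bump h k : 0 < h -> 4 / c0 <= h -> k != (0, 0) -> bump h^-1 (lobe h k).
Proof.
move=> h0 hc k0; apply: (bump_cap (nL k0) (cL k0) (L0 k) (Ld k0)); first by rewrite invr_gt0.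
exact: long.
Qed.

(** Replaces the depth [1 / t] by one fixed depth for the whole window, at the cost of a factor 2,
    by concavity and the zero at the far end. *)
Lemma tip_compare h k t : 0 < h -> 4 / c0 <= h -> 2 <= h -> k != (0, 0) -> h ^+ 2 / 2 <= t ->
  L k (b k - 2 * (2 * t)^-1) <= 2 * L k (b k - 2 / h ^+ 2).
Proof.
move=> h0 hc h2 k0 ht.
have hh : 0 < h ^+ 2 by rewrite exprn_gt0.
have t0 : 0 < t by lra.
have w0 : 2 / h ^+ 2 <= h^-1.
  have -> : h^-1 = h / h ^+ 2 by field; rewrite gt_eqF.
  by rewrite ler_pM2r // invr_gt0.
have lg := long h0 hc k0.
have wt : 2 * (2 * t)^-1 <= 2 / h ^+ 2.
  by rewrite ler_pM2l // lef_pV2 ?posrE ?mulr_gt0 //; lra.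
have wp : 0 < 2 * (2 * t)^-1 by rewrite mulr_gt0 // invr_gt0 mulr_gt0.
have hV : 0 < h^-1 by rewrite invr_gt0.
have := @cL k k0 (- b (opp2 k)) (b k - 2 / h ^+ 2) (b k - 2 * (2 * t)^-1).
rewrite Lc // mulr0 add0r.
have LL := L0 k (b k - 2 / h ^+ 2).
move: LL lg w0 wt wp; set A := L k _; set B := L k _; set u := 2 * (2 * t)^-1.
move: (2 / h ^+ 2) (b k) (- b (opp2 k)) => w d c LL lg w0 wt wp H.
have {}H := H ltac:(lra) ltac:(lra) ltac:(lra) ltac:(lra).
have D0 : 0 < d - w - c by lra.
rewrite -(ler_pM2l D0); apply: le_trans H _.
have -> : (d - w - c) * (2 * A) = 2 * (d - w - c) * A by ring.
by apply: ler_wpM2r => //; lra.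
Qed.

(** Cut to the window and set to 0 at the zero frequency, so that it is [nice] for every index. *)
Definition lobe_amp x0 h p k t : R :=
  if k == (0, 0) then 0 else
  \1_(`[x0 - 3 * h, x0 + 3 * h]%classic : set R) t * amp (lobe h k) p t.

Lemma nice_lobe_amp x0 h p k : 0 < h -> 4 / c0 <= h -> nice (lobe_amp x0 h p k).
Proof.
move=> h0 hc; rewrite /lobe_amp; case: (boolP (k == _)) => k0; first exact: nice0.
by apply: nice_osc_transform; have [] := lobe_bump h0 hc k0.
Qed.

(** The constant is [10 * 768] from [amp_D2_bound] times 2 from [tip_compare]; of the power,
    [h ^ -2] comes from [1 / t] and [h ^ -1] from the normalisation of [tip_len]. *)
Let a0 h : R := 20 * 768 / h ^+ 3.

Let a0_ge0 h : 0 <= h -> 0 <= a0 h.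
Proof.
move=> h0; apply: divr_ge0; last exact: exprn_ge0.
by apply: mulr_ge0; exact: ler0n.
Qed.

Lemma lobe_reg x0 h p k : 6 <= h -> 4 / c0 <= h -> h ^+ 2 <= x0 ->
  reg h (x0 - 3 * h) (x0 + 3 * h) (a0 h * tip_len Om h k) (lobe_amp x0 h p k).
Proof.
move=> h6 hc hx t v v0 vh tl tr.
have h0 : 0 < h by lra.
have T0 := tip_len_ge0 Om k (ltW h0).
have A0 := a0_ge0 (ltW h0).
have P0 : 0 <= a0 h * tip_len Om h k by exact: mulr_ge0.
have vh0 : 0 <= v / h by apply: divr_ge0 => //; exact: ltW.
case: (boolP (k == (0, 0))) => k0.
  rewrite /lobe_amp /D2 k0; split; rewrite ?subr0 ?addr0 ?mulr0 ?subr0 normr0 //.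
    exact: mulr_ge0.
  by apply: mulr_ge0 => //; exact: sqr_ge0.
have lE u : x0 - 3 * h <= u <= x0 + 3 * h -> lobe_amp x0 h p k u = amp (lobe h k) p u.
  by move=> hu; rewrite /lobe_amp (negbTE k0) box_in // mul1r.
rewrite /D2 !lE; try by apply/andP; split; lra.
have h6h : 6 * h <= h ^+ 2 by rewrite expr2 ler_pM2r.
have ht : h ^+ 2 / 2 <= t by lra.
have hh : 0 < h ^+ 2 by rewrite exprn_gt0.
have t0 : 0 < t by lra.
have tW : 1 <= t * h^-1.
  rewrite ler_pdivlMr // mul1r; apply: le_trans ht.
  by rewrite expr2 ler_pdivlMr // mulrC ler_pM2r //; lra.
have q1 : (2 * t)^-1 <= h ^- 2 by rewrite lef_pV2 ?posrE ?mulr_gt0 //; lra.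
have q0 : 0 < (2 * t)^-1 by rewrite invr_gt0 mulr_gt0.
have qW : 2 * (2 * t)^-1 <= h^-1.
  have -> : 2 * (2 * t)^-1 = t^-1 by field; rewrite gt_eqF.
  rewrite lef_pV2 ?posrE //; apply: le_trans ht; rewrite expr2 ler_pdivlMr // mulrC.
  by rewrite ler_pM2r //; lra.
have hV : 0 < h^-1 by rewrite invr_gt0.
have LE : bump_le (lobe h k) h^-1 (2 * t)^-1 (L k (b k - 2 * (2 * t)^-1)).
  by apply: (bump_le_cap (cL k0) (L0 k) (Ld k0) hV (long h0 hc k0)).
have bl := lobe_bump h0 hc k0.
have vW : v * h^-1 <= 1 by rewrite ler_pdivrMr // mul1r.
have B1 := amp_bound p bl t0 tW LE.
have B2 := amp_D1_bound p bl t0 tW LE v0 vW.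
have B3 := amp_D2_bound p bl t0 tW LE v0 vW.
have TC := tip_compare h0 hc (ltac:(lra)) k0 ht.
have X0 := L0 k (b k - 2 * (2 * t)^-1).
have key : (2 * t)^-1 * L k (b k - 2 * (2 * t)^-1) <= 2 * (tip_len Om h k / h ^+ 3).
  apply: le_trans (ler_pM (ltW q0) X0 q1 TC) _.
  rewrite /tip_len -/(b k) -/(L k _) le_eqVlt; apply/orP; left; apply/eqP; field.
  by rewrite gt_eqF.
have aE : a0 h * tip_len Om h k = 10 * 768 * (2 * (tip_len Om h k / h ^+ 3)).
  by rewrite /a0; field; rewrite gt_eqF.
have Z0 : 0 <= (2 * t)^-1 * L k (b k - 2 * (2 * t)^-1) by apply: mulr_ge0; [exact: ltW|exact: X0].
rewrite -(mulrA _ (2 * t)^-1) in B1.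
rewrite -(mulrA _ (2 * t)^-1) in B2.
rewrite -(mulrA _ (2 * t)^-1) in B3.
rewrite aE; move: B1 B2 B3 key Z0.
move: (tip_len Om h k / h ^+ 3) ((2 * t)^-1 * L k _) => Y Z B1 B2 B3 key Z0.
have Y0 : 0 <= 2 * Y by exact: le_trans Z0 key.
split.
- by apply: le_trans B1 _; lra.
- apply: le_trans B2 _; have := ler_wpM2l vh0 key; have := mulr_ge0 vh0 Y0; lra.
- apply: le_trans B3 _; have v2 := sqr_ge0 (v / h).
  have := ler_wpM2l v2 key; lra.
Qed.

Let term x0 h p k t : R := osc (b k) p t * lobe_amp x0 h p k t.

Lemma transform_split x0 h k t : 6 <= h -> 4 / c0 <= h -> k != (0, 0) ->
  x0 - 3 * h <= t <= x0 + 3 * h ->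
  Ir (fun x => L k x * osc t 0 x) =
  Ir (fun x => mid (L k) (- b (opp2 k)) (b k) h^-1 x * osc t 0 x) +
  (term x0 h 0 k t + term x0 h (- (pi / 2)) k t) +
  (term x0 h 0 (opp2 k) t + term x0 h (- (pi / 2)) (opp2 k) t).
Proof.
move=> h6 hc k0 ht; have h0 : 0 < h by lra.
have hV : 0 < h^-1 by rewrite invr_gt0.
have tE p l : l != (0, 0) ->
    term x0 h p l t = osc (b l) p t * amp (cap (L l) (b l) h^-1) p t.
  by move=> l0; rewrite /term /lobe_amp (negbTE l0) box_in // [1 * _]mul1r.
have k0' : opp2 k != (0, 0) by rewrite opp2_eq0.
rewrite (tE 0 _ k0) (tE _ _ k0) (tE 0 _ k0') (tE _ _ k0') LN.
have /= := Ir_split (nL k0) (L0 k) hV (long h0 hc k0) t.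
by rewrite opprK.
Qed.

(** [Ir_mid] contributes [h ^ -3], and the slice at depth [h ^ -1] contributes [h ^ -1/2] and the
    power of [nrm]. *)
Lemma mid_bound h k t : 6 <= h -> 4 / c0 <= h -> k != (0, 0) -> h ^+ 2 / 2 <= t ->
  `|Ir (fun x => mid (L k) (- b (opp2 k)) (b k) h^-1 x * osc t 0 x)| <=
  16 * Num.sqrt K2 / (h ^+ 3 * Num.sqrt h) / (Num.sqrt (nrm (vec R k)) * nrm (vec R k)).
Proof.
move=> h6 hc k0 ht; have h0 : 0 < h by lra.
have hV : 0 < h^-1 by rewrite invr_gt0.
have hh : 0 < h ^+ 2 by rewrite exprn_gt0.
have t0 : 0 < t by lra.
have tW : 1 <= t * h^-1.
  rewrite ler_pdivlMr // mul1r; apply: le_trans ht.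
  by rewrite expr2 ler_pdivlMr // mulrC ler_pM2r //; lra.
have out x : x <= - b (opp2 k) \/ b k <= x -> L k x = 0 by exact: Lout.
have := Ir_mid (nL k0) (cL k0) (L0 k) (Lc k0) (Ld k0) out hV (long h0 hc k0) 0 t0 tW.
move=> /le_trans; apply.
have nk : 0 < nrm (vec R k) by apply: lt_le_trans (nrm_vec_ge1 R k0).
have S (l : int * int) : l != (0, 0) -> nrm (vec R l) = nrm (vec R k) ->
    L l (b l - h^-1) <= Num.sqrt K2 / Num.sqrt h / (Num.sqrt (nrm (vec R k)) * nrm (vec R k)).
  move=> l0 lk; have := slice_len_sqrt oO c0_gt0 OM cOm K20 chord (vec_neq0 R l0) (ltW hV).
  move=> /le_trans; apply; rewrite lk le_eqVlt; apply/orP; left; apply/eqP.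
  rewrite sqrtrM ?mulr_ge0 ?(ltW hV) // sqrtrM // !sqrtrV ?(ltW nk) ?(ltW h0) //.
  have s1 : Num.sqrt h != 0 by rewrite gt_eqF // sqrtr_gt0.
  have s2 : Num.sqrt (nrm (vec R k)) != 0 by rewrite gt_eqF // sqrtr_gt0.
  move: (Num.sqrt h) (Num.sqrt (nrm _)) (Num.sqrt K2) s1 s2 => y z u s1 s2.
  by field; rewrite s1 s2 gt_eqF.
have S1 := S _ k0 erefl.
have k0' : opp2 k != (0, 0) by rewrite opp2_eq0.
have S2 := S _ k0' (nrm_opp2 k).
have {}S2 : L k (- b (opp2 k) + h^-1) <= Num.sqrt K2 / Num.sqrt h / (Num.sqrt (nrm (vec R k)) * nrm (vec R k)).
  by move: S2; rewrite LN; congr (L k _ <= _); ring.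
have tp : 2 / (t ^+ 2 * h^-1) <= 8 / h ^+ 3.
  rewrite ler_pdivrMr ?mulr_gt0 ?exprn_gt0 //.
  have -> : 8 / h ^+ 3 * (t ^+ 2 * h^-1) = 8 * t ^+ 2 / (h ^+ 2) ^+ 2 by field; rewrite gt_eqF.
  rewrite ler_pdivlMr ?exprn_gt0 //.
  have : (h ^+ 2) ^+ 2 <= (2 * t) ^+ 2 by rewrite lerXn2r ?nnegrE //; lra.
  rewrite exprMn; lra.
have P : 0 <= 2 / (t ^+ 2 * h^-1) by apply: divr_ge0 => //; apply: mulr_ge0; [exact: sqr_ge0|exact: ltW].
apply: le_trans (ler_pM P (addr_ge0 (L0 _ _) (L0 _ _)) tp (lerD S2 S1)) _.
have s1 : Num.sqrt h != 0 by rewrite gt_eqF // sqrtr_gt0.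
have s2 : Num.sqrt (nrm (vec R k)) != 0 by rewrite gt_eqF // sqrtr_gt0.
rewrite le_eqVlt; apply/orP; left; apply/eqP.
move: (Num.sqrt h) (Num.sqrt (nrm _)) (Num.sqrt K2) s1 s2 => y z u s1 s2.
by field; rewrite s1 s2 !gt_eqF.
Qed.

(** Five sums are squared: the middle parts, then two phases for each of the two ends. The middle is
    bounded pointwise by [h ^ -3]; an end piece gives [h * a0 h ^+ 2] times the bounded sum of
    [weighted_bins]. Both are of order [h ^ -5]. *)
Lemma window_trig (Gam : R) : 0 <= Gam -> exists2 C : R, 0 < C & exists2 h0 : R, 6 <= h0 &
  forall h x0 s (g : int * int -> R), h0 <= h -> h ^+ 2 <= x0 -> uniq s ->
  (forall k, k \in s -> k != (0, 0)) ->
  (forall k, `|g k| <= Gam) -> (forall k, `|g k| * nrm (vec R k) ^+ 2 <= Gam * h ^+ 2) ->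
  Ir (fun t => chi x0 h t *
    (\sum_(k <- s) g k * Ir (fun x => slice_len Om (vec R k) x * osc t 0 x)) ^+ 2) <= C / h ^+ 5.
Proof.
move=> G0.
have fin (i1 i2 i3 i4 i5 u v w : R) : i1 <= u * w -> i2 <= v * w -> i3 <= v * w ->
    i4 <= v * w -> i5 <= v * w ->
    5 * i1 + 5 * i2 + 5 * i3 + 5 * i4 + 5 * i5 <= (5 * u + 20 * v) * w.
  by move=> *; lra.
have alg (g a c d e f : R) : g * (a + (c + d) + (e + f)) = g * a + g * c + g * d + g * e + g * f.
  by ring.
have [C1 C10 [h1 h11 H1]] := weighted_bins oO cO c0_gt0 M_gt0 OM cOm K20 chord G0.
have [C2 C20 H2] := weighted_sum c0_gt0 M_gt0 OM cOm G0.
pose CM := 16 * Num.sqrt K2 * C2.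
pose CX := 240 * 32 * 32 * (20 * 768) ^+ 2 * C1.
have CX0 : 0 < CX.
  by rewrite /CX; do ![rewrite ltr0n | exact: C10 | apply: exprn_gt0 | apply: mulr_gt0].
exists (5 * (147 * 6 * CM ^+ 2) + 20 * CX).
  by apply: ltr_wpDl; [apply: mulr_ge0 => //; apply: mulr_ge0 => //; exact: sqr_ge0|exact: mulr_gt0].
exists (h1 + 6 + 4 / c0); first by have : 0 < 4 / c0; [rewrite divr_gt0|lra].
move=> h x0 s g hh hx us s0 g1 g2.
have c4 : 0 < 4 / c0 by rewrite divr_gt0.
have h6 : 6 <= h by lra.
have hc : 4 / c0 <= h by lra.
have hh1 : h1 <= h by lra.
have h0 : 0 < h by lra.
have hV : 0 < h^-1 by rewrite invr_gt0.
pose box t : R := \1_(`[x0 - 3 * h, x0 + 3 * h]%classic : set R) t.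
pose md k t : R := if k == (0, 0) then 0 else
  box t * Ir (fun x => mid (L k) (- b (opp2 k)) (b k) h^-1 x * osc t 0 x).
have nmd k : nice (md k).
  rewrite /md; case: (boolP (k == _)) => k0; first exact: nice0.
  apply: nice_osc_transform; apply: nice_mid; [exact: nL|exact: L0|exact: hV|exact: long].
pose X p (t : R) := \sum_(k <- s) g k * term x0 h p k t.
pose Y p (t : R) := \sum_(k <- s) g k * term x0 h p (opp2 k) t.
pose Z (t : R) := \sum_(k <- s) g k * md k t.
have nterm p k : nice (term x0 h p k).
  apply: (eq_nice _ (nice_osc (b k) p (nice_lobe_amp x0 p k h0 hc))) => t.
  by rewrite mulrC.
have nX p : nice (X p) by apply: nice_sum => k; exact: niceZ.
have nY p : nice (Y p) by apply: nice_sum => k; exact: niceZ.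
have nZ : nice Z by apply: nice_sum => k; exact: niceZ.
have nchi := nice_window x0 h0.
have nsq f : nice f -> nice (fun t => chi x0 h t * f t ^+ 2).
  by move=> nf; apply: niceM => //; apply: (eq_nice _ (niceM nf nf)) => t; rewrite expr2.
pose q : R := - (pi / 2).
have E t : chi x0 h t * (\sum_(k <- s) g k * Ir (fun x => L k x * osc t 0 x)) ^+ 2 =
    chi x0 h t * (Z t + X 0 t + X q t + Y 0 t + Y q t) ^+ 2.
  case: (boolP (x0 - 3 * h <= t <= x0 + 3 * h)) => ht; last first.
    rewrite chi_out ?mul0r //; apply: contraNT ht; rewrite -ltNge ltr_norml => /andP[? ?].
    by apply/andP; split; lra.
  congr (_ * _ ^+ 2); rewrite /Z /X /Y -!big_split /= big_seq [RHS]big_seq.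
  apply: eq_bigr => k /s0 k0.
  have -> : Ir (fun x => L k x * osc t 0 x) = md k t + (term x0 h 0 k t + term x0 h q k t) +
      (term x0 h 0 (opp2 k) t + term x0 h q (opp2 k) t).
    by rewrite (transform_split h6 hc k0 ht) /md (negbTE k0) /box box_in // [1 * _]mul1r.
  exact: alg.
rewrite (eq_Ir E).
apply: le_trans (Ir_square_sum5 nchi (@chi_ge0 _ x0 h) nZ (nX 0) (nX q) (nY 0) (nY q)) _.
have hp n : 0 < h ^+ n by rewrite exprn_gt0.
have BX p (s' : seq (int * int)) (g' : int * int -> R) : uniq s' ->
    (forall k, k \in s' -> k != (0, 0)) -> (forall k, `|g' k| <= Gam) ->
    (forall k, `|g' k| * nrm (vec R k) ^+ 2 <= Gam * h ^+ 2) ->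
    Ir (fun t => chi x0 h t * (\sum_(k <- s') g' k * term x0 h p k t) ^+ 2) <= CX / h ^+ 5.
  move=> us' s0' g1' g2'.
  have A0 k : 0 <= a0 h * tip_len Om h k.
    apply: mulr_ge0; last by apply: tip_len_ge0; exact: ltW.
    exact: (a0_ge0 (ltW h0)).
  have := window_mean_square s' g' p h0 b_ge0 A0 (fun k => nice_meas (nice_lobe_amp x0 p k h0 hc))
    (fun k => lobe_reg p k h6 hc hx).
  move=> /le_trans; apply.
  have W := H1 h s' g' hh1 us' s0' g1' g2'.
  rewrite (eq_bigr (fun k => a0 h ^+ 2 * \sum_(l <- s' | Num.truncn (h * b l) == Num.truncn (h * b k))
      (`|g' k| * tip_len Om h k) * (`|g' l| * tip_len Om h l))) => [|k _]; last first.
    by rewrite mulr_sumr; apply: eq_bigr => l _; ring.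
  rewrite -mulr_sumr.
  have P : 0 <= 240 * 32 * 32 * h * a0 h ^+ 2.
    by do ![exact: ler0n | exact: (ltW h0) | exact: sqr_ge0 | apply: mulr_ge0].
  rewrite mulrA; apply: le_trans (ler_wpM2l P W) _.
  rewrite le_eqVlt; apply/orP; left; apply/eqP; rewrite /CX /a0; field.
  by rewrite gt_eqF.
(* The left end of the profile of [k] is the right end of that of [opp2 k], so reindexing reduces to
   [BX]. *)
have BY p : Ir (fun t => chi x0 h t * Y p t ^+ 2) <= CX / h ^+ 5.
  have EY t : Y p t = \sum_(k <- map opp2 s) g (opp2 k) * term x0 h p k t.
    by rewrite big_map /Y; apply: eq_bigr => k _; rewrite opp2K.
  rewrite (eq_Ir (g := fun t => chi x0 h t *
     (\sum_(k <- map opp2 s) g (opp2 k) * term x0 h p k t) ^+ 2)); last by move=> t; rewrite EY.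
  apply: BX.
  - by rewrite map_inj_uniq //; exact: (can_inj opp2K).
  - by move=> k /mapP[l ls ->]; rewrite opp2_eq0; exact: s0.
  - by move=> k; exact: g1.
  - by move=> k; rewrite -nrm_opp2; exact: g2.
have BZ : Ir (fun t => chi x0 h t * Z t ^+ 2) <= 147 * 6 * CM ^+ 2 / h ^+ 5.
  have Zb t : chi x0 h t * Z t ^+ 2 <= (CM / h ^+ 3) ^+ 2 * chi x0 h t.
    rewrite mulrC; apply: ler_wpM2r; first exact: chi_ge0.
    rewrite -(real_normK (num_real (Z t))); rewrite lerXn2r ?nnegrE //.
      apply: divr_ge0; last exact: ltW.
      by rewrite /CM; apply: mulr_ge0; [apply: mulr_ge0 => //; exact: sqrtr_ge0|exact: ltW].
    apply: le_trans (ler_norm_sum _ _ _) _.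
    have sh : 0 < Num.sqrt h by rewrite sqrtr_gt0.
    have cc : 0 <= 16 * Num.sqrt K2 / (h ^+ 3 * Num.sqrt h).
      apply: divr_ge0; first by apply: mulr_ge0 => //; exact: sqrtr_ge0.
      by apply: ltW; exact: mulr_gt0.
    apply: (@le_trans _ _ (16 * Num.sqrt K2 / (h ^+ 3 * Num.sqrt h) *
        \sum_(k <- s) `|g k| / (Num.sqrt (nrm (vec R k)) * nrm (vec R k)))).
      rewrite mulr_sumr big_seq [leRHS]big_seq; apply: ler_sum => k /s0 k0.
      rewrite normrM mulrCA; apply: ler_wpM2l => //.
      have d0 : 0 <= Num.sqrt (nrm (vec R k)) * nrm (vec R k).
        by apply: mulr_ge0; [exact: sqrtr_ge0|exact: nrm_ge0].
      rewrite /md (negbTE k0); case: (boolP (x0 - 3 * h <= t <= x0 + 3 * h)) => ht; last first.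
        by rewrite /box box_out // mul0r normr0; apply: divr_ge0.
      rewrite /box box_in // mul1r; apply: mid_bound => //; case/andP: ht => ht _.
      by have : 6 * h <= h ^+ 2; [rewrite expr2 ler_pM2r|lra].
    have h1' : 1 <= h by lra.
    apply: le_trans (ler_wpM2l cc (H2 h s g h1' us s0 g1 g2)) _.
    rewrite le_eqVlt; apply/orP; left; apply/eqP; rewrite /CM.
    have sn : Num.sqrt h != 0 by rewrite gt_eqF.
    move: (Num.sqrt h) sn => y yn; field; by rewrite yn gt_eqF.
  apply: le_trans (Ir_le (nsq _ nZ) (niceZ _ nchi) Zb) _; rewrite IrZ //.
  apply: le_trans (ler_wpM2l (sqr_ge0 _) (Ir_window x0 h0)) _.
  rewrite le_eqVlt; apply/orP; left; apply/eqP; field; by rewrite gt_eqF.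
have B1 := BX 0 s g us s0 g1 g2; have B2 := BX q s g us s0 g1 g2.
have B3 := BY 0; have B4 := BY q.
exact: (fin _ _ _ _ _ _ _ _ BZ B1 B2 B3 B4).
Qed.

End Window.

(** * Smoothed lattice point counts *)

Section DoubleIntegral.
Variable R : realType.
Implicit Types (f g : R * R -> R).

Lemma eq_I2 f g : f =1 g -> I2 f = I2 g.
Proof. by move=> fg; apply: eq_Ir => x; apply: eq_Ir => y. Qed.

Lemma I2_ge0 f : (forall x, 0 <= f x) -> 0 <= I2 f.
Proof. by move=> f0; apply: Ir_ge0 => x; apply: Ir_ge0 => y. Qed.

Lemma I2_le f g : nice2 f -> nice2 g -> (forall x, f x <= g x) -> I2 f <= I2 g.
Proof.
move=> nf ng fg; apply: Ir_le; [exact: nice_marg|exact: nice_marg|] => x.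
by apply: Ir_le => [||y]; [exact: nice2_sec1|exact: nice2_sec1|].
Qed.

Lemma I2Z (a : R) f : nice2 f -> I2 (fun x => a * f x) = a * I2 f.
Proof.
move=> nf; rewrite /I2 -IrZ; last exact: nice_marg.
by apply: eq_Ir => x; rewrite IrZ //; exact: nice2_sec1.
Qed.

Lemma I2D f g : nice2 f -> nice2 g ->
  I2 (fun x => f x + g x) = I2 f + I2 g.
Proof.
move=> nf ng; rewrite /I2 -IrD; [|exact: nice_marg|exact: nice_marg].
by apply: eq_Ir => x; rewrite IrD //; exact: nice2_sec1.
Qed.

Lemma I2B f g : nice2 f -> nice2 g -> I2 (fun x => f x - g x) = I2 f - I2 g.
Proof.
move=> nf ng; rewrite /I2 -IrB; [|exact: nice_marg|exact: nice_marg].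
by apply: eq_Ir => x; rewrite IrB //; exact: nice2_sec1.
Qed.

Lemma I2_sum (I : Type) (s : seq I) (F : I -> R * R -> R) : (forall i, nice2 (F i)) ->
  I2 (fun x => \sum_(i <- s) F i x) = \sum_(i <- s) I2 (F i).
Proof.
move=> nF; rewrite /I2 -Ir_sum; last by move=> i; exact: nice_marg.
apply: eq_Ir => x; rewrite Ir_sum // => i; exact: (nice2_sec1 x (nF i)).
Qed.

Lemma eq_nice2 f g : f =1 g -> nice2 f -> nice2 g.
Proof. by move=> /funext ->. Qed.

End DoubleIntegral.

(** * Lattice counts between smoothed counts *)

Section Count.
Variable R : realType.
Implicit Types (m k p : int * int) (t : R) (B : nat).

Definition sq B : seq (int * int) := [seq (a, c) | a <- zs B, c <- zs B].

Lemma mem_sq B p : (p \in sq B) = (p.1 \in zs B) && (p.2 \in zs B).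
Proof.
apply/allpairsP/andP => [[[x y] /= [h1 h2 ->]]|[h1 h2]] //.
by exists p; split=> //; exact: surjective_pairing.
Qed.

Lemma uniq_sq B : uniq (sq B).
Proof. by apply: allpairs_uniq => [||[a c] [a' c'] _ _ []]; rewrite ?uniq_zs // => -> ->. Qed.

Lemma sum_sqN B (F : int * int -> R) : \sum_(m <- sq B) F (opp2 m) = \sum_(m <- sq B) F m.
Proof.
rewrite -(big_map opp2 xpredT F); apply: perm_big; apply: uniq_perm.
- by rewrite map_inj_uniq ?uniq_sq //; exact: (can_inj opp2K).
- exact: uniq_sq.
move=> z; rewrite -{1}[z]opp2K mem_map; last exact: (can_inj opp2K).
by rewrite !mem_sq !mem_zs /= !abszN.
Qed.

Lemma zs_bound B (z : int) : `|z%:~R : R| <= B%:R -> z \in zs B.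
Proof. by rewrite mem_zs -intr_norm -[B%:R]/(B%:~R) ler_int; lia. Qed.

Variables (Om : set (R * R)) (c0 M : R).
Hypotheses (oO : open Om) (cO : convex2 Om) (c0_gt0 : 0 < c0) (M_gt0 : 0 < M).
Hypothesis (OM : forall x : R * R, Om x -> nrm x <= M).
Hypothesis (cOm : forall x : R * R, `|x.1| <= c0 -> `|x.2| <= c0 -> Om x).

Definition hit t p : bool := `[< dilate t Om (vec R p) >].

Lemma dilate_mono (s t : R) x : 0 <= s -> s <= t -> dilate s Om x -> dilate t Om x.
Proof.
move=> s0 st [z Oz <-]; have [t0|t0] := ltP 0 t; last first.
  have -> : t = s by lra.
  by exists z.
have sl : 0 <= s / t <= 1.
  by apply/andP; split; [apply: divr_ge0 => //; exact: ltW|rewrite ler_pdivrMr // mul1r].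
have := cO (Om0 c0_gt0 cOm) Oz sl; rewrite /= !mulr0 !add0r => H.
by exists (s / t * z.1, s / t * z.2) => //=; congr (_, _); field; rewrite gt_eqF.
Qed.

(** The point [u / d] lies in the inscribed square, and the sum is [t + d] times a convex
    combination with weights [t / (t + d)] and [d / (t + d)]. *)
Lemma dilate_thicken t (d : R) x (u : R * R) : 0 <= t -> 0 < d -> dilate t Om x ->
  `|u.1| <= d * c0 -> `|u.2| <= d * c0 -> dilate (t + d) Om (x.1 + u.1, x.2 + u.2).
Proof.
move=> t0 d0 [z Oz <-] u1 u2; have td : 0 < t + d by lra.
have Ou : Om (u.1 / d, u.2 / d).
  by apply: cOm; rewrite /= normrM (gtr0_norm (x := d^-1)) ?invr_gt0 // ler_pdivrMr // mulrC.
have l : 0 <= d / (t + d) <= 1.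
  apply/andP; split; first by apply: divr_ge0; exact: ltW.
  by rewrite ler_pdivrMr // mul1r; lra.
have H := cO Oz Ou l; eexists; first exact: H.
by congr (_, _) => /=; field; rewrite !gt_eqF.
Qed.

Lemma dilate_bound t x : 0 <= t -> dilate t Om x -> `|x.1| <= t * M /\ `|x.2| <= t * M.
Proof.
move=> t0 [z Oz <-] /=; have zM := OM Oz.
have z1 := le_trans (abs1_le_nrm z) zM; have z2 := le_trans (abs2_le_nrm z) zM.
by rewrite !normrM (ger0_norm t0); split; apply: ler_wpM2l.
Qed.

Lemma dilate_sq t B p : 0 <= t -> t * M <= B%:R -> dilate t Om (vec R p) -> p \in sq B.
Proof.
move=> t0 tB /(dilate_bound t0) [h1 h2].
by rewrite mem_sq !zs_bound ?(le_trans _ tB).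
Qed.

Lemma latcountE t B : 0 <= t -> t * M <= B%:R -> latcount Om t = \sum_(p <- sq B) (hit t p)%:R.
Proof.
move=> t0 tB; rewrite /latcount.
set S := [set p | _].
have SE : S = [set` sq B] `&` S.
  by apply/esym/setIidr => p hp /=; apply: (dilate_sq t0 tB).
rewrite SE esum_mkcondr esum_fset; [|exact: finite_seq|by move=> p _; case: ifP].
rewrite -fsbig_seq ?uniq_sq // (eq_bigr (fun p => ((hit t p)%:R)%:E)) => [|p _].
  by rewrite sumEFin.
by case: (boolP (hit t p)) => /asboolP h; [rewrite mem_set|rewrite memNset].
Qed.

Lemma latcount_mono (s t : R) : 0 <= s -> s <= t -> latcount Om s <= latcount Om t.
Proof.
move=> s0 st; have t0 : 0 <= t by exact: le_trans st.
have tM : 0 <= t * M by apply: mulr_ge0 => //; exact: ltW.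
pose B := (Num.truncn (t * M)).+1.
have tB : t * M <= B%:R by have /andP[_ /ltW] := truncn_itv tM.
have sB : s * M <= B%:R by apply: le_trans tB; rewrite ler_pM2r.
rewrite (latcountE s0 sB) (latcountE t0 tB); apply: ler_sum => p _.
rewrite ler_nat; case: (boolP (hit s p)) => // /asboolP h.
by have -> : hit t p by apply/asboolP; exact: dilate_mono h.
Qed.

Lemma latcount_ge0 t : 0 <= t -> 0 <= latcount Om t.
Proof.
move=> t0; have tM : 0 <= t * M by apply: mulr_ge0 => //; exact: ltW.
have tB : t * M <= (Num.truncn (t * M)).+1%:R by have /andP[_ /ltW] := truncn_itv tM.
by rewrite (latcountE t0 tB); apply: sumr_ge0.
Qed.

Lemma nice2_indic (F : R * R -> R) C : measurable_fun setT F -> (forall x, `|F x| <= C) ->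
  nice2 (fun x => \1_Om x * F x).
Proof.
move=> mF FC; apply: (@nice2_bound _ _ C M).
- apply: measurable_funM => //; apply: measurable_indic; exact: measurable_open2.
- move=> x; rewrite indicE; case: (_ \in _); first by rewrite mul1r.
  by rewrite mul0r normr0; exact: le_trans (FC x).
move=> x h; rewrite indicE; case: (boolP (x \in Om)) => [|_]; last by rewrite mul0r.
rewrite inE => /OM xM; case: h; rewrite ltNge.
  by rewrite (le_trans (abs1_le_nrm x) xM).
by rewrite (le_trans (abs2_le_nrm x) xM).
Qed.

Lemma areaE : area Om = I2 (\1_Om : R * R -> R).
Proof.
have n2 : nice2 (\1_Om : R * R -> R).
  apply: (eq_nice2 _ (@nice2_indic (fun=> 1) 1 _ _)) => //.
    by move=> x; rewrite mulr1.
  by move=> x; rewrite normr1.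
rewrite (I2_prod n2) /Rintegral integral_indic ?setIT //.
exact: measurable_open2.
Qed.

Lemma area_ge0 : 0 <= area Om.
Proof. by rewrite areaE; apply: I2_ge0 => x; rewrite indicE. Qed.

Variable eps : R.
Hypothesis eps0 : 0 < eps.
(** The dilate of [Om] by [d] contains the square of half-side [eps] that supports the smoothing
    kernel. *)
Let d := eps / c0.
Let d0 : 0 < d. Proof. exact: divr_gt0. Qed.
Let dc : d * c0 = eps. Proof. by rewrite /d divfK // gt_eqF. Qed.

Let bumps t m (x : R * R) := tri eps (t * x.1 + m.1%:~R) * tri eps (t * x.2 + m.2%:~R).

Let nice_tri_affine t (z : int) : 0 < t -> nice (fun x => tri eps (t * x + z%:~R)).
Proof. by move=> t0; apply: nice_affine; [rewrite gt_eqF|exact: nice_tri]. Qed.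

Let nice2_bumps t m : 0 < t -> nice2 (bumps t m).
Proof.
move=> t0.
have /niceP[N1 [N10 m1 b1 o1]] := nice_tri_affine m.1 t0.
have /niceP[N2 [N20 m2 b2 o2]] := nice_tri_affine m.2 t0.
apply: (@nice2_bound _ _ (N1 * N2) (N1 + N2)).
- apply: measurable_funM; first by apply: (measurableT_comp m1); exact: measurable_fst.
  by apply: (measurableT_comp m2); exact: measurable_snd.
- by move=> x; rewrite normrM; apply: ler_pM.
move=> x [h|h]; rewrite /bumps; first by rewrite o1 ?mul0r //; lra.
by rewrite o2 ?mulr0 //; lra.
Qed.

Let I2_bumps t m : 0 < t -> I2 (bumps t m) = t ^- 2.
Proof.
move=> t0; have n0 (z : int) := nice_tri_affine z t0.
have I0 (z : int) : Ir (fun x => tri eps (t * x + z%:~R)) = t^-1.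
  rewrite Ir_affine ?Ir_tri ?mulr1 ?gtr0_norm ?gt_eqF //; exact: nice_tri.
rewrite /I2 (eq_Ir (g := fun x => t^-1 * tri eps (t * x + m.1%:~R))) => [|x].
  by rewrite IrZ // I0 -expr2 exprVn.
by rewrite /bumps /= IrZ // I0 mulrC.
Qed.

Let bumps_ge0 t m x : 0 <= bumps t m x.
Proof. by apply: mulr_ge0; apply: tri_ge0. Qed.

Let bumps_near t m x : bumps t m x != 0 ->
  `|t * x.1 + m.1%:~R| <= eps /\ `|t * x.2 + m.2%:~R| <= eps.
Proof.
move=> h; split; rewrite leNgt; apply: contra h => /ltW h; rewrite /bumps.
  by rewrite (tri_out eps0 h) mul0r.
by rewrite (tri_out eps0 h) mulr0.
Qed.

Let nice2_cut t m : 0 < t -> nice2 (fun x => \1_Om x * bumps t m x).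
Proof.
move=> t0; have /nice2P[N [N0 mb bb _]] := nice2_bumps m t0.
exact: nice2_indic bb.
Qed.

Let cut_le t m : 0 < t -> I2 (fun x => \1_Om x * bumps t m x) <= t ^- 2.
Proof.
move=> t0; rewrite -(I2_bumps m t0); apply: I2_le => [||x]; [exact: nice2_cut|exact: nice2_bumps|].
rewrite indicE; case: (_ \in _); first by rewrite mul1r.
by rewrite mul0r.
Qed.

Let cut_out t m : 0 < t -> ~~ hit (t + d) (opp2 m) -> I2 (fun x => \1_Om x * bumps t m x) = 0.
Proof.
move=> t0 nh; rewrite (eq_I2 (g := fun=> 0)) => [|x].
  by rewrite /I2 (eq_Ir (g := fun=> 0)) ?Ir0 // => x; exact: Ir0.
rewrite indicE; case: (boolP (x \in Om)) => [|_]; last by rewrite mul0r.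
rewrite inE mul1r => Ox; apply/eqP; apply: contraNT nh => /bumps_near[h1 h2].
apply/asboolP; have Dx : dilate t Om (t * x.1, t * x.2) by exists x.
have := @dilate_thicken t d _ (- (t * x.1 + m.1%:~R), - (t * x.2 + m.2%:~R)) (ltW t0) d0 Dx.
rewrite /= !normrN dc => /(_ h1 h2); rewrite /vec /opp2 /= !intrN.
by congr (dilate _ _ (_, _)); ring.
Qed.

Let cut_in t m : d < t -> hit (t - d) (opp2 m) -> I2 (fun x => \1_Om x * bumps t m x) = t ^- 2.
Proof.
move=> td /asboolP h; have t0 : 0 < t by exact: lt_trans td.
rewrite -(I2_bumps m t0); apply: eq_I2 => x.
have [->|/bumps_near[h1 h2]] := eqVneq (bumps t m x) 0; first by rewrite mulr0.
have td0 : 0 <= t - d by rewrite subr_ge0 ltW.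
have := dilate_thicken (u := (t * x.1 + m.1%:~R, t * x.2 + m.2%:~R)) td0 d0 h.
rewrite dc subrK => /(_ h1 h2) [z Oz] /= [e1 e2].
have -> : x = z.
  rewrite /vec /opp2 /= !intrN in e1 e2.
  rewrite [x]surjective_pairing [z]surjective_pairing.
  by congr (_, _); apply: (@mulfI _ t); rewrite ?gt_eqF //; lra.
by rewrite indicE mem_set // mul1r.
Qed.

(** Each kernel has integral [t ^- 2]. One that meets [Om] comes from a lattice point of the larger
    dilate ([cut_out]), and one from a lattice point of the smaller dilate lies wholly in [Om]
    ([cut_in]). *)
Lemma spike_sandwich t B : d < t -> (t + d) * M <= B%:R ->
  t ^- 2 * latcount Om (t - d) <=
    I2 (fun x => \1_Om x * (spike eps B (t * x.1) * spike eps B (t * x.2)))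
  <= t ^- 2 * latcount Om (t + d).
Proof.
move=> td tB; have dp := d0; have t0 : 0 < t by exact: lt_trans td.
have tm0 : 0 <= t - d by rewrite subr_ge0 ltW.
have tp0 : 0 <= t + d by apply: addr_ge0; exact: ltW.
have tB' : (t - d) * M <= B%:R by apply: le_trans tB; rewrite ler_pM2r //; lra.
have t2 : 0 <= t ^- 2 by rewrite invr_ge0 exprn_ge0 // ltW.
have -> : I2 (fun x => \1_Om x * (spike eps B (t * x.1) * spike eps B (t * x.2))) =
    \sum_(m <- sq B) I2 (fun x => \1_Om x * bumps t m x).
  rewrite -I2_sum; last by move=> m; exact: nice2_cut.
  apply: eq_I2 => x; rewrite -mulr_sumr; congr (_ * _).
  rewrite /spike big_distrlr /= /sq big_allpairs_dep /=; exact: eq_bigr.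
rewrite (latcountE tm0 tB') (latcountE tp0 tB) -(sum_sqN B (fun p => (hit (t - d) p)%:R)).
rewrite -(sum_sqN B (fun p => (hit (t + d) p)%:R)) !mulr_sumr; apply/andP; split.
  apply: ler_sum => m _; case: (boolP (hit (t - d) (opp2 m))) => h.
    by rewrite mulr1 cut_in.
  rewrite mulr0; apply: I2_ge0 => x; apply: mulr_ge0; last exact: bumps_ge0.
  by rewrite indicE.
apply: ler_sum => m _; case: (boolP (hit (t + d) (opp2 m))) => h.
  by rewrite mulr1; exact: cut_le.
by rewrite mulr0 cut_out.
Qed.

End Count.

(** * Fourier expansion of the smoothed count *)

Section Expansion.
Variable R : realType.
Implicit Types (k m : int * int) (t h : R) (n B : nat).
Variables (Om : set (R * R)) (c0 M : R).
Hypotheses (oO : open Om) (cO : convex2 Om) (c0_gt0 : 0 < c0) (M_gt0 : 0 < M).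
Hypothesis (OM : forall x : R * R, Om x -> nrm x <= M).
Hypothesis (cOm : forall x : R * R, `|x.1| <= c0 -> `|x.2| <= c0 -> Om x).

Definition flip k : int * int := (k.1, - k.2).

Lemma flipK : involutive flip. Proof. by case=> a c; rewrite /flip /= opprK. Qed.

Lemma flip_eq0 k : (flip k == (0, 0)) = (k == (0, 0)).
Proof. by case: k => a c; rewrite /flip /= !xpair_eqE oppr_eq0. Qed.

Lemma nrm_flip k : nrm (vec R (flip k)) = nrm (vec R k).
Proof. by rewrite /nrm /vec /flip /= intrN sqrrN. Qed.

Variable eps : R.
Hypothesis eps0 : 0 < eps.

Definition coef n k : R :=
  weight R n k.1 * gam eps k.1 * (weight R n k.2 * gam eps k.2).

Definition trig (s : seq (int * int)) (g : int * int -> R) t : R :=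
  \sum_(k <- s) g k * Ir (fun x => slice_len Om (vec R k) x * osc t 0 x).

Definition freqs n := [seq k <- sq n | k != (0, 0)].

Let Phi t k : R := I2 (fun x => \1_Om x * osc t 0 (dot2 x (vec R k))).

Let measurable_wave t (y : R * R) : measurable_fun setT (fun x : R * R => osc t 0 (dot2 x y)).
Proof.
apply: (measurableT_comp (@measurable_osc R t 0)); rewrite /dot2.
by apply: measurable_funD; apply: measurable_funM.
Qed.

Let nice2_wave t k : nice2 (fun x => \1_Om x * osc t 0 (dot2 x (vec R k))).
Proof. by apply: (nice2_indic oO OM (C := 1)) => // x; exact: osc_le1. Qed.

Let Phi0 t : Phi t (0, 0) = area Om.
Proof.
rewrite (areaE oO OM); apply: eq_I2 => x.
have -> : dot2 x (vec R (0, 0)) = 0 by rewrite /dot2 /vec /= mulr0z !mulr0 addr0.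
by rewrite /osc mulr0 addr0 cos0 mulr1.
Qed.

Let sum_Phi n t (F : int * int -> int * int) : F (0, 0) = (0, 0) ->
  (forall k, k != (0, 0) -> F k != (0, 0)) ->
  \sum_(k <- sq n.+1) coef n.+1 k * Phi t (F k) = area Om +
  \sum_(k <- freqs n.+1) coef n.+1 k *
    Ir (fun x => slice_len Om (vec R (F k)) x * osc t 0 x).
Proof.
move=> F0 F1; have m0 : (0, 0) \in sq n.+1 by rewrite mem_sq !mem_zs.
rewrite (bigD1_seq _ m0) ?uniq_sq //= F0 Phi0 /coef /= weight0 (gam0 eps0) !mulr1 mul1r.
congr (_ + _); rewrite -big_filter; rewrite big_seq [RHS]big_seq; apply: eq_bigr => k.
rewrite mem_filter => /andP[/F1 k0 _]; congr (_ * _).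
exact: (I2_slice oO c0_gt0 OM cOm t 0 (vec_neq0 R k0)).
Qed.

(** A product of two cosines is the half sum of the waves at [k] and at [flip k]. The zero frequency
    has coefficient 1 and contributes the area. *)
Lemma trig_expand n t :
  I2 (fun x => \1_Om x * (tsum eps n.+1 (t * x.1) * tsum eps n.+1 (t * x.2))) =
  area Om + (2^-1 * trig (freqs n.+1) (coef n.+1) t +
    2^-1 * trig (map flip (freqs n.+1)) (fun k => coef n.+1 (flip k)) t).
Proof.
pose G k x := 2^-1 * coef n.+1 k * (\1_Om x * osc t 0 (dot2 x (vec R k))) +
  2^-1 * coef n.+1 k * (\1_Om x * osc t 0 (dot2 x (vec R (flip k)))).
have nZ (a : R) k : nice2 (fun x => a * (\1_Om x * osc t 0 (dot2 x (vec R k)))).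
  apply: (eq_nice2 (f := fun x => \1_Om x * (a * osc t 0 (dot2 x (vec R k))))) => [x|].
    by rewrite mulrCA.
  apply: (nice2_indic oO OM (C := `|a|)); first exact: measurable_funM.
  by move=> x; rewrite normrM ler_piMr // osc_le1.
have nG k : nice2 (G k).
  pose H x := 2^-1 * coef n.+1 k * osc t 0 (dot2 x (vec R k)) +
     2^-1 * coef n.+1 k * osc t 0 (dot2 x (vec R (flip k))).
  apply: (eq_nice2 (f := fun x => \1_Om x * H x)) => [x|].
    by rewrite /H /G mulrDr !(mulrCA (\1_Om x)).
  apply: (nice2_indic oO OM (C := `|2^-1 * coef n.+1 k| + `|2^-1 * coef n.+1 k|)).
    by apply: measurable_funD; apply: measurable_funM.
  move=> x; apply: le_trans (ler_normD _ _) _.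
  by apply: lerD; rewrite normrM ler_piMr // osc_le1.
have E x : \1_Om x * (tsum eps n.+1 (t * x.1) * tsum eps n.+1 (t * x.2)) =
    \sum_(k <- sq n.+1) G k x.
  have -> : tsum eps n.+1 (t * x.1) * tsum eps n.+1 (t * x.2) =
      \sum_(a <- zs n.+1) \sum_(c <- zs n.+1)
        weight R n.+1 a * gam eps a * osc a%:~R 0 (t * x.1) *
        (weight R n.+1 c * gam eps c * osc c%:~R 0 (t * x.2)).
    by rewrite !tsum_weight mulr_suml; apply: eq_bigr => a _; rewrite mulr_sumr.
  rewrite /sq big_allpairs_dep /= mulr_sumr.
  apply: eq_bigr => a _; rewrite mulr_sumr; apply: eq_bigr => c _.
  rewrite /G /coef /flip /osc /dot2 /vec /= intrN !addr0.
  have -> : 2 * pi * t * (x.1 * a%:~R + x.2 * c%:~R) =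
    2 * pi * a%:~R * (t * x.1) + 2 * pi * c%:~R * (t * x.2) by ring.
  have -> : 2 * pi * t * (x.1 * a%:~R + x.2 * - c%:~R) =
    2 * pi * a%:~R * (t * x.1) - 2 * pi * c%:~R * (t * x.2) by ring.
  rewrite cosD cosB.
  move: (weight _ _ a) (weight _ _ c) (gam _ a) (gam _ c) => w1 w2 g1 g2.
  move: (cos _) (cos _) (sin _) (sin _) => c1 c2 s1 s2; by field.
rewrite (eq_I2 E) I2_sum //.
have IG k : I2 (G k) = 2^-1 * (coef n.+1 k * Phi t k) + 2^-1 * (coef n.+1 k * Phi t (flip k)).
  have -> := I2D (nZ (2^-1 * coef n.+1 k) k) (nZ (2^-1 * coef n.+1 k) (flip k)).
  rewrite (I2Z _ (nice2_wave t k)) (I2Z _ (nice2_wave t (flip k))) -/(Phi t k) -/(Phi t (flip k)).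
  by move: (Phi t k) (Phi t (flip k)) (coef _ _) => a c w; rewrite !mulrA.
have f1 k : k != (0, 0) -> flip k != (0, 0) by rewrite flip_eq0.
have S1 := sum_Phi n t (F := id) erefl (fun k nk => nk).
have S2 := sum_Phi n t (F := flip) erefl f1.
have lin (F1 F2 : int * int -> R) : \sum_(k <- sq n.+1) (2^-1 * F1 k + 2^-1 * F2 k) =
    2^-1 * (\sum_(k <- sq n.+1) F1 k) + 2^-1 * (\sum_(k <- sq n.+1) F2 k).
  by rewrite big_split /= !mulr_sumr.
have S3 : trig (map flip (freqs n.+1)) (fun k => coef n.+1 (flip k)) t =
  \sum_(k <- freqs n.+1) coef n.+1 k *
    Ir (fun x => slice_len Om (vec R (flip k)) x * osc t 0 x).
  by rewrite /trig big_map; apply: eq_bigr => k _; rewrite flipK.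
transitivity (2^-1 * (\sum_(k <- sq n.+1) coef n.+1 k * Phi t k) +
    2^-1 * (\sum_(k <- sq n.+1) coef n.+1 k * Phi t (flip k))).
  rewrite -(lin (fun k => coef n.+1 k * Phi t k) (fun k => coef n.+1 k * Phi t (flip k))).
  by apply: eq_bigr => k _; exact: IG.
transitivity (2^-1 * (area Om + trig (freqs n.+1) (coef n.+1) t) +
    2^-1 * (area Om + trig (map flip (freqs n.+1)) (fun k => coef n.+1 (flip k)) t)).
  by rewrite S3; congr (2^-1 * _ + 2^-1 * _); [exact: S1|exact: S2].
have half (z a c : R) : 2^-1 * (z + a) + 2^-1 * (z + c) = z + (2^-1 * a + 2^-1 * c) by field.
exact: half.
Qed.

(** The square of the norm is split by coordinates: one factor decays in its own coordinate while
    the other is at most 1, so 8 is [4 + 4]. *)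
Lemma coef_bounds n h k : eps = h^-1 -> 0 < h ->
  `|coef n k| <= 8 /\ `|coef n k| * nrm (vec R k) ^+ 2 <= 8 * h ^+ 2.
Proof.
move=> eh h0.
have w z : `|weight R n z * gam eps z| <= `|gam eps z|.
  rewrite normrM ger0_norm ?weight_ge0 // -[leRHS]mul1r; apply: ler_wpM2r => //.
  exact: weight_le1.
have w1 z : `|weight R n z * gam eps z| <= 1 by apply: le_trans (w z) (gam_le1 eps0 z).
have D z : `|weight R n z * gam eps z| * (z%:~R) ^+ 2 <= 4 * h ^+ 2.
  apply: le_trans (ler_wpM2r (sqr_ge0 _) (w z)) _.
  have := gam_decay eps0 z; rewrite eh exprMn exprVn => H.
  have hh : 0 < h ^+ 2 by rewrite exprn_gt0.
  have := ler_wpM2r (ltW hh) H; congr (_ <= _); field.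
  by rewrite gt_eqF.
rewrite /coef normrM nrmE /vec /=.
have D1 := D k.1; have D2 := D k.2; have u1 := w1 k.1; have u2 := w1 k.2.
have := normr_ge0 (weight R n k.1 * gam eps k.1).
have := normr_ge0 (weight R n k.2 * gam eps k.2).
move: `|weight R n k.1 * gam eps k.1| `|weight R n k.2 * gam eps k.2| D1 D2 u1 u2 => a c.
have := sqr_ge0 (k.1%:~R : R); have := sqr_ge0 (k.2%:~R : R).
move: (k.1%:~R ^+ 2) (k.2%:~R ^+ 2) => x y x0 y0 D1 D2 u1 u2 c0' a0.
split; first by have : a * c <= 1 by [rewrite -[leRHS]mul1r; apply: ler_pM]; lra.
have ax : 0 <= a * x by exact: mulr_ge0.
have cy : 0 <= c * y by exact: mulr_ge0.
have e1 : c * (a * x) <= a * x by rewrite -[leRHS]mul1r; apply: ler_wpM2r.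
have e2 : a * (c * y) <= c * y by rewrite -[leRHS]mul1r; apply: ler_wpM2r.
lra.
Qed.

Lemma tsum_uniform (T e : R) B : eps <= 1 -> 0 <= T -> T * M + 1 <= B%:R -> 0 < e ->
  exists n, forall t, 0 <= t <= T ->
  `|I2 (fun x => \1_Om x * (spike eps B (t * x.1) * spike eps B (t * x.2))) -
    I2 (fun x => \1_Om x * (tsum eps n.+1 (t * x.1) * tsum eps n.+1 (t * x.2)))| <= e.
Proof.
move=> eps1 T0 TB e0.
have /niceP[C [C0 mS bS _]] := nice_spike eps0 B.
have a0 := area_ge0 oO OM.
pose D := (2 * C + 1) * (area Om + 1).
have D0 : 0 < D by apply: mulr_gt0; lra.
(* If the factors are at most [C] and off by [e1 <= 1], the product is off by at most
   [e1 * (2 * C + 1)]. *)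
pose e1 := Num.min 1 (e / D).
have e10 : 0 < e1 by rewrite lt_min ltr01 divr_gt0.
have e11 : e1 <= 1 by rewrite ge_min lexx.
have e1D : e1 * D <= e by rewrite -ler_pdivlMr // ge_min lexx orbT.
have [n0 Hn] := fejer_approx eps0 eps1 B e10.
exists n0 => t /andP[t0 tT].
have mT : measurable_fun setT (tsum eps n0.+1).
  apply: measurable_funM => //; apply: measurable_sum => i; apply: measurable_sum => j.
  by apply: measurable_funM => //; exact: measurable_osc.
have bT y : `|tsum eps n0.+1 y| <= n0.+1%:R^-1 * \sum_(i < n0.+1) \sum_(j < n0.+1) 1.
  rewrite normrM ger0_norm ?invr_ge0 //; apply: ler_wpM2l; first by rewrite invr_ge0.
  apply: le_trans (ler_norm_sum _ _ _) _; apply: ler_sum => i _.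
  apply: le_trans (ler_norm_sum _ _ _) _; apply: ler_sum => j _; rewrite normrM.
  rewrite -[leRHS]mul1r; apply: ler_pM => //; [exact: gam_le1|exact: osc_le1].
have mlin (f : R -> R) : measurable_fun setT f ->
    measurable_fun setT (fun x : R * R => f (t * x.1) * f (t * x.2)).
  move=> mf.
  have m1 : measurable_fun setT (fun x : R * R => t * x.1).
    by apply: measurable_funM; [exact: measurable_cst|exact: measurable_fst].
  have m2 : measurable_fun setT (fun x : R * R => t * x.2).
    by apply: measurable_funM; [exact: measurable_cst|exact: measurable_snd].
  by apply: measurable_funM; [exact: (measurableT_comp mf m1)|exact: (measurableT_comp mf m2)].
have nS : nice2 (fun x => \1_Om x * (spike eps B (t * x.1) * spike eps B (t * x.2))).
  apply: (nice2_indic oO OM (C := C * C)); first exact: mlin.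
  by move=> x; rewrite normrM; apply: ler_pM.
have nT : nice2 (fun x => \1_Om x * (tsum eps n0.+1 (t * x.1) * tsum eps n0.+1 (t * x.2))).
  move: bT; move: (_ * _) => b bT.
  apply: (nice2_indic oO OM (C := b * b)); first exact: mlin.
  by move=> x; rewrite normrM; apply: ler_pM.
have n1 : nice2 (\1_Om : R * R -> R).
  apply: (eq_nice2 (f := fun x => \1_Om x * 1)) => [x|]; first by rewrite mulr1.
  by apply: (nice2_indic oO OM (C := 1)) => // x; rewrite normr1.
have nc (a : R) : nice2 (fun x => a * (\1_Om x : R)).
  apply: (eq_nice2 (f := fun x => \1_Om x * a)) => [x|]; first by rewrite mulrC.
  exact: (nice2_indic oO OM (C := `|a|)).
have key x : `|\1_Om x * (spike eps B (t * x.1) * spike eps B (t * x.2)) -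
    \1_Om x * (tsum eps n0.+1 (t * x.1) * tsum eps n0.+1 (t * x.2))| <= e1 * (2 * C + 1) * \1_Om x.
  rewrite indicE; case: (boolP (x \in Om)) => [|_]; last by rewrite !mul0r subrr normr0 mulr0.
  rewrite inE !mul1r mulr1 => Ox; have xM := OM Ox.
  have near y : `|y| <= M -> `|t * y| + 1 <= B%:R.
    move=> yM; apply: le_trans TB; rewrite lerD2r normrM ger0_norm //.
    exact: ler_pM.
  have h1 := Hn n0 (t * x.1) (leqnn _) (near _ (le_trans (abs1_le_nrm x) xM)).
  have h2 := Hn n0 (t * x.2) (leqnn _) (near _ (le_trans (abs2_le_nrm x) xM)).
  have s1 := bS (t * x.1); have s2 := bS (t * x.2).
  move: (spike _ _ _) (spike _ _ _) (tsum _ _ _) (tsum _ _ _) h1 h2 s1 s2 => a' a c' c h1 h2 s1 s2.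
  have -> : a * a' - c * c' = - ((c - a) * a' + (c - a) * (c' - a') + a * (c' - a')) by ring.
  rewrite normrN; apply: le_trans (ler_normD _ _) _.
  have := ler_normD ((c - a) * a') ((c - a) * (c' - a')).
  rewrite !normrM.
  have q1 := ler_pM (normr_ge0 _) (normr_ge0 _) h1 s2.
  have q2 := ler_pM (normr_ge0 _) (normr_ge0 _) h1 h2.
  have q3 := ler_pM (normr_ge0 _) (normr_ge0 _) s1 h2.
  have : e1 * e1 <= e1 by rewrite -[leRHS]mulr1 ler_pM2l.
  lra.
rewrite -I2B //.
have nB : nice2 (fun x => \1_Om x * (spike eps B (t * x.1) * spike eps B (t * x.2)) -
    \1_Om x * (tsum eps n0.+1 (t * x.1) * tsum eps n0.+1 (t * x.2))).
  have /nice2P[b1 [b10 m1 B1 o1]] := nS; have /nice2P[b2 [b20 m2 B2 o2]] := nT.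
  apply: (@nice2_bound _ _ (b1 + b2) (b1 + b2)).
  - exact: measurable_funB.
  - by move=> x; apply: le_trans (ler_normB _ _) _; exact: lerD.
  move=> x h; rewrite o1 ?o2 ?subrr //; first by case: h => h; [left|right]; lra.
  by case: h => h; [left|right]; lra.
have fin : e1 * (2 * C + 1) * area Om <= e.
  apply: le_trans e1D; rewrite -mulrA /D; apply: ler_wpM2l; first exact: ltW.
  by apply: ler_wpM2l; lra.
rewrite ler_norml; apply/andP; split.
  rewrite lerNl; apply: le_trans fin; rewrite (areaE oO OM) -mulN1r -I2Z // -I2Z //.
  apply: I2_le => [||x]; [|exact: nc|].
    apply: (eq_nice2 (f := fun x => \1_Om x * (tsum eps n0.+1 (t * x.1) * tsum eps n0.+1 (t * x.2)) -
       \1_Om x * (spike eps B (t * x.1) * spike eps B (t * x.2)))) => [x|]; first by ring.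
    have /nice2P[b1 [b10 m1 B1 o1]] := nS; have /nice2P[b2 [b20 m2 B2 o2]] := nT.
    apply: (@nice2_bound _ _ (b2 + b1) (b1 + b2)).
    - exact: measurable_funB.
    - by move=> x; apply: le_trans (ler_normB _ _) _; exact: lerD.
    move=> x h; rewrite o1 ?o2 ?subrr //; first by case: h => h; [left|right]; lra.
    by case: h => h; [left|right]; lra.
  by rewrite mulN1r; apply: le_trans (key x); rewrite -normrN ler_norm.
apply: le_trans fin; rewrite (areaE oO OM) -I2Z //.
by apply: I2_le => [||x]; [exact: nB|exact: nc|apply: le_trans (key x); exact: ler_norm].
Qed.

End Expansion.

Lemma Ir_square_half (R : realType) (w f g : R -> R) : (forall t, 0 <= w t) ->
  nice (fun t => w t * f t ^+ 2) -> nice (fun t => w t * g t ^+ 2) ->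
  nice (fun t => w t * (2^-1 * f t + 2^-1 * g t) ^+ 2) ->
  Ir (fun t => w t * (2^-1 * f t + 2^-1 * g t) ^+ 2) <=
  2^-1 * Ir (fun t => w t * f t ^+ 2) + 2^-1 * Ir (fun t => w t * g t ^+ 2).
Proof.
move=> w0 n1 n2 n3; have m1 := niceZ 2^-1 n1; have m2 := niceZ 2^-1 n2.
rewrite -(IrZ 2^-1 n1) -(IrZ 2^-1 n2) -(IrD m1 m2).
apply: Ir_le => [||t]; [exact: n3|exact: (niceD m1 m2)|].
have := w0 t; move: (w t) (f t) (g t) => c x y c0.
have -> : 2^-1 * (c * x ^+ 2) + 2^-1 * (c * y ^+ 2) = c * (2^-1 * x ^+ 2 + 2^-1 * y ^+ 2) by ring.
by apply: ler_wpM2l => //; have := sqr_ge0 (x - y); rewrite sqrrB; lra.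
Qed.

Lemma chi_cut (R : realType) (x0 h t : R) (f : R -> R) : 0 < h ->
  chi x0 h t * f t ^+ 2 =
  chi x0 h t * (\1_(`[x0 - 3 * h, x0 + 3 * h]%classic : set R) t * f t) ^+ 2.
Proof.
move=> h0; case: (boolP (x0 - 3 * h <= t <= x0 + 3 * h)) => ht; first by rewrite box_in // mul1r.
rewrite chi_out ?mul0r //; apply: contraNT ht; rewrite -ltNge ltr_norml => /andP[? ?].
by apply/andP; split; lra.
Qed.

(** * From the expansion to the lattice point error *)

Section Error.
Variable R : realType.
Implicit Types (k : int * int) (t u h : R) (n B : nat) (s : seq (int * int)).
Variables (Om : set (R * R)) (c0 M K2 : R).
Hypotheses (oO : open Om) (cO : convex2 Om) (c0_gt0 : 0 < c0) (M_gt0 : 0 < M).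
Hypothesis (OM : forall x : R * R, Om x -> nrm x <= M).
Hypothesis (cOm : forall x : R * R, `|x.1| <= c0 -> `|x.2| <= c0 -> Om x).

Lemma nice_trig (a c : R) s (g : int * int -> R) : (forall k, k \in s -> k != (0, 0)) ->
  nice (fun t => \1_(`[a, c]%classic : set R) t * trig Om s g t).
Proof.
move=> s0; pose F k t := if k == (0, 0) then 0 else
  \1_(`[a, c]%classic : set R) t * Ir (fun x => slice_len Om (vec R k) x * osc t 0 x).
have nF k : nice (F k).
  rewrite /F; case: (boolP (k == (0, 0))) => k0; first exact: nice0.
  exact: (nice_osc_transform a c 0 (nice_slice_len oO c0_gt0 OM cOm (vec_neq0 R k0))).
apply: (eq_nice (f := fun t => \sum_(k <- s) g k * F k t)); last first.
  by apply: nice_sum => k; exact: niceZ.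
move=> t; rewrite /trig mulr_sumr big_seq [RHS]big_seq; apply: eq_bigr => k /s0 /negbTE k0.
by rewrite /F k0 mulrCA.
Qed.

(** Measurability comes from the monotonicity of the count, which is available for nonnegative
    dilations; hence the replacement of [u] by [Num.max 0 u]. *)
Lemma nice_error (a c : R) : 0 <= a -> a <= c ->
  nice (fun u => \1_(`[a, c]%classic : set R) u * Eerr Om u ^+ 2).
Proof.
move=> a0 ac; have A0 := area_ge0 oO OM; have c0' : 0 <= c by exact: le_trans ac.
pose f u := (latcount Om (Num.max 0 u) - u ^+ 2 * area Om) ^+ 2.
have mf : measurable_fun setT f.
  apply: measurable_funX; apply: measurable_funB; last first.
    by apply: measurable_funM; [exact: measurable_funX|exact: measurable_cst].
  apply: nondecreasing_measurable => // x y xy.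
  apply: (latcount_mono cO c0_gt0 M_gt0 OM cOm); first by rewrite le_max lexx.
  by rewrite ge_max !le_max lexx xy orbT.
have E u : a <= u -> Eerr Om u ^+ 2 = f u.
  by move=> au; rewrite /f /Eerr max_r //; exact: le_trans au.
apply: (eq_nice (f := fun u => \1_(`[a, c]%classic : set R) u * f u)) => [u|].
  case: (boolP (a <= u <= c)) => h; last by rewrite box_out ?mul0r.
  by rewrite E //; case/andP: h.
apply: (nice_cut (M := (latcount Om c + c ^+ 2 * area Om) ^+ 2) mf) => u /andP[au uc].
have u0 : 0 <= u by exact: le_trans au.
have N0 := latcount_ge0 M_gt0 OM u0; have N1 := latcount_mono cO c0_gt0 M_gt0 OM cOm u0 uc.
have sq : u ^+ 2 * area Om <= c ^+ 2 * area Om.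
  by apply: ler_wpM2r => //; rewrite lerXn2r ?nnegrE.
have sq0 : 0 <= u ^+ 2 * area Om by apply: mulr_ge0 => //; exact: sqr_ge0.
rewrite ger0_norm ?sqr_ge0 // /f max_r // -[leLHS]real_normK ?num_real //.
rewrite lerXn2r ?nnegrE //; first by lra.
by rewrite ler_norml; apply/andP; split; lra.
Qed.

Lemma GintE r h : 0 <= r -> 0 <= h ->
  Gint Om r h = (Ir (fun u => \1_(`[r, r + h]%classic : set R) u * Eerr Om u ^+ 2))%:E.
Proof.
move=> r0 h0; have rh : r <= r + h by rewrite lerDl.
have nf := nice_error r0 rh; have fi := nice_integrable nf.
rewrite /Gint integral_mkcond /Ir /Rintegral fineK; last exact: integrable_fin_num.
apply: eq_integral => u _; rewrite patchE /= indicE.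
case: ifP => h1 /=; last by rewrite mul0r.
by rewrite mul1r real_normK ?num_real.
Qed.

Definition osc_error (eps : R) n t : R :=
  2^-1 * trig Om (freqs n.+1) (coef eps n.+1) t +
  2^-1 * trig Om (map flip (freqs n.+1)) (fun k => coef eps n.+1 (flip k)) t.

(** The sandwich at [u + d] bounds the count at [u] from above, the one at [u - d] from below.
    Bringing the area term back to [u ^+ 2] costs the last summand. *)
Lemma error_pointwise h u n B (e : R) : let d := h^-1 / c0 in
  1 <= h -> d < u - d -> u + d <= 5 * h ^+ 2 -> 5 * h ^+ 2 * M + 1 <= B%:R ->
  u + 2 * d <= 5 * h ^+ 2 ->
  (forall t, 0 <= t <= 5 * h ^+ 2 ->
   `|I2 (fun x => \1_Om x * (spike h^-1 B (t * x.1) * spike h^-1 B (t * x.2))) -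
     I2 (fun x => \1_Om x * (tsum h^-1 n.+1 (t * x.1) * tsum h^-1 n.+1 (t * x.2)))| <= e) ->
  `|Eerr Om u| <= (5 * h ^+ 2) ^+ 2 * (`|osc_error h^-1 n (u + d)| + `|osc_error h^-1 n (u - d)| + e)
    + 2 * (5 * h ^+ 2) * d * area Om.
Proof.
move=> d h1 du ud HB u2d He; have hp : 0 < h by lra.
have hV : 0 < h^-1 by rewrite invr_gt0.
have d0 : 0 < d by exact: divr_gt0.
have A0 := area_ge0 oO OM; have M0 := M_gt0.
move: (5 * h ^+ 2) ud HB u2d He => T ud HB u2d He.
have ap t : 0 <= t -> t <= T ->
    `|I2 (fun x => \1_Om x * (spike h^-1 B (t * x.1) * spike h^-1 B (t * x.2))) -
      (area Om + osc_error h^-1 n t)| <= e.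
  move=> t0 tT; have := He t; rewrite t0 tT => /(_ isT).
  by rewrite (trig_expand oO c0_gt0 OM cOm hV).
have tp0 : 0 <= u + d by lra.
have tm0 : 0 <= u - d by lra.
have tmT : u - d <= T by lra.
have P1 := ap _ tp0 ud; have P2 := ap _ tm0 tmT.
have tB t : t <= u + d -> (t + d) * M <= B%:R.
  move=> tu; apply: le_trans HB; apply: ler_wpDr => //; apply: ler_wpM2r; lra.
have dp : d < u + d by lra.
have udd : u - d <= u + d by lra.
have /andP[S1 _] := spike_sandwich oO cO c0_gt0 M_gt0 OM cOm hV dp (tB _ (lexx _)).
have /andP[_ S2] := spike_sandwich oO cO c0_gt0 M_gt0 OM cOm hV du (tB _ udd).
rewrite -/d addrK in S1; rewrite -/d subrK in S2.
move: P1 P2 S1 S2; rewrite /Eerr.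
move: (I2 _) (I2 _) (osc_error _ _ (u + d)) (osc_error _ _ (u - d)) (latcount Om u) (area Om) A0
  => I3 I1 D1 D2 N a A0 P1 P2 S1 S2.
have q1 : 0 < (u + d) ^+ 2 by rewrite exprn_gt0 //; lra.
have q2 : 0 < (u - d) ^+ 2 by rewrite exprn_gt0 //; lra.
rewrite ler_pdivrMl // in S1; rewrite ler_pdivlMl // in S2.
move: P1 P2; rewrite !ler_norml => /andP[p1 p2] /andP[p3 p4].
have e0 : 0 <= e by lra.
have Q1 : (u + d) ^+ 2 <= T ^+ 2 by rewrite lerXn2r ?nnegrE //; lra.
have Q2 : (u - d) ^+ 2 <= T ^+ 2 by rewrite lerXn2r ?nnegrE //; lra.
have X1 : 0 <= `|D1| + `|D2| + e by rewrite !addr_ge0.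
have n1 := ler_norm D1; have n2 := ler_norm (- D2); rewrite normrN in n2.
have k1 := normr_ge0 D1; have k2 := normr_ge0 D2.
have U1 : (u + d) ^+ 2 * I1 <= (u + d) ^+ 2 * a + T ^+ 2 * (`|D1| + `|D2| + e).
  apply: (@le_trans _ _ ((u + d) ^+ 2 * (a + (`|D1| + `|D2| + e)))).
    by apply: ler_wpM2l; [exact: ltW|lra].
  by rewrite mulrDr lerD2l; apply: ler_wpM2r.
have U2 : (u - d) ^+ 2 * a - T ^+ 2 * (`|D1| + `|D2| + e) <= (u - d) ^+ 2 * I3.
  apply: (@le_trans _ _ ((u - d) ^+ 2 * (a - (`|D1| + `|D2| + e)))).
    by rewrite mulrBr lerD2l lerN2; apply: ler_wpM2r.
  by apply: ler_wpM2l; [exact: ltW|lra].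
have da : 0 <= d * a by apply: mulr_ge0 => //; exact: ltW.
have V1 : (u + d) ^+ 2 * a <= u ^+ 2 * a + 2 * T * d * a.
  have -> : (u + d) ^+ 2 * a = u ^+ 2 * a + (2 * u + d) * (d * a) by ring.
  have -> : 2 * T * d * a = (2 * T) * (d * a) by ring.
  by rewrite lerD2l; apply: ler_wpM2r => //; lra.
have V2 : u ^+ 2 * a - 2 * T * d * a <= (u - d) ^+ 2 * a.
  have -> : (u - d) ^+ 2 * a = u ^+ 2 * a - (2 * u - d) * (d * a) by ring.
  have -> : 2 * T * d * a = (2 * T) * (d * a) by ring.
  by rewrite lerD2l lerN2; apply: ler_wpM2r => //; lra.
move: U1 U2 V1 V2 S1 S2; move: (T ^+ 2 * _) => Y; lra.
Qed.

Hypothesis K20 : 0 <= K2.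
Hypothesis chord : forall k p q : R * R, k != (0, 0) -> Om p -> Om q -> dot2 p k = dot2 q k ->
  ((p.1 - q.1) ^+ 2 + (p.2 - q.2) ^+ 2) * nrm k <= K2 * (rho_star Om k - dot2 p k).

Lemma window_osc_error : exists2 C : R, 0 < C & exists2 h0 : R, 6 <= h0 &
  forall h x0 n, h0 <= h -> h ^+ 2 <= x0 ->
  nice (fun t => chi x0 h t * osc_error h^-1 n t ^+ 2) /\
  Ir (fun t => chi x0 h t * osc_error h^-1 n t ^+ 2) <= C / h ^+ 5.
Proof.
have fin (i1 i2 z : R) : i1 <= z -> i2 <= z -> 2^-1 * i1 + 2^-1 * i2 <= z by move=> *; lra.
have [C C0 [h0 h06 H]] := window_trig oO cO c0_gt0 M_gt0 OM cOm K20 chord (ler0n R 8).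
exists C => //; exists h0 => // h x0 n hh hx.
have hp : 0 < h by lra.
pose box t : R := \1_(`[x0 - 3 * h, x0 + 3 * h]%classic : set R) t.
pose s1 := freqs n.+1; pose g1 := coef h^-1 n.+1.
pose s2 := map flip s1; pose g2 k := g1 (flip k).
have eV : 0 < h^-1 by rewrite invr_gt0.
have cb k := @coef_bounds R h^-1 eV n.+1 h k erefl hp.
have z1 k : k \in s1 -> k != (0, 0) by rewrite mem_filter => /andP[].
have z2 k : k \in s2 -> k != (0, 0) by move=> /mapP[l ls ->]; rewrite flip_eq0; exact: z1.
have u1 : uniq s1 by apply: filter_uniq; exact: uniq_sq.
have u2 : uniq s2 by rewrite map_inj_uniq //; exact: (can_inj flipK).
have B1 := H h x0 s1 g1 hh hx u1 z1 (fun k => proj1 (cb k)) (fun k => proj2 (cb k)).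
have B2 := H h x0 s2 g2 hh hx u2 z2 (fun k => proj1 (cb (flip k))).
have {}B2 := B2 (fun k => ltac:(rewrite -(nrm_flip R k); exact: (proj2 (cb (flip k))))).
have nb1 := nice_trig (x0 - 3 * h) (x0 + 3 * h) g1 z1.
have nb2 := nice_trig (x0 - 3 * h) (x0 + 3 * h) g2 z2.
have nchi := nice_window x0 hp.
have nsq (f : R -> R) : nice (fun t => box t * f t) -> nice (fun t => chi x0 h t * f t ^+ 2).
  move=> nf; apply: (eq_nice (f := fun t => chi x0 h t * (box t * f t * (box t * f t)))) => [t|].
    by rewrite (chi_cut _ _ _ hp) expr2.
  by apply: niceM => //; exact: niceM.
have nD : nice (fun t => box t * osc_error h^-1 n t).
  apply: (eq_nice _ (niceD (niceZ 2^-1 nb1) (niceZ 2^-1 nb2))) => t.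
  rewrite /osc_error -/s1 -/s2 -/g1 -/g2 -/(box t).
  by move: (box t) (trig _ _ _ _) (trig _ _ _ _) => b x y; ring.
split; first exact: nsq.
have n1 := nsq _ nb1; have n2 := nsq _ nb2.
apply: (@le_trans _ _ (2^-1 * Ir (fun t => chi x0 h t * trig Om s1 g1 t ^+ 2) +
    2^-1 * Ir (fun t => chi x0 h t * trig Om s2 g2 t ^+ 2))).
  exact: (Ir_square_half (@chi_ge0 _ x0 h) n1 n2 (nsq _ nD)).
exact: fin B1 B2.
Qed.

(** The oscillating part, with integrated square [h ^ -5], is multiplied by a quantity of order
    [h ^ 4], squared, which gives [h ^ 3]. Integrating over half of the range where [chi] is at
    least [1 / 2] leaves room for the shifts by [d]. *)
Lemma window_error : exists2 C : R, 0 < C & exists2 h0 : R, 1 <= h0 &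
  forall h x0, h0 <= h -> h ^+ 2 <= x0 -> x0 <= 4 * h ^+ 2 ->
  Ir (fun u => \1_(`[x0 - h / 2, x0 + h / 2]%classic : set R) u * Eerr Om u ^+ 2) <= C * h ^+ 3.
Proof.
have [C C0 [h0 h06 H]] := window_osc_error.
have A0 := area_ge0 oO OM; have hc := c0_gt0; have M0 := M_gt0.
pose K := 25 + 10 * (area Om / c0).
have K0 : 0 <= K by apply: addr_ge0 => //; apply: mulr_ge0 => //; apply: divr_ge0 => //; exact: ltW.
have cV : 0 < 2 / c0 by rewrite divr_gt0.
exists (12 * (25 * 25) * C + 3 * K ^+ 2 + 1).
  by apply: ltr_wpDl => //; nneg.
exists (h0 + 2 / c0); first by lra.
move=> h x0 hh hx hx4.
have h6 : 6 <= h by lra.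
have hp : 0 < h by lra.
have hh0 : h0 <= h by lra.
pose d := h^-1 / c0.
have d0 : 0 < d by rewrite divr_gt0 // invr_gt0.
have d1 : d <= 2^-1.
  rewrite /d -invfM lef_pV2 ?posrE ?mulr_gt0 // -ler_pdivrMr //; lra.
have h2 : 6 * h <= h ^+ 2 by rewrite expr2 ler_pM2r.
pose T := 5 * h ^+ 2.
have T0 : 0 <= T by rewrite /T mulr_ge0 ?exprn_ge0 // ltW.
have TM : 0 <= T * M + 1 by apply: addr_ge0 => //; apply: mulr_ge0 => //; exact: ltW.
pose B := (Num.truncn (T * M + 1)).+1.
have TB : T * M + 1 <= B%:R by have /andP[_ /ltW] := truncn_itv TM.
(* The approximation error then enters [E] with size [25 * h], of the same order as the loss by
   smoothing. *)
pose e := h ^- 3.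
have e0 : 0 < e by rewrite invr_gt0 exprn_gt0.
have eV : 0 < h^-1 by rewrite invr_gt0.
have eV1 : h^-1 <= 1 by rewrite invf_le1 //; lra.
have [n Hn] := tsum_uniform oO OM eV eV1 T0 TB e0.
have [nP IP] := H h x0 n hh0 hx.
set P := (fun t => _) in nP IP.
pose b u : R := \1_(`[x0 - h / 2, x0 + h / 2]%classic : set R) u.
(* The bound has three terms, whose squares cost a factor 3; the 6 includes the lower bound [1 / 2]
   for [chi], and 25 comes from [(5 * h ^+ 2) ^+ 2]. *)
have key u : b u * Eerr Om u ^+ 2 <=
    6 * (25 * 25) * h ^+ 8 * (P (u + d) + P (u + - d)) + 3 * (K * h) ^+ 2 * b u.
  have P0 t : 0 <= P t by apply: mulr_ge0; [exact: chi_ge0|exact: sqr_ge0].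
  have h8 : 0 <= 6 * (25 * 25) * h ^+ 8.
    by do ![exact: ler0n | apply: exprn_ge0 | apply: mulr_ge0 | exact: (ltW hp)].
  case: (boolP (x0 - h / 2 <= u <= x0 + h / 2)) => hu; last first.
    rewrite /b box_out // mul0r mulr0 addr0; apply: mulr_ge0 => //; exact: addr_ge0.
  rewrite /b box_in // mul1r mulr1; case/andP: hu => u1 u2.
  have EP := @error_pointwise h u n B e ltac:(lra) ltac:(rewrite -/d; lra) ltac:(rewrite -/d; lra) TB
    ltac:(rewrite -/d; lra) Hn.
  rewrite -/d in EP.
  have c1 : 2^-1 <= chi x0 h (u + d) by apply: chi_ge => //; rewrite ler_norml; apply/andP; split; lra.
  have c2 : 2^-1 <= chi x0 h (u + - d) by apply: chi_ge => //; rewrite ler_norml; apply/andP; split; lra.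
  have Kh : (5 * h ^+ 2) ^+ 2 * e + 2 * (5 * h ^+ 2) * d * area Om = K * h.
    by rewrite /e /d /K; field; rewrite !gt_eqF.
  have EP' : `|Eerr Om u| <= 25 * h ^+ 4 * `|osc_error h^-1 n (u + d)| +
      25 * h ^+ 4 * `|osc_error h^-1 n (u + - d)| + K * h.
    by apply: le_trans EP _; rewrite -Kh le_eqVlt; apply/orP; left; apply/eqP; ring.
  have K1 : 0 <= K * h by apply: mulr_ge0 => //; exact: ltW.
  have h4 : 0 <= h ^+ 4 by apply: exprn_ge0; exact: ltW.
  rewrite /P -[leLHS]real_normK ?num_real //.
  rewrite -(real_normK (num_real (osc_error _ _ (u + d)))) -(real_normK (num_real (osc_error _ _ (u + - d)))).
  have -> : h ^+ 8 = h ^+ 4 * h ^+ 4 by rewrite -exprD.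
  move: (normr_ge0 (osc_error h^-1 n (u + d))) (normr_ge0 (osc_error h^-1 n (u + - d))) (normr_ge0 (Eerr Om u)) EP'.
  move: `|osc_error h^-1 n (u + d)| `|osc_error h^-1 n (u + - d)| `|Eerr Om u| => x y z x1 y1 z1.
  move: (chi _ _ _) (chi _ _ _) c1 c2 (K * h) K1 (h ^+ 4) h4 => q2 q1 c1 c2 k k0 w w0 zz.
  have wx : 0 <= 25 * w * x by do ![exact: ler0n | assumption | apply: mulr_ge0].
  have wy : 0 <= 25 * w * y by do ![exact: ler0n | assumption | apply: mulr_ge0].
  have z2 : z ^+ 2 <= (25 * w * x + 25 * w * y + k) ^+ 2.
    by rewrite lerXn2r ?nnegrE //; exact: le_trans zz.
  have z3 (p q r : R) : (p + q + r) ^+ 2 <= 3 * p ^+ 2 + 3 * q ^+ 2 + 3 * r ^+ 2.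
    rewrite -subr_ge0; have -> : 3 * p ^+ 2 + 3 * q ^+ 2 + 3 * r ^+ 2 - (p + q + r) ^+ 2 =
       (p - q) ^+ 2 + (p - r) ^+ 2 + (q - r) ^+ 2 by ring.
    by rewrite !addr_ge0 ?sqr_ge0.
  apply: le_trans z2 _; apply: le_trans (z3 _ _ _) _.
  rewrite lerD2r.
  have -> : 6 * (25 * 25) * (w * w) * (q1 * x ^+ 2 + q2 * y ^+ 2) =
     3 * (25 * w * x) ^+ 2 * (2 * q1) + 3 * (25 * w * y) ^+ 2 * (2 * q2) by ring.
  apply: lerD.
    rewrite ler_peMr //; [by apply: mulr_ge0 => //; exact: sqr_ge0|lra].
  rewrite ler_peMr //; [by apply: mulr_ge0 => //; exact: sqr_ge0|lra].
have nE : nice (fun u => b u * Eerr Om u ^+ 2).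
  by apply: nice_error; lra.
have nPd := nice_shift d nP; have nPd' := nice_shift (- d) nP.
have nS := niceD nPd nPd'.
have nb : nice b := nice_box _ _.
pose w := 6 * (25 * 25) * h ^+ 8; pose v := 3 * (K * h) ^+ 2.
have -> : Ir (fun u => \1_(`[x0 - h / 2, x0 + h / 2]%classic : set R) u * Eerr Om u ^+ 2) =
  Ir (fun u => b u * Eerr Om u ^+ 2) by [].
apply: le_trans (Ir_le nE (niceD (niceZ w nS) (niceZ v nb)) key) _.
rewrite (IrD (niceZ w nS) (niceZ v nb)) (IrZ w nS) (IrZ v nb) (IrD nPd nPd').
rewrite (Ir_shift d nP) (Ir_shift (- d) nP) /b Ir_box; last by lra.
have w0 : 0 <= w by rewrite /w; do ![exact: ler0n | apply: exprn_ge0 | apply: mulr_ge0 | exact: (ltW hp)].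
apply: le_trans (lerD (ler_wpM2l w0 (lerD IP IP)) (lexx _)) _.
have -> : w * (C / h ^+ 5 + C / h ^+ 5) = 12 * (25 * 25) * C * h ^+ 3.
  by rewrite /w; field; rewrite gt_eqF.
have -> : v * (x0 + h / 2 - (x0 - h / 2)) = 3 * K ^+ 2 * h ^+ 3 by rewrite /v; field.
by rewrite -mulrDl; apply: ler_wpM2r; [apply: exprn_ge0; exact: ltW|rewrite lerDl].
Qed.

End Error.

(** * Covering by windows *)

Section Final.
Variable R : realType.
Variables (Om : set (R * R)) (c0 M K2 : R).
Hypotheses (oO : open Om) (cO : convex2 Om) (c0_gt0 : 0 < c0) (M_gt0 : 0 < M).
Hypothesis (OM : forall x : R * R, Om x -> nrm x <= M).
Hypothesis (cOm : forall x : R * R, `|x.1| <= c0 -> `|x.2| <= c0 -> Om x).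
Hypothesis K20 : 0 <= K2.
Hypothesis chord : forall k p q : R * R, k != (0, 0) -> Om p -> Om q -> dot2 p k = dot2 q k ->
  ((p.1 - q.1) ^+ 2 + (p.2 - q.2) ^+ 2) * nrm k <= K2 * (rho_star Om k - dot2 p k).

Let err (a c : R) := Ir (fun u => \1_(`[a, c]%classic : set R) u * Eerr Om u ^+ 2).

(** Windows of length [w = sqrt r] centred at the points [r + j * w] cover the range. Since [w <= h]
    at most [3 * h / w] of them are needed, each contributing [C * w ^+ 3]. *)
Lemma large_error : exists2 C : R, 0 < C & exists2 r0 : R, 2 <= r0 &
  forall r h : R, r0 <= r -> Num.sqrt r <= h -> h <= r -> err r (r + h) <= C * h * r.
Proof.
have [C C0 [h0 h01 H]] := window_error oO cO c0_gt0 M_gt0 OM cOm K20 chord.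
exists (3 * C); first exact: mulr_gt0.
exists (h0 ^+ 2 + 2); first by rewrite lerDr sqr_ge0.
move=> r h rr sh hr.
have r2 : 2 <= r by have := sqr_ge0 h0; lra.
have rp : 0 < r by lra.
pose w := Num.sqrt r.
have w0 : 0 < w by rewrite sqrtr_gt0.
have wE : w ^+ 2 = r by rewrite sqr_sqrtr // ltW.
have wh : w <= h by exact: sh.
have wh0 : h0 <= w.
  have h00 : 0 <= h0 by lra.
  by rewrite -(ler_pXn2r (ltn0Sn 1)) ?nnegrE ?(ltW w0) // wE; lra.
have hp : 0 < h by exact: lt_le_trans wh.
have q0 : 0 <= h / w by apply: divr_ge0; exact: ltW.
pose J := (Num.truncn (h / w)).+1.
have /andP[J1 J2] := truncn_itv q0; rewrite -/J in J2.
have q1 : 1 <= h / w by rewrite ler_pdivlMr // mul1r.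
have J3 : J.+1%:R <= 3 * (h / w).
  by rewrite /J -[_.+2%:R]natr1 -natr1; lra.
pose x (j : nat) : R := r + j%:R * w.
pose F j u := \1_(`[x j - w / 2, x j + w / 2]%classic : set R) u * Eerr Om u ^+ 2.
have jw j : (j < J.+1)%N -> j%:R * w <= h + w.
  move=> jJ; have j1 : (j%:R : R) <= (Num.truncn (h / w))%:R + 1 by rewrite natr1 ler_nat.
  have : (j%:R : R) <= h / w + 1 by lra.
  move=> /(ler_wpM2r (ltW w0)); rewrite mulrDl divfK ?gt_eqF // mul1r; lra.
have j0 j : 0 <= j%:R * w by apply: mulr_ge0 => //; exact: ltW.
have wr : w / 2 <= r.
  by have : w <= r; [exact: le_trans hr|lra].
have nF j : nice (F j).
  by apply: (nice_error oO cO c0_gt0 M_gt0 OM cOm); rewrite /x; have := j0 j; lra.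
have nE : nice (fun u => \1_(`[r, r + h]%classic : set R) u * Eerr Om u ^+ 2).
  by apply: (nice_error oO cO c0_gt0 M_gt0 OM cOm); lra.
have FB j : (j < J.+1)%N -> Ir (F j) <= C * w ^+ 3.
  move=> jJ; apply: H => //; rewrite wE /x; first by rewrite lerDl.
  have := jw j jJ; have : w <= r by exact: le_trans hr.
  lra.
have F0 j u : 0 <= F j u by apply: mulr_ge0; [rewrite indicE|exact: sqr_ge0].
apply: (@le_trans _ _ (Ir (fun u => \sum_(j < J.+1) F j u))).
  apply: Ir_le => [||u]; [exact: nE|exact: nice_sum|].
  case: (boolP (r <= u <= r + h)) => hu; last by rewrite box_out // mul0r sumr_ge0.
  rewrite box_in // mul1r; case/andP: hu => u1 u2.
  (* Adding one half before truncating selects the nearest centre. *)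
  have v0 : 0 <= (u - r) / w + 2^-1 by rewrite addr_ge0 ?invr_ge0 // divr_ge0 ?subr_ge0 // ltW.
  have /andP[t1 t2] := truncn_itv v0.
  pose j := Num.truncn ((u - r) / w + 2^-1); rewrite -/j in t1 t2.
  have uw : (u - r) / w <= h / w by rewrite ler_pM2r ?invr_gt0 //; lra.
  have jJ : (j < J.+1)%N.
    by rewrite -(ltr_nat R) -[J.+1%:R]natr1; lra.
  rewrite (bigD1 (Ordinal jJ)) //= {1}/F box_in ?mul1r.
    by rewrite lerDl sumr_ge0.
  rewrite -[j.+1%:R]natr1 in t2.
  have e1 : j%:R * w <= u - r + w / 2.
    have := ler_wpM2r (ltW w0) t1; rewrite mulrDl divfK ?gt_eqF //; lra.
  have e2 : u - r + w / 2 <= j%:R * w + w.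
    have := ler_wpM2r (ltW w0) (ltW t2); rewrite mulrDl divfK ?gt_eqF //; lra.
  by rewrite /x; apply/andP; split; lra.
rewrite Ir_sum //; apply: (@le_trans _ _ (\sum_(j < J.+1) C * w ^+ 3)).
  by apply: ler_sum => j _; exact: FB.
rewrite sumr_const card_ord -[_ *+ _]mulr_natl.
have P : 0 <= C * w ^+ 3 by apply: mulr_ge0; [exact: ltW|apply: exprn_ge0; exact: ltW].
apply: le_trans (ler_wpM2r P J3) _.
rewrite -wE le_eqVlt; apply/orP; left; apply/eqP; field.
by rewrite gt_eqF.
Qed.

Lemma bounded_error (r1 : R) : exists2 C : R, 0 <= C &
  forall r h : R, 0 <= r -> 0 <= h -> r + h <= r1 -> err r (r + h) <= C * h.
Proof.
have A0 := area_ge0 oO OM; have M0 := M_gt0.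
pose E := latcount Om (Num.max 0 r1) + r1 ^+ 2 * area Om.
have r10 : 0 <= Num.max 0 r1 by rewrite le_max lexx.
have L0 := latcount_ge0 M_gt0 OM r10.
exists (E ^+ 2); first exact: sqr_ge0.
move=> r h r0 h0 rh.
have rrh : r <= r + h by rewrite lerDl.
have -> : E ^+ 2 * h = E ^+ 2 * (r + h - r) by ring.
apply: Ir_le_box => //.
- exact: (nice_error oO cO c0_gt0 M_gt0 OM cOm).
- move=> u hu; rewrite box_in // mul1r; case/andP: hu => u1 u2.
  have u0 : 0 <= u by exact: le_trans u1.
  have ur : u <= Num.max 0 r1 by rewrite le_max (le_trans u2 rh) orbT.
  have N0 := latcount_ge0 M_gt0 OM u0.
  have N1 := latcount_mono cO c0_gt0 M_gt0 OM cOm u0 ur.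
  have s1 : u ^+ 2 * area Om <= r1 ^+ 2 * area Om.
    by apply: ler_wpM2r => //; rewrite lerXn2r ?nnegrE //; lra.
  have s0 : 0 <= u ^+ 2 * area Om by apply: mulr_ge0 => //; exact: sqr_ge0.
  rewrite -[leLHS]real_normK ?num_real // lerXn2r ?nnegrE //; first by rewrite /E; lra.
  by rewrite /Eerr /E ler_norml; apply/andP; split; lra.
by move=> u hu; rewrite box_out // mul0r.
Qed.

End Final.

Theorem theorem1p2 (R : realType) (Om : set (R * R)) :
  open Om -> convex2 Om -> bounded2 Om -> Om (0, 0) ->
  (exists K : R, forall (th : R * R) (d : R), S1 th -> 0 < d ->
       d ^-1 * @Num.sqrt R d * mu Om th d <= K) ->
  exists C : R, forall r h : R, 2 <= r -> Num.sqrt r <= h -> h <= r ->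
    (Gint Om r h < +oo)%E /\ G Om r h <= C * Num.sqrt r.
Proof.
move=> oO cO [M' bO] O0 [K hK].
have /nbhs_ballP[e /= e0 he] : nbhs (0 : R, 0 : R) Om by exact: open_nbhs_nbhs.
have c0 : 0 < e / 2 by rewrite divr_gt0.
have cOm (x : R * R) : `|x.1| <= e / 2 -> `|x.2| <= e / 2 -> Om x.
  by move=> x1 x2; apply: he; split; rewrite /ball /= sub0r normrN; lra.
pose M := `|M'| + `|M'| + 1.
have M0 : 0 < M by apply: ltr_wpDl => //; exact: addr_ge0.
have OM (x : R * R) : Om x -> nrm x <= M.
  move=> /bO[x1 x2]; apply: le_trans (nrm_le_abs x) _; have := ler_norm M'; rewrite /M; lra.
have ch := chord_bound oO c0 OM cOm hK.
have K20 : 0 <= (`|K| + 1) ^+ 2 by exact: sqr_ge0.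
have [C1 C10 [r0 r02 H1]] := large_error oO cO c0 M0 OM cOm K20 ch.
have [C2 C20 H2] := bounded_error oO cO c0 M0 OM cOm (r0 + r0).
(* [C1] serves [r0 <= r]. Below [r0] the range stays under [2 * r0], where the error is bounded, and
   [2 <= r] turns the constant into a multiple of [r]. *)
exists (Num.sqrt (C1 + C2)) => r h r2 sr hr.
have rp : 0 < r by lra.
have sp : 0 < Num.sqrt r by rewrite sqrtr_gt0.
have hp : 0 < h by exact: lt_le_trans sr.
have GE := GintE oO cO c0 M0 OM cOm (ltW rp) (ltW hp).
split; first by rewrite GE ltry.
rewrite /G GE /= -sqrtrM; last by apply: addr_ge0 => //; exact: ltW.
apply: ler_wsqrtr; rewrite ler_pdivrMl //.
have hr0 : 0 <= h * r by apply: mulr_ge0; exact: ltW.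
have [rr|rr] := leP r0 r.
  apply: le_trans (H1 r h rr sr hr) _; rewrite mulrDl mulrDr.
  have -> : C1 * h * r = h * (C1 * r) by ring.
  by rewrite lerDl; apply: mulr_ge0; [exact: ltW|apply: mulr_ge0; lra].
apply: le_trans (H2 r h (ltW rp) (ltW hp) _) _; first by lra.
rewrite mulrC ler_pM2l // mulrDl.
have : C2 <= C2 * r by rewrite ler_peMr //; lra.
have : 0 <= C1 * r by apply: mulr_ge0; exact: ltW.
lra.
Qed.
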